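(* Let $(c_p)_{p\ge 2}$ be any real sequence with $\sum_{p\ge2}2^pc_p^2<\infty$, let $\xi(s)=\sum_{p\ge 2}c_p^2s^p$, and let $h\in\mathbb R$. Then the mixed $p$-spin model with mixture $\xi$ and external field $h$ is $\infty$-RSB at zero temperature; that is, the Parisi measure at zero temperature $\gamma_P(dt)$ (the measure on $[0,1)$ inducing the minimizer $\gamma_P$ of the zero-temperature Parisi functional $\mathcal P$ over $\mathcal U$) contains infinitely many points in its support.
   Context: $\mathcal U$ is the set of all functions $\gamma:[0,1)\to[0,\infty)$ of the form $\gamma(t)=\nu([0,t])$ for a (nonnegative Borel) measure $\nu$ on $[0,1)$, satisfying $\int_0^1\gamma(t)\,dt<\infty$. The measure $\nu$ is denoted $\gamma(dt)$; its total mass may be infinite. $\mathcal U$ is endowed with the $L^1(dt)$-distance. For $\gamma\in\mathcal U$, $\Psi_\gamma$ denotes the weak solution on $[0,1]\times\mathbb R$ of the Parisi PDE $$\partial_t\Psi_\gamma(t,x)=-\frac{\xi''(t)}{2}\bigl(\partial_{xx}\Psi_\gamma(t,x)+\gamma(t)(\partial_x\Psi_\gamma(t,x))^2\bigr),\quad (t,x)\in[0,1)\times\mathbb R,\qquad \Psi_\gamma(1,x)=|x|.$$ Weak solution means: $\Psi_\gamma$ is continuous on $[0,1]\times\mathbb R$ with essentially bounded weak derivative $\partial_x\Psi_\gamma$, and for every smooth compactly supported $\varphi$ on $(0,1]\times\mathbb R$, $$\int_0^1\!\!\int_{\mathbb R}\Bigl(-\Psi_\gamma\,\partial_t\varphi+\frac{\xi''(t)}{2}\bigl(\Psi_\gamma\,\partial_{xx}\varphi+\gamma(t)(\partial_x\Psi_\gamma)^2\varphi\bigr)\Bigr)dx\,dt+\int_{\mathbb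 R}\varphi(1,x)|x|\,dx=0.$$ The zero-temperature Parisi functional is $$\mathcal P(\gamma)=\Psi_\gamma(0,h)-\frac12\int_0^1t\,\xi''(t)\gamma(t)\,dt .$$ Its minimizer over $\mathcal U$, whose existence and uniqueness are taken from the earlier literature, is denoted $\gamma_P$. By the Parisi formula at zero temperature, $\inf_{\gamma\in\mathcal U}\mathcal P(\gamma)$ equals the almost sure limit, as $N\to\infty$, of $\max_{\sigma\in\{-1,1\}^N}H_N(\sigma)/N$, where $$H_N(\sigma)=\sum_{p\ge2}\frac{c_p}{N^{(p-1)/2}}\sum_{1\le i_1,\dots,i_p\le N}g_{i_1,\dots,i_p}\sigma_{i_1}\cdots\sigma_{i_p}+h\sum_{i=1}^N\sigma_i$$ is the mixed $p$-spin Hamiltonian, with $g_{i_1,\dots,i_p}$ i.i.d. standard normal. *)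

(* Defs.v *)
From HB Require Import structures.
From mathcomp Require Import all_boot all_order all_algebra.
From mathcomp Require Import all_classical all_reals all_analysis.
Import Order.TTheory GRing.Theory Num.Theory.
Import numFieldNormedType.Exports.

Set Implicit Arguments.
Unset Strict Implicit.
Unset Printing Implicit Defensive.

Local Open Scope classical_set_scope.
Local Open Scope ring_scope.

Definition mixture (R : realType) (c : nat -> R) (s : R) : R :=
  limn (fun n => \sum_(2 <= p < n) c p ^+ 2 * s ^+ p).

Definition mixture2 (R : realType) (c : nat -> R) : R -> R :=
  derive1n 2 (mixture c).

(** Borel measures on [0,1[ are encoded as Borel measures on the line that
    vanish outside [0,1[; correspondingly, a function on [0,1[ is a function on
    the line whose values outside [0,1[ are irrelevant. *)
Definition induces (R : realType)
    (nu : {measure set (measurableTypeR R) -> \bar R}) (gamma : R -> R) : Prop :=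
  nu (~` `[0, 1[) = 0%E /\
  forall t : R, t \in `[0, 1[ -> nu `[0, t]%classic = (gamma t)%:E.

Definition parisi_space (R : realType) : set (R -> R) :=
  [set gamma |
    (exists nu : {measure set (measurableTypeR R) -> \bar R},
       induces nu gamma) /\
    (\int[@lebesgue_measure R]_(t in `[0%R, 1%R[) (gamma t)%:E < +oo)%E].

(** The support, in the topological space [0,1[, of a measure carried by
    [0,1[; in particular the point 1 is excluded. *)
Definition measure_support (R : realType)
    (nu : {measure set (measurableTypeR R) -> \bar R}) : set R :=
  [set t | (t \in `[0, 1[) /\
           forall U : set R, open U -> U t -> (0 < nu U)%E].

Definition uncurry2 (R : realType) (f : R -> R -> R) : R * R -> R :=
  fun p => f p.1 p.2.

Definition dt (R : realType) (f : R -> R -> R) : R -> R -> R :=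
  fun t x => derive1 (f^~ x) t.

Definition dx (R : realType) (f : R -> R -> R) : R -> R -> R :=
  fun t x => derive1 (f t) x.

Fixpoint Ck (R : realType) (k : nat) (f : R -> R -> R) : Prop :=
  match k with
  | 0%N => continuous (uncurry2 f)
  | k'.+1 => [/\ forall t x, derivable (f^~ x) t 1,
                 forall t x, derivable (f t) x 1,
                 Ck k' (dt f) & Ck k' (dx f)]
  end.

Definition smooth (R : realType) (f : R -> R -> R) : Prop :=
  forall k, Ck k f.

(** [phi] represents an element of C_c^oo(A). When [A] is not open, as for
    ]0,1] x R, smoothness on [A] means being the restriction of a function that
    is smooth on the whole plane, so a test function need not vanish on the
    part of the boundary contained in [A]. *)
Definition test_function (R : realType) (A : set (R * R))
    (phi : R -> R -> R) : Prop :=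
  smooth phi /\
  exists K : set (R * R),
    [/\ compact K, K `<=` A &
        forall t x, A (t, x) -> ~ K (t, x) -> phi t x = 0].

Definition int_strip (R : realType) (f : R -> R -> R) : R :=
  \int[@lebesgue_measure R]_(t in `[0, 1[)
    \int[@lebesgue_measure R]_(x in setT) f t x.

Definition open_strip (R : realType) : set (R * R) := [set p | 0 < p.1 < 1].

Definition half_open_strip (R : realType) : set (R * R) :=
  [set p | 0 < p.1 <= 1].

Definition closed_strip (R : realType) : set (R * R) :=
  [set p | 0 <= p.1 <= 1].

Definition bounded_weak_dx (R : realType) (Psi D : R -> R -> R) : Prop :=
  [/\ measurable_fun (@open_strip R) (uncurry2 D),
      exists M : R,
        {ae (@lebesgue_measure R \x @lebesgue_measure R)%E,
          forall p : R * R, open_strip p -> `|D p.1 p.2| <= M} &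
      forall phi, test_function (@open_strip R) phi ->
        int_strip (fun t x => Psi t x * dx phi t x) =
        - int_strip (fun t x => D t x * phi t x)].

(** [xi2] stands for the second derivative of the mixture. *)
Definition parisi_weak_solution (R : realType) (xi2 gamma : R -> R)
    (Psi : R -> R -> R) : Prop :=
  {within @closed_strip R, continuous (uncurry2 Psi)} /\
  exists2 D : R -> R -> R, bounded_weak_dx Psi D &
    forall phi, test_function (@half_open_strip R) phi ->
      int_strip (fun t x =>
        - (Psi t x * dt phi t x)
        + xi2 t / 2 * (Psi t x * dx (dx phi) t x
                       + gamma t * D t x ^+ 2 * phi t x))
      + \int[@lebesgue_measure R]_(x in setT) (phi 1 x * `|x|) = 0.

(** The weak solution exists and is unique on [0,1] x R for every [gamma] in
    the space above, so there the choice operator only names it. *)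
Definition parisi_Psi (R : realType) (xi2 gamma : R -> R) : R -> R -> R :=
  xget (fun _ _ => 0) [set Psi | parisi_weak_solution xi2 gamma Psi].

Definition parisi_functional (R : realType) (c : nat -> R) (h : R)
    (gamma : R -> R) : R :=
  parisi_Psi (mixture2 c) gamma 0 h
  - 2^-1 * \int[@lebesgue_measure R]_(t in `[0, 1[)
             (t * mixture2 c t * gamma t).

(** "The" minimizer, as a definite description. Uniqueness fails only for the
    zero mixture, for which the functional is constant. *)
Definition is_the_parisi_minimizer (R : realType) (c : nat -> R) (h : R)
    (gamma : R -> R) : Prop :=
  [/\ parisi_space gamma,
      forall gamma', parisi_space gamma' ->
        parisi_functional c h gamma <= parisi_functional c h gamma' &
      forall gamma', parisi_space gamma' ->
        (forall gamma'', parisi_space gamma'' ->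
           parisi_functional c h gamma' <= parisi_functional c h gamma'') ->
        {in `[0, 1[, gamma' =1 gamma}].

(* Main.v *)
(* Suppose that the support is finite.  Then [gamma_P] is piecewise constant and equals some
   [m] on [q, 1[.  Perturb it by adding mass [2] at a point [s] close to [1], and let [v] be the
   integral of [xi''] over [s, 1[.  Over [s, 1[ the Cole-Hopf formula with boundary value [|x|]
   increases [Psi] by at most [v], because the space derivative has modulus at most one; near
   the cusp of [|x|], for [|x| <= sqrt v], the increase is smaller by a fixed multiple of [v].
   As the process started at [h] meets that window with probability of order [sqrt v], the
   value [Psi(0, h)] increases by at most [v - kappa v^(3/2)].  The subtracted integral grows by
   at least [s v = v - (1 - s) v = v - O(v^2)], since [xi''] is bounded below near [1].  So the
   functional decreases when [s] is close to [1], contradicting minimality.  For the zero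
   mixture the functional is constant and the minimizer cannot be unique. *)

From HB Require Import structures.
Require Import Defs.
From mathcomp Require Import all_boot all_order all_algebra.
From mathcomp Require Import all_classical all_reals all_analysis.
From mathcomp Require Import measurable_realfun gauss_integral ring lra.
Import Order.TTheory GRing.Theory Num.Theory.
Import numFieldNormedType.Exports.
Set Implicit Arguments.
Unset Strict Implicit.
Unset Printing Implicit Defensive.
Local Open Scope classical_set_scope.
Local Open Scope ring_scope.

(** Existence and uniqueness of weak solutions are not borrowed: [parisi_Psi] may be its default 0,
    and a weak solution is only a distributional identity with a bounded derivative [D]. So the
    Cole-Hopf formula must be derived from the weak form. Mollifying in space produces the average
    of [D ^+ 2] where the formula wants the square of the average of [D]. Jensen's inequality
    settles one bound; for the other, the difference is a variance that tends to 0, but it depends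
    on the point and has to be summed under a Gaussian kernel after exponentiation. Existence at the
    minimizer is deduced from minimality; at the perturbed function the default value only lowers
    the functional. A level [m = 0] has no Cole-Hopf formula, so a level is described by operators
    of parameter [m' >= m], [m' > 0], which bound it from above, and from below up to [(m' - m) / 2]
    per unit of variance. This explains the mass 2: the comparison passes from [m] to [m + 1] and
    from there to [m + 2], each step costs at most half the variance [v], and the factor 1/2 before
    the subtracted integral turns mass 2 into [s * v]. *)

Section ExpBounds.
Variable R : realType.
Implicit Types (x y : R) (f : R -> R).

Lemma mean_value_bound f (df : R -> R) (B x y : R) :
  (forall z : R, Num.min x y <= z <= Num.max x y -> is_derive z 1 f (df z)) ->
  (forall z, Num.min x y <= z <= Num.max x y -> `|df z| <= B) ->
  `|f y - f x| <= B * `|y - x|.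
Proof.
wlog xy : x y / x < y => [hw|].
  move=> hd hB; have [xy|xy|->] := ltgtP x y; first exact: hw.
  - rewrite distrC [X in _ * X]distrC.
    by apply: hw => // z; [rewrite minC maxC; exact: hd|rewrite minC maxC; exact: hB].
  - by rewrite !subrr normr0 mulr0.
rewrite min_l ?max_r ?(ltW xy)// => hd hB.
have [||c hc ->] := @MVT _ f df x y xy.
- by move=> z; rewrite in_itv/= => /andP[h1 h2]; apply: hd; rewrite !ltW.
- apply: derivable_within_continuous => z.
  by rewrite in_itv/= => hz; have := hd _ hz; case.
- rewrite normrM ler_wpM2r//; apply: hB.
  by move: hc; rewrite in_itv/= => /andP[/ltW -> /ltW ->].
Qed.

Lemma mean_value_bound0 f (df : R -> R) (B y : R) :
  (forall z : R, is_derive z 1 f (df z)) ->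
  (forall z, `|z| <= `|y| -> `|df z| <= B) ->
  `|f y - f 0| <= B * `|y|.
Proof.
move=> hd hB; rewrite -[X in _ * `|X|]subr0; apply: mean_value_bound => // z hz.
apply: hB; move: hz; have [y0|y0] := leP 0 y => /andP[h1 h2].
  by rewrite !ger0_norm.
by rewrite (ltr0_norm y0) ler0_norm//; lra.
Qed.

(** The derivative of each Taylor remainder of the exponential is the preceding remainder, so this
    bound and the next two follow from one another by the mean value inequality. Factorials are
    given up; only the power of [|y|] matters later. *)
Lemma expR_sub1_bound y : `|expR y - 1| <= `|y| * expR `|y|.
Proof.
rewrite -[X in _ - X](@expR0 R) mulrC.
apply: (@mean_value_bound0 expR expR) => z zy.
by rewrite ger0_norm ?expR_ge0// ler_expR (le_trans _ zy)// ler_norm.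
Qed.

Lemma expR_sub2_bound y : `|expR y - 1 - y| <= `|y| ^+ 2 * expR `|y|.
Proof.
have -> : expR y - 1 - y = (expR y - y) - (expR 0 - 0) by rewrite expR0; ring.
rewrite expr2 mulrAC.
apply: (@mean_value_bound0 (fun z => expR z - z) (fun z => expR z - 1)) => z zy.
apply: le_trans (expR_sub1_bound z) _.
by apply: ler_pM => //; rewrite ?expR_ge0// ler_expR.
Qed.

Lemma expR_sub3_bound y : `|expR y - 1 - y - y ^+ 2 / 2| <= `|y| ^+ 3 * expR `|y|.
Proof.
have -> : expR y - 1 - y - y ^+ 2 / 2 = (expR y - y - y ^+ 2 / 2) - (expR 0 - 0 - 0 ^+ 2 / 2) by rewrite expR0; ring.
rewrite (_ : `|y| ^+ 3 * expR `|y| = `|y| ^+ 2 * expR `|y| * `|y|); last by ring.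
apply: (@mean_value_bound0 (fun z => expR z - z - z ^+ 2 / 2) (fun z => expR z - 1 - z)) => z; last first.
  move=> zy; apply: le_trans (expR_sub2_bound z) _.
  by apply: ler_pM => //; rewrite ?expR_ge0 ?exprn_ge0 ?lerXn2r ?ler_expR ?nnegrE.
apply: is_derive_eq; rewrite /GRing.scale/=; lra.
Qed.

Lemma ler_norm_expR x : `|x| <= expR `|x|.
Proof. by have := expR_ge1Dx `|x|; lra. Qed.

End ExpBounds.

(** * Domination and almost-everywhere comparison for real-valued integrals *)

Section Integrals.
Context d (T : measurableType d) (R : realType).
Variable mu : {measure set T -> \bar R}.
Implicit Types (f g h : T -> R) (D : set T).

Lemma dominated_integrable f h D : measurable D -> measurable_fun D f ->
  mu.-integrable D (EFin \o h) -> (forall x, D x -> `|f x| <= h x) ->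
  mu.-integrable D (EFin \o f).
Proof.
move=> mD mf ih fh; apply: (le_integrable mD _ _ ih).
  exact/measurable_EFinP.
move=> x Dx /=; rewrite lee_fin; apply: le_trans (fh _ Dx) _; exact: ler_norm.
Qed.

Lemma Rintegrable_add f g D : measurable D -> mu.-integrable D (EFin \o f) ->
  mu.-integrable D (EFin \o g) ->
  mu.-integrable D (EFin \o (fun x => f x + g x)).
Proof. by move=> mD hf hg; have := integrableD mD hf hg. Qed.

Lemma Rintegrable_sub f g D : measurable D -> mu.-integrable D (EFin \o f) ->
  mu.-integrable D (EFin \o g) ->
  mu.-integrable D (EFin \o (fun x => f x - g x)).
Proof. by move=> mD hf hg; have := integrableB mD hf hg. Qed.

Lemma Rintegrable_scale (k : R) f D : measurable D ->
  mu.-integrable D (EFin \o f) ->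
  mu.-integrable D (EFin \o (fun x => k * f x)).
Proof. by move=> mD hf; have := integrableZl mD k hf. Qed.

Lemma dominated_Rintegral (f_ : nat -> T -> R) f h D : measurable D ->
  (forall n, measurable_fun D (f_ n)) -> measurable_fun D f ->
  mu.-integrable D (EFin \o h) ->
  (forall n x, D x -> `|f_ n x| <= h x) ->
  {ae mu, forall x, D x -> f_ n x @[n --> \oo] --> f x} ->
  (\int[mu]_(x in D) f_ n x) @[n --> \oo] --> \int[mu]_(x in D) f x.
Proof.
move=> mD mf_ mf ih fh ff.
have [] := @dominated_convergence _ _ _ mu D mD (fun n => EFin \o f_ n) (EFin \o f) (EFin \o h).
- by move=> n; exact/measurable_EFinP.
- exact/measurable_EFinP.
- apply: filterS ff => x + Dx => /(_ Dx) hx.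
  by apply: cvg_comp hx _.
- exact: ih.
- by apply: aeW => x n Dx /=; rewrite lee_fin fh.
move=> if_ _ h3; apply: fine_cvg; rewrite fineK//.
exact: integrable_fin_num.
Qed.

Lemma ae_eq_Rintegral f g D : measurable D -> measurable_fun D f ->
  measurable_fun D g -> {ae mu, forall x, D x -> f x = g x} ->
  \int[mu]_(x in D) f x = \int[mu]_(x in D) g x.
Proof.
move=> mD mf mg fg; congr fine; apply: ae_eq_integral => //.
- exact/measurable_EFinP.
- exact/measurable_EFinP.
- by apply: filterS fg => x h Dx; rewrite h.
Qed.

(** [min f g] lies below [g] everywhere and equals [f] almost everywhere, which reduces the claim to
    monotonicity under a pointwise bound. *)
Lemma ae_le_Rintegral f g D : measurable D -> 
  mu.-integrable D (EFin \o f) -> mu.-integrable D (EFin \o g) ->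
  {ae mu, forall x, D x -> f x <= g x} ->
  \int[mu]_(x in D) f x <= \int[mu]_(x in D) g x.
Proof.
move=> mD if_ ig fg.
have mf : measurable_fun D f by apply/measurable_EFinP; exact: measurable_int if_.
have mg : measurable_fun D g by apply/measurable_EFinP; exact: measurable_int ig.
rewrite (@ae_eq_Rintegral f (fun x => Num.min (f x) (g x)) D)//; last 2 first.
- exact: measurable_minr.
- by apply: filterS fg => x h /h fgx; rewrite min_l.
apply: le_Rintegral => //.
- apply: (@dominated_integrable _ (fun x => `|f x| + `|g x|)) => //.
  + exact: measurable_minr.
  + by apply: Rintegrable_add => //; exact: integrable_norm.
  + by move=> x _; have [_|_] := leP (f x) (g x); rewrite ?lerDl ?lerDr.
- by move=> x _; rewrite ge_min lexx orbT.
Qed.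

End Integrals.

(** * Joint measurability on the plane *)

Section Plane.
Variable R : realType.
Notation mu := (@lebesgue_measure R).

(* Approximating the first argument from a grid reduces the joint
   measurability to that of countably many sections. *)
Lemma caratheodory_measurable (f : R -> R -> R) :
  (forall x, continuous (f ^~ x)) -> (forall t, measurable_fun setT (f t)) ->
  measurable_fun setT (fun p : R * R => f p.1 p.2).
Proof.
move=> cf mf.
pose g n (t : R) : R := (Num.floor (t * n.+1%:R))%:~R / n.+1%:R.
have gt t : g n t @[n --> \oo] --> t.
  apply/cvgrPdist_le => e e0.
  have : \forall n \near \oo, n.+1%:R^-1 < e by apply: near_infty_natSinv_lt (PosNum e0).
  apply: filterS => n hn.
  have n0 : (0:R) < n.+1%:R by [].
  rewrite /g -[X in `|X - _|](mulfK (lt0r_neq0 n0)) -mulrBl normrM.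
  rewrite [X in _ * X]ger0_norm ?invr_ge0 ?ler0n//.
  apply: le_trans (ltW hn); rewrite -[leRHS]mul1r ler_wpM2r ?invr_ge0 ?ler0n//.
  have := floor_itv (t * n.+1%:R); rewrite ler_norml => /andP[h1 h2].
  by rewrite intrD in h2; lra.
apply: (measurable_fun_cvg (h := fun n (p : R * R) => f (g n p.1) p.2)) => [n|p _].
  have -> : (fun p : R * R => f (g n p.1) p.2) = (fun p : R * R => f ((Num.floor (p.1 * n.+1%:R))%:~R / n.+1%:R) p.2) by [].
  move=> _ Y mY; rewrite setTI.
  have -> : (fun p : R * R => f ((Num.floor (p.1 * n.+1%:R))%:~R / n.+1%:R) p.2) @^-1` Y =
     \bigcup_(k : int) ([set t : R | Num.floor (t * n.+1%:R) = k] `*` (f (k%:~R / n.+1%:R) @^-1` Y)).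
    apply/seteqP; split => [[t x] /= h|[t x] /= [k _ [/= <-]]//].
    by exists (Num.floor (t * n.+1%:R)).
  apply: countable_bigcupT_measurable => // k.
  apply: measurableX; last by rewrite -[X in measurable X]setTI; exact: mf.
  have -> : [set t : R | Num.floor (t * n.+1%:R) = k] = (fun t => t * n.+1%:R) @^-1` `[k%:~R, (k + 1)%:~R[%classic.
    apply/seteqP; split => t /=; rewrite in_itv/=; first by move=> <-; exact: floor_itv.
    by move=> h; apply/eqP; rewrite floor_eq.
  by rewrite -[X in measurable X]setTI; apply: mulrr_measurable.
exact: (continuous_cvg _ (cf p.2 p.1) (gt p.1)).
Qed.

Lemma continuous_uncurry_measurable (f : R * R -> R) : continuous f ->
  measurable_fun setT f.
Proof.
move=> cf; rewrite (_ : f = fun p => f (p.1, p.2)); last by apply/funext => -[].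
apply: (@caratheodory_measurable (fun t x => f (t, x))) => [x t|t].
- apply: (cvg_comp (fun t : R => (t, x)) f); last exact: cf.
  by apply: (@cvg_pair _ _ _ _ (nbhs t) (nbhs x)); [exact: cvg_id|exact: cvg_cst].
- apply: continuous_measurable_fun => x.
  apply: (cvg_comp (fun x : R => (t, x)) f); last exact: cf.
  by apply: (@cvg_pair _ _ _ _ (nbhs t) (nbhs x)); [exact: cvg_cst|exact: cvg_id].
Qed.

End Plane.

HB.lock Definition gmean (R : realType) (f : R -> R) : R :=
  \int[@lebesgue_measure R]_z (f z * normal_pdf 0 1 z).

(** * Gaussian means and the Cole-Hopf operator *)

Section GaussianMean.
Variable R : realType.
Notation mu := (@lebesgue_measure R).
Notation phi := (@normal_pdf R 0 1).
Implicit Types (f g h : R -> R).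

(** At most exponential growth: a class closed under sums, products and affine changes of variable,
    on which every Gaussian mean converges absolutely. The constants may have any sign;
    [moderate_weaken] normalises them. *)
Definition moderate f := measurable_fun setT f /\
  exists A B : R, forall z, `|f z| <= A * expR (B * `|z|).

Lemma phiE z : phi z = normal_peak 1 * expR (- z ^+ 2 / 2).
Proof.
by rewrite normal_pdfE ?oner_neq0// /normal_fun subr0 expr1n.
Qed.

Lemma phi_ge0 z : 0 <= phi z. Proof. exact: normal_pdf_ge0. Qed.

Lemma continuous_phi : continuous phi.
Proof. by apply: continuous_normal_pdf; exact: oner_neq0. Qed.

(** Exponential tilting shifts the mean of the Gaussian; integrability of exponentials and the
    Laplace transform both follow. *)
Lemma expR_phi c z : expR (c * z) * phi z = expR (c ^+ 2 / 2) * normal_pdf c 1 z.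
Proof.
rewrite phiE normal_pdfE ?oner_neq0// /normal_fun expr1n.
rewrite mulrCA [RHS]mulrCA -!expRD; congr (_ * expR _).
by rewrite -[1 *+ 2]/(2%:R); field.
Qed.

Lemma integrable_expR_phi c : mu.-integrable setT (EFin \o (fun z => expR (c * z) * phi z)).
Proof.
rewrite (_ : (fun z => _) = fun z => expR (c ^+ 2 / 2) * normal_pdf c 1 z).
  apply: Rintegrable_scale => //.
  by apply: integrable_normal_pdf.
by apply/funext => z; exact: expR_phi.
Qed.

Lemma gmean_expR c : gmean (fun z : R => expR (c * z)) = expR (c ^+ 2 / 2).
Proof.
rewrite gmean.unlock; under eq_Rintegral do rewrite expR_phi.
rewrite RintegralZl//; last exact: integrable_normal_pdf.
by rewrite /Rintegral integral_normal_pdf ?oner_neq0// mulr1.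
Qed.

Lemma moderate_integrable f : moderate f -> mu.-integrable setT (EFin \o (fun z => f z * phi z)).
Proof.
move=> [mf [A [B fB]]].
(* [expR (B * |z|)] is at most the sum of the exponentials of [B * z] and [- B * z], both integrable
   by tilting. *)
have iexp : mu.-integrable setT (EFin \o (fun z => `|A| * (expR (B * z) * phi z + expR (- B * z) * phi z))).
  by apply: Rintegrable_scale => //; apply: Rintegrable_add => //; exact: integrable_expR_phi.
apply: dominated_integrable iexp _ => //.
  by apply: measurable_funM => //; exact: measurable_normal_pdf.
move=> z _; rewrite normrM (ger0_norm (phi_ge0 z)) -mulrDl mulrA ler_wpM2r ?phi_ge0//.
apply: le_trans (fB z) _; apply: le_trans (ler_wpM2r (expR_ge0 _) (ler_norm A)) _.
rewrite ler_wpM2l//.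
have := expR_ge0 (B * z); have := expR_ge0 (- B * z).
by have [z0|z0] := leP 0 z; [rewrite ger0_norm//; lra|rewrite ltr0_norm// mulrN -mulNr; lra].
Qed.

Lemma moderate_bounded f C : measurable_fun setT f -> (forall z, `|f z| <= C) -> moderate f.
Proof. by move=> mf fC; split => //; exists C, 0 => z; rewrite mul0r expR0 mulr1. Qed.

Lemma moderate_cst (k : R) : moderate (fun=> k).
Proof. exact: (@moderate_bounded _ `|k|). Qed.

Lemma moderate_weaken f : moderate f -> measurable_fun setT f /\
  exists A B : R, [/\ 0 <= A, 0 <= B & forall z, `|f z| <= A * expR (B * `|z|)].
Proof.
move=> [mf [A [B fB]]]; split => //; exists `|A|, `|B|; split => // z.
apply: le_trans (fB z) _; apply: ler_pM; rewrite ?expR_ge0 ?ler_norm//.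
- rewrite leNgt; apply/negP => A0; have := fB 0; rewrite normr0 mulr0 expR0 mulr1.
  by have := normr_ge0 (f 0); lra.
- by rewrite ler_expR ler_wpM2r// ler_norm.
Qed.

Lemma moderate_add f g : moderate f -> moderate g -> moderate (fun z => f z + g z).
Proof.
move=> /moderate_weaken[mf [A [B [A0 B0 fB]]]] /moderate_weaken[mg [A' [B' [A'0 B'0 gB]]]].
split; first exact: measurable_funD.
exists (A + A'), (B + B') => z; apply: le_trans (ler_normD _ _) _.
rewrite mulrDl; apply: lerD; [apply: le_trans (fB z) _|apply: le_trans (gB z) _].
- by rewrite ler_wpM2l// ler_expR ler_wpM2r// lerDl.
- by rewrite ler_wpM2l// ler_expR ler_wpM2r// lerDr.
Qed.

Lemma moderate_mul f g : moderate f -> moderate g -> moderate (fun z => f z * g z).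
Proof.
move=> [mf [A [B fB]]] [mg [A' [B' gB]]].
split; first exact: measurable_funM.
exists (A * A'), (B + B') => z; rewrite normrM mulrDl expRD mulrACA.
exact: ler_pM.
Qed.

Lemma moderate_scale k f : moderate f -> moderate (fun z => k * f z).
Proof. exact: moderate_mul (moderate_cst k). Qed.

Lemma moderate_sub f g : moderate f -> moderate g -> moderate (fun z => f z - g z).
Proof.
move=> mf mg; rewrite (_ : (fun z => _) = fun z => f z + (-1) * g z).
  by apply: moderate_add => //; exact: moderate_scale.
by apply/funext => z; rewrite mulN1r.
Qed.

Lemma moderate_le f g : measurable_fun setT f -> moderate g -> (forall z, `|f z| <= g z) -> moderate f.
Proof.
move=> mf [mg [A [B gB]]] fg; split=> //; exists A, B => z.
by apply: le_trans (fg z) (le_trans (ler_norm _) (gB z)).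
Qed.

Lemma moderate_norm f : moderate f -> moderate (fun z => `|f z|).
Proof.
move=> [mf [A [B gB]]]; split; first exact: measurableT_comp.
by exists A, B => z; rewrite normr_id.
Qed.

Lemma moderate_id : moderate id.
Proof.
split => //; exists 1, 1 => z; rewrite !mul1r; exact: ler_norm_expR.
Qed.

Lemma moderate_exp f n : moderate f -> moderate (fun z => f z ^+ n).
Proof.
move=> mf; elim: n => [|n ih]; first exact: moderate_cst.
by under eq_fun do rewrite exprS; exact: moderate_mul.
Qed.

Lemma moderate_expR_norm B : moderate (fun z => expR (B * `|z|)).
Proof.
split; first by apply: measurableT_comp => //; apply: measurable_funM => //; exact: measurableT_comp.
by exists 1, B => z; rewrite mul1r ger0_norm ?expR_ge0.
Qed.

Lemma moderate_affine f a b : moderate f -> moderate (fun z => f (a + b * z)).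
Proof.
move=> /moderate_weaken[mf [A [B [A0 B0 fB]]]]; split.
  by apply: measurableT_comp => //; apply: measurable_funD => //; exact: measurable_funM.
exists (A * expR (B * `|a|)), (B * `|b|) => z; apply: le_trans (fB _) _.
rewrite -mulrA -expRD ler_wpM2l// ler_expR -mulrA -mulrDr ler_wpM2l// -normrM.
exact: ler_normD.
Qed.

Lemma gmean_cst (k : R) : gmean (fun _ : R => k) = k.
Proof.
rewrite gmean.unlock RintegralZl//; last exact: integrable_normal_pdf.
by rewrite /Rintegral integral_normal_pdf ?oner_neq0// mulr1.
Qed.

Lemma gmean_add f g : moderate f -> moderate g -> gmean (fun z => f z + g z) = gmean f + gmean g.
Proof.
move=> mf mg; rewrite gmean.unlock -RintegralD//; try exact: moderate_integrable.
by apply: eq_Rintegral => z _; rewrite mulrDl.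
Qed.

Lemma gmean_scale (k : R) f : moderate f -> gmean (fun z => k * f z) = k * gmean f.
Proof.
move=> mf; rewrite gmean.unlock -RintegralZl//; last exact: moderate_integrable.
by apply: eq_Rintegral => z _; rewrite mulrA.
Qed.

Lemma gmean_sub f g : moderate f -> moderate g -> gmean (fun z => f z - g z) = gmean f - gmean g.
Proof.
move=> mf mg; rewrite (_ : (fun z => _) = fun z => f z + (-1) * g z).
  by rewrite gmean_add ?gmean_scale ?mulN1r//; exact: moderate_scale.
by apply/funext => z; rewrite mulN1r.
Qed.

Lemma gmean_le f g : moderate f -> moderate g -> (forall z, f z <= g z) -> gmean f <= gmean g.
Proof.
move=> mf mg fg; rewrite gmean.unlock; apply: le_Rintegral => //; try exact: moderate_integrable.
by move=> z _; rewrite ler_wpM2r ?phi_ge0.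
Qed.

Lemma gmean_ge0 f : (forall z, 0 <= f z) -> 0 <= gmean f.
Proof. by move=> f0; rewrite gmean.unlock; apply: Rintegral_ge0 => z _; rewrite mulr_ge0 ?phi_ge0. Qed.

Lemma gmean_norm f : moderate f -> `|gmean f| <= gmean (fun z => `|f z|).
Proof.
move=> mf; rewrite gmean.unlock.
apply: le_trans (le_normr_Rintegral _ _) _ => //; first exact: moderate_integrable.
by rewrite le_eqVlt; apply/orP; left; apply/eqP/eq_Rintegral => z _; rewrite normrM (ger0_norm (phi_ge0 z)).
Qed.

Lemma gmean_le_norm f g : moderate f -> moderate g -> (forall z, `|f z| <= g z) -> `|gmean f| <= gmean g.
Proof.
move=> mf mg fg; rewrite (le_trans (gmean_norm mf))//.
by apply: gmean_le => //; exact: moderate_norm.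
Qed.

Lemma eq0_of_le_scale (x K : R) : (forall c, 0 < c <= 1 -> `|x| <= K * c) -> x = 0.
Proof.
move=> h; apply/eqP; rewrite -normr_le0 leNgt; apply/negP => x0.
have K0 : 0 < K by have := h 1; rewrite ltr01 lexx mulr1 => /(_ isT); lra.
have c0 : 0 < Num.min 1 (`|x| / (2 * K)) by rewrite lt_min ltr01 divr_gt0// mulr_gt0.
have := h (Num.min 1 (`|x| / (2 * K))); rewrite c0 ge_min lexx => /(_ isT) h1.
have : K * Num.min 1 (`|x| / (2 * K)) <= K * (`|x| / (2 * K)).
  by rewrite ler_wpM2l// ?(ltW K0)// ge_min lexx orbT.
have -> : K * (`|x| / (2 * K)) = `|x| / 2 by field; lra.
lra.
Qed.

Lemma moderate_pow_expR n B : moderate (fun z : R => `|z| ^+ n * expR (B * `|z|)).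
Proof.
apply: moderate_mul; last exact: moderate_expR_norm.
by apply: moderate_exp; apply: moderate_norm; exact: moderate_id.
Qed.

Lemma moderate_expR c : moderate (fun z : R => expR (c * z)).
Proof.
split; first by apply: measurableT_comp => //; exact: measurable_funM.
exists 1, `|c| => z; rewrite mul1r ger0_norm ?expR_ge0// ler_expR.
by rewrite -normrM ler_norm.
Qed.

(** The Laplace transform is even in [c], so [expR (c * z) - expR (- c * z)] has mean 0, while it
    equals [2 * c * z] up to O(c^2). Dividing by [c] and letting it tend to 0 gives the first
    moment. *)
Lemma gmean_id : gmean (fun z : R => z) = 0.
Proof.
apply: (@eq0_of_le_scale _ (gmean (fun z : R => `|z| ^+ 2 * expR (1 * `|z|)))) => c /andP[c0 c1].
have bnd (z : R) : `|expR (c * z) - expR (- c * z) - (2 * c) * z| <= 2 * c ^+ 2 * (`|z| ^+ 2 * expR (1 * `|z|)).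
  have h w : `|w| = c * `|z| -> `|expR w - 1 - w| <= c ^+ 2 * (`|z| ^+ 2 * expR (1 * `|z|)).
    move=> wE; apply: le_trans (expR_sub2_bound w) _; rewrite wE exprMn -mulrA.
    by rewrite !ler_wpM2l ?exprn_ge0 ?(ltW c0)// ler_expR ler_wpM2r.
  have h1 := h (c * z); have h2 := h (- c * z).
  move: h1 h2; rewrite !normrM normrN (ger0_norm (ltW c0)) => /(_ erefl) h1 /(_ erefl) h2.
  rewrite (_ : expR (c * z) - _ - _ = (expR (c * z) - 1 - c * z) - (expR (- c * z) - 1 - - c * z)); last by ring.
  by apply: le_trans (ler_normB _ _) _; lra.
have mz : moderate (fun z : R => (2 * c) * z) by exact: moderate_scale moderate_id.
have me : moderate (fun z : R => expR (c * z) - expR (- c * z)).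
  by apply: moderate_sub; exact: moderate_expR.
have := gmean_le_norm (moderate_sub me mz) (moderate_scale (2 * c ^+ 2) (moderate_pow_expR 2 1)) bnd.
rewrite gmean_sub// gmean_sub; try exact: moderate_expR.
rewrite !gmean_expR sqrrN subrr sub0r normrN !gmean_scale; last 2 first.
- exact: moderate_id.
- exact: moderate_pow_expR.
rewrite normrM ger0_norm; last by lra.
rewrite (_ : 2 * c ^+ 2 * _ = 2 * c * (gmean (fun z : R => `|z| ^+ 2 * expR (1 * `|z|)) * c)); last by ring.
by rewrite ler_pM2l//; lra.
Qed.

(** Same device with the even combination of exponentials: its mean is known from the Laplace
    transform, and it equals [2 + c ^+ 2 * z ^+ 2] up to O(c^3). *)
Lemma gmean_sqr : gmean (fun z : R => z ^+ 2) = 1.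
Proof.
apply/eqP; rewrite -subr_eq0; apply/eqP.
pose K := gmean (fun z : R => `|z| ^+ 3 * expR (1 * `|z|)).
apply: (@eq0_of_le_scale _ (2 * K + expR 1)) => c /andP[c0 c1].
have msq : moderate (fun z : R => z ^+ 2) by apply: moderate_exp; exact: moderate_id.
have mf : moderate (fun z : R => expR (c * z) + expR (- c * z) - 2 - c ^+ 2 * z ^+ 2).
  apply: moderate_sub; last exact: moderate_scale.
  by apply: moderate_sub; [apply: moderate_add; exact: moderate_expR|exact: moderate_cst].
have bnd (z : R) : `|expR (c * z) + expR (- c * z) - 2 - c ^+ 2 * z ^+ 2| <= 2 * c ^+ 3 * (`|z| ^+ 3 * expR (1 * `|z|)).
  have h w : `|w| = c * `|z| -> `|expR w - 1 - w - w ^+ 2 / 2| <= c ^+ 3 * (`|z| ^+ 3 * expR (1 * `|z|)).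
    move=> wE; apply: le_trans (expR_sub3_bound w) _; rewrite wE exprMn -mulrA.
    by rewrite !ler_wpM2l ?exprn_ge0 ?(ltW c0)// ler_expR ler_wpM2r.
  have h1 := h (c * z); have h2 := h (- c * z).
  move: h1 h2; rewrite !normrM normrN (ger0_norm (ltW c0)) => /(_ erefl) h1 /(_ erefl) h2.
  rewrite (_ : expR (c * z) + _ - _ - _ = (expR (c * z) - 1 - c * z - (c * z) ^+ 2 / 2) + (expR (- c * z) - 1 - - c * z - (- c * z) ^+ 2 / 2)); last by field.
  by apply: le_trans (ler_normD _ _) _; lra.
have := gmean_le_norm mf (moderate_scale (2 * c ^+ 3) (moderate_pow_expR 3 1)) bnd.
rewrite gmean_sub//; last 2 first.
- by apply: moderate_sub; [apply: moderate_add; exact: moderate_expR|exact: moderate_cst].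
- exact: moderate_scale.
rewrite gmean_sub; last 2 first.
- by apply: moderate_add; exact: moderate_expR.
- exact: moderate_cst.
rewrite gmean_add; try exact: moderate_expR.
rewrite !gmean_expR gmean_cst !gmean_scale//; last exact: moderate_pow_expR.
rewrite sqrrN -/K => h1.
have h2 : `|expR (c ^+ 2 / 2) - 1 - c ^+ 2 / 2| <= c ^+ 3 * expR 1 / 2.
  apply: le_trans (expR_sub2_bound _) _.
  have c20 : 0 <= c ^+ 2 / 2 by rewrite divr_ge0 ?exprn_ge0 ?(ltW c0).
  have c21 : c ^+ 2 <= 1 by rewrite exprn_ile1 ?(ltW c0).
  rewrite ger0_norm// (_ : c ^+ 3 * _ / 2 = (c ^+ 3 / 2) * expR 1); last by ring.
  apply: ler_pM; rewrite ?exprn_ge0 ?expR_ge0//; last by rewrite ler_expR; lra.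
  rewrite (_ : (c ^+ 2 / 2) ^+ 2 = c ^+ 3 / 2 * (c / 2)); last by field.
  by rewrite ler_piMr ?divr_ge0 ?exprn_ge0 ?(ltW c0)//; lra.
have : c ^+ 2 * `|gmean (fun z : R => z ^+ 2) - 1| <= c ^+ 2 * ((2 * K + expR 1) * c).
  rewrite -[X in X * `|_|]ger0_norm ?exprn_ge0 ?(ltW c0)// -normrM.
  rewrite (_ : c ^+ 2 * (_ - 1) = 2 * (expR (c ^+ 2 / 2) - 1 - c ^+ 2 / 2) - (expR (c ^+ 2 / 2) + expR (c ^+ 2 / 2) - 2 - c ^+ 2 * gmean (fun z : R => z ^+ 2))); last by field.
  apply: le_trans (ler_normB _ _) _; rewrite normrM ger0_norm//.
  by rewrite (_ : c ^+ 2 * ((2 * K + expR 1) * c) = 2 * (c ^+ 3 * expR 1 / 2) + 2 * c ^+ 3 * K); [lra|field].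
by rewrite ler_pM2l ?exprn_gt0.
Qed.

End GaussianMean.

(** * Normalised log-Laplace transforms under the Gaussian law *)

HB.lock Definition cumulant (R : realType) (m : R) (F : R -> R) : R :=
  m^-1 * ln (gmean (fun z => expR (m * F z))).

Section Cumulant.
Variable R : realType.
Notation mu := (@lebesgue_measure R).
Implicit Types (f g h F G : R -> R) (m L : R).

Definition sublinear F := measurable_fun setT F /\
  exists A B : R, [/\ 0 <= A, 0 <= B & forall z, `|F z| <= A + B * `|z|].

Lemma sublinear_moderate F : sublinear F -> moderate F.
Proof.
move=> [mF [A [B [A0 B0 h]]]].
apply: moderate_le (fun z => A + B * `|z|) mF _ h.
by apply: moderate_add; [exact: moderate_cst|exact/moderate_scale/moderate_norm/moderate_id].
Qed.

Lemma moderate_expR_sublinear m F : sublinear F -> moderate (fun z => expR (m * F z)).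
Proof.
move=> [mF [A [B [A0 B0 h]]]]; split.
  by apply: measurableT_comp => //; exact: measurable_funM.
exists (expR (`|m| * A)), (`|m| * B) => z.
rewrite ger0_norm ?expR_ge0// -expRD ler_expR -mulrA -mulrDr.
by apply: le_trans (ler_norm _) _; rewrite normrM ler_wpM2l.
Qed.

Lemma sublinear_add F G : sublinear F -> sublinear G -> sublinear (fun z => F z + G z).
Proof.
move=> [mF [A [B [A0 B0 h]]]] [mG [A' [B' [A'0 B'0 h']]]]; split; first exact: measurable_funD.
exists (A + A'), (B + B'); split; try lra.
by move=> z; apply: le_trans (ler_normD _ _) _; have := h z; have := h' z; lra.
Qed.

Lemma sublinear_scale (k : R) F : sublinear F -> sublinear (fun z => k * F z).
Proof.
move=> [mF [A [B [A0 B0 h]]]]; split; first exact: measurable_funM.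
exists (`|k| * A), (`|k| * B); split; rewrite ?mulr_ge0//.
by move=> z; rewrite normrM -mulrA -mulrDr ler_wpM2l.
Qed.

Lemma sublinear_cst (k : R) : sublinear (fun=> k).
Proof. by split => //; exists `|k|, 0; split => // z; rewrite mul0r addr0. Qed.

Lemma sublinear_sub F G : sublinear F -> sublinear G -> sublinear (fun z => F z - G z).
Proof.
move=> hF hG; rewrite (_ : (fun z => _) = fun z => F z + (-1) * G z).
  by apply: sublinear_add => //; exact: sublinear_scale.
by apply/funext => z; rewrite mulN1r.
Qed.

(** Jensen's inequality, from the tangent line of the exponential at the mean [c]. *)
Lemma gmean_expR_ge F : sublinear F -> expR (gmean F) <= gmean (fun z => expR (F z)).
Proof.
move=> hF; set c := gmean F.
have mF := sublinear_moderate hF.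
have h1 : moderate (fun z => expR c * (1 + (F z - c))).
  by apply/moderate_scale/moderate_add; [exact: moderate_cst|apply: moderate_sub => //; exact: moderate_cst].
have h2 : moderate (fun z => expR (F z)).
  by have := moderate_expR_sublinear 1 hF; under eq_fun do rewrite mul1r.
have := gmean_le h1 h2; rewrite gmean_scale; last first.
  by apply: moderate_add; [exact: moderate_cst|apply: moderate_sub => //; exact: moderate_cst].
rewrite gmean_add ?gmean_sub ?gmean_cst ?subrr ?addr0 ?mulr1 //; try exact: moderate_cst.
  apply=> z; rewrite -[in leRHS](subrK c (F z)) expRD mulrC ler_wpM2r ?expR_ge0//.
  exact: expR_ge1Dx.
by apply: moderate_sub => //; exact: moderate_cst.
Qed.

Lemma gmean_expR_gt0 m F : sublinear F -> 0 < gmean (fun z => expR (m * F z)).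
Proof.
move=> hF; apply: lt_le_trans (gmean_expR_ge (sublinear_scale m hF)).
exact: expR_gt0.
Qed.

Lemma expR_cumulant m F : 0 < m -> sublinear F ->
  expR (m * cumulant m F) = gmean (fun z => expR (m * F z)).
Proof.
move=> m0 hF; rewrite cumulant.unlock mulrA divff ?gt_eqF// mul1r lnK// posrE.
exact: gmean_expR_gt0.
Qed.

Lemma cumulant_le m F G : 0 < m -> sublinear F -> sublinear G ->
  (forall z, F z <= G z) -> cumulant m F <= cumulant m G.
Proof.
move=> m0 hF hG FG; rewrite -(ler_pM2l m0) -ler_expR expR_cumulant// expR_cumulant//.
apply: gmean_le; try exact: moderate_expR_sublinear.
by move=> z; rewrite ler_expR ler_pM2l.
Qed.

Lemma cumulant_shift m F c : 0 < m -> sublinear F -> cumulant m (fun z => F z + c) = cumulant m F + c.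
Proof.
move=> m0 hF; apply: (mulfI (lt0r_neq0 m0)); apply: expR_inj.
rewrite expR_cumulant//; last by apply: sublinear_add => //; exact: sublinear_cst.
rewrite mulrDr expRD expR_cumulant// mulrC -gmean_scale; last exact: moderate_expR_sublinear.
by congr gmean; apply/funext => z; rewrite mulrDr expRD mulrC.
Qed.

(** Removes the logarithm: an upper bound on a cumulant becomes an upper bound by 1 on an
    exponential mean, the form in which the comparisons below are proved. *)
Lemma cumulant_leP m F c : 0 < m -> sublinear F ->
  (cumulant m F <= c) = (gmean (fun z => expR (m * (F z - c))) <= 1).
Proof.
move=> m0 hF; rewrite -expR_cumulant//; last first.
  by apply: sublinear_sub => //; exact: sublinear_cst.
by rewrite -expR0 ler_expR cumulant_shift// pmulr_rle0// subr_le0.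
Qed.

Lemma gmean_expR_sub_cumulant m F : 0 < m -> sublinear F ->
  gmean (fun z => expR (m * (F z - cumulant m F))) = 1.
Proof.
move=> m0 hF; rewrite -expR_cumulant//; last first.
  by apply: sublinear_sub => //; exact: sublinear_cst.
by rewrite cumulant_shift// subrr mulr0 expR0.
Qed.

(** Cauchy-Schwarz in disguise: both exponentials are normalised to mean 1, and the exponential of
    the half sum is at most their average by the inequality of arithmetic and geometric means. *)
Lemma cumulant_midpoint m F G : 0 < m -> sublinear F -> sublinear G ->
  cumulant m (fun z => (F z + G z) / 2) <= (cumulant m F + cumulant m G) / 2.
Proof.
move=> m0 hF hG; set a := cumulant m F; set b := cumulant m G.
have sF : moderate (fun z => expR (m * (F z - a))).
  by apply: moderate_expR_sublinear; apply: sublinear_sub => //; exact: sublinear_cst.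
have sG : moderate (fun z => expR (m * (G z - b))).
  by apply: moderate_expR_sublinear; apply: sublinear_sub => //; exact: sublinear_cst.
have hH : sublinear (fun z => (F z + G z) / 2).
  by under eq_fun do rewrite mulrC; apply: sublinear_scale; exact: sublinear_add.
rewrite cumulant_leP//.
rewrite [leRHS](_ : 1 = gmean (fun z => 2^-1 * (expR (m * (F z - a)) + expR (m * (G z - b))))); last first.
  rewrite gmean_scale ?gmean_add//; last exact: moderate_add.
  by rewrite gmean_expR_sub_cumulant// gmean_expR_sub_cumulant//; field.
apply: gmean_le.
- by apply: moderate_expR_sublinear; apply: sublinear_sub => //; exact: sublinear_cst.
- by apply: moderate_scale; exact: moderate_add.
move=> z; set s := m * (F z - a); set t := m * (G z - b).
have -> : m * ((F z + G z) / 2 - (a + b) / 2) = s / 2 + t / 2 by rewrite /s /t; field.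
rewrite -[in leRHS](_ : s / 2 + s / 2 = s); last by field.
rewrite -[in leRHS](_ : t / 2 + t / 2 = t); last by field.
rewrite !expRD; have := sqr_ge0 (expR (s / 2) - expR (t / 2)).
by rewrite sqrrB; rewrite !expr2; lra.
Qed.

(** Lyapunov's inequality. After normalising the [m'] exponential to mean 1, convexity bounds
    [expR (m * s)] by the combination of [expR (m' * s)] and 1 with weights [m / m'] and
    [1 - m / m']; it is obtained from the tangent line at [m * s]. *)
Lemma cumulant_mono m m' F : 0 < m -> m <= m' -> sublinear F -> cumulant m F <= cumulant m' F.
Proof.
move=> m0 mm' hF; have m'0 : 0 < m' by lra.
rewrite cumulant_leP//; set c := cumulant m' F.
have hc : sublinear (fun z => F z - c) by apply: sublinear_sub => //; exact: sublinear_cst.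
have t0 : 0 <= m / m' by rewrite divr_ge0; lra.
rewrite [leRHS](_ : 1 = gmean (fun z => m / m' * expR (m' * (F z - c)) + (1 - m / m'))); last first.
  rewrite gmean_add ?gmean_scale ?gmean_cst; try exact: moderate_expR_sublinear.
  - by rewrite gmean_expR_sub_cumulant//; lra.
  - by apply: moderate_scale; exact: moderate_expR_sublinear.
  - exact: moderate_cst.
apply: gmean_le; first exact: moderate_expR_sublinear.
  by apply: moderate_add; [apply: moderate_scale; exact: moderate_expR_sublinear|exact: moderate_cst].
move=> z; set s := F z - c.
have h w : expR (m * s) * (1 + (w - m * s)) <= expR w.
  rewrite [leRHS](_ : _ = expR (m * s) * expR (w - m * s)).
    by rewrite ler_wpM2l ?expR_ge0// expR_ge1Dx.
  by rewrite -expRD; congr expR; ring.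
have h1 := h (m' * s); have h2 := h 0; rewrite expR0 in h2.
have t1 : 0 <= 1 - m / m' by rewrite subr_ge0 ler_pdivrMr// mul1r.
have h1' := ler_wpM2l t0 h1; have h2' := ler_wpM2l t1 h2.
rewrite mulr1 in h2'; apply: le_trans (lerD h1' h2').
by rewrite le_eqVlt; apply/orP; left; apply/eqP; field; lra.
Qed.

End Cumulant.

(** * Second-order expansion of the cumulant for small functions *)

Section CumulantTaylor.
Variable R : realType.
Implicit Types (f g h F G D : R -> R) (m L K : R).

Lemma ln1Dx_bound (x : R) : 0 <= x -> `|ln (1 + x) - x| <= x ^+ 2.
Proof.
move=> x0; have x1 : 0 < 1 + x by lra.
have h1 : ln (1 + x) <= x by apply: le_ln1Dx; lra.
have h2 : x / (1 + x) <= ln (1 + x).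
  have := @le_ln1Dx R (- (x / (1 + x))).
  have -> : 1 + - (x / (1 + x)) = (1 + x)^-1 by field; lra.
  rewrite lnV// => h; rewrite -lerN2; apply: h.
  by rewrite ltrN2 ltr_pdivrMr//; lra.
have h3 : x - x ^+ 2 <= x / (1 + x).
  rewrite ler_pdivlMr// (_ : _ * _ = x - x ^+ 3); last by ring.
  by have := exprn_ge0 3 x0; lra.
by rewrite ler_norml; have := sqr_ge0 x; lra.
Qed.

(** Centring takes the mean out exactly. For the centred function, [zeta], its exponential moment
    minus 1, equals [m ^+ 2 / 2] times the variance up to O(K^3), and is nonnegative by Jensen. Then
    [ln (1 + zeta)] is [zeta] up to [zeta ^+ 2], which is O(K^4). The constant depends only on [m]
    and [K0], so that errors can be summed over many short intervals. *)
Lemma cumulant_taylor m K0 : 0 < m -> 0 <= K0 -> exists2 C : R, 0 <= C &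
  forall D K, measurable_fun setT D -> 0 <= K <= K0 -> (forall z, `|D z| <= K * `|z|) ->
  `|cumulant m D - (gmean D + m / 2 * (gmean (fun z => D z ^+ 2) - gmean D ^+ 2))| <= C * K ^+ 3.
Proof.
move=> m0 K00.
have mnorm : moderate (fun z : R => `|z|) by apply: moderate_norm; exact: moderate_id.
pose c1 := gmean (fun z : R => `|z|).
have c10 : 0 <= c1 by apply: gmean_ge0 => z.
pose W (z : R) := `|z| + c1.
have W0 z : 0 <= W z by rewrite addr_ge0.
have mW : moderate W by apply: moderate_add => //; exact: moderate_cst.
pose V3 (z : R) := W z ^+ 3 * expR (m * K0 * W z).
have mV3 : moderate V3.
  apply: moderate_mul; first exact: moderate_exp.
  apply: moderate_expR_sublinear; split; first by case: mW.
  exists c1, 1; split => // z; rewrite ger0_norm//; rewrite /W; lra.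
pose C1 := gmean V3; pose M2 := gmean (fun z => W z ^+ 2).
have C10 : 0 <= C1 by apply: gmean_ge0 => z; rewrite mulr_ge0 ?expR_ge0 ?exprn_ge0.
have M20 : 0 <= M2 by apply: gmean_ge0 => z; rewrite exprn_ge0.
pose C2 := m ^+ 2 / 2 * M2 + m ^+ 3 * K0 * C1.
have C20 : 0 <= C2 by rewrite addr_ge0// !mulr_ge0 ?exprn_ge0 ?(ltW m0).
(* The term with [C2 ^+ 2] pays for [zeta ^+ 2], one of whose four factors [K] is replaced by [K0];
   the term with [C1] pays for the cubic remainder of the exponential. *)
exists (m^-1 * (K0 * C2 ^+ 2 + m ^+ 3 * C1)).
  by rewrite mulr_ge0 ?invr_ge0 ?(ltW m0)// addr_ge0// !mulr_ge0 ?exprn_ge0 ?(ltW m0).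
move=> D0 K mD0 /andP[K0' KK0] hD0.
have sD0 : sublinear D0 by split => //; exists 0, K; split => // z; rewrite add0r.
have modD0 := sublinear_moderate sD0.
set e0 := gmean D0.
have he0 : `|e0| <= K * c1.
  rewrite /e0 /c1 -gmean_scale//; apply: gmean_le_norm => //; exact: moderate_scale.
pose D z := D0 z - e0.
have sD : sublinear D by apply: sublinear_sub => //; exact: sublinear_cst.
have modD := sublinear_moderate sD.
have hD z : `|D z| <= K * W z.
  by apply: le_trans (ler_normB _ _) _; rewrite /W mulrDr lerD.
have ED : gmean D = 0 by rewrite gmean_sub ?gmean_cst ?subrr//; exact: moderate_cst.
have modD2 : moderate (fun z => D z ^+ 2) by exact: moderate_exp.
have ED2 : gmean (fun z => D z ^+ 2) = gmean (fun z => D0 z ^+ 2) - e0 ^+ 2.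
  rewrite (_ : (fun z => D z ^+ 2) = fun z => D0 z ^+ 2 - ((2 * e0) * D0 z - e0 ^+ 2)); last first.
    by apply/funext => z; rewrite /D; ring.
  have h1 : moderate (fun z => (2 * e0) * D0 z) by exact: moderate_scale.
  rewrite gmean_sub; last 2 first.
  - exact: moderate_exp.
  - by apply: moderate_sub => //; exact: moderate_cst.
  rewrite gmean_sub//; last exact: moderate_cst.
  by rewrite gmean_scale// gmean_cst -/e0; ring.
pose zeta := gmean (fun z => expR (m * D z)) - 1.
have mexp : moderate (fun z => expR (m * D z)) by exact: moderate_expR_sublinear.
have zeta0 : 0 <= zeta.
  rewrite subr_ge0; have := gmean_expR_ge (sublinear_scale m sD).
  by rewrite gmean_scale// ED mulr0 expR0.
have hzeta : `|zeta - m ^+ 2 / 2 * gmean (fun z => D z ^+ 2)| <= m ^+ 3 * K ^+ 3 * C1.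
  have modr : moderate (fun z => expR (m * D z) - 1 - m * D z - m ^+ 2 / 2 * D z ^+ 2).
    apply: moderate_sub; last exact: moderate_scale.
    apply: moderate_sub; last exact: moderate_scale.
    by apply: moderate_sub => //; exact: moderate_cst.
  have -> : zeta - m ^+ 2 / 2 * gmean (fun z => D z ^+ 2) = gmean (fun z => expR (m * D z) - 1 - m * D z - m ^+ 2 / 2 * D z ^+ 2).
    rewrite gmean_sub; last 2 first.
    - by apply: moderate_sub; [apply: moderate_sub => //; exact: moderate_cst|exact: moderate_scale].
    - exact: moderate_scale.
    rewrite gmean_sub; last 2 first.
    - by apply: moderate_sub => //; exact: moderate_cst.
    - exact: moderate_scale.
    rewrite gmean_sub//; last exact: moderate_cst.
    by rewrite gmean_cst !gmean_scale// ED mulr0 subr0.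
  rewrite -gmean_scale//; apply: gmean_le_norm => //; first exact: moderate_scale.
  move=> z; rewrite (_ : m ^+ 2 / 2 * D z ^+ 2 = (m * D z) ^+ 2 / 2); last by ring.
  apply: le_trans (expR_sub3_bound _) _; rewrite normrM (ger0_norm (ltW m0)).
  rewrite (_ : (m * `|D z|) ^+ 3 * expR (m * `|D z|) = m ^+ 3 * (`|D z| ^+ 3 * expR (m * `|D z|))); last by ring.
  rewrite (_ : m ^+ 3 * K ^+ 3 * V3 z = m ^+ 3 * ((K * W z) ^+ 3 * expR (m * K0 * W z))); last by rewrite /V3; ring.
  rewrite ler_wpM2l ?exprn_ge0 ?(ltW m0)//.
  apply: ler_pM; rewrite ?exprn_ge0 ?expR_ge0//.
    by rewrite lerXn2r ?nnegrE// mulr_ge0.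
  rewrite ler_expR -mulrA ler_wpM2l ?(ltW m0)//; apply: le_trans (hD z) _.
  by rewrite ler_wpM2r.
have hD2 : gmean (fun z => D z ^+ 2) <= K ^+ 2 * M2.
  rewrite -gmean_scale; last exact: moderate_exp.
  apply: gmean_le => //; first by apply/moderate_scale/moderate_exp.
  by move=> z; rewrite -exprMn -real_normK ?num_real// lerXn2r ?nnegrE// mulr_ge0.
have zetaC : zeta <= K ^+ 2 * C2.
  have -> : K ^+ 2 * C2 = m ^+ 2 / 2 * (K ^+ 2 * M2) + K0 * (m ^+ 3 * K ^+ 2 * C1) by rewrite /C2; ring.
  have h1 : m ^+ 3 * K ^+ 3 * C1 <= K0 * (m ^+ 3 * K ^+ 2 * C1).
    rewrite (_ : _ * K ^+ 3 * _ = K * (m ^+ 3 * K ^+ 2 * C1)); last by ring.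
    by rewrite ler_wpM2r// !mulr_ge0 ?exprn_ge0// ltW.
  have h2 : m ^+ 2 / 2 * gmean (fun z => D z ^+ 2) <= m ^+ 2 / 2 * (K ^+ 2 * M2).
    by rewrite ler_wpM2l// mulr_ge0 ?exprn_ge0 ?(ltW m0).
  by move: hzeta; rewrite ler_norml => /andP[_]; lra.
have -> : cumulant m D0 = e0 + m^-1 * ln (1 + zeta).
  have -> : D0 = fun z => D z + e0 by apply/funext => z; rewrite /D subrK.
  by rewrite cumulant_shift// addrC; congr (_ + _); rewrite cumulant.unlock /zeta addrC subrK.
rewrite -ED2.
have -> : e0 + m^-1 * ln (1 + zeta) - (e0 + m / 2 * gmean (fun z => D z ^+ 2)) =
   m^-1 * ((ln (1 + zeta) - zeta) + (zeta - m ^+ 2 / 2 * gmean (fun z => D z ^+ 2))).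
  by field; lra.
have mi0 : 0 <= m^-1 by rewrite invr_ge0 ltW.
rewrite normrM ger0_norm// [leRHS](_ : _ = m^-1 * ((K0 * C2 ^+ 2 + m ^+ 3 * C1) * K ^+ 3)); last by ring.
rewrite ler_wpM2l//.
apply: le_trans (ler_normD _ _) _; rewrite mulrDl; apply: lerD; last first.
  by apply: le_trans hzeta _; rewrite le_eqVlt; apply/orP; left; apply/eqP; ring.
apply: le_trans (ln1Dx_bound zeta0) _.
have : zeta ^+ 2 <= (K ^+ 2 * C2) ^+ 2 by rewrite lerXn2r ?nnegrE// (le_trans zeta0).
move/le_trans; apply.
rewrite (_ : (K ^+ 2 * C2) ^+ 2 = K * (C2 ^+ 2 * K ^+ 3)); last by ring.
rewrite [leRHS](_ : _ = K0 * (C2 ^+ 2 * K ^+ 3)); last by ring.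
by rewrite ler_wpM2r// mulr_ge0 ?exprn_ge0.
Qed.

Lemma gmean_ge_interval F (a b k p : R) : moderate F -> (forall z, 0 <= F z) -> a <= b ->
  0 <= k -> 0 <= p -> (forall z, a <= z <= b -> k <= F z) -> (forall z, a <= z <= b -> p <= normal_pdf 0 1 z) ->
  k * p * (b - a) <= gmean F.
Proof.
move=> mF F0 ab k0 p0 hk hp; rewrite gmean.unlock.
have -> : k * p * (b - a) = \int[@lebesgue_measure R]_(z in `[a, b]) (k * p).
  by rewrite Rintegral_cst//= lebesgue_measure_itv/= lte_fin; move: ab; rewrite le_eqVlt => /predU1P[->|->//]; rewrite ltxx subrr.
rewrite Rintegral_mkcond.
apply: le_Rintegral => //.
- have h := @integrable_indic_itv R a b true false.
  have := @Rintegrable_scale _ _ _ (@lebesgue_measure R) (k * p) (\1_`[a, b]) setT measurableT h.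
  apply: eq_integrable => // x _ /=; rewrite patchE indicE.
  by case: ifPn => _; rewrite ?mulr1 ?mulr0.
- exact: moderate_integrable.
move=> z _; rewrite patchE; case: ifPn => [|_]; last by rewrite mulr_ge0 ?phi_ge0.
by rewrite inE/= in_itv/= => zab; apply: ler_pM => //; [exact: hk|exact: hp].
Qed.

Lemma phi_gt0 (z : R) : 0 < normal_pdf 0 1 z.
Proof. by rewrite phiE mulr_gt0 ?expR_gt0// normal_peak_gt0 ?oner_neq0. Qed.

Lemma phi_ge (z w : R) : `|z| <= w -> normal_pdf 0 1 w <= normal_pdf 0 1 z.
Proof.
move=> zw; rewrite !phiE ler_wpM2l ?normal_peak_ge0// ler_expR ler_pM2r//.
rewrite lerN2 -real_normK ?num_real// lerXn2r ?nnegrE//.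
exact: le_trans (normr_ge0 _) zw.
Qed.

End CumulantTaylor.

(** * The heat flow and the Cole-Hopf operator *)

Section Heat.
Variable R : realType.
Notation mu := (@lebesgue_measure R).
Notation phi := (@normal_pdf R 0 1).
Implicit Types (f g h F G D : R -> R) (m L K v w x y : R).

Definition Lip L f := forall x y, `|f x - f y| <= L * `|x - y|.

Definition heat v f x := gmean (fun z => f (x + Num.sqrt v * z)).

Lemma Lip_ge0 L f : Lip L f -> 0 <= L.
Proof. by move=> /(_ 1 0); rewrite subr0 normr1 mulr1; exact: le_trans. Qed.

Lemma Lip_continuous L f : Lip L f -> continuous f.
Proof.
move=> hf x; apply/cvgrPdist_le => e e0.
have L0 := Lip_ge0 hf.
have d0 : 0 < e / (L + 1) by rewrite divr_gt0//; lra.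
near=> y; apply: le_trans (hf x y) _.
have : `|x - y| <= e / (L + 1) by near: y; exact: cvgr_dist_le.
rewrite ler_pdivlMr; last by lra.
move=> h; apply: le_trans h; rewrite mulrC ler_wpM2l//; lra.
Unshelve. all: by end_near. Qed.

Lemma Lip_measurable L f : Lip L f -> measurable_fun setT f.
Proof. by move=> /Lip_continuous; exact: continuous_measurable_fun. Qed.

Lemma Lip_sublinear L f : Lip L f -> sublinear f.
Proof.
move=> hf; split; first exact: Lip_measurable hf.
exists `|f 0|, L; split => //; first exact: Lip_ge0 hf.
move=> z; rewrite -[X in `|X|](subrK (f 0)) addrC (le_trans (ler_normD _ _))// lerD2l.
by have := hf z 0; rewrite subr0.
Qed.

Lemma sublinear_affine F x s : sublinear F -> sublinear (fun z => F (x + s * z)).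
Proof.
move=> [mF [A [B [A0 B0 h]]]]; split.
  by apply: measurableT_comp => //; apply: measurable_funD => //; exact: measurable_funM.
exists (A + B * `|x|), (B * `|s|); split; rewrite ?addr_ge0 ?mulr_ge0// => z.
apply: le_trans (h _) _; rewrite -addrA lerD2l -mulrA -mulrDr ler_wpM2l// -normrM.
exact: ler_normD.
Qed.

Lemma linear_substitution G (a b : R) : 0 < a -> continuous G -> (forall x, 0 <= G x) ->
  (\int[mu]_x (G x)%:E = \int[mu]_x (G (a * x + b) * a)%:E)%E.
Proof.
move=> a0 cG G0.
have dF x : is_derive x 1 (fun x : R => a * x + b) a.
  by apply: is_derive_eq; rewrite /GRing.scale/= mulr1 addr0.
have dE : derive1 (fun x : R => a * x + b) = cst a.
  by apply/funext => x; rewrite derive1E; have [_] := dF x.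
rewrite (@increasing_ge0_integration_by_substitutionT R (fun x => a * x + b) G)//.
- by apply: eq_integral => x _; rewrite dE.
- by move=> x y xy; rewrite ltrD2r ltr_pM2l.
- by rewrite dE => x; exact: cvg_cst.
- by rewrite dE; exact: is_cvg_cst.
- by rewrite dE; exact: is_cvg_cst.
- apply/cvgrNyPle => A; near=> x.
  have : x <= (A - b) / a by near: x; apply: nbhs_ninfty_le; exact: num_real.
  by rewrite ler_pdivlMr//; lra.
- apply/cvgryPge => A; near=> x.
  have : (A - b) / a <= x by near: x; apply: nbhs_pinfty_ge; exact: num_real.
  by rewrite ler_pdivrMr//; lra.
Unshelve. all: by end_near. Qed.

Lemma gmeanE F : moderate F -> ((gmean F)%:E = \int[mu]_z (F z * phi z)%:E)%E.
Proof.
move=> mF; rewrite gmean.unlock /Rintegral fineK//.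
by apply: integrable_fin_num => //; exact: moderate_integrable.
Qed.

Lemma heat0 f x : heat 0 f x = f x.
Proof.
rewrite /heat sqrtr0; under [X in gmean X]eq_fun do rewrite mul0r addr0.
exact: gmean_cst.
Qed.

Lemma moderate_heat F v : moderate F -> continuous F -> (forall x, 0 <= F x) -> moderate (heat v F).
Proof.
move=> mF cF F0.
have [mF' [A [B [A0 B0 hF]]]] := moderate_weaken mF.
split.
  have mj : measurable_fun setT (fun p : R * R => F (p.1 + Num.sqrt v * p.2) * phi p.2).
    apply: measurable_funM; last by apply: (measurableT_comp (measurable_normal_pdf 0 1)).
    apply: measurableT_comp => //; apply: measurable_funD => //.
    by apply: measurable_funM.
  rewrite (_ : heat v F = fun x => fine (\int[mu]_z (F (x + Num.sqrt v * z) * phi z)%:E)%E); last first.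
    by apply/funext => x; rewrite /heat gmean.unlock.
  apply: measurableT_comp => //.
  apply: (@measurable_fun_fubini_tonelli_F _ _ _ _ _ mu (fun p : R * R => (F (p.1 + Num.sqrt v * p.2) * phi p.2)%:E)).
  - exact/measurable_EFinP.
  - by move=> p; rewrite lee_fin mulr_ge0 ?phi_ge0.
exists (A * gmean (fun z => expR (B * Num.sqrt v * `|z|))), B => x.
rewrite mulrAC -gmean_scale; last exact: moderate_expR_norm.
apply: gmean_le_norm; first exact: moderate_affine.
  exact/moderate_scale/moderate_expR_norm.
move=> z; apply: le_trans (hF _) _; rewrite -[leRHS]mulrA -expRD ler_wpM2l// ler_expR -[in leRHS](mulrA B) -mulrDr ler_wpM2l//.
by rewrite (le_trans (ler_normD _ _))// normrM ger0_norm// sqrtr_ge0.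
Qed.

(** Gaussian conditioning. If the increments [sqrt v * y] and [sqrt w * z] add up to [s * u], then
    the joint density of [y] and [u] is the density of [u] times the normal density of [y] given
    [u]. The factor [s / sqrt w] is the Jacobian of [z] as a function of [u]. *)
Lemma normal_product v w y u : 0 < v -> 0 < w ->
  let s := Num.sqrt (v + w) in
  phi (s / Num.sqrt w * u - Num.sqrt v / Num.sqrt w * y) * phi y * (s / Num.sqrt w) =
  phi u * normal_pdf (Num.sqrt v / s * u) (Num.sqrt w / s) y.
Proof.
move=> v0 w0 s.
have sv : 0 < Num.sqrt v by rewrite sqrtr_gt0.
have sw : 0 < Num.sqrt w by rewrite sqrtr_gt0.
have s0 : 0 < s by rewrite sqrtr_gt0 addr_gt0.
have ws0 : Num.sqrt w / s != 0 by rewrite mulf_neq0 ?invr_eq0 ?gt_eqF.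
rewrite !phiE normal_pdfE// /normal_fun.
have -> : normal_peak (Num.sqrt w / s) = normal_peak 1 * (s / Num.sqrt w).
  rewrite /normal_peak expr1n mul1r -mulrnAr sqrtrM ?sqr_ge0// sqrtr_sqr invfM mulrC.
  by rewrite ger0_norm ?invf_div// divr_ge0// ltW.
set N := normal_peak 1.
have hexp : - (s / Num.sqrt w * u - Num.sqrt v / Num.sqrt w * y) ^+ 2 / 2 + - y ^+ 2 / 2 =
  - u ^+ 2 / 2 + - (y - Num.sqrt v / s * u) ^+ 2 / ((Num.sqrt w / s) ^+ 2 *+ 2).
  have hs : s ^+ 2 = Num.sqrt v ^+ 2 + Num.sqrt w ^+ 2 by rewrite !sqr_sqrtr// ?ltW// addr_gt0.
  rewrite -mulr_natr.
  apply/eqP; rewrite -subr_eq0; apply/eqP.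
  rewrite (_ : _ - _ = (s ^+ 2 - (Num.sqrt v ^+ 2 + Num.sqrt w ^+ 2)) * (y ^+ 2 - u ^+ 2) / (2 * Num.sqrt w ^+ 2)).
    by rewrite hs subrr mul0r mul0r.
  by field; rewrite !gt_eqF.
transitivity (N * N * (s / Num.sqrt w) * expR (- (s / Num.sqrt w * u - Num.sqrt v / Num.sqrt w * y) ^+ 2 / 2 + - y ^+ 2 / 2)).
  by rewrite expRD; ring.
by rewrite hexp expRD; ring.
Qed.

Lemma integral_scale_normal_pdf (k m w : R) : w != 0 ->
  (\int[mu]_y (k * normal_pdf m w y)%:E = k%:E)%E.
Proof.
move=> w0; under eq_integral do rewrite EFinM.
rewrite integralZl//=; last exact: integrable_normal_pdf.
by rewrite integral_normal_pdf// mule1.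
Qed.

(** For fixed [y] the inner variable is changed to the normalised total increment [u]; after
    Tonelli, [y] appears only in its conditional normal density given [u] and integrates to 1. *)
Lemma heat_semigroup F v w x : moderate F -> continuous F -> (forall x, 0 <= F x) ->
  0 <= v -> 0 <= w -> heat v (heat w F) x = heat (v + w) F x.
Proof.
move=> mF cF F0; rewrite le_eqVlt => /predU1P[<- _|v0]; first by rewrite heat0 add0r.
rewrite le_eqVlt => /predU1P[<-|w0].
  by rewrite addr0; congr heat; apply/funext => y; rewrite heat0.
apply: EFin_inj; rewrite /heat gmeanE; last exact: (moderate_affine x (Num.sqrt v) (moderate_heat w mF cF F0)).
rewrite gmeanE; last exact: moderate_affine.
set s := Num.sqrt (v + w).
have sv : 0 < Num.sqrt v by rewrite sqrtr_gt0.
have sw : 0 < Num.sqrt w by rewrite sqrtr_gt0.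
have s0 : 0 < s by rewrite sqrtr_gt0 addr_gt0.
have sw0 : 0 < s / Num.sqrt w by rewrite divr_gt0.
pose b y := - (Num.sqrt v / Num.sqrt w * y).
have inner y : ((heat w F (x + Num.sqrt v * y) * phi y)%:E =
   \int[mu]_u (F (x + s * u) * (phi (s / Num.sqrt w * u + b y) * phi y * (s / Num.sqrt w)))%:E)%E.
  rewrite mulrC /heat -gmean_scale; last exact: moderate_affine.
  rewrite gmeanE; last by apply: moderate_scale; exact: moderate_affine.
  have cG : continuous (fun z : R => phi y * F (x + Num.sqrt v * y + Num.sqrt w * z) * phi z).
    move=> z; apply: cvgM; last exact: continuous_phi.
    apply: cvgM; first exact: cvg_cst.
    apply: (@continuous_comp _ _ _ (fun z => x + Num.sqrt v * y + Num.sqrt w * z) F); last exact: cF.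
    by apply: cvgD; [exact: cvg_cst|apply: cvgM; [exact: cvg_cst|exact: cvg_id]].
  rewrite (@linear_substitution _ (s / Num.sqrt w) (b y) sw0 cG); last first.
    by move=> z; rewrite !mulr_ge0 ?phi_ge0.
  apply: eq_integral => u _; congr EFin.
  rewrite (_ : x + Num.sqrt v * y + _ = x + s * u); last by rewrite /b; field; rewrite gt_eqF.
  by ring.
under eq_integral do rewrite inner.
rewrite (@fubini_tonelli _ _ _ _ _ mu mu (fun p : R * R => (F (x + s * p.2) * (phi (s / Num.sqrt w * p.2 + b p.1) * phi p.1 * (s / Num.sqrt w)))%:E))/=; last 2 first.
- apply/measurable_EFinP; apply: measurable_funM.
    by apply: measurableT_comp; [exact: mF.1|apply: measurable_funD => //; exact: measurable_funM].
  apply: measurable_funM => //; apply: measurable_funM.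
    apply: measurableT_comp; first exact: measurable_normal_pdf.
    apply: measurable_funD; first exact: measurable_funM.
    by rewrite /b; apply: measurableT_comp => //; exact: measurable_funM.
  by apply: measurableT_comp => //; exact: measurable_normal_pdf.
- by move=> p; rewrite lee_fin !mulr_ge0 ?phi_ge0// ltW.
apply: eq_integral => u _.
have ws0 : Num.sqrt w / s != 0 by rewrite mulf_neq0 ?invr_eq0 ?gt_eqF.
rewrite -[RHS](@integral_scale_normal_pdf _ (Num.sqrt v / s * u) _ ws0).
apply: eq_integral => y _; congr EFin; rewrite -[RHS]mulrA; congr (_ * _).
exact: (normal_product y u v0 w0).
Qed.

(* The Cole-Hopf operator: backward in time, it solves the Parisi equation over an
   interval where [gamma] is the constant [m] and [xi''] has integral [v]. *)
Definition chop m v f x := cumulant m (fun z => f (x + Num.sqrt v * z)).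

(** The Cole-Hopf transformation: exponentiation turns the nonlinear operator into the heat flow,
    from which it inherits the semigroup property. *)
Lemma expR_chop m L v f x : 0 < m -> Lip L f -> expR (m * chop m v f x) = heat v (fun y => expR (m * f y)) x.
Proof.
by move=> m0 hf; rewrite expR_cumulant//; apply: sublinear_affine; exact: Lip_sublinear hf.
Qed.

Lemma chop_le m L L' v f g x : 0 < m -> Lip L f -> Lip L' g -> (forall y, f y <= g y) ->
  chop m v f x <= chop m v g x.
Proof.
move=> m0 hf hg fg; apply: cumulant_le => //.
- by apply: sublinear_affine; exact: Lip_sublinear hf.
- by apply: sublinear_affine; exact: Lip_sublinear hg.
Qed.

Lemma chop_shift m L v f c x : 0 < m -> Lip L f ->
  chop m v (fun y => f y + c) x = chop m v f x + c.
Proof.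
move=> m0 hf; rewrite /chop cumulant_shift//.
by apply: sublinear_affine; exact: Lip_sublinear hf.
Qed.

Lemma Lip_shift L f c : Lip L f -> Lip L (fun y => f y + c).
Proof.
move=> hf x y; rewrite (_ : f x + c - _ = f x - f y); last by ring.
exact: hf.
Qed.

Lemma Lip_translate L f a : Lip L f -> Lip L (fun y => f (y + a)).
Proof.
by move=> hf x y; have := hf (x + a) (y + a); rewrite (_ : x + a - _ = x - y); last by ring.
Qed.

(** The operator is monotone and commutes with translations and with adding constants; translating
    [f] by [x - y] raises it by at most [L * |x - y|]. *)
Lemma chop_Lip m L v f : 0 < m -> Lip L f -> Lip L (chop m v f).
Proof.
move=> m0 hf.
have h x y : chop m v f x <= chop m v f y + L * `|x - y|.
  have := @chop_le m L L v (fun z => f (z + (x - y))) (fun z => f z + L * `|x - y|) y m0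
    (Lip_translate (x - y) hf) (Lip_shift (L * `|x - y|) hf).
  rewrite (@chop_shift m L)//.
  rewrite (_ : chop m v (fun z => f (z + (x - y))) y = chop m v f x); last first.
    by congr cumulant; apply/funext => z; congr f; ring.
  apply => z; rewrite -lerBlDl; apply: le_trans (ler_norm _) _.
  by apply: le_trans (hf _ _) _; rewrite addrAC subrr add0r.
move=> x y; rewrite ler_norml; apply/andP; split.
  by have := h y x; rewrite distrC; lra.
by have := h x y; lra.
Qed.

Lemma chop_semigroup m L v w f x : 0 < m -> Lip L f -> 0 <= v -> 0 <= w ->
  chop m v (chop m w f) x = chop m (v + w) f x.
Proof.
move=> m0 hf v0 w0; apply: (mulfI (lt0r_neq0 m0)); apply: expR_inj.
rewrite !(@expR_chop _ L)//; last exact: chop_Lip.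
rewrite -heat_semigroup//.
- by congr heat; apply/funext => y; exact: expR_chop hf.
- by apply: moderate_expR_sublinear; exact: Lip_sublinear hf.
- move=> y; apply: (@continuous_comp _ _ _ (fun y => m * f y) expR); last exact: continuous_expR.
  by apply: cvgM; [exact: cvg_cst|exact: (Lip_continuous hf)].
Qed.

Lemma chop_mono m m' L v f x : 0 < m -> m <= m' -> Lip L f -> chop m v f x <= chop m' v f x.
Proof.
move=> m0 mm' hf; apply: cumulant_mono => //.
by apply: sublinear_affine; exact: Lip_sublinear hf.
Qed.

(* Midpoint convexity is stable under [chop] and pointwise limits, and for continuous
   functions it is convexity. *)
Definition midconvex f := forall x y, f ((x + y) / 2) <= (f x + f y) / 2.

Lemma chop_midconvex m L v f : 0 < m -> Lip L f -> midconvex f -> midconvex (chop m v f).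
Proof.
move=> m0 hf cf x y.
have sf w : sublinear (fun z => f (w + Num.sqrt v * z)).
  by apply: sublinear_affine; exact: Lip_sublinear hf.
apply: le_trans (cumulant_midpoint m0 (sf x) (sf y)).
apply: cumulant_le => // [|z].
  by under eq_fun do rewrite mulrC; apply: sublinear_scale; exact: sublinear_add.
rewrite (_ : (x + y) / 2 + _ = ((x + Num.sqrt v * z) + (y + Num.sqrt v * z)) / 2); last by field.
exact: cf.
Qed.

Definition increment v f x z := f (x + Num.sqrt v * z) - f x.

(** A short-time expansion in terms of increments that asks only for a Lipschitz function, uniformly
    in [f] and [x]; in particular it is available at the kink of [|x|]. *)
Lemma chop_local m L v0 : 0 < m -> 0 <= L -> 0 <= v0 -> exists2 C : R, 0 <= C &
  forall f v x, Lip L f -> 0 <= v <= v0 ->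
  `|chop m v f x - (f x + gmean (increment v f x) +
     m / 2 * (gmean (fun z => increment v f x z ^+ 2) - gmean (increment v f x) ^+ 2))| <= C * (v * Num.sqrt v).
Proof.
move=> m0 L0 v00.
have K0 : 0 <= L * Num.sqrt v0 by rewrite mulr_ge0 ?sqrtr_ge0.
have [C C0 hC] := cumulant_taylor m0 K0.
exists (C * L ^+ 3); first by rewrite mulr_ge0 ?exprn_ge0.
move=> f v x hf /andP[v_0 vv0]; set D := increment v f x.
have sf : sublinear (fun z => f (x + Num.sqrt v * z)).
  by apply: sublinear_affine; exact: Lip_sublinear hf.
have sD : sublinear D by apply: sublinear_sub => //; exact: sublinear_cst.
have := hC D (L * Num.sqrt v) sD.1.
rewrite mulr_ge0 ?sqrtr_ge0//= ler_wpM2l// ?ler_sqrt// => /(_ isT) h.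
have -> : chop m v f x = cumulant m D + f x.
  by rewrite /chop -cumulant_shift//; congr cumulant; apply/funext => z; rewrite /D /increment subrK.
rewrite (_ : _ - _ = cumulant m D - (gmean D + m / 2 * (gmean (fun z => D z ^+ 2) - gmean D ^+ 2))); last by ring.
apply: le_trans (h _) _.
  move=> z; apply: le_trans (hf _ _) _.
  by rewrite (_ : x + _ - x = Num.sqrt v * z) ?normrM ?mulrA ?(ger0_norm (sqrtr_ge0 _))//; ring.
rewrite le_eqVlt; apply/orP; left; apply/eqP.
transitivity (C * L ^+ 3 * (Num.sqrt v ^+ 2 * Num.sqrt v)); first by ring.
by rewrite sqr_sqrtr.
Qed.

(** Over [n] equal pieces the errors of order 3/2 add up to a multiple of [n ^ (-1/2)]. This
    replaces differentiation in time throughout: one-step expansions are turned into inequalities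
    between the ends of an interval. *)
Lemma partition_le (F : R -> R) (a b C d : R) : a <= b -> 0 < d ->
  (forall s t, a <= s -> s <= t -> t <= b -> t - s <= d ->
     F s <= F t + C * ((t - s) * Num.sqrt (t - s))) ->
  F a <= F b.
Proof.
move=> ab d0 hF.
apply/ler_addgt0Pr => e e0.
wlog C0 : C hF / 0 <= C.
  move=> hw; apply: (hw `|C|) => // s t h1 h2 h3 h4; apply: le_trans (hF s t h1 h2 h3 h4) _.
  by rewrite lerD2l ler_wpM2r ?ler_norm// mulr_ge0 ?sqrtr_ge0// subr_ge0.
pose B := b - a.
have B0 : 0 <= B by rewrite subr_ge0.
have [n [n0 hn hne]] : exists n : nat, [/\ (0 < n)%N, B / n%:R <= d & C * B * Num.sqrt (B / n%:R) <= e].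
  have q0 : 0 < (e / (C * B + 1)) ^+ 2 by rewrite exprn_gt0// divr_gt0// ltr_wpDl// mulr_ge0.
  (* The first quotient makes the mesh at most [d]; the second makes the square root of the mesh at
     most [e / (C * B + 1)], so that the total error is at most [e]. *)
  pose N := (Num.trunc (B / d + B / (e / (C * B + 1)) ^+ 2)).+1.
  have N0 : (0 : R) < N%:R by rewrite ltr0n.
  have hN : B / d + B / (e / (C * B + 1)) ^+ 2 < N%:R by rewrite truncnS_gt.
  have h1 : 0 <= B / d by rewrite divr_ge0 // ltW.
  have h2 : 0 <= B / (e / (C * B + 1)) ^+ 2 by rewrite divr_ge0 // ltW.
  exists N; split => //.
    rewrite ler_pdivrMr// mulrC -ler_pdivrMr//; lra.
  have h3 : B / N%:R <= (e / (C * B + 1)) ^+ 2.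
    rewrite ler_pdivrMr// mulrC -ler_pdivrMr//; lra.
  have h4 : Num.sqrt (B / N%:R) <= e / (C * B + 1).
    have c0 : 0 <= e / (C * B + 1) by rewrite divr_ge0 ?(ltW e0)// addr_ge0 ?mulr_ge0.
    by rewrite -[leRHS](ger0_norm c0) -sqrtr_sqr ler_sqrt ?exprn_ge0.
  apply: le_trans (ler_wpM2l (mulr_ge0 C0 B0) h4) _.
  rewrite mulrCA ler_piMr ?(ltW e0)// ler_pdivrMr ?ltr_wpDl ?mulr_ge0//; lra.
have nR : (0 : R) < n%:R by rewrite ltr0n.
pose h := B / n%:R.
have h0 : 0 <= h by rewrite divr_ge0 // ltW.
have hk k : (k <= n)%N -> F a <= F (a + k%:R * h) + k%:R * (C * (h * Num.sqrt h)).
  elim: k => [_|k ih kn]; first by rewrite !mul0r !addr0.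
  apply: le_trans (ih (ltnW kn)) _.
  have kh : 0 <= k%:R * h by rewrite mulr_ge0.
  have kn1 : k.+1%:R * h <= B.
    rewrite /h mulrCA ler_piMr// ler_pdivrMr// mul1r ler_nat//.
  have := hF (a + k%:R * h) (a + k.+1%:R * h).
  rewrite (_ : a + k.+1%:R * h - _ = h); last by rewrite -natr1; ring.
  rewrite lerDl kh lerD2l ler_wpM2r// ?ler_nat// => /(_ isT isT) hh.
  have := hh _ hn; rewrite -[k.+1%:R]natr1 mulrDl mul1r.
  rewrite /B in kn1; move=> /(_ _) h5.
  have : a + (k%:R * h + h) <= b by rewrite -natr1 in kn1; lra.
  by move=> /h5; lra.
have := hk n (leqnn n).
rewrite (_ : a + n%:R * h = b); last by rewrite /h /B; field; rewrite gt_eqF.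
rewrite (_ : n%:R * (C * (h * Num.sqrt h)) = C * B * Num.sqrt h); last by rewrite {1}/h; field; rewrite gt_eqF.
rewrite -/h in hne; lra.
Qed.

End Heat.

(** * Dependence of the Cole-Hopf operator on its parameter, and propagation of local gains *)

Section ChopComparison.
Variable R : realType.
Implicit Types (f g : R -> R) (m L v x : R).

Lemma increment_bound L f v x z : Lip L f -> `|increment v f x z| <= L * Num.sqrt v * `|z|.
Proof.
move=> hf; apply: le_trans (hf _ _) _.
by rewrite (_ : x + _ - x = Num.sqrt v * z) ?normrM ?mulrA ?(ger0_norm (sqrtr_ge0 _))//; ring.
Qed.

Lemma increment_sublinear L f v x : Lip L f -> sublinear (increment v f x).
Proof.
move=> hf; apply: sublinear_sub; last exact: sublinear_cst.
by apply: sublinear_affine; exact: Lip_sublinear hf.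
Qed.

Lemma increment_sqr_mean L f v x : 0 <= v -> Lip L f ->
  gmean (fun z => increment v f x z ^+ 2) <= L ^+ 2 * v.
Proof.
move=> v0 hf; have msq : moderate (fun z : R => z ^+ 2) by apply: moderate_exp; exact: moderate_id.
have -> : L ^+ 2 * v = gmean (fun z : R => (L ^+ 2 * v) * z ^+ 2).
  by rewrite gmean_scale// gmean_sqr mulr1.
apply: gmean_le.
- by apply: moderate_exp; apply: sublinear_moderate; exact: increment_sublinear hf.
- exact: moderate_scale.
move=> z; rewrite -real_normK ?num_real//.
rewrite (_ : L ^+ 2 * v * z ^+ 2 = (L * Num.sqrt v * `|z|) ^+ 2); last first.
  by rewrite !exprMn sqr_sqrtr// real_normK ?num_real.
rewrite lerXn2r ?nnegrE//; last exact: increment_bound.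
by rewrite !mulr_ge0 ?sqrtr_ge0// (Lip_ge0 hf).
Qed.

Lemma chop0 m f x : 0 < m -> chop m 0 f x = f x.
Proof.
move=> m0; rewrite /chop sqrtr0.
have -> : (fun z : R => f (x + 0 * z)) = (fun z : R => 0 + f x).
  by apply/funext => z; rewrite mul0r addr0 add0r.
rewrite cumulant_shift//; last exact: sublinear_cst.
rewrite cumulant.unlock (_ : (fun z : R => _) = fun z : R => 1) ?gmean_cst ?ln1 ?mulr0 ?add0r//.
by apply/funext => z; rewrite ?mulr0 expR0.
Qed.

(** Over a short time the operators of parameters [m'] and [m] differ by [(m' - m) / 2] times the
    variance of an increment, which is at most [L ^+ 2] times the elapsed time, up to errors of
    order 3/2. *)
Lemma chop_cumulant_bound m m' L v f x : 0 < m -> m <= m' -> 0 <= v -> Lip L f ->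
  chop m' v f x <= chop m v f x + (m' - m) / 2 * L ^+ 2 * v.
Proof.
move=> m0 mm' v0 hf; have m'0 : 0 < m' by lra.
have L0 := Lip_ge0 hf.
have [C C0 hC] := chop_local m0 L0 v0; have [C' C'0 hC'] := chop_local m'0 L0 v0.
pose A := (m' - m) / 2 * L ^+ 2.
have local g w y : Lip L g -> 0 <= w <= v -> chop m' w g y <= chop m w g y + (A * w + (C + C') * (w * Num.sqrt w)).
  move=> hg /andP[w0 wv]; have wv' : 0 <= w <= v by rewrite w0.
  have := hC g w y hg wv'; have := hC' g w y hg wv'.
  have h2 := increment_sqr_mean y w0 hg.
  set E1 := gmean (increment w g y) in h2 *; set E2 := gmean _ in h2 *.
  have hA : m' / 2 * (E2 - E1 ^+ 2) - m / 2 * (E2 - E1 ^+ 2) <= A * w.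
    rewrite [leLHS](_ : _ = (m' - m) / 2 * (E2 - E1 ^+ 2)); last by ring.
    rewrite /A [leRHS](_ : _ = (m' - m) / 2 * (L ^+ 2 * w)); last by ring.
    rewrite ler_wpM2l ?divr_ge0 ?subr_ge0//.
    by have := sqr_ge0 E1; lra.
  by rewrite !ler_norml => /andP[h3 h4] /andP[h5 h6]; lra.
(* Interpolates between the two sides: parameter [m'] acts first, over [v - t], then [m] over [t].
   Moving [t] exchanges the two on one short piece, at a price covered by [A * t]. *)
pose F t := chop m t (chop m' (v - t) f) x + A * t.
have -> : chop m' v f x = F 0 by rewrite /F chop0// subr0 mulr0 addr0.
have -> : chop m v f x + A * v = F v.
  by rewrite /F subrr; congr (chop _ _ _ _ + _); apply/funext => y; rewrite chop0.
apply: (@partition_le _ F 0 v (C + C') (v + 1)) => //; first by lra.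
move=> s t s0 st tv _; rewrite /F.
set g := chop m' (v - t) f.
have hg : Lip L g by exact: chop_Lip.
have ts : 0 <= t - s <= v by lra.
have tsw : 0 <= t - s by lra.
have -> : chop m' (v - s) f = chop m' (t - s) g.
  apply/funext => y; rewrite (@chop_semigroup _ _ L)//; last by rewrite subr_ge0.
  by rewrite (_ : t - s + (v - t) = v - s)//; ring.
set k := A * (t - s) + (C + C') * ((t - s) * Num.sqrt (t - s)).
have : chop m s (chop m' (t - s) g) x <= chop m s (fun y => chop m (t - s) g y + k) x.
  apply: (@chop_le _ _ L L) => // [||y]; [exact: chop_Lip|apply: Lip_shift; exact: chop_Lip|exact: local].
rewrite (@chop_shift _ _ L)//; last exact: chop_Lip.
rewrite (@chop_semigroup _ _ L)// [s + _]addrC subrK.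
by rewrite /k; lra.
Qed.

(** The amount by which a Gaussian step overshoots a point one standard deviation away, on either
    side. The constant is the density at 3: on the unit intervals ending at -3 or 3 the overshoot is
    at least 1. *)
Lemma half_line_mean : exists2 c0 : R, 0 < c0 &
  c0 <= gmean (fun z : R => Num.max 0 (- 1 - z)) /\ c0 <= gmean (fun z : R => Num.max 0 (z - 1)).
Proof.
have maux (F : R -> R) : sublinear F -> moderate (fun z : R => Num.max 0 (F z)).
  move=> [mF [A [B [A0 B0 h]]]]; apply: sublinear_moderate; split; first exact: measurable_maxr.
  exists A, B; split => // z; apply: le_trans (h z).
  by rewrite ger0_norm ?le_max ?lexx// ge_max normr_ge0 ler_norm.
have sid : sublinear (fun z : R => z) by split => //; exists 0, 1; split => // z; rewrite add0r mul1r.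
exists (normal_pdf 0 1 (3 : R)); first exact: phi_gt0; split.
  have := @gmean_ge_interval R (fun z => Num.max 0 (- 1 - z)) (- 3) (- 2) 1 (normal_pdf 0 1 3).
  rewrite mul1r (_ : - 2 - - 3 = 1) ?mulr1; last by ring.
  apply => //.
  - by apply: maux; apply: sublinear_sub => //; exact: sublinear_cst.
  - by move=> z; rewrite le_max lexx.
  - lra.
  - exact: phi_ge0.
  - by move=> z hz; rewrite le_max; apply/orP; right; lra.
  - by move=> z hz; apply: phi_ge; rewrite ler_norml; lra.
have := @gmean_ge_interval R (fun z => Num.max 0 (z - 1)) 2 3 1 (normal_pdf 0 1 3).
rewrite mul1r (_ : 3 - 2 = 1 :> R) ?mulr1; last by ring.
apply => //.
- by apply: maux; apply: sublinear_sub => //; exact: sublinear_cst.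
- by move=> z; rewrite le_max lexx.
- lra.
- exact: phi_ge0.
- by move=> z hz; rewrite le_max; apply/orP; right; lra.
- by move=> z hz; apply: phi_ge; rewrite ler_norml; lra.
Qed.

Lemma Lip_normr : Lip 1 (fun x : R => `|x|).
Proof. by move=> x y; rewrite mul1r; exact: ler_dist_dist. Qed.

(** To leading order the two sides differ by half the variance of [|x + s * z|], which is
    [v + x ^+ 2 - M ^+ 2] for the mean [M]. When [|x| <= s] the kink is within one standard
    deviation, so [M] exceeds [|x|] by at least [2 * s * c0] and half the variance falls short of
    [v / 2] by [2 * c0 ^+ 2 * v]. One half of this gain absorbs the expansion errors, the other half
    is the constant [c]. *)
Lemma chop_normr_gain m : 0 < m -> exists c v0 : R, [/\ 0 < c, 0 < v0 &
  forall v x, 0 < v <= v0 -> `|x| <= Num.sqrt v ->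
    chop (m + 1) v (fun y => `|y|) x <= chop m v (fun y => `|y|) x + v / 2 - c * v].
Proof.
move=> m0; have m10 : 0 < m + 1 by lra.
have [c0 c00 [hc1 hc2]] := half_line_mean.
have [C C0 hC] := chop_local m0 ler01 ler01; have [C' C'0 hC'] := chop_local m10 ler01 ler01.
(* For [s <= r] the two expansion errors, of total size [(C + C') * v * s], stay below
   [c0 ^+ 2 * v]. *)
pose r := c0 ^+ 2 / (C + C' + 1).
have r0 : 0 < r by rewrite divr_gt0 ?exprn_gt0//; lra.
exists (c0 ^+ 2), (Num.min 1 (r ^+ 2)); split; rewrite ?exprn_gt0 ?lt_min ?ltr01 ?exprn_gt0//.
move=> v x /andP[v_gt0]; rewrite le_min => /andP[v1 vr] xv.
have v0 : 0 <= v by rewrite ltW.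
set s := Num.sqrt v in xv *.
have s0 : 0 <= s by rewrite sqrtr_ge0.
have sr : s <= r by rewrite -(ger0_norm (ltW r0)) -sqrtr_sqr ler_sqrt ?exprn_ge0 ?(ltW r0).
have v01 : 0 <= v <= 1 by rewrite v0.
have := hC _ v x Lip_normr v01; have := hC' _ v x Lip_normr v01.
pose N (z : R) := `|x + s * z|.
have mN : moderate N.
  by apply: sublinear_moderate; apply: (@sublinear_affine _ (fun y => `|y|)); exact: Lip_sublinear Lip_normr.
pose M := gmean N.
have ED : gmean (increment v (fun y => `|y|) x) = M - `|x|.
  by rewrite gmean_sub ?gmean_cst//; exact: moderate_cst.
have msq : moderate (fun z : R => z ^+ 2) by apply: moderate_exp; exact: moderate_id.
have m1 : moderate (fun z : R => x ^+ 2 + (2 * x * s) * z + v * z ^+ 2).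
  apply: moderate_add; last exact: moderate_scale.
  by apply: moderate_add; [exact: moderate_cst|apply: moderate_scale; exact: moderate_id].
have mlin : moderate (fun z : R => 2 * x * s * z) by apply: moderate_scale; exact: moderate_id.
have m2 : moderate (fun z => 2 * `|x| * N z - x ^+ 2).
  by apply: moderate_sub; [exact: moderate_scale|exact: moderate_cst].
have ED2 : gmean (fun z => increment v (fun y => `|y|) x z ^+ 2) = v + 2 * x ^+ 2 - 2 * `|x| * M.
  (* Because [N z ^+ 2] is [(x + s * z) ^+ 2], the squared increment is a quadratic polynomial in
     [z] minus a multiple of [N], so its mean involves only two Gaussian moments and [M]. *)
  rewrite (_ : (fun z => _) = fun z => (x ^+ 2 + (2 * x * s) * z + v * z ^+ 2) - (2 * `|x| * N z - x ^+ 2)).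
    rewrite gmean_sub// gmean_add; last 2 first.
    - by apply: moderate_add => //; exact: moderate_cst.
    - exact: moderate_scale.
    rewrite gmean_add//; last exact: moderate_cst.
    rewrite gmean_cst (gmean_scale _ (moderate_id R)) (gmean_scale _ msq) gmean_id gmean_sqr.
    rewrite (@gmean_sub _ (fun z => 2 * `|x| * N z))//; last 2 first.
    - exact: moderate_scale.
    - exact: moderate_cst.
    by rewrite gmean_cst gmean_scale// -/M; ring.
  apply/funext => z; rewrite /increment -/s.
  have hx : `|x| ^+ 2 = x ^+ 2 by rewrite real_normK ?num_real.
  have hN : N z ^+ 2 = (x + s * z) ^+ 2 by rewrite real_normK ?num_real.
  rewrite -(@sqr_sqrtr _ v)// -/s (_ : (`|x + s * z| - `|x|) ^+ 2 = N z ^+ 2 - 2 * `|x| * N z + `|x| ^+ 2).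
    by rewrite hx hN; ring.
  by rewrite /N; ring.
(* The absolute value is bounded below by the line through the kink extending the side of [x], plus
   twice the overshoot beyond one standard deviation; the line contributes [|x|] to the mean. *)
have hM : `|x| + 2 * s * c0 <= M.
  have [x0|x0] := leP 0 x.
    have mm : moderate (fun z : R => Num.max 0 (- 1 - z)).
      apply: (@moderate_le _ _ (fun z => 1 + `|z|)).
      - by apply: measurable_maxr => //; exact: measurable_funB.
      - by apply: moderate_add; [exact: moderate_cst|apply: moderate_norm; exact: moderate_id].
      - move=> z; rewrite ger0_norm ?le_max ?lexx// ge_max addr_ge0//=.
        by have := ler_norm (- z); rewrite normrN; lra.
    have : gmean (fun z : R => (x + s * z) + 2 * s * Num.max 0 (- 1 - z)) <= M.
      apply: gmean_le => //.
        apply: moderate_add; last exact: moderate_scale.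
        by apply: moderate_add; [exact: moderate_cst|apply: moderate_scale; exact: moderate_id].
      move=> z; rewrite /N; rewrite ger0_norm// in xv.
      have [h|h] := leP 0 (- 1 - z); last by rewrite mulr0 addr0 ler_norm.
      have : 0 <= s * (- 1 - z) by rewrite mulr_ge0.
      by have := ler_norm (- (x + s * z)); rewrite normrN; lra.
    rewrite gmean_add; last 2 first.
    - by apply: moderate_add; [exact: moderate_cst|apply: moderate_scale; exact: moderate_id].
    - exact: moderate_scale.
    rewrite gmean_add; last 2 first.
    - exact: moderate_cst.
    - by apply: moderate_scale; exact: moderate_id.
    rewrite gmean_cst (gmean_scale _ (moderate_id R)) gmean_id (gmean_scale _ mm) mulr0 addr0 ger0_norm//.
    by apply: le_trans; rewrite lerD2l ler_wpM2l// mulr_ge0.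
  have mm : moderate (fun z : R => Num.max 0 (z - 1)).
    apply: (@moderate_le _ _ (fun z => 1 + `|z|)).
    - by apply: measurable_maxr => //; exact: measurable_funB.
    - by apply: moderate_add; [exact: moderate_cst|apply: moderate_norm; exact: moderate_id].
    - move=> z; rewrite ger0_norm ?le_max ?lexx// ge_max addr_ge0//=.
      by have := ler_norm z; lra.
  have : gmean (fun z : R => (- x + (- s) * z) + 2 * s * Num.max 0 (z - 1)) <= M.
    apply: gmean_le => //.
      apply: moderate_add; last exact: moderate_scale.
      by apply: moderate_add; [exact: moderate_cst|apply: moderate_scale; exact: moderate_id].
    move=> z; rewrite /N; rewrite ltr0_norm// in xv.
    have [h|h] := leP 0 (z - 1); last by rewrite mulr0 addr0; have := ler_norm (- (x + s * z)); rewrite normrN; lra.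
    have : 0 <= s * (z - 1) by rewrite mulr_ge0.
    by have := ler_norm (x + s * z); lra.
  rewrite gmean_add; last 2 first.
  - by apply: moderate_add; [exact: moderate_cst|apply: moderate_scale; exact: moderate_id].
  - exact: moderate_scale.
  rewrite gmean_add; last 2 first.
  - exact: moderate_cst.
  - by apply: moderate_scale; exact: moderate_id.
  rewrite gmean_cst (gmean_scale _ (moderate_id R)) gmean_id (gmean_scale _ mm) mulr0 addr0 ltr0_norm//.
  by apply: le_trans; rewrite lerD2l ler_wpM2l// mulr_ge0.
have sc0 : 0 <= s * c0 by rewrite mulr_ge0// ltW.
have hM2 : x ^+ 2 + 4 * (c0 ^+ 2 * v) <= M ^+ 2.
  have : (`|x| + 2 * s * c0) ^+ 2 <= M ^+ 2.
    rewrite lerXn2r ?nnegrE//; first by rewrite addr_ge0//; lra.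
    by apply: le_trans hM; rewrite addr_ge0//; lra.
  apply: le_trans; have hx : `|x| ^+ 2 = x ^+ 2 by rewrite real_normK ?num_real.
  have hs : s ^+ 2 = v by rewrite sqr_sqrtr.
  rewrite (_ : (`|x| + 2 * s * c0) ^+ 2 = `|x| ^+ 2 + 4 * (`|x| * (s * c0)) + 4 * (c0 ^+ 2 * s ^+ 2)); last by ring.
  have : 0 <= `|x| * (s * c0) by rewrite mulr_ge0.
  by rewrite hx hs; lra.
rewrite ED ED2 -/s.
have hvs : (C + C') * (v * s) <= c0 ^+ 2 * v.
  rewrite mulrCA mulrC ler_wpM2r// (le_trans (ler_wpM2l _ sr))//; first by lra.
  rewrite /r mulrCA ler_piMr ?exprn_ge0 ?(ltW c00)// ler_pdivrMr; lra.
have hV : v + 2 * x ^+ 2 - 2 * `|x| * M - (M - `|x|) ^+ 2 = v + x ^+ 2 - M ^+ 2.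
  have hx : `|x| ^+ 2 = x ^+ 2 by rewrite real_normK ?num_real.
  rewrite (_ : (M - `|x|) ^+ 2 = M ^+ 2 - 2 * `|x| * M + `|x| ^+ 2); last by ring.
  by rewrite hx; ring.
rewrite hV !ler_norml => /andP[h3 h4] /andP[h5 h6].
by lra.
Qed.

(** Under the Gaussian law tilted by [expR (m * f)], the interval [|y| <= r] has mass at least a
    constant times [r], and a gain [th] there lowers the value by about [th] times that mass. The
    constant [kappa] is uniform in [m <= m1], with no lower bound on [m], because it is used for
    parameters tending to 0. *)
Lemma chop_gain (m1 K v0 v1 : R) : 0 <= K -> 0 < v0 -> v0 <= v1 -> 0 < m1 ->
  exists2 kappa : R, 0 < kappa &
  forall m v L f g x r d th, 0 < m <= m1 -> v0 <= v <= v1 -> Lip 1 f -> Lip L g ->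
    0 < r <= 1 -> 0 <= th <= 1 -> `|x| <= K ->
    (forall y, g y <= f y + d) -> (forall y, `|y| <= r -> g y <= f y + d - th) ->
    chop m v g x <= chop m v f x + d - th * (r * kappa).
Proof.
move=> K0 v00 v01 m10.
have v10 : 0 < v1 by lra.
have sv0 : 0 < Num.sqrt v0 by rewrite sqrtr_gt0.
have sv1 : 0 < Num.sqrt v1 by rewrite sqrtr_gt0.
have snorm (a : R) : sublinear (fun z : R => a * `|z|).
  by apply: sublinear_scale; exact: Lip_sublinear Lip_normr.
(* [b1] bounds the value of the operator above [f x]; then [k] bounds the tilting factor and [p] the
   Gaussian density from below on the event [|x + s * z| <= r], all uniformly in [m] and [v]. *)
pose b1 := cumulant m1 (fun z : R => Num.sqrt v1 * `|z|).
pose k := expR (- (m1 * (K + 1 + `|b1|))).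
pose p := normal_pdf 0 1 ((K + 1) / Num.sqrt v0).
have k0 : 0 < k by exact: expR_gt0.
have p0 : 0 < p by exact: phi_gt0.
exists (expR (- m1) * (k * p * (2 / Num.sqrt v1))).
  by apply: mulr_gt0; [exact: expR_gt0|apply: mulr_gt0; [exact: mulr_gt0|exact: divr_gt0]].
move=> m v L f g x r d th /andP[m0 mm1] /andP[v0v vv1] hf hg /andP[r0 r1] /andP[th0 th1] xK gf gfr.
set kappa := r * _.
have v_gt0 : 0 < v by lra.
set s := Num.sqrt v.
have s0 : 0 < s by rewrite sqrtr_gt0.
have sf : sublinear (fun z => f (x + s * z)) by apply: sublinear_affine; exact: Lip_sublinear hf.
have sg : sublinear (fun z => g (x + s * z)) by apply: sublinear_affine; exact: Lip_sublinear hg.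
set c := chop m v f x.
pose E z := expR (m * (f (x + s * z) - c)).
have mE : moderate E by apply: moderate_expR_sublinear; apply: sublinear_sub => //; exact: sublinear_cst.
have E1 : gmean E = 1 by exact: gmean_expR_sub_cumulant.
have E0 z : 0 <= E z by exact: expR_ge0.
pose B z : R := (`|x + s * z| <= r)%R%:R.
have mB : measurable_fun setT B.
  rewrite (_ : B = \1_[set z | `|x + s * z| <= r]); last by apply/funext => z; rewrite indicE /B mem_setE.
  apply: measurable_indic.
  rewrite (_ : [set z | _] = (fun z => `|x + s * z|) @^-1` `]-oo, r]%classic); last first.
    by apply/seteqP; split => z /=; rewrite in_itv.
  rewrite -[X in measurable X]setTI; apply: (measurableT_comp (@normr_measurable R setT)) => //.
  by apply: measurable_funD => //; exact: measurable_funM.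
have modB : moderate B.
  by apply: (@moderate_bounded _ _ 1) => // z; rewrite /B ger0_norm ?ler0n// lern1 leq_b1.
have mEB : moderate (fun z => E z * B z) by exact: moderate_mul.
have sr1 : s <= Num.sqrt v1 by rewrite ler_sqrt ?(ltW v10).
have s0r : Num.sqrt v0 <= s by rewrite ler_sqrt ?(ltW v_gt0).
have hc : c <= f x + `|b1|.
  have h1 : c <= cumulant m (fun z => Num.sqrt v1 * `|z| + f x).
    apply: cumulant_le => // [|z]; first by apply: sublinear_add => //; exact: sublinear_cst.
    have := hf (x + s * z) x; rewrite (_ : x + s * z - x = s * z); last by ring.
    rewrite mul1r normrM (ger0_norm (ltW s0)) => h.
    have := le_trans (ler_norm _) h.
    have := ler_wpM2r (normr_ge0 z) sr1; lra.
  rewrite cumulant_shift// in h1.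
  have h2 : cumulant m (fun z => Num.sqrt v1 * `|z|) <= b1 by exact: cumulant_mono.
  by have := ler_norm b1; lra.
have hmass : k * p * (2 * r / s) <= gmean (fun z => E z * B z).
  have := @gmean_ge_interval R (fun z => E z * B z) ((- r - x) / s) ((r - x) / s) k p mEB.
  rewrite (_ : (r - x) / s - _ = 2 * r / s); last by ring.
  have hz z : (- r - x) / s <= z <= (r - x) / s -> `|x + s * z| <= r.
    by rewrite ler_pdivrMr// ler_pdivlMr// ler_norml => /andP[h1 h2]; apply/andP; lra.
  apply.
  - by move=> z; rewrite mulr_ge0// /B ler0n.
  - by rewrite ler_pM2r ?invr_gt0//; lra.
  - exact: ltW.
  - exact: ltW.
  - move=> z /hz hzr; rewrite /B hzr mulr1 ler_expR.
    have h1 : `|s * z| <= K + 1.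
      by rewrite (_ : s * z = (x + s * z) - x); [apply: le_trans (ler_normB _ _) _; lra|ring].
    have := hf (x + s * z) x; rewrite (_ : x + s * z - x = s * z); last by ring.
    rewrite mul1r => h; have h3 : - (K + 1 + `|b1|) <= f (x + s * z) - c.
      by move: h; rewrite ler_norml => /andP[]; lra.
    have h4 := ler_wpM2l (ltW m0) h3.
    have h5 : 0 <= (m1 - m) * (K + 1 + `|b1|) by rewrite mulr_ge0 ?subr_ge0 ?addr_ge0.
    by lra.
  - move=> z /hz hzr; apply: phi_ge; rewrite ler_pdivlMr//.
    have h1 : `|s * z| <= K + 1.
      by rewrite (_ : s * z = (x + s * z) - x); [apply: le_trans (ler_normB _ _) _; lra|ring].
    apply: le_trans h1; rewrite normrM (ger0_norm (ltW s0)) mulrC.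
    exact: ler_wpM2r.
have hkap : kappa <= expR (- m1) * gmean (fun z => E z * B z).
  rewrite /kappa mulrCA ler_wpM2l ?expR_ge0//; apply: le_trans hmass.
  rewrite mulrCA ler_wpM2l ?mulr_ge0 ?(ltW k0) ?(ltW p0)//.
  rewrite mulrA [r * 2]mulrC ler_wpM2l ?mulr_ge0 ?(ltW r0)//.
  by rewrite lef_pV2.
have kap0 : 0 <= kappa by rewrite !mulr_ge0 ?expR_ge0 ?(ltW r0) ?(ltW k0) ?(ltW p0) ?invr_ge0 ?(ltW sv1).
rewrite cumulant_leP//.
have msg : moderate (fun z => expR (m * (g (x + s * z) - (c + d - th * kappa)))).
  by apply: moderate_expR_sublinear; apply: sublinear_sub => //; exact: sublinear_cst.
(* A lower bound for [1 - expR (- (m * th))]. Its factor [m] cancels the one in the exponent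
   [m * th * kappa], so [kappa] does not degenerate as [m] tends to 0. *)
pose q := m * th * expR (- m1).
have q0 : 0 <= q by rewrite !mulr_ge0 ?expR_ge0// ltW.
have : gmean (fun z => expR (m * (g (x + s * z) - (c + d - th * kappa)))) <=
  gmean (fun z => expR (m * th * kappa) * (E z - q * (E z * B z))).
  apply: gmean_le => //.
    by apply: moderate_scale; apply: moderate_sub => //; exact: moderate_scale.
  move=> z.
  have -> : m * (g (x + s * z) - (c + d - th * kappa)) = m * th * kappa + m * (g (x + s * z) - d - c) by ring.
  rewrite expRD ler_wpM2l ?expR_ge0//.
  have -> : E z - q * (E z * B z) = E z * (1 - q * B z) by ring.
  rewrite /B; have [h|h] := boolP (`|x + s * z| <= r); last first.
    by rewrite mulr0 subr0 mulr1 ler_expR ler_pM2l//; have := gf (x + s * z); lra.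
  rewrite mulr1.
  apply: (@le_trans _ _ (E z * expR (- (m * th)))).
    rewrite -expRD ler_expR; have := ler_wpM2l (ltW m0) (gfr _ h); lra.
  rewrite ler_wpM2l//.
  have h1 := expR_ge1Dx (m * th).
  have h2 : expR (- (m * th)) * (1 + m * th) <= expR (- (m * th)) * expR (m * th).
    by rewrite ler_wpM2l ?expR_ge0.
  rewrite -expRD addNr expR0 in h2.
  have h3 : expR (- m1) <= expR (- (m * th)).
    rewrite ler_expR lerN2; apply: le_trans mm1; by rewrite ler_piMr// ltW.
  have : q <= m * th * expR (- (m * th)) by rewrite ler_wpM2l// mulr_ge0// ltW.
  by lra.
move/le_trans; apply.
rewrite gmean_scale; last by apply: moderate_sub => //; exact: moderate_scale.
rewrite gmean_sub//; last exact: moderate_scale.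
rewrite gmean_scale// E1.
have h1 : m * th * kappa <= q * gmean (fun z => E z * B z).
  by rewrite /q -[leRHS]mulrA ler_wpM2l// mulr_ge0// ltW.
have h2 := expR_ge1Dx (- (m * th * kappa)).
rewrite -[leRHS](expR0 R) -(addrN (m * th * kappa)) expRD ler_wpM2l ?expR_ge0//; lra.
Qed.

End ChopComparison.

(** * Test functions and mollification *)

Section Smooth.
Variable R : realType.
Implicit Types (f g : R -> R).

Fixpoint diffk (k : nat) f : Prop :=
  match k with
  | 0%N => continuous f
  | k'.+1 => (forall x, derivable f x 1) /\ diffk k' (derive1 f)
  end.

Definition smooth1 f := forall k, diffk k f.

Lemma derivable_continuous f : (forall x, derivable f x 1) -> continuous f.
Proof. by move=> df x; apply/differentiable_continuous/derivable1_diffP/df. Qed.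

Lemma is_derive_derive1 f f' : (forall x : R, is_derive x 1 f (f' x)) -> derive1 f = f'.
Proof. by move=> h; apply/funext => x; rewrite derive1E; have [_] := h x. Qed.

Lemma derive1_is_derive f (x : R) : derivable f x 1 -> is_derive x 1 f (derive1 f x).
Proof. by move=> h; rewrite derive1E; exact: DeriveDef. Qed.

Lemma diffkW k f : diffk k.+1 f -> diffk k f.
Proof.
elim: k f => [f [df _]|k ih f [df h]]; first exact: derivable_continuous.
by split => //; exact: ih.
Qed.

Lemma diffk_is_derive k f f' : (forall x : R, is_derive x 1 f (f' x)) -> diffk k f' -> diffk k.+1 f.
Proof.
by move=> h h'; split; [move=> x; case: (h x)|rewrite (is_derive_derive1 h)].
Qed.

Lemma diffk_add k f g : diffk k f -> diffk k g -> diffk k (fun x => f x + g x).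
Proof.
elim: k f g => [f g cf cg x|k ih f g [df hf] [dg hg]]; first by apply: cvgD; [exact: cf|exact: cg].
apply: diffk_is_derive (ih _ _ hf hg) => x.
have := derive1_is_derive (df x); have := derive1_is_derive (dg x) => ? ?.
exact: is_deriveD.
Qed.

Lemma diffk_mul k f g : diffk k f -> diffk k g -> diffk k (fun x => f x * g x).
Proof.
elim: k f g => [f g cf cg x|k ih f g hf hg]; first by apply: cvgM; [exact: cf|exact: cg].
have := ih _ _ hf.2 (diffkW hg); have := ih _ _ (diffkW hf) hg.2 => h1 h2.
apply: diffk_is_derive (diffk_add h1 h2) => x.
have := derive1_is_derive (hf.1 x); have := derive1_is_derive (hg.1 x) => h3 h4.
have h5 := is_deriveM h4 h3.
by apply: is_derive_eq; rewrite /GRing.scale/=; ring.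
Qed.

Lemma diffk_cst k (c : R) : diffk k (fun=> c).
Proof.
elim: k c => [c x|k ih c]; first exact: cvg_cst.
by apply: diffk_is_derive (ih 0) => x; exact: is_derive_cst.
Qed.

Lemma diffk_affine k f (a b : R) : diffk k f -> diffk k (fun x => f (a * x + b)).
Proof.
have dl (x : R) : is_derive x 1 (fun x : R => a * x + b) a.
  by apply: is_derive_eq; rewrite /GRing.scale/= mulr1 addr0.
elim: k f => [f cf x|k ih f [df hf]].
  apply: (@continuous_comp _ _ _ (fun x : R => a * x + b) f); last exact: cf.
  by apply: derivable_continuous => y; case: (dl y).
apply: diffk_is_derive (diffk_mul (ih _ hf) (@diffk_cst k a)) => x.
have h := derive1_is_derive (df (a * x + b)).
exact: (@is_derive1_comp _ f (fun x => a * x + b) x _ _ h (dl x)).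
Qed.

Lemma smooth1_derive f : smooth1 f -> smooth1 (derive1 f).
Proof. by move=> hf k; have [_] := hf k.+1. Qed.

Lemma smooth1_continuous f : smooth1 f -> continuous f.
Proof. by move=> hf; exact: (hf 0%N). Qed.

Lemma smooth1_is_derive f (x : R) : smooth1 f -> is_derive x 1 f (derive1 f x).
Proof. by move=> hf; apply: derive1_is_derive; have [] := hf 1%N. Qed.

Lemma smooth1_primitive f f' : (forall x : R, is_derive x 1 f (f' x)) -> smooth1 f' -> smooth1 f.
Proof.
move=> h hf' [|k]; first by apply: derivable_continuous => x; case: (h x).
exact: diffk_is_derive h (hf' k).
Qed.

Lemma smooth1_affine f (a b : R) : smooth1 f -> smooth1 (fun x => f (a * x + b)).
Proof. by move=> hf k; exact: diffk_affine. Qed.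

Lemma smooth1_scale f (a : R) : smooth1 f -> smooth1 (fun x => a * f x).
Proof. by move=> hf k; apply: diffk_mul => //; exact: diffk_cst. Qed.

Lemma dt_tensor f g : smooth1 f -> dt (fun t x => f t * g x) = fun t x => derive1 f t * g x.
Proof.
move=> sf; apply/funext => t; apply/funext => x; rewrite /dt derive1E.
have h := smooth1_is_derive t sf.
have h2 : is_derive t 1 (fun t => f t * g x) (derive1 f t * g x).
  by apply: is_derive_eq; rewrite /GRing.scale/=; ring.
by case: h2.
Qed.

Lemma dx_tensor f g : smooth1 g -> dx (fun t x => f t * g x) = fun t x => f t * derive1 g x.
Proof.
move=> sg; apply/funext => t; apply/funext => x; rewrite /dx derive1E.
have h := smooth1_is_derive x sg.
have h2 : is_derive x 1 (fun x => f t * g x) (f t * derive1 g x).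
  by apply: is_derive_eq; rewrite /GRing.scale/=; ring.
by case: h2.
Qed.

Lemma smooth_tensor f g : smooth1 f -> smooth1 g -> smooth (fun t x => f t * g x).
Proof.
move=> sf sg k; elim: k f g sf sg => [f g sf sg|k ih f g sf sg] /=.
  move=> p; apply: cvgM.
    apply: (@continuous_comp _ _ _ fst f); first exact: cvg_fst.
    exact: smooth1_continuous.
  apply: (@continuous_comp _ _ _ snd g); first exact: cvg_snd.
  exact: smooth1_continuous.
split.
- move=> t x; have h := smooth1_is_derive t sf.
  have : is_derive t 1 (fun t => f t * g x) (derive1 f t * g x).
    by apply: is_derive_eq; rewrite /GRing.scale/=; ring.
  by case.
- move=> t x; have h := smooth1_is_derive x sg.
  have : is_derive x 1 (fun x => f t * g x) (f t * derive1 g x).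
    by apply: is_derive_eq; rewrite /GRing.scale/=; ring.
  by case.
- by rewrite dt_tensor//; apply: ih => //; exact: smooth1_derive.
- by rewrite dx_tensor//; apply: ih => //; exact: smooth1_derive.
Qed.

End Smooth.

Lemma is_derive_of_bound (R : realType) (f : R -> R) (x d C : R) :
  (forall h, `|h| <= 1 -> `|f (x + h) - f x - h * d| <= C * h ^+ 2) -> is_derive x 1 f d.
Proof.
move=> hf.
have hc : h^-1 *: (f (h *: 1 + x) - f x) @[h --> 0^'] --> d.
  apply/cvgrPdist_le => e e0.
  have C1 : 0 < `|C| + 1 by rewrite ltr_wpDl.
  near=> h.
  have h0 : h != 0 by near: h; exact: nbhs_dnbhs_neq.
  have h1 : `|h| <= 1.
    by near: h; apply: dnbhs0_le; exact: ltr01.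
  have he : `|h| <= e / (`|C| + 1) by near: h; apply: dnbhs0_le; rewrite divr_gt0.
  rewrite /GRing.scale/= mulr1 [h + x]addrC.
  rewrite (_ : d - _ = - (h^-1 * (f (x + h) - f x - h * d))); last by field.
  rewrite normrN normrM normfV mulrC ler_pdivrMr ?normr_gt0//.
  apply: le_trans (hf _ h1) _; rewrite -real_normK ?num_real// expr2 mulrA ler_wpM2r//.
  move: he; rewrite ler_pdivlMr//; have := ler_norm C.
  by have := normr_ge0 h => h2 h3 h4; have := ler_wpM2r h2 h3; lra.
apply: DeriveDef; first by apply/cvg_ex; exists d.
by rewrite /derive; apply/cvg_lim.
Unshelve. all: by end_near. Qed.

(** * A smooth bump function built from the flat exponential *)

Section Bump.
Variable R : realType.
Implicit Types (P Q : {poly R}).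

(* The derivatives of [exp (-1/x)] stay in this family, indexed by polynomials in [1/x]. *)
Definition flat P (x : R) : R := if 0 < x then P.[x^-1] * expR (- x^-1) else 0.

Lemma poly_expR_bound P : exists C : R, forall y, 0 < y -> `|P.[y]| * expR (- y) <= C.
Proof.
exists (\sum_(i < size P) `|P`_i| * (i`!)%:R) => y y0.
rewrite horner_coef expRN ler_pdivrMr ?expR_gt0// mulr_suml.
apply: le_trans (ler_norm_sum _ _ _) _; apply: ler_sum => i _.
rewrite normrM -mulrA ler_wpM2l// normrX (ger0_norm (ltW y0)).
case: (nat_of_ord i) => [|n].
  by rewrite expr0 fact0 mul1r -expR0 ler_expR ltW.
have := expR_ge1Dxn n (ltW y0).
have f0 : (0 : R) < (n.+1)`!%:R by rewrite ltr0n fact_gt0.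
by move=> h; rewrite [leRHS]mulrC -ler_pdivrMr//; lra.
Qed.

(** Quadratic smallness at 0 makes every member of the family differentiable there with derivative
    0. It is the boundedness of polynomial times [expR (- y)], applied to [P * 'X^2] at
    [y = x^-1]. *)
Lemma flat_small P : exists2 C : R, 0 <= C & forall x, `|flat P x| <= C * x ^+ 2.
Proof.
have [C hC] := poly_expR_bound (P * 'X^2).
have C0 : 0 <= C by apply: le_trans (hC 1 ltr01); rewrite mulr_ge0 ?expR_ge0.
exists C => // x; rewrite /flat; case: ltP => x0; last first.
  by rewrite normr0 mulr_ge0 ?sqr_ge0.
have := hC x^-1; rewrite invr_gt0 => /(_ x0).
rewrite hornerM hornerXn normrM normrX [X in _ * X ^+ 2 * _ <= _]ger0_norm ?invr_ge0 ?(ltW x0)//.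
rewrite exprVn mulrAC ler_pdivrMr ?exprn_gt0//.
by rewrite normrM [X in _ -> _ * X <= _]ger0_norm ?expR_ge0.
Qed.

Lemma flat_is_derive P (x : R) : is_derive x 1 (flat P) (flat ('X^2 * (P - P^`())) x).
Proof.
have [x0|x0|->] := ltgtP x 0.
- have -> : flat ('X^2 * (P - P^`())) x = 0 by rewrite /flat ltNge (ltW x0).
  have h : is_derive x 1 (fun _ : R => (0 : R)) (0 : R) by exact: is_derive_cst.
  apply: (near_eq_is_derive _ h).
  near=> y; rewrite /flat ltNge (_ : y <= 0)//.
  by apply: ltW; near: y; exact: lt_nbhsl.
- have xn0 : x != 0 by rewrite gt_eqF.
  have d1 : is_derive x 1 (fun y : R => y^-1) (- x ^- 2).
    by have := is_deriveV xn0 (is_derive_id x 1); rewrite /GRing.scale/= mulr1.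
  have d2 : is_derive x 1 (fun y : R => P.[y^-1]) (P^`().[x^-1] * (- x ^- 2)).
    exact: (@is_derive1_comp _ (fun y => P.[y]) (fun y => y^-1) x _ _ (is_derive_poly P (x^-1)) d1).
  have d3 : is_derive x 1 (fun y : R => expR (- y^-1)) (expR (- x^-1) * - - x ^- 2).
    by apply: (@is_derive1_comp _ expR (fun y => - y^-1) x).
  have d4 := is_deriveM d2 d3.
  have -> : flat ('X^2 * (P - P^`())) x = P.[x^-1] *: (expR (- x^-1) * - - x ^- 2) + expR (- x^-1) *: (P^`().[x^-1] * - x ^- 2).
    by rewrite /flat x0 /GRing.scale/= hornerM hornerXn hornerD hornerN exprVn; ring.
  apply: (near_eq_is_derive _ d4).
  near=> y; rewrite /flat (_ : 0 < y)//.
  by near: y; exact: lt_nbhsr.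
have [C C0 hC] := flat_small P.
have f0 Q : flat Q 0 = 0 by rewrite /flat ltxx.
rewrite f0; apply: (@is_derive_of_bound _ _ _ _ C) => h _.
by rewrite add0r f0 subr0 mulr0 subr0.
Unshelve. all: by end_near. Qed.

Lemma flat_smooth P : smooth1 (flat P).
Proof.
move=> k; elim: k P => [P|k ih P].
  by apply: derivable_continuous => x; case: (flat_is_derive P x).
exact: diffk_is_derive (@flat_is_derive P) (ih _).
Qed.

Definition bump (x : R) : R := flat 1 (1 * x + 1) * flat 1 (-1 * x + 1).

Lemma flat_ge0 (x : R) : 0 <= flat 1 x.
Proof. by rewrite /flat; case: ifP => // _; rewrite hornerC mul1r expR_ge0. Qed.

Lemma bump_ge0 x : 0 <= bump x.
Proof. by rewrite mulr_ge0 ?flat_ge0. Qed.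

Lemma bump_smooth : smooth1 bump.
Proof. by move=> k; apply: diffk_mul; apply: diffk_affine; exact: flat_smooth. Qed.

Lemma bump_supp x : 1 <= `|x| -> bump x = 0.
Proof.
rewrite ler_normr /bump /flat => /orP[x1|x1].
  by rewrite [X in _ * X]ifF ?mulr0//; apply/negbTE; rewrite -leNgt; lra.
by rewrite [X in X * _]ifF ?mul0r//; apply/negbTE; rewrite -leNgt; lra.
Qed.

Lemma bump_pos x : `|x| <= 1 / 2 -> expR (- 4) <= bump x.
Proof.
rewrite ler_norml => /andP[x1 x2].
have h (y : R) : 1 / 2 <= y -> expR (- 2) <= flat 1 y.
  move=> y0; rewrite /flat ifT; last by lra.
  rewrite hornerC mul1r ler_expR lerN2 -[leRHS]invrK lef_pV2 ?posrE; lra.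
rewrite (_ : - 4 = - 2 + - 2 :> R); last by ring.
by rewrite expRD; apply: ler_pM; rewrite ?expR_ge0//; apply: h; lra.
Qed.

End Bump.

(** * Integration against compactly supported test functions *)

Section CompactSupport.
Variable R : realType.
Notation mu := (@lebesgue_measure R).
Implicit Types (f g k : R -> R) (r C x y h : R).

Definition supp_in r f := forall x, r < `|x| -> f x = 0.

(** The common class for coefficients, solutions and test functions: stable under products, sums and
    translations, and integrable on bounded intervals. *)
Definition locbdd f := measurable_fun setT f /\
  forall r, exists C, forall x, `|x| <= r -> `|f x| <= C.

Lemma continuous_locbdd f : continuous f -> locbdd f.
Proof.
move=> cf; split; first exact: continuous_measurable_fun.
move=> r; have [r0|r0] := leP 0 r; last first.
  by exists 0 => x xr; have := normr_ge0 x; lra.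
have cn : {within `[- r, r], continuous (fun x => `|f x|)}.
  apply: continuous_subspaceT => x; apply: continuous_comp; first exact: cf.
  exact: norm_continuous.
have rr : - r <= r by lra.
have [c _ hc] := EVT_max rr cn.
exists `|f c| => x; rewrite ler_norml => xr; apply: hc.
by rewrite in_itv.
Qed.

Lemma locbdd_mul f g : locbdd f -> locbdd g -> locbdd (fun x => f x * g x).
Proof.
move=> [mf hf] [mg hg]; split; first exact: measurable_funM.
move=> r; have [C hC] := hf r; have [C' hC'] := hg r; exists (C * C') => x xr.
by rewrite normrM; apply: ler_pM => //; [exact: hC|exact: hC'].
Qed.

Lemma locbdd_supp_bounded r f : locbdd f -> supp_in r f -> exists2 C, 0 <= C & forall x, `|f x| <= C.
Proof.
move=> [_ /(_ r) [C hC]] sf; exists `|C| => // x.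
have [xr|xr] := leP `|x| r; last by rewrite sf// normr0.
exact: le_trans (hC x xr) (ler_norm _).
Qed.

Lemma integral_cst_itv (a b C : R) : a <= b -> \int[mu]_(x in `[a, b]) C = C * (b - a).
Proof.
move=> ab; rewrite Rintegral_cst//= lebesgue_measure_itv/= lte_fin.
by move: ab; rewrite le_eqVlt => /predU1P[->|->//]; rewrite ltxx subrr.
Qed.

Lemma integrable_itv_bounded (a b : R) f C : measurable_fun setT f ->
  (forall x, a <= x <= b -> `|f x| <= C) -> mu.-integrable `[a, b] (EFin \o f).
Proof.
move=> mf hf; apply: measurable_bounded_integrable => //.
- by rewrite /= lebesgue_measure_itv/=; case: ifP => _; rewrite ?ltry// -EFinD ltry.
- exact: measurable_funTS.
- exists `|C|; split; first exact: num_real.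
  move=> M CM x /=; rewrite in_itv/= => xab; apply: le_trans (hf x xab) _.
  by apply: le_trans (ler_norm _) (ltW CM).
Qed.

Lemma supp_integral r f : supp_in r f ->
  \int[mu]_x f x = \int[mu]_(x in `[- r, r]) f x.
Proof.
move=> sf; rewrite [RHS]Rintegral_mkcond; apply: eq_Rintegral => x _.
rewrite patchE; case: ifPn => //; rewrite notin_setE/= in_itv/= => /negP xr.
by rewrite sf// ltNge ler_norml.
Qed.

Lemma supp_integrable r f : locbdd f -> supp_in r f -> mu.-integrable setT (EFin \o f).
Proof.
move=> hf sf; have [C C0 hC] := locbdd_supp_bounded hf sf.
have h := @Rintegrable_scale _ _ _ mu C (\1_`[- r, r]) setT measurableT (@integrable_indic_itv R (- r) r true false).
apply: (dominated_integrable _ _ h) => //; first exact: hf.1.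
move=> x _; rewrite indicE; have [|] := boolP (x \in _); first by rewrite mulr1.
rewrite notin_setE/= in_itv/= => /negP xr.
by rewrite mulr0 sf ?normr0// ltNge ler_norml.
Qed.

Lemma supp_integral_le r f C : 0 <= r -> locbdd f -> supp_in r f -> (forall x, `|f x| <= C) ->
  `|\int[mu]_x f x| <= C * (2 * r).
Proof.
move=> r0 hf sf hC; rewrite (supp_integral sf).
have hi := @integrable_itv_bounded (- r) r f C hf.1 (fun x _ => hC x).
apply: le_trans (le_normr_Rintegral _ hi) _ => //.
rewrite (_ : C * (2 * r) = \int[mu]_(x in `[- r, r]) C); last by rewrite integral_cst_itv; [ring|lra].
apply: le_Rintegral => //; first exact: integrable_norm.
by apply: (@integrable_itv_bounded _ _ (cst C) `|C|).
Qed.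

Lemma supp_inW r r' f : r <= r' -> supp_in r f -> supp_in r' f.
Proof. by move=> rr sf x xr; apply: sf; lra. Qed.

Lemma supp_in_mull r f g : supp_in r g -> supp_in r (fun x => f x * g x).
Proof. by move=> sg x xr; rewrite sg// mulr0. Qed.

Lemma supp_in_derive r f : supp_in r f -> smooth1 f -> supp_in r (derive1 f).
Proof.
move=> sf smf x xr; have d0 : is_derive x 1 (fun _ : R => (0 : R)) (0 : R) by exact: is_derive_cst.
have : is_derive x 1 f 0.
  apply: (near_eq_is_derive _ d0); near=> y; rewrite sf//.
  near: y; have : \forall y \near `|x|, r < y by exact: lt_nbhsr.
  exact: norm_continuous.
by move=> [_]; rewrite derive1E.
Unshelve. all: by end_near. Qed.

Lemma smooth1_supp_bounded r f : smooth1 f -> supp_in r f -> exists2 C, 0 <= C & forall x, `|f x| <= C.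
Proof. by move=> sm; apply: locbdd_supp_bounded; apply: continuous_locbdd; exact: smooth1_continuous. Qed.

Lemma smooth1_taylor r k : smooth1 k -> supp_in r k ->
  exists2 C, 0 <= C & forall x h, `|k (x + h) - k x - h * derive1 k x| <= C * h ^+ 2.
Proof.
move=> sm sk.
have sm1 := smooth1_derive sm; have sk1 := supp_in_derive sk sm.
have [C C0 hC] := smooth1_supp_bounded (smooth1_derive sm1) (supp_in_derive sk1 sm1).
exists C => // x h.
have := @mean_value_bound0 R (fun z => k (x + z) - k x - z * derive1 k x) (fun z => derive1 k (x + z) - derive1 k x) (C * `|h|) h.
rewrite addr0 subrr mul0r !subr0 -mulrA -expr2 real_normK ?num_real//; apply.
- move=> z; have hk := smooth1_is_derive (x + z) sm.
  have dxz : is_derive z 1 (fun z : R => x + z) 1.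
    by have := is_deriveD (is_derive_cst x z 1) (is_derive_id z 1); rewrite add0r.
  have := is_derive1_comp hk dxz; rewrite mulr1 => h1.
  by apply: is_derive_eq; rewrite /GRing.scale/=; ring.
- move=> z zh.
  have := @mean_value_bound R (derive1 k) (derive1 (derive1 k)) C x (x + z).
  rewrite [x + z - x]addrC addKr => /(_ (fun w _ => smooth1_is_derive w sm1) (fun w _ => hC w)).
  by move/le_trans; apply; rewrite ler_wpM2l.
Qed.

(* Integrating against a test function centred at [y]; the sign of the
   derivative in [y] is the opposite of that of a convolution. *)
Definition pairing f k y : R := \int[mu]_x (f x * k (x - y)).

Lemma locbdd_translate f y : locbdd f -> locbdd (fun x => f (x + y)).
Proof.
move=> [mf hf]; split; first by apply: measurableT_comp => //; exact: measurable_funD.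
move=> r; have [C hC] := hf (r + `|y|); exists C => x xr; apply: hC.
by apply: le_trans (ler_normD _ _) _; lra.
Qed.

Lemma supp_translate r k y : supp_in r k -> supp_in (r + `|y|) (fun x => k (x - y)).
Proof.
move=> sk x xr; apply: sk; have := ler_normD (x - y) y; rewrite subrK; lra.
Qed.

Lemma smooth1_translate k y : smooth1 k -> smooth1 (fun x => k (x - y)).
Proof. by move=> sk; have := smooth1_affine 1 (- y) sk; under eq_fun do rewrite mul1r. Qed.

Lemma pairing_locbdd f k y : locbdd f -> continuous k -> locbdd (fun x => f x * k (x - y)).
Proof.
move=> hf ck; apply: locbdd_mul => //.
by apply: (@locbdd_translate k (- y)); exact: continuous_locbdd.
Qed.

Lemma pairing_integrable f k y r : locbdd f -> continuous k -> supp_in r k ->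
  mu.-integrable setT (EFin \o (fun x => f x * k (x - y))).
Proof.
move=> hf ck sk; apply: (@supp_integrable (r + `|y|)); first exact: pairing_locbdd.
by apply: supp_in_mull; exact: supp_translate.
Qed.

(** Differentiation under the integral by the uniform quadratic Taylor bound on [k]. For [|h| <= 1]
    all the translates involved are supported in the ball of radius [r + 1 + |y|], on which [f] is
    bounded. *)
Lemma pairing_is_derive f k r y : locbdd f -> smooth1 k -> supp_in r k -> 0 <= r ->
  is_derive y 1 (pairing f k) (- pairing f (derive1 k) y).
Proof.
move=> hf sm sk r0.
have [C C0 hC] := smooth1_taylor sm sk.
have [K hK] := hf.2 (r + 1 + `|y|).
have K0 : 0 <= `|K| by [].
have ck := smooth1_continuous sm.
have ck1 := smooth1_continuous (smooth1_derive sm).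
have sk1 := supp_in_derive sk sm.
apply: (@is_derive_of_bound _ _ _ _ (`|K| * C * (2 * (r + 1 + `|y|)))) => h h1.
have i1 := pairing_integrable (y + h) hf ck sk.
have i2 := pairing_integrable y hf ck sk.
have i3 := pairing_integrable y hf ck1 sk1.
pose F x := f x * (k (x - (y + h)) - k (x - y) - (- h) * derive1 k (x - y)).
have -> : pairing f k (y + h) - pairing f k y - h * - pairing f (derive1 k) y = \int[mu]_x F x.
  rewrite /pairing mulrN opprK -RintegralB// -RintegralZl// -RintegralD//; last 2 first.
  - exact: Rintegrable_sub.
  - exact: Rintegrable_scale.
  by apply: eq_Rintegral => x _; rewrite /F; ring.
have sF : supp_in (r + 1 + `|y|) F.
  move=> x xr; rewrite /F sk ?sk ?sk1 ?subrr ?mulr0 ?subr0 ?mulr0//.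
  - by have := ler_normD (x - y) y; rewrite subrK; lra.
  - by have := ler_normD (x - y) y; rewrite subrK; lra.
  - have := ler_normD (x - (y + h)) (y + h); rewrite subrK; have := ler_normD y h; lra.
have lF : locbdd F.
  apply: locbdd_mul => //; apply: continuous_locbdd => x.
  have cs (k' : R -> R) w : continuous k' -> {for x, continuous (fun x => k' (x - w))}.
    move=> ck'; apply: (@continuous_comp _ _ _ (fun x => x - w) k'); last exact: ck'.
    by apply: cvgB; [exact: cvg_id|exact: cvg_cst].
  apply: cvgB; first by apply: cvgB; exact: cs.
  by apply: cvgM; [exact: cvg_cst|exact: cs].
rewrite (_ : _ * h ^+ 2 = `|K| * (C * h ^+ 2) * (2 * (r + 1 + `|y|))); last by ring.
apply: supp_integral_le => //; first by rewrite addr_ge0//; lra.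
move=> x; have [xr|xr] := leP `|x| (r + 1 + `|y|); last first.
  by rewrite sF// normr0; apply: mulr_ge0 => //; apply: mulr_ge0 => //; exact: sqr_ge0.
rewrite normrM; apply: ler_pM => //; first exact: le_trans (hK x xr) (ler_norm _).
have := hC (x - y) (- h); rewrite sqrrN; congr (`|k _ - _ - _| <= _); ring.
Qed.

End CompactSupport.

(** * Mollifiers, and weak derivatives in one variable *)

Section Mollifier.
Variable R : realType.
Notation mu := (@lebesgue_measure R).
Implicit Types (f g k A B eta : R -> R) (x y s t C : R) (j : nat).

Definition bump_mass : R := \int[mu]_x bump x.

Lemma bump_supp_in : supp_in 1 (@bump R).
Proof. by move=> x x1; apply: bump_supp; exact: ltW. Qed.

Lemma bump_continuous : continuous (@bump R).
Proof. exact: smooth1_continuous (@bump_smooth R). Qed.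

Lemma bump_integrable : mu.-integrable setT (EFin \o (@bump R)).
Proof. by apply: supp_integrable bump_supp_in; apply: continuous_locbdd; exact: bump_continuous. Qed.

Lemma bump_mass_gt0 : 0 < bump_mass.
Proof.
have h : expR (- 4) * (1 / 2 - - (1 / 2)) <= bump_mass.
  rewrite -integral_cst_itv; last by lra.
  rewrite Rintegral_mkcond; apply: le_Rintegral => //.
  - have := @Rintegrable_scale _ _ _ mu (expR (- 4)) (\1_`[- (1 / 2), 1 / 2]) setT measurableT (@integrable_indic_itv R _ _ true false).
    apply: eq_integrable => // x _ /=; rewrite patchE indicE.
    by case: ifPn => _; rewrite ?mulr1 ?mulr0.
  - exact: bump_integrable.
  move=> x _; rewrite patchE; case: ifPn => [|_]; last exact: bump_ge0.
  by rewrite inE/= in_itv/= => xh; apply: bump_pos; rewrite ler_norml.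
by apply: lt_le_trans h; rewrite mulr_gt0 ?expR_gt0//; lra.
Qed.

Definition rho x : R := bump_mass^-1 * bump x.

Lemma rho_ge0 x : 0 <= rho x.
Proof. by rewrite mulr_ge0 ?bump_ge0// invr_ge0 ltW// bump_mass_gt0. Qed.

Lemma rho_smooth : smooth1 rho.
Proof. exact: smooth1_scale (@bump_smooth R). Qed.

Lemma rho_supp : supp_in 1 rho.
Proof. exact: supp_in_mull bump_supp_in. Qed.

Lemma rho_integral : \int[mu]_x rho x = 1.
Proof.
by rewrite RintegralZl ?bump_integrable// -/bump_mass mulVf// gt_eqF// bump_mass_gt0.
Qed.

Definition moll j x : R := j.+1%:R * rho (j.+1%:R * x).

Lemma moll_ge0 j x : 0 <= moll j x.
Proof. by rewrite mulr_ge0 ?rho_ge0. Qed.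

Lemma moll_smooth j : smooth1 (moll j).
Proof.
apply: smooth1_scale; have := smooth1_affine j.+1%:R 0 rho_smooth.
by under eq_fun do rewrite addr0.
Qed.

Lemma moll_eq0 j x : j.+1%:R^-1 <= `|x| -> moll j x = 0.
Proof.
move=> xr; rewrite /moll /rho bump_supp ?mulr0// normrM ger0_norm//.
by rewrite mulrC -ler_pdivrMr// mul1r.
Qed.

Lemma moll_supp j : supp_in j.+1%:R^-1 (moll j).
Proof. by move=> x /ltW; exact: moll_eq0. Qed.

Lemma moll_supp1 j : supp_in 1 (moll j).
Proof. by apply: supp_inW (@moll_supp j); rewrite invf_le1 ?ltr0n// ler1n. Qed.

Lemma moll_continuous j : continuous (moll j).
Proof. exact: smooth1_continuous (moll_smooth j). Qed.

Lemma moll_integral j : \int[mu]_x moll j x = 1.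
Proof.
rewrite -[RHS]rho_integral; congr fine.
rewrite (@linear_substitution R rho j.+1%:R 0)//.
- by apply: eq_integral => x _; rewrite addr0 mulrC.
- exact: smooth1_continuous rho_smooth.
- exact: rho_ge0.
Qed.

Lemma moll_integral_translate j y : \int[mu]_x moll j (x - y) = 1.
Proof.
rewrite -[RHS](moll_integral j); congr fine.
rewrite (@linear_substitution R (moll j) 1 (- y))//.
- by apply: eq_integral => x _; rewrite mul1r mulr1.
- exact: moll_continuous.
- exact: moll_ge0.
Qed.

Lemma locbdd_cst (c : R) : locbdd (fun _ : R => c).
Proof. by split => // r; exists `|c|. Qed.

Lemma moll_integrable j y : mu.-integrable setT (EFin \o (fun x => moll j (x - y))).
Proof.
have := @pairing_integrable R (cst 1) (moll j) y 1 (locbdd_cst 1) (@moll_continuous j) (@moll_supp1 j).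
by apply: eq_integrable => // x _ /=; rewrite mul1r.
Qed.

Lemma locbdd_locally_integrable f : locbdd f -> locally_integrable setT f.
Proof.
move=> [mf hf]; split => //; first exact: openT.
move=> K _ cK; have [r [_ hr]] := compact_bounded cK.
have [C hC] := hf (`|r| + 1).
have mK : measurable K by exact: compact_measurable.
apply: (@le_lt_trans _ _ (\int[mu]_(x in K) `|C|%:E)%E).
  apply: ge0_le_integral => //.
  - by apply/measurable_EFinP; apply: measurableT_comp => //; exact: measurable_funTS.
  - move=> x Kx; rewrite lee_fin (le_trans (hC x _) (ler_norm C))//.
    by apply: hr => //; rewrite (le_lt_trans (ler_norm _))// ltrDl.
rewrite integral_cst// lte_mul_pinfty//; exact: compact_finite_measure.
Qed.

(** The kernel is at most [j.+1 * C] on an interval of length [2 / j.+1], so the error is at most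
    [2 * C] times the average of [|f x - f y|] over it, which vanishes at a Lebesgue point. *)
Lemma pairing_moll_cvg f y : locbdd f -> lebesgue_pt f y ->
  pairing f (moll j) y @[j --> \oo] --> f y.
Proof.
move=> hf ly.
have [C C0 hC] := smooth1_supp_bounded rho_smooth rho_supp.
apply/cvgrPdist_le => e e0.
have e1 : 0 < e / (2 * C + 1) by rewrite divr_gt0//; lra.
have : \forall r \near (0 : R)^'+, (davg f y r < (e / (2 * C + 1))%:E)%E.
  have hU : nbhs (0 : \bar R)%E [set x | (x < (e / (2 * C + 1))%:E)%E].
    by apply: open_nbhs_nbhs; split; [exact: open_ereal_lt_ereal|rewrite /= lte_fin].
  exact: (ly _ hU).
move=> [d /= d0 hd].
have hdj : \forall j \near \oo, (j.+1%:R^-1 : R) < d by exact: near_infty_natSinv_lt (PosNum d0).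
apply: filterS hdj => j hj.
set r := j.+1%:R^-1 in hj.
have r0 : 0 < r by rewrite invr_gt0.
have := hd r; rewrite /ball/= sub0r normrN gtr0_norm// => /(_ hj r0).
rewrite /davg /iavg (lebesgue_measure_ball _ (ltW r0)).
have mb : measurable (ball y r) by exact: measurable_ball.
have mub : (mu (ball y r) < +oo)%E by rewrite (lebesgue_measure_ball _ (ltW r0)) ltry.
have iF : mu.-integrable (ball y r) (EFin \o (fun x => f x - f y)).
  have [K hK] := hf.2 (`|y| + r).
  apply: measurable_bounded_integrable => //.
  - by apply: measurable_funB => //; apply: measurable_funTS; exact: hf.1.
  - exists (K + `|f y|); split; first exact: num_real.
    move=> M KM x /=; rewrite /ball/= => xr; apply: le_trans (ltW KM).
    apply: le_trans (ler_normB _ _) _; rewrite lerD2r hK//.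
    have := ler_normB y (y - x); rewrite (_ : y - (y - x) = x); last by ring.
    lra.
have -> : (\int[mu]_(x in ball y r) `|((center (f y) \o f) x)%:E| = (\int[mu]_(x in ball y r) `|f x - f y|)%:E)%E.
  rewrite /Rintegral fineK//; apply: integrable_fin_num => //.
  exact: (integrable_norm iF).
rewrite inver mulrn_eq0/= gt_eqF// -EFinM lte_fin => hI.
have ipair := @pairing_integrable R f (moll j) y 1 hf (@moll_continuous j) (@moll_supp1 j).
have imoll := moll_integrable j y.
have -> : f y - pairing f (moll j) y = \int[mu]_x ((f y - f x) * moll j (x - y)).
  rewrite -[X in X - _]mulr1 -(moll_integral_translate j y) -RintegralZl// -RintegralB//; last first.
    exact: Rintegrable_scale.
  by apply: eq_Rintegral => x _; ring.
have iD : mu.-integrable setT (EFin \o (fun x => (f y - f x) * moll j (x - y))).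
  have := Rintegrable_sub measurableT (Rintegrable_scale (f y) measurableT imoll) ipair.
  by apply: eq_integrable => // x _ /=; congr EFin; ring.
apply: le_trans (le_normr_Rintegral _ iD) _ => //.
have iN : mu.-integrable (ball y r) (EFin \o (fun x => j.+1%:R * C * `|f x - f y|)).
  by apply: Rintegrable_scale => //; exact: integrable_norm.
have hle : \int[mu]_x `|(f y - f x) * moll j (x - y)| <= \int[mu]_(x in ball y r) (j.+1%:R * C * `|f x - f y|).
  rewrite [leRHS]Rintegral_mkcond; apply: le_Rintegral => //.
  - exact: integrable_norm.
  - have mB : (measurable : set (set (measurableTypeR R))) (ball y r) by exact: mb.
    have := (@integrable_mkcond _ (measurableTypeR R) R mu _ (EFin \o (fun x => j.+1%:R * C * `|f x - f y|)) mB).1 iN.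
    by apply: eq_integrable => // x _ /=; rewrite !patchE; case: ifP.
  move=> x _; rewrite patchE normrM distrC mulrC; case: ifPn => [_|].
    rewrite ler_wpM2r// /moll normrM ger0_norm// ler_wpM2l//.
  rewrite notin_setE /ball/= => /negP; rewrite -leNgt => xr.
  by rewrite moll_eq0 ?normr0 ?mul0r// distrC.
apply: le_trans hle _; rewrite RintegralZl//; last exact: integrable_norm.
move: hI; rewrite -(mulr_natr r 2) invfM /r invrK => hI.
set I := Rintegral _ _ _ in hI *.
have I0 : 0 <= I by exact: Rintegral_ge0.
have : j.+1%:R * I <= 2 * (e / (2 * C + 1)) by lra.
move=> h; have := ler_wpM2l C0 h.
have : C * (2 * (e / (2 * C + 1))) <= e.
  by rewrite (_ : C * _ = 2 * C * e / (2 * C + 1)) ?ler_pdivrMr; [lra|lra|field; lra].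
by lra.
Qed.

Lemma bounded_locbdd f C : measurable_fun setT f -> (forall x, `|f x| <= C) -> locbdd f.
Proof. by move=> mf hf; split => // r; exists C. Qed.

(** Mollifiers centred at [t] are admissible test functions once their support is inside the open
    interval, and at Lebesgue points the pairings, all zero, converge to [f t]. *)
Lemma fundamental_variations (f : R -> R) : locbdd f ->
  (forall eta (a b : R), 0 < a -> b < 1 -> smooth1 eta -> (forall t, ~~ (a <= t <= b) -> eta t = 0) ->
     \int[mu]_t (f t * eta t) = 0) ->
  {ae mu, forall t, 0 < t < 1 -> f t = 0}.
Proof.
move=> hf h; have := lebesgue_differentiation (locbdd_locally_integrable hf).
apply: filterS; first exact: (ae_filter_ringOfSetsType mu).
move=> t /(pairing_moll_cvg hf) ht /andP[t0 t1].
have d0 : 0 < Num.min (t / 2) ((1 - t) / 2) by rewrite lt_min; lra.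
have : \forall j \near \oo, pairing f (moll j) t = 0.
  have : \forall j \near \oo, (j.+1%:R^-1 : R) < Num.min (t / 2) ((1 - t) / 2).
    exact: near_infty_natSinv_lt (PosNum d0).
  apply: filterS => j; rewrite lt_min => /andP[h1 h2].
  apply: (h _ (t / 2) ((1 + t) / 2)); [lra|lra|exact: smooth1_translate (moll_smooth j)|].
  move=> s hs; apply: moll_eq0; rewrite leNgt; apply/negP; rewrite ltr_norml => /andP[h3 h4].
  move: h1 h2 h3 h4; set r := j.+1%:R^-1; move: r => r h1 h2 h3 h4.
  by move/negP: hs; apply; apply/andP; split; lra.
move=> hz; have : pairing f (moll j) t @[j --> \oo] --> (0 : R).
  by apply: cvg_near_cst; apply: filterS hz.
by move=> h0; apply: (@cvg_unique _ (@Rhausdorff R) _ _ _ _ ht h0).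
Qed.

(** A smooth Heaviside function; rescaled around [s], its derivative is the mollifier centred at
    [s]. *)
Definition smooth_step x : R := \int[mu]_(y in `]-oo, x]) rho y.

Lemma rho_integrable : mu.-integrable setT (EFin \o rho).
Proof. exact: Rintegrable_scale bump_integrable. Qed.

Lemma smooth_step_derive x : is_derive x 1 smooth_step (rho x).
Proof.
have xu : x < x + 1 by rewrite ltrDl.
have hi : mu.-integrable `]-oo, (x + 1)] (EFin \o rho).
  by apply: (integrableS measurableT) => //; exact: rho_integrable.
have [|d1 d2] := @continuous_FTC1 R rho -oo%O x (x + 1) xu hi (ltNyr _).
  exact: (smooth1_continuous rho_smooth).
by rewrite -d2; apply: derive1_is_derive.
Qed.

Lemma smooth_step_smooth : smooth1 smooth_step.
Proof. exact: smooth1_primitive smooth_step_derive rho_smooth. Qed.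

Lemma smooth_step0 x : x <= - 1 -> smooth_step x = 0.
Proof.
move=> x1; rewrite /smooth_step (@eq_Rintegral _ _ _ mu _ (cst 0)).
  by rewrite Rintegral_cst// mul0r.
move=> y; rewrite inE/= in_itv/= => yx; rewrite /rho bump_supp ?mulr0//.
by rewrite ler_normr; apply/orP; right; lra.
Qed.

Lemma smooth_step1 x : 1 <= x -> smooth_step x = 1.
Proof.
move=> x1; rewrite /smooth_step -[RHS]rho_integral Rintegral_mkcond.
apply: eq_Rintegral => y _; rewrite patchE; case: ifPn => //.
rewrite notin_setE/= in_itv/= => /negP; rewrite -ltNge => xy.
by rewrite /rho bump_supp ?mulr0// ler_normr; apply/orP; left; lra.
Qed.

Lemma smooth_step_bound x : `|smooth_step x| <= 1.
Proof.
rewrite ger0_norm; last by apply: Rintegral_ge0 => y _; exact: rho_ge0.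
rewrite -rho_integral /smooth_step Rintegral_mkcond; apply: le_Rintegral => //.
- have mB : (measurable : set (set (measurableTypeR R))) `]-oo, x]%classic by exact: measurable_itv.
  have hI : mu.-integrable `]-oo, x] (EFin \o rho).
    by apply: (integrableS measurableT) => //; exact: rho_integrable.
  have := (@integrable_mkcond _ (measurableTypeR R) R mu _ (EFin \o rho) mB).1 hI.
  by apply: eq_integrable => // y _ /=; rewrite !patchE; case: ifP.
- exact: rho_integrable.
move=> y _; rewrite patchE; case: ifP => // _; exact: rho_ge0.
Qed.

Lemma continuous_at_lebesgue_pt f x : locbdd f -> {for x, continuous f} -> lebesgue_pt f x.
Proof.
move=> [mf _] cf; apply: (@continuous_lebesgue_pt _ _ _ setT) => //.
by split => //; exact: openT.
Qed.

Lemma integrable01 f : measurable_fun setT f ->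
  (exists C, forall t, 0 <= t <= 1 -> `|f t| <= C) -> mu.-integrable `[0, 1[ (EFin \o f).
Proof.
move=> mf [C hC]; have hI : mu.-integrable `[0, 1] (EFin \o f) by exact: integrable_itv_bounded hC.
by apply: integrableS hI => // t /=; rewrite !in_itv/= => /andP[-> /ltW ->].
Qed.

Lemma ae_neq (s : R) (P : R -> Prop) : (forall t, t != s -> P t) -> {ae mu, forall t, P t}.
Proof.
move=> h; exists [set s]; split; rewrite ?lebesgue_measure_set1//.
by move=> t /= ht; apply: contrapT => /eqP ts; exact/ht/h.
Qed.

(** Testing with smoothed Heaviside functions at [s]: their derivatives concentrate at [s] and
    recover [A s] by continuity, they equal 1 at time 1, and in the term with [B] they converge to
    the indicator of the times after [s]. *)
Lemma integral_of_weak_derivative A B (A1 s : R) : locbdd A -> locbdd B ->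
  (forall eta (a : R), 0 < a -> smooth1 eta -> (forall t, t < a -> eta t = 0) ->
    \int[mu]_(t in `[0, 1[) (- (A t * derive1 eta t) + B t * eta t) + eta 1 * A1 = 0) ->
  0 < s < 1 -> {for s, continuous A} ->
  A s = A1 + \int[mu]_(t in `[s, 1[) B t.
Proof.
move=> hA hB h /andP[s0 s1] cA.
have lA := pairing_moll_cvg hA (continuous_at_lebesgue_pt hA cA).
pose eta j t := smooth_step (j.+1%:R * t + - (j.+1%:R * s)).
have eta_s j : smooth1 (eta j) by exact: smooth1_affine smooth_step_smooth.
have eta_d j : derive1 (eta j) = fun t => moll j (t - s).
  apply: is_derive_derive1 => t.
  have dl : is_derive t 1 (fun t : R => j.+1%:R * t + - (j.+1%:R * s)) j.+1%:R.
    by apply: is_derive_eq; rewrite /GRing.scale/=; ring.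
  have := @is_derive1_comp _ smooth_step (fun t : R => j.+1%:R * t + - (j.+1%:R * s)) t _ _ (smooth_step_derive _) dl.
  by rewrite (_ : moll j (t - s) = rho (j.+1%:R * t - j.+1%:R * s) * j.+1%:R)// /moll mulrC mulrBr.
have d0 : 0 < Num.min (s / 2) ((1 - s) / 2) by rewrite lt_min; lra.
have hlim : \forall j \near \oo, pairing A (moll j) s = A1 + \int[mu]_(t in `[0, 1[) (B t * eta j t).
  have : \forall j \near \oo, (j.+1%:R^-1 : R) < Num.min (s / 2) ((1 - s) / 2).
    exact: near_infty_natSinv_lt (PosNum d0).
  apply: filterS => j; rewrite lt_min => /andP[h1 h2].
  have N0 : (0 : R) < j.+1%:R by [].
  have N1 : j.+1%:R * j.+1%:R^-1 = 1 :> R by rewrite divff// gt_eqF.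
  have hN x : j.+1%:R^-1 <= x -> 1 <= j.+1%:R * x by move=> hx; rewrite -[leLHS]N1 ler_pM2l.
  have := h (eta j) (s / 2).
  rewrite eta_d => /(_ _ (eta_s j)) hh.
  have e1 : eta j 1 = 1.
    by rewrite /eta smooth_step1// -mulrBr hN// (le_trans (ltW h2))//; lra.
  have {}hh : \int[mu]_(t in `[0, 1[) (- (A t * moll j (t - s)) + B t * eta j t) + eta j 1 * A1 = 0.
    apply: hh; first by lra.
    move=> t ts; rewrite /eta smooth_step0// -mulrBr -lerN2 opprK -mulrN hN// (le_trans (ltW h1))//; lra.
  move: hh; rewrite e1 mul1r.
  have [C C0 hC] : exists2 C, 0 <= C & forall t, 0 <= t <= 1 -> `|B t| <= C.
    have [C hC] := hB.2 1; exists `|C| => // t /andP[t0 t1].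
    by apply: le_trans (ler_norm C); apply: hC; rewrite ger0_norm.
  have lam : locbdd (fun t => A t * moll j (t - s)) by apply: pairing_locbdd => //; exact: moll_continuous.
  have iA : mu.-integrable `[0, 1[ (EFin \o (fun t => A t * moll j (t - s))).
    apply: integrable01; first exact: lam.1.
    by have [K hK] := lam.2 1; exists K => t /andP[t0 t1]; apply: hK; rewrite ger0_norm.
  have iB : mu.-integrable `[0, 1[ (EFin \o (fun t => B t * eta j t)).
    apply: integrable01.
      apply: measurable_funM; first exact: hB.1.
      by apply: continuous_measurable_fun; exact: smooth1_continuous.
    exists C => t ht; rewrite normrM -[C]mulr1; apply: ler_pM => //; first exact: hC.
    exact: smooth_step_bound.
  rewrite (@eq_Rintegral _ _ _ mu _ (fun t => B t * eta j t - A t * moll j (t - s))); last by move=> t _; ring.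
  rewrite RintegralB//.
  have -> : pairing A (moll j) s = \int[mu]_(t in `[0, 1[) (A t * moll j (t - s)).
    rewrite [RHS]Rintegral_mkcond; apply: eq_Rintegral => t _; rewrite patchE; case: ifPn => //.
    rewrite notin_setE/= in_itv/= => /negP ht; rewrite moll_eq0 ?mulr0//.
    rewrite leNgt; apply/negP; rewrite ltr_norml => /andP[h3 h4]; move/negP: ht; apply.
    move: h1 h2 h3 h4; set r := j.+1%:R^-1; move: r => r h1 h2 h3 h4.
    by apply/andP; split; lra.
  by lra.
have hR : (A1 + \int[mu]_(t in `[0, 1[) (B t * eta j t)) @[j --> \oo] --> A1 + \int[mu]_(t in `[s, 1[) B t.
  apply: cvgD; first exact: cvg_cst.
  have [C hC] := hB.2 1.
  have -> : \int[mu]_(t in `[s, 1[) B t = \int[mu]_(t in `[0, 1[) (B t * (s <= t)%R%:R).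
    rewrite Rintegral_mkcond [RHS]Rintegral_mkcond; apply: eq_Rintegral => t _.
    rewrite !patchE; case: ifPn; rewrite ?inE ?notin_setE/= !in_itv/=.
      by move=> /andP[st t1]; rewrite ifT ?st ?mulr1// inE/= in_itv/= t1 andbT; lra.
    move=> ht; case: ifPn => //; rewrite inE/= in_itv/= => /andP[t0 t1].
    by move: ht; rewrite t1 andbT => /negP/negbTE ->; rewrite mulr0.
  apply: (@dominated_Rintegral _ _ R mu (fun j t => B t * eta j t) _ (cst `|C|)) => //.
  - move=> j; apply: measurable_funTS; apply: measurable_funM; first exact: hB.1.
    by apply: continuous_measurable_fun; exact: smooth1_continuous.
  - apply: measurable_funTS; apply: measurable_funM; first exact: hB.1.
    rewrite (_ : (fun t => _) = \1_`[s, +oo[); first exact: measurable_indic.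
    by apply/funext => t; rewrite indicE mem_setE in_itv/= andbT.
  - by apply: integrable01 => //; exists `|C| => t _; rewrite normr_id.
  - move=> j t; rewrite /= in_itv/= => /andP[t0 t1]; rewrite normrM -[`|C|]mulr1.
    apply: ler_pM => //; last exact: smooth_step_bound.
    by apply: le_trans (ler_norm C); apply: hC; rewrite ger0_norm// ltW.
  apply: (@ae_neq s) => t ts _; apply: cvg_near_cst.
  have d1 : 0 < `|t - s| by rewrite normr_gt0 subr_eq0.
  have : \forall j \near \oo, (j.+1%:R^-1 : R) < `|t - s| by exact: near_infty_natSinv_lt (PosNum d1).
  apply: filterS => j hj; congr (_ * _); rewrite /eta -mulrBr.
  have N0 : (0 : R) < j.+1%:R by [].
  have N1 : j.+1%:R * j.+1%:R^-1 = 1 :> R by rewrite divff// gt_eqF.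
  have hj2 : 1 <= j.+1%:R * `|t - s| by rewrite -[leLHS]N1 ler_pM2l// ltW.
  have [st|st] := leP s t.
    by rewrite smooth_step1//; move: hj2; rewrite ger0_norm// subr_ge0.
  by rewrite smooth_step0//; move: hj2; rewrite ltr0_norm ?subr_lt0//; lra.
have hE : pairing A (moll j) s @[j --> \oo] --> A1 + \int[mu]_(t in `[s, 1[) B t.
  by apply: cvg_trans hR; apply: near_eq_cvg; apply: filterS hlim => j ->.
exact: (@cvg_unique _ (@Rhausdorff R) _ _ _ _ lA hE).
Qed.

End Mollifier.

(** * Operations on null sets *)

Section AlmostEverywhere.
Context d (T : measurableType d) (R : realType).
Variable mu : {measure set T -> \bar R}.
Implicit Types (P Q : T -> Prop).

Lemma ae_mono P Q : (forall x, P x -> Q x) -> {ae mu, forall x, P x} -> {ae mu, forall x, Q x}.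
Proof.
move=> h [A [mA A0 hA]]; exists A; split => // x /= nQ; apply: hA => /= p.
by apply: nQ; exact: h.
Qed.

Lemma ae_conj P Q : {ae mu, forall x, P x} -> {ae mu, forall x, Q x} ->
  {ae mu, forall x, P x /\ Q x}.
Proof.
move=> [A [mA A0 hA]] [B [mB B0 hB]]; exists (A `|` B); split.
- exact: measurableU.
- by rewrite null_set_setU.
move=> x /= h; have [hP|hP] := pselect (P x); last by left; exact: hA.
by right; apply: hB => hQ; exact: h.
Qed.

Lemma ae_forall (P : nat -> T -> Prop) : (forall n, {ae mu, forall x, P n x}) ->
  {ae mu, forall x, forall n, P n x}.
Proof.
move=> h; have : mu.-negligible (\bigcup_n ~` [set x | P n x]) by apply: negligible_bigcup.
move=> [A [mA A0 hA]]; exists A; split => // x /= /existsNP[n hn].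
by apply: hA; exists n.
Qed.

End AlmostEverywhere.

(** * Weak solutions as integral equations in time *)

Section PlaneTools.
Variable R : realType.
Notation mu := (@lebesgue_measure R).
Implicit Types (k : R -> R) (P D : R -> R -> R) (r s t x y C : R).

Lemma measurable_section (F : R * R -> R) t : measurable_fun setT F ->
  measurable_fun setT (fun x => F (t, x)).
Proof. by move=> mF; apply: measurableT_comp => //; exact: measurable_pair1. Qed.

Lemma measurable_Rintegral_section (F : R * R -> R) : measurable_fun setT F ->
  measurable_fun setT (fun t => \int[mu]_x F (t, x)).
Proof.
move=> mF.
have mE : measurable_fun setT (EFin \o F) by exact/measurable_EFinP.
rewrite (_ : (fun t => _) = fun t => fine ((\int[mu]_x (EFin \o F)^\+ (t, x)) - (\int[mu]_x (EFin \o F)^\- (t, x)))%E); last first.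
  by apply/funext => t; rewrite /Rintegral [in LHS]integralE; congr (fine (_ - _)%E); apply: eq_integral => x _; rewrite ?funeposE ?funenegE.
apply: (measurableT_comp (fine_measurable _)) => //.
apply: emeasurable_funB.
- apply: (measurable_fun_fubini_tonelli_F (m2 := mu)) => //; exact: measurable_funepos.
- apply: (measurable_fun_fubini_tonelli_F (m2 := mu)) => //; exact: measurable_funeneg.
Qed.

(** The product measure of the exceptional set is the integral of the measures of its sections; if
    it is 0, almost every section is null. *)
Lemma ae_slice (Q : R * R -> Prop) : {ae (mu \x mu)%E, forall p, Q p} ->
  {ae mu, forall t, {ae mu, forall x, Q (t, x)}}.
Proof.
move=> [A [mA A0 hA]].
have mx := @measurable_fun_xsection _ _ _ _ R mu A mA.
have : ae_eq mu setT (mu \o xsection A) (cst 0%E).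
  apply/(ae_eq_integral_abs mu measurableT mx).
  rewrite -[RHS]A0; apply: eq_integral => t _.
  by rewrite gee0_abs//; exact: measure_ge0.
apply: ae_mono => t /(_ I) /= h0; exists (xsection A t); split => //.
- exact: measurable_xsection.
- by move=> x /= nQ; rewrite /xsection/= inE; exact: hA.
Qed.

Lemma continuous_section P t : continuous (uncurry2 P) -> continuous (P t).
Proof.
move=> cP x; apply: (cvg_comp (fun x : R => (t, x)) (uncurry2 P)); last exact: (cP (t, x)).
by apply: (@cvg_pair _ _ _ _ (nbhs t) (nbhs x)); [exact: cvg_cst|exact: cvg_id].
Qed.

Lemma continuous_section_l P x : continuous (uncurry2 P) -> continuous (P^~ x).
Proof.
move=> cP t; apply: (cvg_comp (fun t : R => (t, x)) (uncurry2 P)); last exact: (cP (t, x)).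
by apply: (@cvg_pair _ _ _ _ (nbhs t) (nbhs x)); [exact: cvg_id|exact: cvg_cst].
Qed.

Lemma continuous_rectangle_bound P (a b r : R) : continuous (uncurry2 P) ->
  exists2 C, 0 <= C & forall t x, a <= t <= b -> `|x| <= r -> `|P t x| <= C.
Proof.
move=> cP.
have cK : compact (`[a, b]%classic `*` `[- r, r]%classic : set (R * R)).
  by apply: compact_setX; exact: segment_compact.
have : compact (uncurry2 P @` (`[a, b]%classic `*` `[- r, r]%classic)).
  by apply: continuous_compact => //; exact: continuous_subspaceT.
move=> /compact_bounded[M [_ hM]]; exists (`|M| + 1) => // t x tab xr.
apply: (hM (`|M| + 1)); first by rewrite (le_lt_trans (ler_norm _))// ltrDl.
exists (t, x) => //; split; rewrite /= in_itv//=.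
by rewrite -ler_norml.
Qed.

Lemma pairing_time_continuous P k r : continuous (uncurry2 P) -> continuous k -> supp_in r k ->
  continuous (fun t => \int[mu]_x (P t x * k x)).
Proof.
move=> cP ck sk t.
have [C C0 hC] := continuous_rectangle_bound (t - 1) (t + 1) r cP.
have ik := @supp_integrable _ r k (continuous_locbdd ck) sk.
have lk u : locbdd (fun x => P u x * k x).
  by apply: locbdd_mul; apply: continuous_locbdd => //; exact: continuous_section.
have ig : mu.-integrable setT (EFin \o (fun x => C * `|k x|)).
  by apply: Rintegrable_scale => //; exact: (integrable_norm ik).
have It : t \in `]t - 1, t + 1[%classic by rewrite inE/= in_itv/=; apply/andP; split; lra.
apply: (@continuity_under_integral R _ _ mu (fun u x => P u x * k x) setT measurableT (t - 1) (t + 1) _ _ _ ig _ t It).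
- by move=> u _; apply: supp_integrable (lk u) _; exact: supp_in_mull sk.
- apply: aeW => x _ u _; apply: cvgM; [exact: (continuous_section_l cP)|exact: cvg_cst].
- move=> u; rewrite /= in_itv/= => /andP[h1 h2]; apply: aeW => x _; rewrite normrM.
  have [xr|xr] := leP `|x| r; last by rewrite sk// normr0 !mulr0.
  by rewrite ler_wpM2r// hC// !ltW.
Qed.

End PlaneTools.

(** * From the weak formulation to integral equations in time *)

Section RegularSolution.
Variable R : realType.
Notation mu := (@lebesgue_measure R).
Implicit Types (k xi g : R -> R) (P D Psi : R -> R -> R) (r s t x y C X G M : R).

(* Test functions in [x] alone turn the weak formulation into an integral equation
   in [t] that holds for every [t]. *)
Record regular_solution xi g M P D : Prop := RegularSolution {
  rs_continuous : continuous (uncurry2 P);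
  rs_measurable : measurable_fun setT (uncurry2 D);
  rs_bounded : forall t x, `|D t x| <= M;
  rs_dx : forall k r, smooth1 k -> supp_in r k ->
    {ae mu, forall t, 0 < t < 1 -> \int[mu]_x (P t x * derive1 k x) = - \int[mu]_x (D t x * k x)};
  rs_time : forall k r s, smooth1 k -> supp_in r k -> 0 <= s <= 1 ->
    \int[mu]_x (P s x * k x) = \int[mu]_x (`|x| * k x) +
      \int[mu]_(t in `[s, 1[) (xi t / 2 * (\int[mu]_x (P t x * derive1 (derive1 k) x) +
         g t * \int[mu]_x (D t x ^+ 2 * k x)));
  rs_weak : forall phi, test_function (@half_open_strip R) phi ->
    int_strip (fun t x => - (P t x * dt phi t x) +
      xi t / 2 * (P t x * dx (dx phi) t x + g t * D t x ^+ 2 * phi t x)) +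
    \int[mu]_x (phi 1 x * `|x|) = 0 }.

(** Freezing time outside [0, 1] turns a function continuous on the closed strip into one continuous
    on the plane, so that two-sided continuity and measurability results apply. *)
Definition clamp t : R := Num.min 1 (Num.max 0 t).

Lemma clamp_itv t : 0 <= clamp t <= 1.
Proof. by rewrite /clamp ge_min lexx le_min ler01 le_max lexx. Qed.

Lemma clamp_id t : 0 <= t <= 1 -> clamp t = t.
Proof. by move=> /andP[t0 t1]; rewrite /clamp max_r// min_r. Qed.

Lemma clamp_continuous : continuous clamp.
Proof.
apply: (@Lip_continuous _ 1) => s t; rewrite mul1r /clamp.
have [s0|s0] := leP 0 s; have [t0|t0] := leP 0 t; try have [s1|s1] := leP 1 s; try have [t1|t1] := leP 1 t;
  rewrite ?subrr ?normr0// ?(min_r ler01) ler_norml; apply/andP; split; have := ler_norm (s - t); have := ler_norm (t - s); rewrite (distrC t s); lra.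
Qed.

Lemma continuous_clamp Psi : {within @closed_strip R, continuous (uncurry2 Psi)} ->
  continuous (uncurry2 (fun t x => Psi (clamp t) x)).
Proof.
move=> /subspace_continuousP h p.
have cc : continuous (fun q : R * R => (clamp q.1, q.2)).
  move=> q; apply: (@cvg_pair _ _ _ _ (nbhs (clamp q.1)) (nbhs q.2)); last exact: cvg_snd.
  apply: (@continuous_comp _ _ _ fst clamp); first exact: cvg_fst.
  exact: clamp_continuous.
apply: (cvg_comp (fun q : R * R => (clamp q.1, q.2)) (uncurry2 Psi)).
  2: exact: (h (clamp p.1, p.2) (clamp_itv p.1)).
move=> U [V nV hV].
have hn : nbhs (clamp p.1, p.2) (V.1 `*` V.2) by exists V.
have hh : nbhs p [set q : R * R | (V.1 `*` V.2) (clamp q.1, q.2)] := cc p _ hn.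
change (nbhs p [set q : R * R | U (clamp q.1, q.2)]).
by apply: filterS hh => q hq; apply: (hV _ hq); exact: (clamp_itv q.1).
Qed.

Lemma int_strip_eq (F G : R -> R -> R) : (forall t x, 0 <= t < 1 -> F t x = G t x) ->
  int_strip F = int_strip G.
Proof.
move=> h; apply: eq_Rintegral => t; rewrite inE/= in_itv/= => t01.
by apply: eq_Rintegral => x _; exact: h.
Qed.

(** The strip integrals include [t = 0], where the definitions say nothing about [phi]. The compact
    set carrying [phi] avoids a neighbourhood of [(0, x)], so [phi] vanishes for small positive
    times and, by continuity, at 0. *)
Lemma test_function_at0 (A : set (R * R)) phi x : (forall t y, 0 < t < 1 -> A (t, y)) -> ~ A (0, x) ->
  test_function A phi -> phi 0 x = 0.
Proof.
move=> A1 A0 [sphi [K [cK KA hK]]].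
have oK : open (~` K) by apply: closed_openC; apply: compact_closed => //; exact: (@norm_hausdorff _ (R * R)%type).
have nK : (~` K) (0, x) by move=> /KA.
have ct : (fun t : R => (t, x)) @ (0 : R) --> ((0 : R), x).
  by apply: (@cvg_pair _ _ _ _ (nbhs (0 : R)) (nbhs x)); [exact: cvg_id|exact: cvg_cst].
have [d /= d0 hd] := ct _ (open_nbhs_nbhs (conj oK nK)).
apply/eqP; rewrite -normr_le0; apply/ler_addgt0Pl => e e0; rewrite addr0.
have cp := @continuous_section_l _ phi x (sphi 0%N).
have /cvgrPdist_lt/(_ e e0)[d' /= d'0 hd'] := cp 0.
pose t := Num.min (Num.min (d / 2) (d' / 2)) (1 / 2).
have t0 : 0 < t by rewrite !lt_min !divr_gt0.
have [td td' t1] : [/\ t <= d / 2, t <= d' / 2 & t <= 1 / 2] by rewrite /t !ge_min !lexx ?orbT.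
have h1 : `|0 - t| < d by rewrite sub0r normrN gtr0_norm//; lra.
have h2 : `|0 - t| < d' by rewrite sub0r normrN gtr0_norm//; lra.
have := hd' t h2; rewrite (hK t x) ?subr0; [exact: ltW|by apply: A1; rewrite t0; lra|exact: hd].
Qed.

Lemma tensor_test_function (A : set (R * R)) (eta k : R -> R) (a b r : R) : smooth1 eta -> smooth1 k ->
  supp_in r k -> (forall t x, a <= t <= b -> A (t, x)) ->
  (forall t x, A (t, x) -> ~ (a <= t <= b) -> eta t = 0) ->
  test_function A (fun t x => eta t * k x).
Proof.
move=> se sk skr hA h0; split; first exact: smooth_tensor.
exists (`[a, b]%classic `*` `[- r, r]%classic); split.
- by apply: compact_setX; exact: segment_compact.
- by move=> [t x] [/=]; rewrite in_itv/= => tab _; exact: hA.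
move=> t x Atx hn; have [tab|tab] := boolP (a <= t <= b); last first.
  by rewrite (h0 t x)// ?mul0r//; exact/negP.
rewrite [k x]skr ?mulr0// ltNge; apply/negP => xr; apply: hn; split; rewrite /= in_itv//=.
by rewrite -ler_norml.
Qed.

Lemma bounded_pairing_measurable (F : R * R -> R) k : measurable_fun setT F -> measurable_fun setT k ->
  measurable_fun setT (fun t => \int[mu]_x (F (t, x) * k x)).
Proof.
move=> mF mk; apply: (@measurable_Rintegral_section _ (fun p : R * R => F p * k p.2)).
by apply: measurable_funM => //; apply: measurableT_comp.
Qed.

Lemma bounded_pairing_locbdd (F : R * R -> R) k r C : measurable_fun setT F -> (forall p, `|F p| <= C) ->
  continuous k -> supp_in r k -> locbdd (fun t => \int[mu]_x (F (t, x) * k x)).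
Proof.
move=> mF hF ck sk.
have [K K0 hK] := locbdd_supp_bounded (continuous_locbdd ck) sk.
have sk' : supp_in `|r| k by apply: supp_inW sk; exact: ler_norm.
apply: (@bounded_locbdd _ _ (C * K * (2 * `|r|))).
  by apply: bounded_pairing_measurable => //; exact: continuous_measurable_fun.
move=> t; apply: supp_integral_le => //.
- apply: locbdd_mul; last exact: continuous_locbdd.
  by apply: (@bounded_locbdd _ _ C) => //; exact: measurable_section.
- exact: supp_in_mull.
- by move=> x; rewrite normrM; apply: ler_pM.
Qed.

Lemma bounded_pairing_integrable (f k : R -> R) r C : measurable_fun setT f -> (forall p, `|f p| <= C) ->
  continuous k -> supp_in r k -> mu.-integrable setT (EFin \o (fun x => f x * k x)).
Proof.
move=> mf hf ck sk; apply: (@supp_integrable _ r); last exact: supp_in_mull.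
by apply: locbdd_mul; [exact: bounded_locbdd hf|exact: continuous_locbdd].
Qed.

Lemma cont_pairing_integrable (f k : R -> R) r : continuous f -> continuous k -> supp_in r k ->
  mu.-integrable setT (EFin \o (fun x => f x * k x)).
Proof.
move=> cf ck sk; apply: (@supp_integrable _ r); last exact: supp_in_mull.
by apply: locbdd_mul; exact: continuous_locbdd.
Qed.

Lemma locbdd_integrable01 f : locbdd f -> mu.-integrable `[0, 1[ (EFin \o f).
Proof.
move=> [mf hf]; apply: integrable01 => //; have [C hC] := hf 1; exists C => t /andP[t0 t1].
by apply: hC; rewrite ger0_norm.
Qed.

Lemma locbdd_add (f g : R -> R) : locbdd f -> locbdd g -> locbdd (fun x => f x + g x).
Proof.
move=> [mf hf] [mg hg]; split; first exact: measurable_funD.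
move=> r; have [C hC] := hf r; have [C' hC'] := hg r; exists (C + C') => x xr.
by apply: le_trans (ler_normD _ _) _; apply: lerD; [exact: hC|exact: hC'].
Qed.

Lemma locbdd_itv (s t : R) f : locbdd f -> mu.-integrable `[s, t[ (EFin \o f).
Proof.
move=> [mf hf]; have [C hC] := hf (`|s| + `|t|).
have hI : mu.-integrable `[s, t] (EFin \o f).
  apply: (@integrable_itv_bounded _ _ _ _ C) => // x /andP[sx xt]; apply: hC.
  rewrite ler_norml; apply/andP; split.
    by have := normrN s; have := normr_ge0 t; have := ler_norm (- s); lra.
  by have := ler_norm t; have := normr_ge0 s; lra.
by apply: integrableS hI => // x /=; rewrite !in_itv/= => /andP[-> /ltW ->].
Qed.

Lemma integral_itv_split (s t u : R) f : locbdd f -> s <= t <= u ->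
  \int[mu]_(x in `[s, u[) f x = \int[mu]_(x in `[s, t[) f x + \int[mu]_(x in `[t, u[) f x.
Proof.
move=> lf /andP[st tu].
have -> : `[s, u[%classic = `[s, t[ `|` `[t, u[ :> set R.
  by rewrite -itv_bndbnd_setU// bnd_simp.
rewrite Rintegral_setU//.
- rewrite -itv_bndbnd_setU ?bnd_simp//; exact: locbdd_itv.
- apply/disj_setPS => x /= []; rewrite !in_itv/= => /andP[_ h1] /andP[h2 _].
  by move: h1; rewrite ltNge h2.
Qed.

Lemma integral_itv_le (s t : R) f C : locbdd f -> s <= t -> (forall x, s <= x < t -> `|f x| <= C) ->
  `|\int[mu]_(x in `[s, t[) f x| <= C * (t - s).
Proof.
move=> lf st hC.
have hi := locbdd_itv s t lf.
apply: le_trans (le_normr_Rintegral _ hi) _ => //.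
have -> : C * (t - s) = \int[mu]_(x in `[s, t[) (C : R).
  by rewrite Rintegral_cst//= lebesgue_measure_itv/= lte_fin; move: st; rewrite le_eqVlt => /predU1P[->|->//]; rewrite ltxx subrr.
apply: le_Rintegral => //.
- exact: integrable_norm hi.
- by apply: locbdd_itv; exact: locbdd_cst.
Qed.

(** Both sides are continuous up to the endpoints; the integral is even Lipschitz in [s], since [B]
    is bounded on [0, 1]. *)
Lemma integral_equation_closed (A B : R -> R) A1 : continuous A -> locbdd B ->
  (forall s, 0 < s < 1 -> A s = A1 + \int[mu]_(t in `[s, 1[) B t) ->
  forall s, 0 <= s <= 1 -> A s = A1 + \int[mu]_(t in `[s, 1[) B t.
Proof.
move=> cA lB h s /andP[s0 s1].
have [C hC] := lB.2 1.
have C0 : 0 <= C by apply: le_trans (hC 0 _); rewrite ?normr0.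
pose F s := \int[mu]_(t in `[s, 1[) B t.
have FL x y : 0 <= x -> x <= y -> y <= 1 -> `|F x - F y| <= C * (y - x).
  move=> x0 xy y1; rewrite /F (@integral_itv_split x y 1)// ?xy// addrK.
  by apply: integral_itv_le => // z /andP[xz zy]; apply: hC; rewrite ger0_norm; lra.
suff : `|A s - (A1 + F s)| <= 0 by rewrite normr_le0 subr_eq0 => /eqP.
apply/ler_addgt0Pl => e e0; rewrite addr0.
have /cvgrPdist_le/(_ (e / 2))/= := cA s.
have -> : 0 < e / 2 by lra.
move=> /(_ isT) [d /= d0 hd].
have [z [z0 z1 zd zC]] : exists z, [/\ 0 < z, z < 1, `|s - z| < d & C * `|s - z| <= e / 2].
  pose q := Num.min (d / 2) (Num.min (1 / 4) (e / 2 / (C + 1))).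
  have q0 : 0 < q by rewrite !lt_min !divr_gt0//; lra.
  have [qd q4 qC] : [/\ q <= d / 2, q <= 1 / 4 & q <= e / 2 / (C + 1)] by rewrite /q !ge_min !lexx !orbT.
  have qC' : C * q <= e / 2.
    move: qC; rewrite ler_pdivlMr; last by lra.
    by move=> qC; nra.
  have [s2|s2] := leP s (1 / 2).
    by exists (s + q); rewrite (_ : s - (s + q) = - q) ?normrN ?(gtr0_norm q0); last ring; split => //; lra.
  by exists (s - q); rewrite (_ : s - (s - q) = q) ?(gtr0_norm q0); last ring; split => //; lra.
have hz := h z; rewrite z0 z1 in hz.
have -> : A s - (A1 + F s) = (A s - A z) + (F z - F s) by rewrite (hz isT) /F; ring.
apply: le_trans (ler_normD _ _) _; rewrite [e]splitr; apply: lerD; first exact: hd.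
apply: le_trans zC; have [sz|sz] := leP s z.
  by rewrite distrC -(distrC z s) (ger0_norm (_ : 0 <= z - s)) ?subr_ge0//; apply: FL => //; lra.
by rewrite (gtr0_norm (_ : 0 < s - z)) ?subr_gt0//; apply: FL => //; lra.
Qed.

(** Products [eta t * k x] are used as test functions: the time factor is removed by the variational
    lemma in the identity for the space derivative, and by smoothed Heaviside functions in the
    equation itself. Continuity of the solution then gives the integral equation at every time of
    [0, 1], not only almost everywhere. *)
Lemma regular_of_weak xi g X G Psi : measurable_fun setT xi -> measurable_fun setT g ->
  (forall t, 0 <= xi t <= X) -> (forall t, 0 <= g t <= G) -> parisi_weak_solution xi g Psi ->
  exists M D, 0 <= M /\ regular_solution xi g M (fun t x => Psi (clamp t) x) D.
Proof.
move=> mxi mg hxi hg [cPsi [D0 [mD0 [M0 hM0] hdx] heq]].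
pose P t x := Psi (clamp t) x.
have cP : continuous (uncurry2 P) by exact: continuous_clamp.
pose M := `|M0|.
have mstrip : measurable (@open_strip R).
  rewrite (_ : @open_strip R = `]0, 1[%classic `*` setT); first by apply: measurableX.
  by apply/seteqP; split => [[t x]|[t x] []] /=; rewrite /open_strip/= in_itv.
pose D1 : R * R -> R := uncurry2 D0 \_ (@open_strip R).
have mD1 : measurable_fun setT D1 by apply/(measurable_restrictT _ mstrip).
have D1E t x : 0 < t < 1 -> D1 (t, x) = D0 t x.
  by move=> t01; rewrite /D1 patchE mem_set.
(* [D0] is only essentially bounded and only measurable on the open strip. Extending it by 0 and
   replacing it by 0 where it exceeds [M] changes it inside the strip on a null set only, hence, for
   almost every [t], at almost no [x]. *)
pose D t x := if `|D1 (t, x)| <= M then D1 (t, x) else 0.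
have mD : measurable_fun setT (uncurry2 D).
  rewrite (_ : uncurry2 D = fun p => if `|D1 p| <= M then D1 p else 0); last by apply/funext => -[].
  apply: measurable_fun_ifT => //; apply: measurable_fun_ler => //.
  exact: measurableT_comp.
have hD t x : `|D t x| <= M by rewrite /D; case: ifPn => // _; rewrite normr0 normr_ge0.
have hslice : {ae mu, forall t, {ae mu, forall x, D t x = D1 (t, x)}}.
  apply: (ae_slice (Q := fun p => D p.1 p.2 = D1 p)); apply: ae_mono hM0 => -[t x] /= h.
  rewrite /D; case: ifPn => //; rewrite -ltNge {1}/D1 patchE.
  case: ifPn => [|_]; last by rewrite normr0 ltNge normr_ge0.
  rewrite inE => /h hle; rewrite /M ltNge (le_trans hle)//; exact: ler_norm.
have sliceE t k eta : {ae mu, forall x, D t x = D1 (t, x)} -> measurable_fun setT k ->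
    \int[mu]_x (D1 (t, x) * (eta * k x)) = \int[mu]_x (D t x * (eta * k x)) /\
    \int[mu]_x (D1 (t, x) ^+ 2 * (eta * k x)) = \int[mu]_x (D t x ^+ 2 * (eta * k x)).
  move=> h mk; have m1 := measurable_section t mD1; have m2 := measurable_section t mD.
  have mek : measurable_fun setT (fun x => eta * k x) by exact: measurable_funM.
  split; apply: ae_eq_Rintegral => //; try exact: measurable_funM.
  - by apply: ae_mono h => x ->.
  - by apply: measurable_funM => //; exact: measurable_funX.
  - by apply: measurable_funM => //; exact: measurable_funX.
  - by apply: ae_mono h => x ->.
have mP : measurable_fun setT (uncurry2 P) by apply: continuous_uncurry_measurable.
have hweak phi : test_function (@half_open_strip R) phi ->
    int_strip (fun t x => - (P t x * dt phi t x) +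
      xi t / 2 * (P t x * dx (dx phi) t x + g t * D t x ^+ 2 * phi t x)) +
    \int[mu]_x (phi 1 x * `|x|) = 0.
  move=> hphi; have hphi0 := heq _ hphi; have hz x : phi 0 x = 0.
    apply: test_function_at0 hphi; last by rewrite /half_open_strip/= ltxx.
    by move=> t y /andP[h1 h2]; rewrite /half_open_strip/= h1 ltW.
  have [sphi [K [cK KA hK]]] := hphi.
  have mphi : measurable_fun setT (uncurry2 phi) by apply: continuous_uncurry_measurable; exact: (sphi 0%N).
  have mdt : measurable_fun setT (uncurry2 (dt phi)).
    by apply: continuous_uncurry_measurable; have [_ _] := sphi 1%N.
  have mdxx : measurable_fun setT (uncurry2 (dx (dx phi))).
    by apply: continuous_uncurry_measurable; have [_ _ _ [_ _ _]] := sphi 2%N.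
  have m1 (f : R -> R) : measurable_fun setT f -> measurable_fun setT (fun p : R * R => f p.1).
    by move=> mf; apply: measurableT_comp.
  pose H (F : R * R -> R) (p : R * R) := - (uncurry2 P p * uncurry2 (dt phi) p) + xi p.1 / 2 *
    (uncurry2 P p * uncurry2 (dx (dx phi)) p + g p.1 * F p ^+ 2 * uncurry2 phi p).
  have mH F : measurable_fun setT F -> measurable_fun setT (H F).
    move=> mF; apply: measurable_funD; first by apply: measurableT_comp => //; exact: measurable_funM.
    apply: measurable_funM; first by apply: measurable_funM => //; exact: m1.
    apply: measurable_funD; first exact: measurable_funM.
    apply: measurable_funM => //; apply: measurable_funM; [exact: m1|exact: measurable_funX].
  suff E : int_strip (fun t x => - (P t x * dt phi t x) +
      xi t / 2 * (P t x * dx (dx phi) t x + g t * D t x ^+ 2 * phi t x)) =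
      int_strip (fun t x => - (Psi t x * dt phi t x) +
      xi t / 2 * (Psi t x * dx (dx phi) t x + g t * D0 t x ^+ 2 * phi t x)) by rewrite E.
  transitivity (\int[mu]_(t in `[0, 1[) \int[mu]_x H D1 (t, x)).
    symmetry; apply: ae_eq_Rintegral => //.
    - by apply: measurable_funTS; apply: measurable_Rintegral_section; exact: mH.
    - by apply: measurable_funTS; apply: (measurable_Rintegral_section (mH _ mD)).
    apply: ae_mono hslice => t ht _; apply: ae_eq_Rintegral => //.
    - by apply: measurable_section; exact: mH.
    - exact: (measurable_section t (mH _ mD)).
    by apply: ae_mono ht => x hx _; rewrite /H /uncurry2/= hx.
  apply: eq_Rintegral => t; rewrite inE/= in_itv/= => /andP[t0 t1].
  apply: eq_Rintegral => x _; rewrite /H /= /uncurry2/= /P clamp_id ?t0 ?ltW//.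
  (* At [t = 0] the functions [D0] and [D1] may differ, but [phi] vanishes there. *)
  have [t_0|t_0] := leP t 0; last by rewrite D1E// t_0.
  by rewrite (_ : t = 0) ?hz ?mulr0//; apply/eqP; rewrite eq_le t_0.
exists M, D; split; first exact: normr_ge0.
split => //.
- move=> k r sk skr.
  have ck := smooth1_continuous sk; have ck1 := smooth1_continuous (smooth1_derive sk).
  have sk1r := supp_in_derive skr sk.
  have mk : measurable_fun setT k by exact: continuous_measurable_fun.
  pose A t := \int[mu]_x (P t x * derive1 k x).
  pose E t := \int[mu]_x (D t x * k x).
  have cA : continuous A by exact: pairing_time_continuous sk1r.
  have lE : locbdd E by apply: (@bounded_pairing_locbdd (uncurry2 D) k r M) => // -[].
  (* Set to 0 outside ]0, 1[, where the test functions [eta] vanish as well, so that the integral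
     over the line is the one over [0, 1[. *)
  pose f t := if 0 < t < 1 then A t + E t else 0.
  have lf : locbdd f.
    split.
      apply: measurable_fun_ifT => //.
        by apply: measurable_and; exact: measurable_fun_ltr.
      by apply: measurable_funD; [exact: continuous_measurable_fun|exact: lE.1].
    move=> q; have [C hC] := (continuous_locbdd cA).2 q; have [C' hC'] := lE.2 q.
    exists (`|C| + `|C'|) => t tq; rewrite /f; case: ifP => _; last by rewrite normr0 addr_ge0.
    apply: le_trans (ler_normD _ _) _; apply: lerD.
      exact: le_trans (hC _ tq) (ler_norm _).
    exact: le_trans (hC' _ tq) (ler_norm _).
  have : {ae mu, forall t, 0 < t < 1 -> f t = 0}.
    apply: fundamental_variations => // eta a b a0 b1 se eta0.
    have htest : test_function (@open_strip R) (fun t x => eta t * k x).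
      apply: (tensor_test_function se sk skr (a := a) (b := b)).
        by move=> t x /andP[h1 h2]; rewrite /open_strip/= (lt_le_trans a0 h1) (le_lt_trans h2 b1).
      by move=> t x _ /negP; exact: eta0.
    have := hdx _ htest; rewrite dx_tensor//.
    have -> : int_strip (fun t x => Psi t x * (eta t * derive1 k x)) = \int[mu]_(t in `[0, 1[) (A t * eta t).
      apply: eq_Rintegral => t; rewrite inE/= in_itv/= => /andP[t0 t1].
      rewrite /A -RintegralZr//; last exact: (cont_pairing_integrable (@continuous_section _ P t cP) ck1 sk1r).
      apply: eq_Rintegral => x _; rewrite /P clamp_id; [ring|by rewrite t0 ltW].
    have -> : int_strip (fun t x => D0 t x * (eta t * k x)) = \int[mu]_(t in `[0, 1[) (E t * eta t).
      transitivity (\int[mu]_(t in `[0, 1[) \int[mu]_x (D1 (t, x) * (eta t * k x))).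
        apply: eq_Rintegral => t; rewrite inE/= in_itv/= => /andP[t0 t1].
        apply: eq_Rintegral => x _; have [t_0|t_0] := leP t 0.
          by rewrite eta0 ?mul0r ?mulr0//; apply/negP => /andP[]; lra.
        by rewrite D1E// t_0.
      apply: ae_eq_Rintegral => //.
      + apply: measurable_funTS; apply: (@measurable_Rintegral_section _ (fun p => D1 p * (eta p.1 * k p.2))).
        apply: measurable_funM => //; apply: measurable_funM; last exact: measurableT_comp.
        by apply: measurableT_comp => //; apply: continuous_measurable_fun; exact: smooth1_continuous.
      + apply: measurable_funTS; apply: measurable_funM; first exact: lE.1.
        by apply: continuous_measurable_fun; exact: smooth1_continuous.
      apply: ae_mono hslice => t ht _; rewrite (sliceE t k (eta t) ht mk).1.
      rewrite /E -RintegralZr//; last first.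
        exact: (bounded_pairing_integrable (measurable_section t mD) (hD t) ck skr).
      by apply: eq_Rintegral => x _; ring.
    move=> h.
    have le : locbdd eta by apply: continuous_locbdd; exact: smooth1_continuous.
    have -> : \int[mu]_t (f t * eta t) = \int[mu]_(t in `[0, 1[) (A t * eta t + E t * eta t).
      rewrite [RHS]Rintegral_mkcond; apply: eq_Rintegral => t _; rewrite patchE /f.
      case: ifPn => [t01|nt]; first by rewrite ifT; [rewrite mulrDl|rewrite inE/= in_itv/= ltW; case/andP: t01].
      case: ifPn => [|_]; last by rewrite mul0r.
      rewrite inE/= in_itv/= => /andP[t0 t1].
      rewrite eta0 ?mulr0 ?addr0//; apply/negP => /andP[h1 h2]; move/negP: nt; apply.
      by rewrite (lt_le_trans a0 h1) (le_lt_trans h2 b1).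
    rewrite RintegralD// ?h ?addNr//; apply: locbdd_integrable01.
      by apply: locbdd_mul => //; exact: continuous_locbdd.
    exact: locbdd_mul.
  apply: ae_mono => t h t01; move: (h t01); rewrite /f t01 => /eqP.
  by rewrite addr_eq0 => /eqP.
move=> k r s sk skr.
have ck := smooth1_continuous sk.
have sk1 := smooth1_derive sk; have sk2 := smooth1_derive sk1.
have skr1 := supp_in_derive skr sk; have skr2 := supp_in_derive skr1 sk1.
have ck2 := smooth1_continuous sk2.
have mk : measurable_fun setT k by exact: continuous_measurable_fun.
pose A t := \int[mu]_x (P t x * k x).
pose U t := \int[mu]_x (P t x * derive1 (derive1 k) x).
pose q t := \int[mu]_x (D t x ^+ 2 * k x).
pose B t := xi t / 2 * (U t + g t * q t).
have cA : continuous A by exact: pairing_time_continuous skr.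
have cU : continuous U by exact: pairing_time_continuous skr2.
have mD2 : measurable_fun setT (fun p => uncurry2 D p ^+ 2) by exact: measurable_funX.
have hD2 t x : `|D t x ^+ 2| <= M ^+ 2 by rewrite normrX lerXn2r// nnegrE normr_ge0.
have lq : locbdd q by apply: (@bounded_pairing_locbdd (fun p => uncurry2 D p ^+ 2) k r (M ^+ 2)) => // -[].
have lxi : locbdd xi by apply: (@bounded_locbdd _ xi X) => // t; have /andP[h1 h2] := hxi t; rewrite ger0_norm.
have lg : locbdd g by apply: (@bounded_locbdd _ g G) => // t; have /andP[h1 h2] := hg t; rewrite ger0_norm.
have lB : locbdd B.
  apply: locbdd_mul; first by apply: locbdd_mul => //; exact: locbdd_cst.
  apply: locbdd_add; first exact: continuous_locbdd.
  exact: locbdd_mul.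
apply: (integral_equation_closed cA lB) => {}s s01.
apply: (integral_of_weak_derivative (continuous_locbdd cA) lB) => //.
move=> eta a a0 se eta0.
have htest : test_function (@half_open_strip R) (fun t x => eta t * k x).
  apply: (tensor_test_function se sk skr (a := a) (b := 1)).
    by move=> t x /andP[h1 h2]; rewrite /half_open_strip/= (lt_le_trans a0 h1).
  move=> t x; rewrite /half_open_strip/= => /andP[_ ht1] hn; apply: eta0.
  by rewrite ltNge; apply/negP => h; apply: hn; rewrite h ht1.
have := hweak _ htest; rewrite dt_tensor// dx_tensor// dx_tensor//.
have -> : \int[mu]_x (eta 1 * k x * `|x|) = eta 1 * \int[mu]_x (`|x| * k x).
  rewrite -RintegralZl//; last by apply: (cont_pairing_integrable _ ck skr) => x; exact: norm_continuous.
  by apply: eq_Rintegral => x _; ring.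
have iPk t : mu.-integrable setT (EFin \o (fun x => P t x * k x)).
  exact: (cont_pairing_integrable (@continuous_section _ P t cP) ck skr).
have iPk2 t : mu.-integrable setT (EFin \o (fun x => P t x * derive1 (derive1 k) x)).
  exact: (cont_pairing_integrable (@continuous_section _ P t cP) ck2 skr2).
have iD2t t : mu.-integrable setT (EFin \o (fun x => D t x ^+ 2 * k x)).
  apply: (@bounded_pairing_integrable (fun x => D t x ^+ 2) k r (M ^+ 2)) => //.
  exact: measurable_section mD2.
suff -> : int_strip (fun t x => - (P t x * (derive1 eta t * k x)) + xi t / 2 *
    (P t x * (eta t * derive1 (derive1 k) x) + g t * D t x ^+ 2 * (eta t * k x))) =
  \int[mu]_(t in `[0, 1[) (- (A t * derive1 eta t) + B t * eta t) by [].
apply: eq_Rintegral => t _.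
transitivity (- derive1 eta t * A t + (xi t / 2 * eta t * U t + xi t / 2 * g t * eta t * q t)); last first.
  by rewrite /B; ring.
have r1 (cc : R) := @Rintegrable_scale _ _ _ mu cc _ _ measurableT (iPk t).
have r2 (cc : R) := @Rintegrable_scale _ _ _ mu cc _ _ measurableT (iPk2 t).
have r3 (cc : R) := @Rintegrable_scale _ _ _ mu cc _ _ measurableT (iD2t t).
rewrite -!RintegralZl// -!RintegralD//; last exact: Rintegrable_add.
by apply: eq_Rintegral => x _; ring.
exact: cA.
Qed.

End RegularSolution.

(** * Mollification of Lipschitz and of bounded functions *)

Section MollifiedLipschitz.
Variable R : realType.
Notation mu := (@lebesgue_measure R).
Implicit Types (f g k F : R -> R) (r L C x y h : R) (j : nat).

Lemma Rintegral_translate F y : continuous F -> \int[mu]_x F (x - y) = \int[mu]_x F x.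
Proof.
move=> cF; rewrite /Rintegral [in LHS]integralE [in RHS]integralE; congr (fine (_ - _)%E).
  have h := @linear_substitution R (fun x => Num.max (F x) 0) 1 (- y) ltr01.
  transitivity (\int[mu]_x (Num.max (F (1 * x + - y)) 0 * 1)%:E)%E.
    by apply: eq_integral => x _; rewrite !funeposE mul1r mulr1 EFin_max.
  rewrite -h; first by apply: eq_integral => x _; rewrite !funeposE EFin_max.
  - by move=> x; apply: continuous_max; [exact: cF|exact: cst_continuous].
  - by move=> x; rewrite le_max lexx orbT.
have h := @linear_substitution R (fun x => Num.max (- F x) 0) 1 (- y) ltr01.
transitivity (\int[mu]_x (Num.max (- F (1 * x + - y)) 0 * 1)%:E)%E.
  by apply: eq_integral => x _; rewrite !funenegE mul1r mulr1 EFin_max.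
rewrite -h; first by apply: eq_integral => x _; rewrite !funenegE EFin_max.
- move=> x; have cN : continuous (fun z => - F z) by move=> z; apply: continuousN; exact: cF.
  exact: (continuous_max (cN x) (@cst_continuous _ _ 0 x)).
- by move=> x; rewrite le_max lexx orbT.
Qed.

Lemma pairingE f k y : continuous f -> continuous k ->
  pairing f k y = \int[mu]_x (f (x + y) * k x).
Proof.
move=> cf ck; rewrite -(@Rintegral_translate (fun x => f (x + y) * k x) y).
  by apply: eq_Rintegral => x _; rewrite subrK.
move=> x; apply: continuousM; last exact: ck.
apply: (@continuous_comp _ _ _ (fun x : R => x + y) f); last exact: cf.
by apply: continuousD; [exact: cvg_id|exact: cst_continuous].
Qed.

Lemma pairing_Lip f k r C L : Lip L f -> continuous k -> supp_in r k -> 0 <= r ->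
  (forall x, `|k x| <= C) -> Lip (L * (C * (2 * r))) (pairing f k).
Proof.
move=> hf ck sk r0 hC y y'.
have cf := Lip_continuous hf.
have ii z : mu.-integrable setT (EFin \o (fun x => f (x + z) * k x)).
  apply: (@supp_integrable _ r); last exact: supp_in_mull.
  by apply: locbdd_mul; [apply: locbdd_translate|]; exact: continuous_locbdd.
rewrite !pairingE// -RintegralB//.
have -> : L * (C * (2 * r)) * `|y - y'| = L * `|y - y'| * C * (2 * r) by ring.
apply: supp_integral_le => //.
- have [m1 h1] : locbdd (fun x => (f (x + y) - f (x + y')) * k x).
    apply: locbdd_mul; last exact: continuous_locbdd.
    have [h2 h3] := locbdd_translate y (continuous_locbdd cf).
    have [h4 h5] := locbdd_translate y' (continuous_locbdd cf).
    split; first exact: measurable_funB.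
    move=> q; have [A hA] := h3 q; have [B hB] := h5 q; exists (A + B) => x xq.
    by apply: le_trans (ler_normB _ _) _; apply: lerD; [exact: hA|exact: hB].
  by under eq_fun do rewrite -mulrBl.
- by move=> x xr; rewrite sk// !mulr0 subrr.
move=> x; rewrite -mulrBl normrM; apply: ler_pM => //.
by apply: le_trans (hf _ _) _; rewrite (_ : x + y - (x + y') = y - y')//; ring.
Qed.

Lemma Lip_derive_bound f L y d : Lip L f -> is_derive y 1 f d -> `|d| <= L.
Proof.
move=> hf hd; have := hd; move=> [] dd <-.
have : (fun h => `|h^-1 *: (f (h *: (1 : R) + y) - f y)|) @ 0^' --> `|'D_1 f y|.
  by apply: cvg_norm; exact: dd.
move=> hc; rewrite -(cvg_lim _ hc)//; apply: limr_le; first by apply/cvg_ex; exists `|'D_1 f y|.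
near=> h.
have h0 : h != 0 by near: h; exact: nbhs_dnbhs_neq.
rewrite normrM normfV ler_pdivrMl ?normr_gt0//.
by apply: le_trans (hf _ _) _; rewrite /GRing.scale/= mulr1 addrK mulrC.
Unshelve. all: by end_near. Qed.

(** Integration by parts: one derivative is moved from [k] to [f]. The bound is uniform in [y]
    although [f] itself may grow. *)
Lemma pairing_derive_bound f k r C L y : Lip L f -> smooth1 k -> supp_in r k -> 0 <= r ->
  (forall x, `|k x| <= C) -> `|pairing f (derive1 k) y| <= L * (C * (2 * r)).
Proof.
move=> hf sk skr r0 hC.
have := Lip_derive_bound (pairing_Lip hf (smooth1_continuous sk) skr r0 hC)
  (pairing_is_derive y (continuous_locbdd (Lip_continuous hf)) sk skr r0).
by rewrite normrN.
Qed.

Lemma pairing_moll_near f L j y : Lip L f -> `|pairing f (moll j) y - f y| <= L * j.+1%:R^-1.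
Proof.
move=> hf; have cf := Lip_continuous hf.
have L0 := Lip_ge0 hf.
have im := @moll_integrable R j y.
have ip := @pairing_integrable R f (moll j) y 1 (continuous_locbdd cf) (@moll_continuous R j) (@moll_supp1 R j).
have -> : pairing f (moll j) y - f y = \int[mu]_x (f x * moll j (x - y) - f y * moll j (x - y)).
  rewrite RintegralB//; last exact: (@Rintegrable_scale _ _ _ mu).
  by rewrite RintegralZl// moll_integral_translate mulr1.
have is1 := @Rintegrable_scale _ _ _ mu (L * j.+1%:R^-1) _ _ measurableT im.
have ii : mu.-integrable setT (EFin \o (fun x => f x * moll j (x - y) - f y * moll j (x - y))).
  by apply: Rintegrable_sub => //; exact: (@Rintegrable_scale _ _ _ mu).
apply: le_trans (le_normr_Rintegral _ ii) _ => //.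
rewrite -[leRHS]mulr1 -[X in _ * X](moll_integral_translate j y) -RintegralZl//.
apply: le_Rintegral => //; first exact: integrable_norm.
move=> x _; rewrite -mulrBl normrM (ger0_norm (moll_ge0 _ _)).
have [h|h] := leP j.+1%:R^-1 `|x - y|; first by rewrite moll_eq0// !mulr0.
rewrite ler_wpM2r ?moll_ge0//; apply: le_trans (hf _ _) _.
by rewrite ler_wpM2l// ltW.
Qed.

(** The difference of the two sides is the variance of [D] under the probability density [moll j]
    centred at [y]. *)
Lemma pairing_moll_jensen (D : R -> R) j y M : measurable_fun setT D -> (forall x, `|D x| <= M) ->
  pairing D (moll j) y ^+ 2 <= pairing (fun x => D x ^+ 2) (moll j) y.
Proof.
move=> mD hD; set p := pairing D _ _.
have lD : locbdd D by exact: bounded_locbdd hD.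
have cm := @moll_continuous R j; have sm := @moll_supp1 R j.
have i0 := @moll_integrable R j y.
have i1 := pairing_integrable y lD cm sm.
have i2 : mu.-integrable setT (EFin \o (fun x => D x ^+ 2 * moll j (x - y))).
  by apply: (@pairing_integrable _ (fun x => D x ^+ 2) (moll j) y 1) => //; under eq_fun do rewrite expr2; exact: locbdd_mul.
have : 0 <= \int[mu]_x ((D x - p) ^+ 2 * moll j (x - y)).
  by apply: Rintegral_ge0 => x _; rewrite mulr_ge0 ?sqr_ge0 ?moll_ge0.
have r1 := @Rintegrable_scale _ _ _ mu (- (2 * p)) _ _ measurableT i1.
have r0 := @Rintegrable_scale _ _ _ mu (p ^+ 2) _ _ measurableT i0.
suff -> : \int[mu]_x ((D x - p) ^+ 2 * moll j (x - y)) =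
    pairing (fun x => D x ^+ 2) (moll j) y + (- (2 * p) * p + p ^+ 2 * 1).
  by move=> h; rewrite -subr_ge0; apply: le_trans h _; rewrite le_eqVlt; apply/orP; left; apply/eqP; ring.
have e1 : - (2 * p) * p = \int[mu]_x (- (2 * p) * (D x * moll j (x - y))) by rewrite RintegralZl.
have e0 : p ^+ 2 * 1 = \int[mu]_x (p ^+ 2 * moll j (x - y)) by rewrite RintegralZl// moll_integral_translate.
rewrite e1 e0 /pairing -RintegralD// -RintegralD//; last exact: Rintegrable_add.
by apply: eq_Rintegral => x _; ring.
Qed.

End MollifiedLipschitz.

(** * One Cole-Hopf step on a function with two derivatives *)

Section ChopTaylor.
Variable R : realType.
Implicit Types (f : R -> R) (m v x y z h L C M : R).

Lemma Lip_taylor1 f f1 f2 C2 x h : (forall y, is_derive y 1 f (f1 y)) ->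
  (forall y, is_derive y 1 f1 (f2 y)) -> (forall y, `|f2 y| <= C2) ->
  `|f (x + h) - f x - h * f1 x| <= C2 * h ^+ 2.
Proof.
move=> d1 d2 hC2.
have C20 : 0 <= C2 by apply: le_trans (hC2 0).
have := @mean_value_bound0 R (fun z => f (x + z) - f x - z * f1 x) (fun z => f1 (x + z) - f1 x) (C2 * `|h|) h.
rewrite addr0 subrr mul0r !subr0 -mulrA -expr2 real_normK ?num_real//; apply.
- move=> z; have hk := d1 (x + z).
  have dxz : is_derive z 1 (fun z : R => x + z) 1 by have := is_deriveD (is_derive_cst x z 1) (is_derive_id z 1); rewrite add0r.
  have := @is_derive1_comp _ f (fun z : R => x + z) z _ _ hk dxz; rewrite mulr1 => hc.
  by apply: is_derive_eq; rewrite /GRing.scale/=; ring.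
- move=> z zh.
  have := @mean_value_bound R f1 f2 C2 x (x + z) (fun y _ => d2 y) (fun y _ => hC2 y).
  rewrite addrAC subrr add0r => /le_trans; apply.
  by rewrite ler_wpM2l.
Qed.

Lemma Lip_taylor2 f f1 f2 C3 x h : (forall y, is_derive y 1 f (f1 y)) ->
  (forall y, is_derive y 1 f1 (f2 y)) -> Lip C3 f2 ->
  `|f (x + h) - f x - h * f1 x - h ^+ 2 / 2 * f2 x| <= C3 * `|h| ^+ 3.
Proof.
move=> d1 d2 hC3.
have C30 := Lip_ge0 hC3.
have b1 z : `|f1 (x + z) - f1 x - z * f2 x| <= C3 * `|z| ^+ 2.
  have := @mean_value_bound0 R (fun z => f1 (x + z) - f1 x - z * f2 x) (fun z => f2 (x + z) - f2 x) (C3 * `|z|) z.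
  rewrite addr0 subrr mul0r !subr0 -mulrA -expr2; apply.
  - move=> y; have hk := d2 (x + y).
    have dxz : is_derive y 1 (fun z : R => x + z) 1 by have := is_deriveD (is_derive_cst x y 1) (is_derive_id y 1); rewrite add0r.
    have := @is_derive1_comp _ f1 (fun z : R => x + z) y _ _ hk dxz; rewrite mulr1 => hc.
    by apply: is_derive_eq; rewrite /GRing.scale/=; ring.
  - move=> y yz; apply: le_trans (hC3 _ _) _; rewrite addrAC subrr add0r.
    by rewrite ler_wpM2l.
have := @mean_value_bound0 R (fun z => f (x + z) - f x - z * f1 x - z ^+ 2 / 2 * f2 x)
  (fun z => f1 (x + z) - f1 x - z * f2 x) (C3 * `|h| ^+ 2) h.
rewrite addr0 subrr !mul0r expr0n/= !mul0r !subr0 (_ : C3 * `|h| ^+ 2 * `|h| = C3 * `|h| ^+ 3); last by ring.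
apply.
- move=> z; have hk := d1 (x + z).
  have dxz : is_derive z 1 (fun z : R => x + z) 1 by have := is_deriveD (is_derive_cst x z 1) (is_derive_id z 1); rewrite add0r.
  have := @is_derive1_comp _ f (fun z : R => x + z) z _ _ hk dxz; rewrite mulr1 => hc.
  by apply: is_derive_eq; rewrite /GRing.scale/=; field.
- move=> z zh; apply: le_trans (b1 z) _.
  by rewrite ler_wpM2l// lerXn2r ?nnegrE.
Qed.

(** The generator is the spatial part of the Parisi equation: to first order the mean of the
    increment is [v / 2] times [f2 x], its second moment is [v * f1 x ^+ 2], and its squared mean is
    negligible. Uniformity in [f] lets the expansion be applied along a whole time interval. *)
Lemma chop_taylor m M C2 C3 v0 : 0 < m -> 0 <= M -> 0 <= C2 -> 0 <= C3 -> 0 <= v0 -> exists2 C, 0 <= C &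
  forall f f1 f2 v x, Lip M f -> (forall y, is_derive y 1 f (f1 y)) ->
    (forall y, is_derive y 1 f1 (f2 y)) -> (forall y, `|f2 y| <= C2) -> Lip C3 f2 -> 0 <= v <= v0 ->
    `|chop m v f x - (f x + v / 2 * (f2 x + m * f1 x ^+ 2))| <= C * (v * Num.sqrt v).
Proof.
move=> m0 M0 C20 C30 v00.
have [C C0 hC] := chop_local m0 M0 v00.
pose w0 := Num.sqrt v0; have w00 : 0 <= w0 by exact: sqrtr_ge0.
(* Third and fourth absolute Gaussian moments, in the form covered by [moderate_pow_expR]. *)
pose K3 := gmean (fun z : R => `|z| ^+ 3 * expR (0 * `|z|)).
pose K4 := gmean (fun z : R => `|z| ^+ 4 * expR (0 * `|z|)).
have K30 : 0 <= K3 by apply: gmean_ge0 => z; rewrite mulr_ge0 ?exprn_ge0 ?expR_ge0.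
have K40 : 0 <= K4 by apply: gmean_ge0 => z; rewrite mulr_ge0 ?exprn_ge0 ?expR_ge0.
exists (C + (C3 * K3 + m / 2 * (C2 * (2 * M * K3 + C2 * w0 * K4) + C2 ^+ 2 * w0))).
  have m20 : 0 <= m / 2 by lra.
  have h1 : 0 <= 2 * M * K3 by rewrite !mulr_ge0.
  have h2 : 0 <= C2 * w0 * K4 by rewrite !mulr_ge0.
  have h3 : 0 <= C2 ^+ 2 * w0 by rewrite mulr_ge0 ?sqr_ge0.
  by apply: addr_ge0 => //; apply: addr_ge0; apply: mulr_ge0 => //; apply: addr_ge0 => //; apply: mulr_ge0 => //; apply: addr_ge0.
move=> f f1 f2 v x fL d1 d2 h2 h3 /andP[v_0 vv0].
pose s := Num.sqrt v; have s0 : 0 <= s by exact: sqrtr_ge0.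
have sw : s <= w0 by exact: ler_wsqrtr.
have vE : v = s ^+ 2 by rewrite sqr_sqrtr.
have f1M : `|f1 x| <= M by exact: Lip_derive_bound (d1 x).
pose D := increment v f x.
have sD : sublinear D by exact: increment_sublinear fL.
have mD := sublinear_moderate sD.
have mD2 := moderate_exp 2 mD.
have mz : moderate (fun z : R => z) by exact: moderate_id.
have mz2 : moderate (fun z : R => z ^+ 2) by exact: moderate_exp.
have ml (a : R) : moderate (fun z : R => a * z) by exact: moderate_scale.
have mq (a : R) : moderate (fun z : R => a * z ^+ 2) by exact: moderate_scale.
have mlq (a b : R) : moderate (fun z : R => a * z + b * z ^+ 2) by exact: moderate_add (ml a) (mq b).
have m3 := @moderate_pow_expR R 3 0; have m4 := @moderate_pow_expR R 4 0.
have e1 (z : R) : expR (0 * `|z|) = 1 by rewrite mul0r expR0.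
have b1 : `|gmean D - v / 2 * f2 x| <= C3 * K3 * (v * s).
  have -> : gmean D - v / 2 * f2 x = gmean (fun z : R => D z - ((s * f1 x) * z + (v / 2 * f2 x) * z ^+ 2)).
    rewrite (gmean_sub mD (mlq _ _)).
    by rewrite (gmean_add (ml _) (mq _)) !gmean_scale// gmean_id gmean_sqr; ring.
  have -> : C3 * K3 * (v * s) = gmean (fun z : R => (C3 * (v * s)) * (`|z| ^+ 3 * expR (0 * `|z|))).
    by rewrite gmean_scale// -/K3; ring.
  apply: gmean_le_norm.
  - exact: moderate_sub (mlq _ _).
  - exact: moderate_scale.
  move=> z; rewrite e1 mulr1.
  have := Lip_taylor2 x (s * z) d1 d2 h3.
  rewrite normrM (ger0_norm s0) /D /increment -/s.
  rewrite (_ : f (x + s * z) - f x - _ - _ = f (x + s * z) - f x - (s * f1 x * z + v / 2 * f2 x * z ^+ 2)); last by rewrite vE; ring.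
  by rewrite (_ : C3 * (s * `|z|) ^+ 3 = C3 * (v * s) * `|z| ^+ 3)//; rewrite vE; ring.
have b2 : `|gmean (fun z => D z ^+ 2) - v * f1 x ^+ 2| <= C2 * (2 * M * K3 + C2 * w0 * K4) * (v * s).
  have -> : gmean (fun z => D z ^+ 2) - v * f1 x ^+ 2 = gmean (fun z : R => D z ^+ 2 - (v * f1 x ^+ 2) * z ^+ 2).
    by rewrite (gmean_sub mD2 (mq _)) gmean_scale// gmean_sqr mulr1.
  have -> : C2 * (2 * M * K3 + C2 * w0 * K4) * (v * s) = gmean (fun z : R =>
      (C2 * (2 * M) * (v * s)) * (`|z| ^+ 3 * expR (0 * `|z|)) + (C2 * (C2 * w0) * (v * s)) * (`|z| ^+ 4 * expR (0 * `|z|))).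
    by rewrite gmean_add; [rewrite !gmean_scale// -/K3 -/K4; ring|exact: moderate_scale..].
  apply: gmean_le_norm.
  - exact: moderate_sub (mq _).
  - by apply: moderate_add; exact: moderate_scale.
  move=> z; rewrite e1 !mulr1.
  have := Lip_taylor1 x (s * z) d1 d2 h2.
  rewrite /D /increment -/s; set E := _ - _ - _ => hE.
  have -> : (f (x + s * z) - f x) ^+ 2 - v * f1 x ^+ 2 * z ^+ 2 = E * (2 * (s * z * f1 x) + E).
    by rewrite /E vE; ring.
  rewrite normrM.
  have n2 : `|2 * (s * z * f1 x) + E| <= 2 * (s * `|z|) * M + C2 * (s * z) ^+ 2.
    apply: le_trans (ler_normD _ _) _; apply: lerD => //.
    rewrite !normrM (ger0_norm s0) (@ger0_norm _ 2)// -[leRHS]mulrA.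
    by rewrite ler_wpM2l// ler_wpM2l// mulr_ge0.
  have -> : C2 * (2 * M) * (v * s) * `|z| ^+ 3 + C2 * (C2 * w0) * (v * s) * `|z| ^+ 4 =
      C2 * (s * z) ^+ 2 * (2 * (s * `|z|) * M + C2 * (s * w0) * z ^+ 2).
    by rewrite -(@real_normK _ z) ?num_real// exprMn -(@real_normK _ z) ?num_real// vE; ring.
  apply: ler_pM => //; apply: le_trans n2 _; rewrite lerD2l exprMn mulrA.
  by rewrite ler_wpM2r ?sqr_ge0// ler_wpM2l// expr2 ler_wpM2l.
(* The linear part of the increment has mean 0, so the mean is O(v) and its square O(v^2). *)
have b3 : gmean D ^+ 2 <= C2 ^+ 2 * w0 * (v * s).
  have h : `|gmean D| <= C2 * v.
    have -> : gmean D = gmean (fun z : R => D z - (s * f1 x) * z).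
      by rewrite (gmean_sub mD (ml _)) gmean_scale// gmean_id mulr0 subr0.
    have -> : C2 * v = gmean (fun z : R => (C2 * v) * z ^+ 2) by rewrite gmean_scale// gmean_sqr mulr1.
    apply: gmean_le_norm; [|exact: moderate_scale|].
      exact: moderate_sub (ml _).
    move=> z; have := Lip_taylor1 x (s * z) d1 d2 h2; rewrite /D /increment -/s.
    rewrite (_ : s * f1 x * z = s * z * f1 x); last by ring.
    by rewrite exprMn -vE mulrA.
  rewrite -(@real_normK _ (gmean D)) ?num_real//.
  apply: (@le_trans _ _ ((C2 * v) ^+ 2)); first by rewrite lerXn2r// nnegrE mulr_ge0.
  rewrite exprMn -mulrA ler_wpM2l ?exprn_ge0// expr2 mulrCA ler_wpM2l//.
  by rewrite vE expr2 ler_wpM2r.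
have := hC f v x fL; rewrite v_0 vv0 => /(_ isT); rewrite -/D -/s.
set A := gmean D in b1 b3 *; set B := gmean _ in b2 *.
move=> hc.
have -> : chop m v f x - (f x + v / 2 * (f2 x + m * f1 x ^+ 2)) =
  (chop m v f x - (f x + A + m / 2 * (B - A ^+ 2))) + ((A - v / 2 * f2 x) + m / 2 * ((B - v * f1 x ^+ 2) - A ^+ 2)) by field.
apply: le_trans (ler_normD _ _) _; rewrite mulrDl; apply: lerD => //.
apply: le_trans (ler_normD _ _) _; rewrite mulrDl; apply: lerD => //.
rewrite normrM (@ger0_norm _ (m / 2)); last by lra.
rewrite -[leRHS]mulrA ler_wpM2l//; first by lra.
apply: le_trans (ler_normB _ _) _; rewrite mulrDl; apply: lerD => //.
by rewrite ger0_norm// sqr_ge0.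
Qed.

End ChopTaylor.

(** * Comparison and exchange of Gaussian integrals *)

Section GaussianFubini.
Variable R : realType.
Notation mu := (@lebesgue_measure R).
Notation phi := (@normal_pdf R 0 1).
Implicit Types (f g w F : R -> R) (a b v x y z B : R).

(** For variance between 1/2 and 1 the normal density is at most twice the standard one: the
    normalisation costs at most 2 and the exponent only gets smaller. One fixed Gaussian weight thus
    controls the errors made at all these times. *)
Lemma heat_le_one F v : moderate F -> continuous F -> (forall x, 0 <= F x) -> 1 / 2 <= v <= 1 ->
  heat v F 0 <= 2 * gmean F.
Proof.
move=> mF cF F0 /andP[v2 v1].
pose s := Num.sqrt v.
have v0 : 0 <= v by lra.
have s2 : 1 / 2 <= s.
  rewrite /s -[leLHS](@ger0_norm _ (1 / 2)); last by lra.
  by rewrite -sqrtr_sqr ler_wsqrtr// expr2; lra.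
have s1 : s <= 1 by rewrite /s -sqrtr1 ler_wsqrtr.
have s0 : 0 < s by lra.
suff h : s * heat v F 0 <= gmean F.
  have : 0 <= heat v F 0 by apply: gmean_ge0.
  by nra.
have mh : moderate (fun z => F (0 + s * z)) by exact: moderate_affine.
rewrite /heat -/s -gmean_scale// -lee_fin !gmeanE//; last exact: moderate_scale.
have c1 : continuous (fun y : R => phi (s^-1 * y)).
  move=> y; apply: (@continuous_comp _ _ _ (fun y : R => s^-1 * y) phi); last exact: continuous_phi.
  by apply: continuousM; [exact: cst_continuous|exact: cvg_id].
have cG : continuous (fun y => F y * phi (s^-1 * y)).
  by move=> y; exact: (continuousM (cF y) (c1 y)).
have := @linear_substitution R (fun y => F y * phi (s^-1 * y)) s 0 s0 cG.
move=> /(_ (fun y => mulr_ge0 (F0 y) (phi_ge0 _))) h.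
rewrite (_ : (\int[mu]_z (s * F (0 + s * z) * phi z)%:E)%E = (\int[mu]_x (F x * phi (s^-1 * x))%:E)%E); last first.
  rewrite h; apply: eq_integral => z _; congr EFin.
  by rewrite addr0 add0r mulKf ?gt_eqF//; ring.
apply: ge0_le_integral => //.
- by move=> x _; rewrite lee_fin mulr_ge0 ?phi_ge0.
- by apply/measurable_EFinP; exact: continuous_measurable_fun.
- apply/measurable_EFinP; apply: continuous_measurable_fun => y; exact: (continuousM (cF y) (@continuous_phi R y)).
move=> x _; rewrite lee_fin ler_wpM2l//.
have h1 : `|x| <= `|s^-1 * x|.
  rewrite normrM normfV (gtr0_norm s0) ler_pdivlMl//.
  by rewrite ler_piMl.
have e (y : R) : phi `|y| = phi y by rewrite !phiE real_normK ?num_real.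
by rewrite -[X in X <= _]e; exact: phi_ge.
Qed.

Lemma gmean_dominated (f_ : nat -> R -> R) f h : (forall n, measurable_fun setT (f_ n)) ->
  measurable_fun setT f -> moderate h -> (forall n z, `|f_ n z| <= h z) ->
  {ae mu, forall z, f_ n z @[n --> \oo] --> f z} ->
  gmean (f_ n) @[n --> \oo] --> gmean f.
Proof.
move=> mf_ mf mh hf hae; rewrite gmean.unlock.
have mp : measurable_fun setT phi by exact: continuous_measurable_fun (@continuous_phi R).
apply: (@dominated_Rintegral _ _ _ mu (fun n z => f_ n z * phi z) _ (fun z => h z * phi z)) => //.
- by move=> n; have := measurable_funM (mf_ n) mp.
- by have := measurable_funM mf mp.
- exact: moderate_integrable.
- by move=> n x _; rewrite normrM (ger0_norm (phi_ge0 _)) ler_wpM2r ?phi_ge0.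
- by apply: ae_mono hae => z hz _; apply: cvgMl.
Qed.

Lemma indic_integrable f a b : locbdd f ->
  mu.-integrable setT (EFin \o (fun z => \1_(`[a, b[%classic) z * f z)).
Proof.
move=> lf.
have -> : EFin \o (fun z => \1_(`[a, b[%classic) z * f z) = (EFin \o f) \_ (`[a, b[%classic).
  by apply/funext => z; rewrite patchE /= indicE; case: (z \in _); rewrite ?mul1r ?mul0r.
exact: (@integrable_mkcond _ (measurableTypeR R) R mu _ (EFin \o f) (measurable_itv `[a, b[)).1 (locbdd_itv a b lf).
Qed.

Lemma gmean_fubini (W : R * R -> R) w a b B : measurable_fun setT W -> (forall p, 0 <= W p <= B) ->
  moderate w -> (forall y, 0 <= w y) -> a <= b ->
  gmean (fun y => w y * \int[mu]_(z in `[a, b[) W (z, y)) =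
  \int[mu]_(z in `[a, b[) gmean (fun y => w y * W (z, y)).
Proof.
move=> mW hW mw w0 ab.
have B0 : 0 <= B by have /andP[h1 h2] := hW 0; exact: le_trans h2.
have lW (y : R) : locbdd (fun z => W (z, y)).
  apply: (@bounded_locbdd _ _ B); first by apply: measurableT_comp => //; exact: measurable_pair2.
  by move=> z; have /andP[h1 h2] := hW (z, y); rewrite ger0_norm.
have mod1 z : moderate (fun y => w y * W (z, y)).
  apply: (@moderate_le _ _ (fun y => B * w y)).
  - by apply: measurable_funM; [exact: mw.1|exact: measurable_section].
  - exact: moderate_scale.
  - by move=> y; have /andP[h1 h2] := hW (z, y); rewrite ger0_norm ?mulr_ge0// mulrC ler_wpM2r.
have mp : measurable_fun setT phi by exact: continuous_measurable_fun (@continuous_phi R).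
have mG : measurable_fun setT (fun z => gmean (fun y => w y * W (z, y))).
  rewrite gmean.unlock; apply: (@measurable_Rintegral_section _ (fun p => w p.2 * W p * phi p.2)).
  have mw2 : measurable_fun setT (fun p : R * R => w p.2) := measurableT_comp mw.1 measurable_snd.
  have mp2 : measurable_fun setT (fun p : R * R => phi p.2) := measurableT_comp mp measurable_snd.
  exact: (measurable_funM (measurable_funM mw2 mW) mp2).
have lG : locbdd (fun z => gmean (fun y => w y * W (z, y))).
  apply: (bounded_locbdd (C := B * gmean w) mG) => z.
  rewrite -(gmean_scale B mw); apply: (gmean_le_norm (mod1 z) (moderate_scale B mw)).
  by move=> y; have /andP[h1 h2] := hW (z, y); rewrite ger0_norm ?mulr_ge0// mulrC ler_wpM2r.
have swapW : measurable_fun setT (fun p : R * R => W (p.2, p.1)).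
  apply: (measurableT_comp mW); apply: (measurable_fun_pair measurable_snd measurable_fst).
pose W1 (p : R * R) := \1_(`[a, b[%classic) p.1 * W p.
have mW1 : measurable_fun setT W1.
  by apply: measurable_funM => //; apply: measurableT_comp => //; exact: measurable_indic.
have W10 p : 0 <= W1 p by rewrite mulr_ge0//; have /andP[] := hW p.
have e1 (F : R -> R) : \int[mu]_(z in `[a, b[) F z = \int[mu]_z (\1_(`[a, b[%classic) z * F z).
  rewrite Rintegral_mkcond; apply: eq_Rintegral => z _; rewrite patchE indicE.
  by case: ifP => _; rewrite ?mul1r ?mul0r.
have mI : measurable_fun setT (fun y => \int[mu]_(z in `[a, b[) W (z, y)).
  have -> : (fun y => \int[mu]_(z in `[a, b[) W (z, y)) = fun y => \int[mu]_z (fun p : R * R => W1 (p.2, p.1)) (y, z).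
    by apply/funext => y; rewrite e1.
  apply: (@measurable_Rintegral_section _ (fun p : R * R => W1 (p.2, p.1))).
  by apply: (measurableT_comp mW1); apply: (measurable_fun_pair measurable_snd measurable_fst).
have I0 y : 0 <= \int[mu]_(z in `[a, b[) W (z, y) by apply: Rintegral_ge0 => z _; have /andP[] := hW (z, y).
have Ib y : \int[mu]_(z in `[a, b[) W (z, y) <= B * (b - a).
  apply: le_trans (ler_norm _) _; apply: integral_itv_le => // z _.
  by have /andP[h1 h2] := hW (z, y); rewrite ger0_norm.
have modI : moderate (fun y => w y * \int[mu]_(z in `[a, b[) W (z, y)).
  apply: moderate_mul => //; apply: (@moderate_bounded _ _ (B * (b - a))) => // y.
  by rewrite ger0_norm.
pose F (p : R * R) : \bar R := (W1 p * (w p.2 * phi p.2))%:E.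
have mF : measurable_fun setT F.
  apply/measurable_EFinP; apply: measurable_funM => //.
  by apply: measurable_funM; apply: measurableT_comp => //; exact: mw.1.
have F0 p : (0 <= F p)%E by rewrite lee_fin mulr_ge0// mulr_ge0 ?phi_ge0.
have fub := @fubini_tonelli _ _ _ _ R mu mu F mF F0.
have lI (y : R) : mu.-integrable setT (EFin \o (fun z => W1 (z, y))).
  exact: indic_integrable (lW y).
apply: EFin_inj; rewrite (gmeanE modI).
have -> : (\int[mu]_y (w y * \int[mu]_(z in `[a, b[) W (z, y) * phi y)%:E)%E = (\int[mu]_y \int[mu]_z F (z, y))%E.
  apply: eq_integral => y _; rewrite e1 /F /=.
  have := @Rintegrable_scale _ _ _ mu (w y * phi y) _ _ measurableT (lI y) => iI.
  rewrite -[LHS]/((w y * \int[mu]_z W1 (z, y) * phi y)%:E).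
  rewrite (_ : w y * _ * phi y = (w y * phi y) * \int[mu]_z W1 (z, y)); last by ring.
  rewrite -(@RintegralZl _ _ _ mu setT _ (w y * phi y) measurableT (lI y)).
  have fin := integrable_fin_num measurableT iI.
  rewrite /Rintegral (fineK fin).
  apply: eq_integral => z _; first [exact: (congr1 EFin (mulrC (w y * phi y) (W1 (z, y)))) |
    exact: (congr1 EFin (mulrC (W1 (z, y)) (w y * phi y)))].
rewrite -fub.
have ez (z : R) : (\int[mu]_y F (z, y) = (\1_(`[a, b[%classic) z * gmean (fun y => w y * W (z, y)))%:E)%E.
  have es := gmeanE (moderate_scale (\1_(`[a, b[%classic) z) (mod1 z)).
  rewrite (gmean_scale _ (mod1 z)) in es; apply: eq_trans (esym es).
  apply: eq_integral => y _; apply: (congr1 EFin); rewrite /F /W1 /=.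
  move: (\1_(`[a, b[%classic) z) (W (z, y)) (w y) (phi y) => c1 c2 c3 c4.
  by ring.
have fin := integrable_fin_num measurableT (indic_integrable a b lG).
rewrite e1 /Rintegral (fineK fin).
by apply: eq_integral => z _; exact: ez.
Qed.

(** The equality case of monotonicity: a strict inequality at one point persists on an interval,
    which has positive Gaussian mass. *)
Lemma gmean_eq_of_le f g : moderate f -> moderate g -> continuous f -> continuous g ->
  (forall z, f z <= g z) -> gmean g <= gmean f -> forall z, g z = f z.
Proof.
move=> mf mg cf cg fg h z; apply/eqP; rewrite eq_le fg andbT leNgt; apply/negP => fz.
have mgf : moderate (fun z => g z - f z) by exact: moderate_sub.
have cgf : continuous (fun z => g z - f z) by move=> y; apply: continuousB; [exact: cg|exact: cf].
pose k := (g z - f z) / 2.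
have k0 : 0 < k by rewrite divr_gt0 ?subr_gt0.
have /cvgrPdist_lt/(_ k k0)[d /= d0 hd] := cgf z.
have := @gmean_ge_interval R (fun z => g z - f z) (z - d / 2) (z + d / 2) k (phi (`|z| + d / 2)) mgf.
rewrite (gmean_sub mg mf) => /(_ (fun y => _)) hh.
have : k * phi (`|z| + d / 2) * (z + d / 2 - (z - d / 2)) <= gmean g - gmean f.
  apply: hh => //; [by move=> y; rewrite subr_ge0|by lra|exact: ltW|exact: phi_ge0| |].
  - move=> y /andP[y1 y2]; have : `|z - y| < d by rewrite ltr_norml; apply/andP; split; lra.
    by move=> /hd /ltr_normlP[h1 h2]; rewrite /k in h1 h2 *; lra.
  - move=> y /andP[y1 y2]; apply: phi_ge; rewrite ler_norml.
    by have := ler_norm z; have := ler_norm (- z); rewrite normrN; move=> h1 h2; apply/andP; split; lra.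
have : 0 < k * phi (`|z| + d / 2) * (z + d / 2 - (z - d / 2)).
  by rewrite !mulr_gt0 ?phi_gt0//; lra.
by lra.
Qed.

End GaussianFubini.

Lemma le_of_natinv (R : realType) (A B K : R) : (forall j, A <= B + K * j.+1%:R^-1) -> A <= B.
Proof.
move=> h; rewrite leNgt; apply/negP => BA.
have K1 : 0 < `|K| + 1 by rewrite ltr_wpDl.
have e0 : 0 < (A - B) / (`|K| + 1) by rewrite divr_gt0 ?subr_gt0.
near \oo => j.
have : j.+1%:R^-1 < (A - B) / (`|K| + 1).
  by near: j; exact: (near_infty_natSinv_lt (PosNum e0)).
have := h j; have : 0 <= j.+1%:R^-1 :> R by rewrite invr_ge0.
rewrite ltr_pdivlMr//; move: (j.+1%:R^-1 : R) => q q0 h1 h2.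
have : K * q <= `|K| * q by rewrite ler_wpM2r// ler_norm.
by lra.
Unshelve. all: by end_near. Qed.

Lemma continuous_scale (R : realType) (f : R -> R) (c : R) : continuous f -> continuous (fun z => c * f z).
Proof. by move=> cf z; apply: cvgMr; exact: cf. Qed.

Lemma continuous_mul (R : realType) (f g : R -> R) : continuous f -> continuous g -> continuous (fun z => f z * g z).
Proof. by move=> cf cg z; apply: cvgM; [exact: cf|exact: cg]. Qed.

(** The variance accumulated between [s] and [t] when [xi] is the squared diffusion coefficient: the
    clock in which a constant level becomes a heat flow. *)
HB.lock Definition vol (R : realType) (xi : R -> R) (s t : R) : R :=
  \int[@lebesgue_measure R]_(z in `[s, t[) xi z.

(** * Cole-Hopf bounds on an interval where gamma is constant *)

Section ColeHopf.
Variable R : realType.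
Notation mu := (@lebesgue_measure R).
Variables (xi g : R -> R) (X G M : R) (P D : R -> R -> R).
Hypothesis mxi : measurable_fun setT xi.
Hypothesis mg : measurable_fun setT g.
Hypothesis hxi : forall t, 0 <= xi t <= X.
Hypothesis hg : forall t, 0 <= g t <= G.
Hypothesis M0 : 0 <= M.
Hypothesis hPD : regular_solution xi g M P D.
Implicit Types (k f : R -> R) (r s t x y a b C L : R) (j : nat).

Let lxi : locbdd xi.
Proof. by apply: (@bounded_locbdd _ xi X) => // t; have /andP[h1 h2] := hxi t; rewrite ger0_norm. Qed.

Let lg : locbdd g.
Proof. by apply: (@bounded_locbdd _ g G) => // t; have /andP[h1 h2] := hg t; rewrite ger0_norm. Qed.

Let X0 : 0 <= X.
Proof. by have /andP[h1 h2] := hxi 0; exact: le_trans h2. Qed.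

Let G0 : 0 <= G.
Proof. by have /andP[h1 h2] := hg 0; exact: le_trans h2. Qed.

Let cP t : continuous (P t).
Proof. exact: continuous_section (rs_continuous hPD). Qed.

Let mD t : measurable_fun setT (D t).
Proof. exact: measurable_section (rs_measurable hPD). Qed.

Let hD := rs_bounded hPD.

Let mD2 : measurable_fun setT (fun p => uncurry2 D p ^+ 2).
Proof. by apply: measurable_funX; exact: rs_measurable hPD. Qed.

Let hD2 t x : `|D t x ^+ 2| <= M ^+ 2.
Proof. by rewrite normrX lerXn2r// nnegrE normr_ge0. Qed.

Lemma derive1_translate k y : smooth1 k -> derive1 (fun x => k (x - y)) = fun x => derive1 k (x - y).
Proof.
move=> sk; apply: is_derive_derive1 => x.
have dl : is_derive x 1 (fun x : R => x - y) 1.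
  by apply: is_derive_eq; rewrite /GRing.scale/=; ring.
by have := @is_derive1_comp _ k (fun x : R => x - y) x _ _ (smooth1_is_derive (x - y) sk) dl; rewrite mulr1.
Qed.

Lemma rs_moll_dx j y : {ae mu, forall t, 0 < t < 1 ->
  - pairing (P t) (derive1 (moll j)) y = pairing (D t) (moll j) y}.
Proof.
have sk := @smooth1_translate R (moll j) y (@moll_smooth R j).
have skr := @supp_translate R 1 (moll j) y (@moll_supp1 R j).
apply: ae_mono (rs_dx hPD sk skr) => t h t01; move: (h t01).
by rewrite derive1_translate; [move=> e; rewrite /pairing e opprK|exact: moll_smooth].
Qed.

Lemma rs_pairing_time k r y s t : smooth1 k -> supp_in r k -> 0 <= s -> s <= t -> t <= 1 ->
  pairing (P s) k y = pairing (P t) k y + \int[mu]_(z in `[s, t[)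
    (xi z / 2 * (pairing (P z) (derive1 (derive1 k)) y + g z * pairing (fun x => D z x ^+ 2) k y)).
Proof.
move=> sk skr s0 st t1.
have sk' := smooth1_translate y sk; have skr' := @supp_translate R _ _ y skr.
have := rs_time hPD sk' skr'.
rewrite derive1_translate// derive1_translate; last exact: smooth1_derive.
move=> h; have := h s; have := h t; rewrite (le_trans s0 st) t1 s0 (le_trans st t1) => /(_ isT) ht /(_ isT) hs.
have skr2 := supp_in_derive (supp_in_derive skr' sk') (smooth1_derive sk').
rewrite derive1_translate// derive1_translate in skr2; last exact: smooth1_derive.
rewrite /pairing hs ht -addrA; congr (_ + _).
rewrite (@integral_itv_split _ s t 1) ?st//; first by rewrite addrC.
apply: locbdd_mul; first by apply: locbdd_mul => //; exact: locbdd_cst.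
apply: locbdd_add.
  apply: continuous_locbdd; apply: (@pairing_time_continuous _ P _ _ (rs_continuous hPD) _ skr2).
  by apply: smooth1_continuous; apply: smooth1_translate; apply: smooth1_derive; exact: smooth1_derive.
apply: locbdd_mul => //.
apply: (@bounded_pairing_locbdd _ (fun p => uncurry2 D p ^+ 2) (fun x => k (x - y)) _ (M ^+ 2) mD2 _ _ skr').
  by case.
by apply: smooth1_continuous.
Qed.

Lemma rs_pairing_continuous k r y : continuous k -> supp_in r k -> continuous (fun t => pairing (P t) k y).
Proof.
move=> ck skr; have skr' := @supp_translate R _ _ y skr.
apply: (pairing_time_continuous (rs_continuous hPD) _ skr') => x.
apply: (@continuous_comp _ _ _ (fun x : R => x - y) k); last exact: ck.
by apply: continuousB; [exact: cvg_id|exact: cst_continuous].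
Qed.

Lemma bounded_pairing_moll (f : R -> R) j y C : measurable_fun setT f -> (forall x, `|f x| <= C) ->
  `|pairing f (moll j) y| <= C.
Proof.
move=> mf hC.
have im := @moll_integrable R j y.
have ip := pairing_integrable y (bounded_locbdd mf hC) (@moll_continuous R j) (@moll_supp1 R j).
apply: le_trans (le_normr_Rintegral _ ip) _ => //.
rewrite -[leRHS]mulr1 -(moll_integral_translate j y) -RintegralZl//.
apply: le_Rintegral => //; [exact: integrable_norm|exact: (@Rintegrable_scale _ _ _ mu)|].
by move=> x _; rewrite normrM (ger0_norm (moll_ge0 _ _)) ler_wpM2r ?moll_ge0.
Qed.

Lemma ae_continuous_le (f : R -> R) C : continuous f -> {ae mu, forall t, 0 < t < 1 -> f t <= C} ->
  forall t, 0 <= t <= 1 -> f t <= C.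
Proof.
move=> cf [A [mA A0 hA]] t t01; rewrite leNgt; apply/negP => h.
have /cvgrPdist_lt/(_ (f t - C))/= := cf t.
rewrite subr_gt0 h => /(_ isT) [d /= d0 hd].
pose e := Num.min (d / 2) (1 / 2).
have e0 : 0 < e by rewrite lt_min; apply/andP; split; lra.
have [ed e2] : e <= d / 2 /\ e <= 1 / 2 by rewrite /e !ge_min !lexx !orbT.
have [a [b [ab hab]]] : exists a b, a < b /\ forall s, a < s < b -> 0 < s < 1 /\ `|t - s| < d.
  move/andP: t01 => [t0 t1]; have [t2|t2] := leP t (1 / 2).
    exists t, (t + e); split; first by lra.
    by move=> s /andP[h1 h2]; split; [apply/andP; split; lra|rewrite distrC ger0_norm; lra].
  exists (t - e), t; split; first by lra.
  by move=> s /andP[h1 h2]; split; [apply/andP; split; lra|rewrite ger0_norm; lra].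
have : (mu `]a, b[%classic <= mu A)%E.
  apply: le_measure; rewrite ?inE// => s /=; rewrite in_itv/= => sab; apply: hA => /= hs.
  have [s01 sd] := hab s sab; have := hs s01; have := hd s sd.
  by move=> h1 h2; have := ler_norm (f t - f s); lra.
by rewrite A0 lebesgue_measure_itv/= lte_fin ab -EFinD lee_fin leNgt subr_gt0 ab.
Qed.

(** The mollified solution has slope at most [M] at almost every time, by the bound on [D]; this
    slope is continuous in time, so the bound holds at every time, and it survives the removal of
    the mollifier. *)
Lemma rs_Lip t : 0 <= t <= 1 -> Lip M (P t).
Proof.
move=> t01.
have hj j : Lip M (pairing (P t) (moll j)).
  have d1 y : `|pairing (P t) (derive1 (moll j)) y| <= M.
    apply: (@ae_continuous_le (fun t => `|pairing (P t) (derive1 (moll j)) y|)) t01.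
      have h := @rs_pairing_continuous (derive1 (moll j)) 1 y (smooth1_continuous (smooth1_derive (@moll_smooth R j)))
        (supp_in_derive (@moll_supp1 R j) (@moll_smooth R j)).
      by move=> z; apply: cvg_norm; exact: h.
    apply: ae_mono (rs_moll_dx j y) => z hz z01; rewrite -normrN hz//.
    exact: bounded_pairing_moll.
  move=> x y; rewrite distrC.
  rewrite (distrC x); apply: (@mean_value_bound R _ (fun z => - pairing (P t) (derive1 (moll j)) z)) => z _.
    by apply: (@pairing_is_derive _ _ _ 1); [exact: continuous_locbdd|exact: moll_smooth|exact: moll_supp1|].
  by rewrite normrN.
have cv y : pairing (P t) (moll j) y @[j --> \oo] --> P t y.
  apply: pairing_moll_cvg; first exact: continuous_locbdd.
  by apply: continuous_at_lebesgue_pt; [exact: continuous_locbdd|exact: cP].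
move=> x y.
have : `|pairing (P t) (moll j) x - pairing (P t) (moll j) y| @[j --> \oo] --> `|P t x - P t y|.
  by apply: cvg_norm; apply: cvgB.
move=> hc; rewrite -(cvg_lim _ hc)//; apply: limr_le; first by apply/cvg_ex; exists `|P t x - P t y|.
by near=> j; exact: hj.
Unshelve. all: by end_near. Qed.

Lemma bounded_pairing_le (f : R -> R) k r y C K : measurable_fun setT f -> (forall x, `|f x| <= K) ->
  continuous k -> supp_in r k -> 0 <= r -> (forall x, `|k x| <= C) ->
  `|pairing f k y| <= K * C * (2 * r).
Proof.
move=> mf hf ck skr r0 hC.
have K0 : 0 <= K by apply: le_trans (hf 0).
have ip := pairing_integrable y (bounded_locbdd mf hf) ck skr.
have cn : continuous (fun x => `|k x|) by move=> x; apply: cvg_norm; exact: ck.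
have sn : supp_in r (fun x => `|k x|) by move=> x xr; rewrite skr// normr0.
have in1 : mu.-integrable setT (EFin \o (fun x => `|k (x - y)|)).
  have := @pairing_integrable R (cst 1) (fun x => `|k x|) y r (locbdd_cst 1) cn sn.
  by apply: eq_integrable => // x _ /=; rewrite mul1r.
apply: le_trans (le_normr_Rintegral _ ip) _ => //.
apply: (@le_trans _ _ (\int[mu]_x (K * `|k (x - y)|))).
  apply: le_Rintegral => //; [exact: integrable_norm|exact: (@Rintegrable_scale _ _ _ mu)|].
  by move=> x _; rewrite normrM ler_wpM2r.
rewrite RintegralZl// (@Rintegral_translate _ (fun x => `|k x|))// -mulrA ler_wpM2l//.
apply: le_trans (ler_norm _) _; apply: supp_integral_le => //; first exact: continuous_locbdd.
by move=> x; rewrite normr_id.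
Qed.

(** The second derivative of [k] is paired with a Lipschitz function, so the integrand of the time
    equation is bounded uniformly in [y], although the solution grows linearly. *)
Lemma rs_pairing_time_Lip k : smooth1 k -> supp_in 1 k -> exists2 C, 0 <= C &
  forall y s t, 0 <= s -> s <= t -> t <= 1 -> `|pairing (P s) k y - pairing (P t) k y| <= C * (t - s).
Proof.
move=> sk skr.
have sk1 := smooth1_derive sk; have sk2 := smooth1_derive sk1.
have skr1 := supp_in_derive skr sk; have skr2 := supp_in_derive skr1 sk1.
have [C C0 hC] := smooth1_supp_bounded sk skr.
have [C1 C10 hC1] := smooth1_supp_bounded sk1 skr1.
pose B := M * (C1 * (2 * 1)) + G * (M ^+ 2 * C * (2 * 1)).
have B0 : 0 <= B by rewrite addr_ge0// !mulr_ge0// sqr_ge0.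
exists (X / 2 * B); first by rewrite mulr_ge0// divr_ge0.
move=> y s t s0 st t1; rewrite (rs_pairing_time y sk skr s0 st t1) addrAC subrr add0r.
have skr2' := @supp_translate R _ _ y skr2.
apply: integral_itv_le => //.
  apply: locbdd_mul; first by apply: locbdd_mul => //; exact: locbdd_cst.
  apply: locbdd_add.
    by apply: continuous_locbdd; apply: (@rs_pairing_continuous _ 1) => //; exact: smooth1_continuous.
  apply: locbdd_mul => //.
  apply: (@bounded_pairing_locbdd _ (fun p => uncurry2 D p ^+ 2) (fun x => k (x - y)) _ (M ^+ 2) mD2 _ _ (@supp_translate R _ _ y skr)).
    by case.
  by apply: smooth1_continuous; exact: smooth1_translate.
move=> z /andP[sz zt]; have /andP[x0 xX] := hxi z; have /andP[g0 gG] := hg z.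
rewrite normrM (@ger0_norm _ (xi z / 2)) ?divr_ge0//.
apply: ler_pM => //; first by rewrite divr_ge0.
  by rewrite ler_wpM2r.
apply: le_trans (ler_normD _ _) _; apply: lerD.
  apply: (@pairing_derive_bound _ _ _ 1) => //.
  by apply: rs_Lip; apply/andP; split; lra.
rewrite normrM (ger0_norm g0); apply: ler_pM => //.
by apply: bounded_pairing_le => //; [exact: measurable_section mD2|exact: smooth1_continuous].
Qed.

Lemma vol_ge0 s t : 0 <= vol xi s t.
Proof. by rewrite vol.unlock; apply: Rintegral_ge0 => z _; have /andP[] := hxi z. Qed.

Lemma vol_same s : vol xi s s = 0.
Proof. by rewrite vol.unlock set_itv_ge ?bnd_simp ?ltxx// Rintegral_set0. Qed.

Lemma vol_le s t : s <= t -> vol xi s t <= X * (t - s).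
Proof.
move=> st; rewrite vol.unlock; apply: le_trans (ler_norm _) _; apply: integral_itv_le => // z _.
by have /andP[z0 zX] := hxi z; rewrite ger0_norm.
Qed.

Lemma vol_add s t w : s <= t -> t <= w -> vol xi s w = vol xi s t + vol xi t w.
Proof. by move=> st tw; rewrite vol.unlock; apply: integral_itv_split => //; rewrite st. Qed.

Lemma vol_scale s t c : c * vol xi s t = \int[mu]_(z in `[s, t[) (xi z * c).
Proof. by rewrite mulrC vol.unlock RintegralZr//; exact: locbdd_itv. Qed.

(** * Two-sided Cole-Hopf bounds on one interval of constancy *)

Section Level.
Variables (m a b : R).
Hypothesis a0 : 0 <= a.
Hypothesis b1 : b <= 1.
Hypothesis m0 : 0 <= m.
Hypothesis gm : forall z, a <= z < b -> g z = m.

(** The mollified solution, followed by its first and second space derivatives (the sign of [u1]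
    comes from [pairing]) and by the mollified square of [D]. At almost every time [u1] is the
    mollified [D], and then [q] minus [u1 ^+ 2] is a variance: the term by which [u] fails to solve
    the Parisi equation. *)
Let u j t y := pairing (P t) (moll j) y.
Let u1 j t y := - pairing (P t) (derive1 (moll j)) y.
Let u2 j t y := pairing (P t) (derive1 (derive1 (moll j))) y.
Let q j t y := pairing (fun x => D t x ^+ 2) (moll j) y.

Let sk j := @moll_smooth R j.
Let sk1 j := smooth1_derive (sk j).
Let sk2 j := smooth1_derive (sk1 j).
Let skr j := @moll_supp1 R j.
Let skr1 j := supp_in_derive (skr j) (sk j).
Let skr2 j := supp_in_derive (skr1 j) (sk1 j).

Lemma rs_moll_derive j t y : is_derive y 1 (u j t) (u1 j t y).
Proof. by apply: (@pairing_is_derive _ _ _ 1) => //; exact: continuous_locbdd. Qed.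

Lemma rs_moll_derive2 j t y : is_derive y 1 (u1 j t) (u2 j t y).
Proof.
have := is_deriveN (@pairing_is_derive R (P t) (derive1 (moll j)) 1 y (continuous_locbdd (@cP t)) (sk1 j) (skr1 j) ler01).
by rewrite opprK.
Qed.

Lemma rs_moll_Lip j t : 0 <= t <= 1 -> Lip M (u j t).
Proof.
move=> t01 x y; have := pairing_Lip (rs_Lip t01) (@moll_continuous R j) (skr j) ler01.
have cj : continuous (P t) by [].
have im := @moll_integrable R j 0.
rewrite /u !pairingE//; try exact: moll_continuous.
have ii z : mu.-integrable setT (EFin \o (fun x => P t (x + z) * moll j x)).
  apply: (@supp_integrable _ 1); last exact: supp_in_mull.
  by apply: locbdd_mul; [apply: locbdd_translate|]; apply: continuous_locbdd => //; exact: moll_continuous.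
move=> _; rewrite -RintegralB//.
have i2 : mu.-integrable setT (EFin \o (fun z => P t (z + x) * moll j z - P t (z + y) * moll j z)).
  exact: Rintegrable_sub.
apply: le_trans (le_normr_Rintegral _ i2) _ => //.
rewrite -[leRHS]mulr1 -(moll_integral_translate j 0) -RintegralZl//.
apply: le_Rintegral => //; [exact: integrable_norm|exact: (@Rintegrable_scale _ _ _ mu)|].
move=> z _; rewrite -mulrBl normrM subr0 (ger0_norm (moll_ge0 _ _)) ler_wpM2r ?moll_ge0//.
by apply: le_trans (rs_Lip t01 _ _) _; rewrite (_ : z + x - (z + y) = x - y)//; ring.
Qed.

Lemma rs_moll_dx_le j t y : 0 <= t <= 1 -> `|u1 j t y| <= M.
Proof. by move=> t01; exact: Lip_derive_bound (rs_moll_Lip j t01) (rs_moll_derive j t y). Qed.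

Lemma rs_moll_dx_continuous j y : continuous (fun t => u1 j t y).
Proof.
move=> t; apply: cvgN; apply: (@rs_pairing_continuous _ 1) => //; exact: smooth1_continuous.
Qed.

Lemma rs_moll_q_locbdd j y : locbdd (fun t => q j t y).
Proof.
apply: (@bounded_pairing_locbdd _ (fun p => uncurry2 D p ^+ 2) (fun x => moll j (x - y)) _ (M ^+ 2) mD2 _ _ (@supp_translate R _ _ y (skr j))).
  by case.
by apply: smooth1_continuous; exact: smooth1_translate.
Qed.

Lemma half_xi_locbdd : locbdd (fun t => xi t / 2).
Proof. by apply: locbdd_mul => //; exact: locbdd_cst. Qed.

Lemma rs_moll_dx_sqr_locbdd j y : locbdd (fun t => u1 j t y * u1 j t y).
Proof. by have l := continuous_locbdd (@rs_moll_dx_continuous j y); exact: (locbdd_mul l l). Qed.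

Lemma rs_loss_locbdd m' j y : locbdd (fun z => xi z / 2 * (m * q j z y - m' * u1 j z y ^+ 2)).
Proof.
apply: (locbdd_mul half_xi_locbdd).
have -> : (fun z => m * q j z y - m' * u1 j z y ^+ 2) = (fun z => m * q j z y + (- m') * (u1 j z y * u1 j z y)).
  by apply/funext => z; rewrite expr2 mulNr.
apply: locbdd_add; first exact: (locbdd_mul (locbdd_cst m) (rs_moll_q_locbdd j y)).
exact: (locbdd_mul (locbdd_cst (- m')) (rs_moll_dx_sqr_locbdd j y)).
Qed.

(** The integral equation gives the exact change of [u], with [u2 + m * q] in the integrand; the
    short-time expansion of the operator has [u2 + m' * u1 ^+ 2] frozen at time [t]. The second
    derivatives cancel up to higher order, leaving only the quadratic discrepancy. The constant may
    depend on [j], as [j] is fixed while the partition is refined. *)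
Lemma level_expansion j m' : 0 < m' -> exists2 C, 0 <= C & forall s t y, a <= s -> s <= t -> t <= b ->
  `|u j s y - chop m' (vol xi s t) (u j t) y - \int[mu]_(z in `[s, t[) (xi z / 2 * (m * q j z y - m' * u1 j z y ^+ 2))|
  <= C * ((t - s) * Num.sqrt (t - s)).
Proof.
move=> m'0.
have [C1 C10 hC1] := smooth1_supp_bounded (sk1 j) (skr1 j).
have [C2 C20 hC2] := smooth1_supp_bounded (sk2 j) (skr2 j).
have [K1 K10 hK1] := rs_pairing_time_Lip (sk1 j) (skr1 j).
have [K2 K20 hK2] := rs_pairing_time_Lip (sk2 j) (skr2 j).
have B10 : 0 <= M * (C1 * (2 * 1)) by rewrite !mulr_ge0.
have B20 : 0 <= M * (C2 * (2 * 1)) by rewrite !mulr_ge0.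
have [CT CT0 hCT] := chop_taylor m'0 M0 B10 B20 X0.
pose B := X / 2 * (K2 + m' * (2 * M * K1)).
have B0 : 0 <= B.
  by apply: mulr_ge0; [rewrite divr_ge0|rewrite addr_ge0// !mulr_ge0// ltW].
exists (CT * (X * Num.sqrt X) + B); first by rewrite addr_ge0// !mulr_ge0// sqrtr_ge0.
move=> s t y as_ st tb.
have s0 : 0 <= s by exact: le_trans as_.
have t1 : t <= 1 by exact: le_trans b1.
have t01 : 0 <= t <= 1 by rewrite (le_trans s0 st).
have ts0 : 0 <= t - s by rewrite subr_ge0.
have ts1 : t - s <= 1 by lra.
set v := vol xi s t.
have v0 : 0 <= v by exact: vol_ge0.
have vX : v <= X * (t - s) by exact: vol_le.
have vX1 : v <= X by apply: le_trans vX _; rewrite ler_piMr.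
have hT : `|chop m' v (u j t) y - (u j t y + v / 2 * (u2 j t y + m' * u1 j t y ^+ 2))| <= CT * (v * Num.sqrt v).
  apply: hCT => //; last by rewrite v0.
  - exact: rs_moll_Lip.
  - exact: rs_moll_derive.
  - exact: rs_moll_derive2.
  - by move=> z; apply: (@pairing_derive_bound _ _ _ 1) => //; exact: rs_Lip.
  - by apply: (pairing_Lip (rs_Lip t01) (smooth1_continuous (sk2 j))).
have hus := rs_pairing_time y (sk j) (skr j) (le_trans a0 as_) st (le_trans tb b1).
rewrite -/(u j s y) -/(u j t y) in hus.
have lu2 : locbdd (fun z => u2 j z y).
  by apply: continuous_locbdd; apply: (@rs_pairing_continuous _ 1) => //; exact: smooth1_continuous.
(* The error of freezing [u2] and [u1] at time [t]; both are Lipschitz in time, so its integral is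
   quadratic in [t - s]. *)
pose E z := xi z / 2 * ((u2 j z y - u2 j t y) + m' * (u1 j z y ^+ 2 - u1 j t y ^+ 2)).
have lE : locbdd E.
  apply: (locbdd_mul half_xi_locbdd).
  have -> : (fun z => (u2 j z y - u2 j t y) + m' * (u1 j z y ^+ 2 - u1 j t y ^+ 2)) =
      (fun z => (u2 j z y + - u2 j t y) + m' * (u1 j z y * u1 j z y + - u1 j t y ^+ 2)).
    by apply/funext => z; rewrite expr2.
  apply: locbdd_add; first by apply: locbdd_add => //; exact: locbdd_cst.
  apply: locbdd_mul; first exact: locbdd_cst.
  exact: (locbdd_add (rs_moll_dx_sqr_locbdd j y) (locbdd_cst _)).
have split_int : \int[mu]_(z in `[s, t[) (xi z / 2 * (u2 j z y + g z * q j z y)) =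
    v / 2 * (u2 j t y + m' * u1 j t y ^+ 2) +
    \int[mu]_(z in `[s, t[) E z + \int[mu]_(z in `[s, t[) (xi z / 2 * (m * q j z y - m' * u1 j z y ^+ 2)).
  have -> : v / 2 * (u2 j t y + m' * u1 j t y ^+ 2) = \int[mu]_(z in `[s, t[) (xi z * (2^-1 * (u2 j t y + m' * u1 j t y ^+ 2))).
    by rewrite -vol_scale /v; ring.
  have l1 : locbdd (fun z => xi z * (2^-1 * (u2 j t y + m' * u1 j t y ^+ 2))) by apply: locbdd_mul => //; exact: locbdd_cst.
  have l3 := rs_loss_locbdd m' j y.
  have := RintegralD (mu := mu) (D := `[s, t[%classic) (measurable_itv _) (locbdd_itv s t l1) (locbdd_itv s t lE) => <-.
  have := RintegralD (mu := mu) (D := `[s, t[%classic) (measurable_itv _) (locbdd_itv s t (locbdd_add l1 lE)) (locbdd_itv s t l3) => <-.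
  by apply: eq_Rintegral => z; rewrite inE/= in_itv/= => /andP[sz zt]; rewrite gm /E; [ring|rewrite (le_trans as_ sz) (lt_le_trans zt tb)].
have EB : `|\int[mu]_(z in `[s, t[) E z| <= B * (t - s) * (t - s).
  apply: integral_itv_le => // z /andP[sz zt].
  have /andP[x0 xX] := hxi z.
  rewrite /E normrM (@ger0_norm _ (xi z / 2)) ?divr_ge0// /B -[leRHS]mulrA.
  apply: ler_pM => //; first by rewrite divr_ge0.
    by rewrite ler_wpM2r.
  have z0 : 0 <= z := le_trans s0 sz.
  have tz : t - z <= t - s by rewrite lerD2l lerN2.
  have d2 : `|u2 j z y - u2 j t y| <= K2 * (t - s).
    by apply: le_trans (hK2 y z t z0 (ltW zt) t1) _; rewrite ler_wpM2l.
  have d1 : `|u1 j z y - u1 j t y| <= K1 * (t - s).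
    by rewrite /u1 -opprD normrN; apply: le_trans (hK1 y z t z0 (ltW zt) t1) _; rewrite ler_wpM2l.
  apply: le_trans (ler_normD _ _) _; rewrite mulrDl; apply: lerD => //.
  rewrite normrM (gtr0_norm m'0) subr_sqr normrM.
  rewrite (_ : m' * _ * (t - s) = m' * (K1 * (t - s) * (2 * M))); last by ring.
  apply: ler_wpM2l; [exact: ltW|apply: ler_pM => //].
  apply: le_trans (ler_normD _ _) _; rewrite mulr2n mulrDl mul1r; apply: lerD; apply: rs_moll_dx_le => //.
  by rewrite z0 (le_trans (ltW zt) t1).
rewrite hus -/(u2 j) split_int.
set I1 := \int[mu]_(z in _) E z in EB *; set I2 := \int[mu]_(z in _) _.
set A := v / 2 * _ in hT *.
have -> : u j t y + (A + I1 + I2) - chop m' v (u j t) y - I2 = I1 - (chop m' v (u j t) y - (u j t y + A)) by ring.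
apply: le_trans (ler_normB _ _) _; rewrite addrC mulrDl; apply: lerD.
  apply: le_trans hT _.
  rewrite -mulrA ler_wpM2l//.
  have -> : X * Num.sqrt X * ((t - s) * Num.sqrt (t - s)) = X * (t - s) * Num.sqrt (X * (t - s)).
    by rewrite sqrtrM//; ring.
  by apply: ler_pM => //; rewrite ?sqrtr_ge0// ler_wsqrtr.
apply: le_trans EB _; rewrite -mulrA ler_wpM2l// ler_wpM2l//.
rewrite -[leLHS](@sqr_sqrtr _ (t - s))// expr2 ler_piMr ?sqrtr_ge0//.
by rewrite -sqrtr1 ler_wsqrtr.
Qed.

Lemma rs_moll_variance_ge0 j y : {ae mu, forall z, 0 < z < 1 -> 0 <= q j z y - u1 j z y ^+ 2}.
Proof.
apply: ae_mono (rs_moll_dx j y) => z hz z01; rewrite /u1 hz// subr_ge0.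
exact: pairing_moll_jensen (mD z) (hD z).
Qed.

(** The integrand splits into [m] times a variance, which has the right sign, and [m' - m] times a
    squared slope, at most [M ^+ 2]. *)
Lemma level_loss_ge j m' y s t : m <= m' -> a <= s -> s <= t -> t <= b ->
  - ((m' - m) / 2 * M ^+ 2 * vol xi s t) <=
  \int[mu]_(z in `[s, t[) (xi z / 2 * (m * q j z y - m' * u1 j z y ^+ 2)).
Proof.
move=> mm' as_ st tb.
rewrite (_ : - _ = - ((m' - m) / 2 * M ^+ 2) * vol xi s t); last by ring.
rewrite vol_scale; apply: ae_le_Rintegral => //.
- by apply: locbdd_itv; apply: (locbdd_mul lxi); exact: locbdd_cst.
- by apply: locbdd_itv; exact: rs_loss_locbdd.
(* Time 0 may belong to the interval, while the almost-everywhere identities concern ]0, 1[ only. *)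
have h0 : {ae mu, forall z : R, z != 0} by apply: (@ae_neq _ 0).
apply: ae_mono (ae_conj (rs_moll_variance_ge0 j y) h0) => z [hz zn0]; rewrite /= in_itv/= => /andP[sz zt].
have z01 : 0 < z < 1.
  by rewrite lt_neqAle eq_sym zn0 (le_trans a0 (le_trans as_ sz)) (lt_le_trans zt (le_trans tb b1)).
have z01' : 0 <= z <= 1 by case/andP: z01 => /ltW -> /ltW ->.
have /andP[x0 xX] := hxi z.
have hq := hz z01.
have hu : u1 j z y ^+ 2 <= M ^+ 2.
  by rewrite -(@real_normK _ (u1 j z y)) ?num_real// lerXn2r ?nnegrE// rs_moll_dx_le.
rewrite (_ : xi z * _ = xi z / 2 * (- (m' - m) * M ^+ 2)); last by field.
apply: ler_wpM2l; first by rewrite divr_ge0.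
have h1 : m * u1 j z y ^+ 2 <= m * q j z y by rewrite ler_wpM2l// -subr_ge0.
have h2 : (m' - m) * u1 j z y ^+ 2 <= (m' - m) * M ^+ 2 by rewrite ler_wpM2l// subr_ge0.
by rewrite mulNr; lra.
Qed.

(** The variance term helps on this side. The solution at time [t], carried back to [a] by the
    operator and corrected for the loss on [a, t[, is monotone in [t] up to errors of order 3/2; the
    mollifier is removed only at the end. *)
Lemma level_lower m' y : 0 < m' -> m <= m' -> a <= b ->
  chop m' (vol xi a b) (P b) y - (m' - m) / 2 * M ^+ 2 * vol xi a b <= P a y.
Proof.
move=> m'0 mm' ab.
have a1 : a <= 1 by exact: le_trans b1.
have b0 : 0 <= b by exact: le_trans ab.
have a01 : 0 <= a <= 1 by rewrite a0.
have b01 : 0 <= b <= 1 by rewrite b0.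
have step j : chop m' (vol xi a b) (u j b) y - (m' - m) / 2 * M ^+ 2 * vol xi a b <= u j a y.
  have [C C0 hC] := level_expansion j m'0.
  pose F t := - (chop m' (vol xi a t) (u j t) y - (m' - m) / 2 * M ^+ 2 * vol xi a t).
  have : F a <= F b.
    apply: (partition_le (C := C) ab ltr01) => s t as_ st tb _.
    have s01 : 0 <= s <= 1 by rewrite (le_trans a0 as_) (le_trans st (le_trans tb b1)).
    have t01 : 0 <= t <= 1 by rewrite (le_trans a0 (le_trans as_ st)) (le_trans tb b1).
    have Ls := rs_moll_Lip j s01; have Lt := rs_moll_Lip j t01.
    rewrite /F (vol_add as_ st) -(@chop_semigroup _ m' M) ?vol_ge0//.
    set e := (m' - m) / 2 * M ^+ 2 * vol xi s t + C * ((t - s) * Num.sqrt (t - s)).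
    have : chop m' (vol xi a s) (chop m' (vol xi s t) (u j t)) y <= chop m' (vol xi a s) (fun z => u j s z + e) y.
      apply: (@chop_le _ m' M M) => //; [exact: chop_Lip|exact: Lip_shift|].
      move=> z; have := hC s t z as_ st tb; have := level_loss_ge j z mm' as_ st tb.
      set I := \int[mu]_(_ in _) _; move=> hI /ler_normlP[hl hr].
      by rewrite /e; lra.
    rewrite (@chop_shift _ m' M)// /e; move: (vol xi s t) => vst; move: (vol xi a s) => vas.
    move: (chop m' vas (u j s) y) (chop m' vas (chop m' vst (u j t)) y) => A B h.
    by lra.
  have -> : F a = - u j a y by rewrite /F (vol_same a) mulr0 subr0 (chop0 _ _ m'0).
  by rewrite /F lerN2.
apply: (@le_of_natinv _ _ _ (2 * M)) => j.
have near_a := pairing_moll_near j y (rs_Lip a01).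
have Lb := rs_moll_Lip j b01.
have : chop m' (vol xi a b) (P b) y <= chop m' (vol xi a b) (fun z => u j b z + M * j.+1%:R^-1) y.
  apply: (@chop_le _ m' M M) => //; [exact: rs_Lip|exact: Lip_shift|].
  by move=> z; have := pairing_moll_near j z (rs_Lip b01); rewrite -/(u j b z); move: (M * j.+1%:R^-1) => e /ler_normlP[h1 h2]; lra.
rewrite (@chop_shift _ m' M)//; move: near_a => /ler_normlP[]; rewrite -/(u j a y).
by have := step j; rewrite -(mulrA 2 M); move: (M * j.+1%:R^-1) => e; lra.
Qed.

(** At level 0 the variance term is absent and the discrepancy, [- m' * u1 ^+ 2], has a sign, so the
    upper bound is as easy as the lower one. *)
Lemma level_upper0 m' y : m = 0 -> 0 < m' -> a <= b -> P a y <= chop m' (vol xi a b) (P b) y.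
Proof.
move=> me m'0 ab.
have a1 : a <= 1 by exact: le_trans b1.
have b0 : 0 <= b by exact: le_trans ab.
have a01 : 0 <= a <= 1 by rewrite a0.
have b01 : 0 <= b <= 1 by rewrite b0.
have step j : u j a y <= chop m' (vol xi a b) (u j b) y.
  have [C C0 hC] := level_expansion j m'0.
  pose F t := chop m' (vol xi a t) (u j t) y.
  have : F a <= F b.
    apply: (partition_le (C := C) ab ltr01) => s t as_ st tb _.
    have s01 : 0 <= s <= 1 by rewrite (le_trans a0 as_) (le_trans st (le_trans tb b1)).
    have t01 : 0 <= t <= 1 by rewrite (le_trans a0 (le_trans as_ st)) (le_trans tb b1).
    have Ls := rs_moll_Lip j s01; have Lt := rs_moll_Lip j t01.
    rewrite /F (vol_add as_ st) -(@chop_semigroup _ m' M) ?vol_ge0//.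
    set e := C * ((t - s) * Num.sqrt (t - s)).
    rewrite -(@chop_shift _ m' M); [|done|exact: chop_Lip].
    apply: (@chop_le _ m' M M) => //; first by apply: Lip_shift; exact: chop_Lip.
    move=> z; have := hC s t z as_ st tb.
    set I := \int[mu]_(_ in _) _.
    have hI : I <= 0.
      rewrite /I -[leRHS](mulr0 (vol xi s t)) mulrC vol_scale.
      apply: le_Rintegral => //; [by apply: locbdd_itv; exact: rs_loss_locbdd|by apply: locbdd_itv; apply: (locbdd_mul lxi); exact: locbdd_cst|].
      move=> w _; rewrite mulr0 me mul0r sub0r mulrN oppr_le0.
      have /andP[x0 _] := hxi w.
      by rewrite mulr_ge0 ?divr_ge0// mulr_ge0 ?sqr_ge0// ltW.
    by move=> /ler_normlP[hl hr]; rewrite /e; lra.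
  have -> : F a = u j a y by rewrite /F (vol_same a) (chop0 _ _ m'0).
  by [].
apply: (@le_of_natinv _ _ _ (2 * M)) => j.
have near_a := pairing_moll_near j y (rs_Lip a01).
have Lb := rs_moll_Lip j b01.
have : chop m' (vol xi a b) (u j b) y <= chop m' (vol xi a b) (fun z => P b z + M * j.+1%:R^-1) y.
  apply: (@chop_le _ m' M M) => //; [by apply: Lip_shift; exact: rs_Lip|].
  by move=> z; have := pairing_moll_near j z (rs_Lip b01); rewrite -/(u j b z); move: (M * j.+1%:R^-1) => e /ler_normlP[h1 h2]; lra.
rewrite (@chop_shift _ m' M)//; last exact: rs_Lip.
move: near_a => /ler_normlP[]; rewrite -/(u j a y).
by have := step j; rewrite -(mulrA 2 M); move: (M * j.+1%:R^-1) => e; lra.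
Qed.

Let p j z y := pairing (D z) (moll j) y.
(** The variance of [D] under the mollifier. It has the wrong sign for the upper bound at positive
    levels and must be shown to vanish as [j] grows. *)
Let W j (w : R * R) := `|q j w.1 w.2 - p j w.1 w.2 ^+ 2|.

Lemma variance_measurable j : measurable_fun setT (W j).
Proof.
have swap (F : R * R -> R) : measurable_fun setT F -> measurable_fun setT (fun w : R * R => F (w.2, w.1)).
  by move=> mF; apply: (measurableT_comp mF); apply: (measurable_fun_pair measurable_snd measurable_fst).
have mF (F : R -> R -> R) C : measurable_fun setT (uncurry2 F) -> (forall t x, `|F t x| <= C) ->
    measurable_fun setT (fun w : R * R => pairing (F w.1) (moll j) w.2).
  move=> mF hF.
  apply: (swap (fun w : R * R => pairing (F w.2) (moll j) w.1)).
  apply: (@caratheodory_measurable _ (fun y z => pairing (F z) (moll j) y)).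
    move=> z; apply: derivable_continuous => y.
    have lF : locbdd (F z) by apply: bounded_locbdd (hF z); exact: measurable_section mF.
    by have [] := pairing_is_derive y lF (sk j) (skr j) ler01.
  move=> y; apply: (@bounded_pairing_measurable _ (uncurry2 F) (fun x => moll j (x - y))) => //.
  by apply: continuous_measurable_fun; apply: smooth1_continuous; exact: smooth1_translate.
apply: measurableT_comp => //; apply: measurable_funB; first exact: (mF (fun t x => D t x ^+ 2) (M ^+ 2)).
by apply: measurable_funX; apply: (mF D M); [exact: rs_measurable hPD|exact: hD].
Qed.

Lemma variance_bounded j w : 0 <= W j w <= M ^+ 2 + M ^+ 2.
Proof.
rewrite normr_ge0/=; apply: le_trans (ler_normB _ _) _; apply: lerD.
  by apply: bounded_pairing_moll => //; exact: measurable_section mD2.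
by rewrite normrX lerXn2r// ?nnegrE//; apply: bounded_pairing_moll.
Qed.

Lemma variance_Lip j : exists2 C, 0 <= C & forall z, Lip C (fun y => W j (z, y)).
Proof.
have [C1 C10 hC1] := smooth1_supp_bounded (sk1 j) (skr1 j).
pose Kp := M * C1 * (2 * 1); pose Kq := M ^+ 2 * C1 * (2 * 1).
have Kp0 : 0 <= Kp by rewrite !mulr_ge0.
have Kq0 : 0 <= Kq by rewrite !mulr_ge0// sqr_ge0.
have pL (F : R -> R) C : measurable_fun setT F -> (forall x, `|F x| <= C) ->
    Lip (C * C1 * (2 * 1)) (pairing F (moll j)).
  move=> mF hF x y; rewrite distrC (distrC x).
  apply: (@mean_value_bound R _ (fun z => - pairing F (derive1 (moll j)) z)) => z _.
    by apply: (@pairing_is_derive _ _ _ 1) => //; exact: bounded_locbdd hF.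
  rewrite normrN; apply: bounded_pairing_le => //; exact: smooth1_continuous.
exists (Kq + 2 * M * Kp); first by rewrite addr_ge0// !mulr_ge0.
move=> z x y; rewrite /W /=.
apply: le_trans (ler_dist_dist _ _) _.
have hq : `|q j z x - q j z y| <= Kq * `|x - y|.
  by apply: pL; [exact: measurable_section mD2|exact: hD2].
have hp : `|p j z x - p j z y| <= Kp * `|x - y| by apply: pL.
have d1 : `|p j z x| <= M by apply: bounded_pairing_moll.
have d2 : `|p j z y| <= M by apply: bounded_pairing_moll.
move: (p j z x) (p j z y) (q j z x) (q j z y) d1 d2 hq hp => p1 p2 q1 q2 d1 d2 hq hp.
rewrite (_ : _ - _ - _ = (q1 - q2) - (p1 - p2) * (p1 + p2)); last by ring.
apply: le_trans (ler_normB _ _) _; rewrite [leRHS]mulrDl; apply: lerD => //.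
rewrite normrM (_ : 2 * M * Kp * _ = Kp * `|x - y| * (M + M)); last by ring.
apply: ler_pM => //; apply: le_trans (ler_normD _ _) _.
exact: lerD.
Qed.

(** At a common Lebesgue point of [D z] and of its square, both mollifications converge and their
    limits cancel. *)
Lemma variance_cvg z : {ae mu, forall y, W j (z, y) @[j --> \oo] --> (0 : R)}.
Proof.
have l1 : locbdd (D z) by exact: bounded_locbdd (hD z).
have l2 : locbdd (fun x => D z x ^+ 2).
  by apply: bounded_locbdd (hD2 z); exact: measurable_section mD2.
have a1 := lebesgue_differentiation (locbdd_locally_integrable l1).
have a2 := lebesgue_differentiation (locbdd_locally_integrable l2).
apply: ae_mono (ae_conj a1 a2) => y [h1 h2].
have c1 := pairing_moll_cvg l1 h1; have c2 := pairing_moll_cvg l2 h2.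
have : `|q j z y - p j z y * p j z y| @[j --> \oo] --> `|D z y ^+ 2 - D z y * D z y|.
  by apply: cvg_norm; apply: cvgB => //; exact: cvgM.
by rewrite -expr2 subrr normr0.
Qed.

Lemma level_dissipation_cvg (w : R -> R) : moderate w -> (forall y, 0 <= w y) -> a <= b ->
  gmean (fun y => w y * \int[mu]_(z in `[a, b[) W j (z, y)) @[j --> \oo] --> (0 : R).
Proof.
move=> mw w0 ab.
have -> : (fun j => gmean (fun y => w y * \int[mu]_(z in `[a, b[) W j (z, y))) =
    fun j => \int[mu]_(z in `[a, b[) gmean (fun y => w y * W j (z, y)).
  apply/funext => j; apply: (gmean_fubini (variance_measurable j) (variance_bounded j) mw w0 ab).
have B0 : 0 <= M ^+ 2 + M ^+ 2 by rewrite addr_ge0 ?sqr_ge0.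
have mod1 j z : moderate (fun y => w y * W j (z, y)).
  apply: moderate_mul => //; apply: (@moderate_bounded _ _ (M ^+ 2 + M ^+ 2)).
    exact: measurable_section (variance_measurable j).
  by move=> y; have /andP[h1 h2] := variance_bounded j (z, y); rewrite ger0_norm.
have modw := moderate_scale (M ^+ 2 + M ^+ 2) mw.
have bd j z y : `|w y * W j (z, y)| <= (M ^+ 2 + M ^+ 2) * w y.
  have /andP[h1 h2] := variance_bounded j (z, y).
  by rewrite ger0_norm ?mulr_ge0// [leRHS]mulrC ler_wpM2l.
rewrite -[X in _ --> X](_ : \int[mu]_(z in `[a, b[) (0 : R) = 0); last by rewrite Rintegral_cst// mul0r.
apply: (@dominated_Rintegral _ _ _ mu (fun j z => gmean (fun y => w y * W j (z, y))) (cst 0) (fun=> gmean (fun y => (M ^+ 2 + M ^+ 2) * w y)) `[a, b[%classic) => //.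
- move=> j; apply: measurable_funTS; rewrite gmean.unlock.
  have mw2 : measurable_fun setT (fun p : R * R => w p.2) := measurableT_comp mw.1 measurable_snd.
  have mp2 : measurable_fun setT (fun p : R * R => normal_pdf 0 1 p.2) :=
    measurableT_comp (continuous_measurable_fun (@continuous_phi R)) measurable_snd.
  apply: (@measurable_Rintegral_section _ (fun p : R * R => w p.2 * W j p * normal_pdf 0 1 p.2)).
  exact: (measurable_funM (measurable_funM mw2 (variance_measurable j)) mp2).
- by apply: locbdd_itv; exact: locbdd_cst.
- by move=> j z _; apply: gmean_le_norm.
apply: aeW => z _; rewrite /cst -[X in _ --> X](@gmean_cst R 0).
apply: (gmean_dominated (f := cst 0)) modw _ _.
- by move=> j; exact: (mod1 j z).1.
- exact: measurable_cst.
- by move=> j y; exact: bd.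
apply: ae_mono (variance_cvg z) => y hy.
have h := cvgM (cvg_cst (w y)) hy; rewrite mulr0 in h; exact: h.
Qed.

(** The error contains the variance and so depends on [y]; unlike a constant, it cannot be pulled
    out of the operator. The tangent line of the exponential moves the estimate to exponentials,
    where the operator is linear and such an error can be integrated. [K] dominates the derivative
    of the exponential at the solution. *)
Lemma level_expansion_exp j C s t y K : 0 < m -> a <= s -> s <= t -> t <= b -> 0 <= C -> m * expR (m * u j s y) <= K ->
  `|u j s y - chop m (vol xi s t) (u j t) y - \int[mu]_(z in `[s, t[) (xi z / 2 * (m * q j z y - m * u1 j z y ^+ 2))| <= C ->
  expR (m * u j s y) <= expR (m * chop m (vol xi s t) (u j t) y) +
    (K * (X / 2 * m) * \int[mu]_(z in `[s, t[) W j (z, y) + K * C).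
Proof.
move=> mp as_ st tb C0 hK; set c := chop _ _ _ _; set I := \int[mu]_(z in _) _; set Q := \int[mu]_(z in _) _.
have lW : locbdd (fun z => W j (z, y)).
  apply: (@bounded_locbdd _ _ (M ^+ 2 + M ^+ 2)); first by apply: measurableT_comp (variance_measurable j) _; exact: measurable_pair2.
  by move=> z; have /andP[h1 h2] := variance_bounded j (z, y); rewrite ger0_norm.
have Q0 : 0 <= Q by apply: Rintegral_ge0 => z _; exact: normr_ge0.
have IQ : I <= X / 2 * m * Q.
  rewrite /I /Q -RintegralZl//; last exact: locbdd_itv.
  apply: ae_le_Rintegral => //; [by apply: locbdd_itv; exact: rs_loss_locbdd| |].
    by apply: locbdd_itv; apply: locbdd_mul => //; exact: locbdd_cst.
  have h0 : {ae mu, forall z : R, z != 0} by apply: (@ae_neq _ 0).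
  apply: ae_mono (ae_conj (rs_moll_dx j y) h0) => z [hz zn0]; rewrite /= in_itv/= => /andP[sz zt].
  have z01 : 0 < z < 1.
    by rewrite lt_neqAle eq_sym zn0 (le_trans a0 (le_trans as_ sz)) (lt_le_trans zt (le_trans tb b1)).
  have /andP[x0 xX] := hxi z.
  rewrite /u1 hz// /W /= -mulrBr mulrA; apply: ler_pM; rewrite ?mulr_ge0 ?divr_ge0//.
  - by rewrite subr_ge0; exact: pairing_moll_jensen (mD z) (hD z).
  - by rewrite ler_wpM2r// ler_wpM2r.
  - exact: ler_norm.
move=> /ler_normlP[_ h].
have h1 : u j s y - c <= X / 2 * m * Q + C by lra.
have S0 : 0 <= X / 2 * m * Q + C by rewrite addr_ge0// !mulr_ge0// divr_ge0.
have h2 : expR (m * u j s y) * (1 + (m * c - m * u j s y)) <= expR (m * c).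
  rewrite (_ : m * c = m * u j s y + (m * c - m * u j s y)); last by ring.
  rewrite expRD addrAC subrr add0r ler_wpM2l ?expR_ge0//; exact: expR_ge1Dx.
have h3 : m * expR (m * u j s y) * (u j s y - c) <= K * (X / 2 * m * Q + C).
  apply: (@le_trans _ _ (m * expR (m * u j s y) * (X / 2 * m * Q + C))).
    by rewrite ler_wpM2l// mulr_ge0 ?expR_ge0.
  by rewrite ler_wpM2r.
move: (expR (m * u j s y)) (expR (m * c)) h2 h3 => e1 e2; move: (u j s y) => us h2 h3.
have : e1 * (1 + (m * c - m * us)) = e1 - m * e1 * (us - c) by ring.
have : K * (X / 2 * m * Q + C) = K * (X / 2 * m) * Q + K * C by ring.
by lra.
Qed.

(** The exponentials are averaged by an additional heat flow of variance 1/2 and evaluated at 0. As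
    the total variance then stays between 1/2 and 1, all errors are controlled by one Gaussian
    weight and vanish with [j]. This compares only two averages, but the pointwise lower bound is
    already known, so the equality case gives equality at every point. *)
Lemma level_upper_small y : 0 < m -> a <= b -> vol xi a b <= 1 / 2 ->
  P a y <= chop m (vol xi a b) (P b) y.
Proof.
move=> mp ab V2.
have a1 : a <= 1 by exact: le_trans b1.
have b0 : 0 <= b by exact: le_trans ab.
have a01 : 0 <= a <= 1 by rewrite a0.
have b01 : 0 <= b <= 1 by rewrite b0.
have [A A0 hA] := continuous_rectangle_bound 0 1 0 (rs_continuous hPD).
(* A linear majorant of every mollified solution, uniform in [j] and in time; it provides the factor
   [K] of the exponential step and hence the fixed weight [w]. *)
pose lin (z : R) := (A + M) + M * `|z|.
have Llin : Lip M lin.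
  move=> x z; rewrite /lin (_ : _ - _ = M * (`|x| - `|z|)); last by ring.
  by rewrite normrM (ger0_norm M0) ler_wpM2l// ler_dist_dist.
have slin := Lip_sublinear Llin; have clin := Lip_continuous Llin.
have mexp f : Lip M f -> moderate (fun z => expR (m * f z)).
  by move=> hf; apply: moderate_expR_sublinear; exact: Lip_sublinear hf.
have cexp f : Lip M f -> continuous (fun z => expR (m * f z)).
  move=> hf z; apply: (@continuous_comp _ _ _ (fun z => m * f z) expR); last exact: continuous_expR.
  exact: (continuous_scale (Lip_continuous hf)).
have u_lin j t z : 0 <= t <= 1 -> u j t z <= lin z.
  move=> t01; have h1 := pairing_moll_near j 0 (rs_Lip t01).
  have h2 := rs_moll_Lip j t01 z 0; have h3 := hA t 0 t01; rewrite normr0 lexx in h3.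
  rewrite subr0 in h2.
  have h4 : M * j.+1%:R^-1 <= M by rewrite ler_piMr// invf_le1// ler1n.
  move: (h3 isT) h2 (le_trans h1 h4); rewrite -/(u j t 0) /lin; move: (u j t z) (u j t 0) (P t 0) (M * `|z|) => c1 c2 c3 c4.
  by move=> /ler_normlP[_ h5] /ler_normlP[_ h6] /ler_normlP[_ h7]; lra.
pose E (z : R) := m * expR (m * lin z).
have mE : moderate E by apply: moderate_scale; exact: moderate_expR_sublinear.
have cE : continuous E.
  exact: continuous_scale (cexp _ Llin).
have E0 z : 0 <= E z by rewrite mulr_ge0 ?expR_ge0.
pose w (z : R) := E z * (X / 2 * m).
have mw : moderate w by rewrite /w; under eq_fun do rewrite mulrC; exact: moderate_scale.
have cw : continuous w by rewrite /w; under eq_fun do rewrite mulrC; exact: continuous_scale.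
have w0 z : 0 <= w z by rewrite !mulr_ge0// divr_ge0.
have lW j z : locbdd (fun t => W j (t, z)).
  apply: (@bounded_locbdd _ _ (M ^+ 2 + M ^+ 2)); first by apply: measurableT_comp (variance_measurable j) _; exact: measurable_pair2.
  by move=> t; have /andP[h1 h2] := variance_bounded j (t, z); rewrite ger0_norm.
have QLip j s t : s <= t -> exists2 C, 0 <= C & Lip C (fun z => \int[mu]_(r in `[s, t[) W j (r, z)).
  move=> st; have [C C0 hC] := variance_Lip j.
  exists (C * (t - s)); first by rewrite mulr_ge0 ?subr_ge0.
  move=> z z'; rewrite -RintegralB//; try exact: locbdd_itv.
  rewrite mulrAC; apply: integral_itv_le => //; last by move=> r _; exact: hC.
  have -> : (fun x => W j (x, z) - W j (x, z')) = (fun x => W j (x, z) + (-1) * W j (x, z')).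
    by apply/funext => x; rewrite mulN1r.
  by apply: locbdd_add => //; apply: locbdd_mul => //; exact: locbdd_cst.
have Q0 j s t z : 0 <= \int[mu]_(r in `[s, t[) W j (r, z) by apply: Rintegral_ge0 => r _; exact: normr_ge0.
have mwQ j s t : s <= t -> moderate (fun z => w z * \int[mu]_(r in `[s, t[) W j (r, z)).
  move=> st; have [C C0 hC] := QLip j s t st.
  by apply: moderate_mul => //; apply: sublinear_moderate; exact: Lip_sublinear hC.
have step j : heat (1 / 2) (fun z => expR (m * u j a z)) 0 <=
    heat (1 / 2 + vol xi a b) (fun z => expR (m * u j b z)) 0 +
    2 * gmean (fun z => w z * \int[mu]_(r in `[a, b[) W j (r, z)).
  have [C C0 hC] := level_expansion j mp.
  (* The error terms telescope: what is spent on [a, t[ is added to the average at time [t], and the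
     total is subtracted, so that [F a <= F b] is the claim. *)
  pose F t := heat (1 / 2 + vol xi a t) (fun z => expR (m * u j t z)) 0 -
    2 * gmean (fun z => w z * \int[mu]_(r in `[a, b[) W j (r, z)) +
    2 * gmean (fun z => w z * \int[mu]_(r in `[a, t[) W j (r, z)).
  have : F a <= F b.
    apply: (partition_le (C := 2 * C * gmean E) ab ltr01) => s t as_ st tb _.
    have s01 : 0 <= s <= 1 by rewrite (le_trans a0 as_) (le_trans st (le_trans tb b1)).
    have t01 : 0 <= t <= 1 by rewrite (le_trans a0 (le_trans as_ st)) (le_trans tb b1).
    have Ls := rs_moll_Lip j s01; have Lt := rs_moll_Lip j t01.
    set e := C * ((t - s) * Num.sqrt (t - s)).
    have e0 : 0 <= e by rewrite mulr_ge0// mulr_ge0 ?subr_ge0 ?sqrtr_ge0.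
    set Vs := 1 / 2 + vol xi a s.
    have Vs0 : 0 <= vol xi a s by exact: vol_ge0.
    have Vs1 : 1 / 2 <= Vs <= 1.
      have h : vol xi a s <= vol xi a b by rewrite (vol_add as_ (le_trans st tb)) lerDl vol_ge0.
      rewrite /Vs lerDl Vs0/=; apply: le_trans (_ : 1 / 2 + 1 / 2 <= _); last by rewrite -splitr.
      by rewrite lerD2l (le_trans h).
    set v := vol xi s t.
    have v0 : 0 <= v by exact: vol_ge0.
    pose T z := w z * \int[mu]_(r in `[s, t[) W j (r, z) + E z * e.
    have mT : moderate T.
      apply: moderate_add; first exact: mwQ.
      by under eq_fun do rewrite mulrC; exact: moderate_scale.
    have cT : continuous T.
      have [CQ CQ0 hCQ] := QLip j s t st.
      have cEe : continuous (fun z => E z * e) by under eq_fun do rewrite mulrC; exact: continuous_scale.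
      by move=> z; apply: cvgD; [exact: (continuous_mul cw (Lip_continuous hCQ))|exact: cEe].
    have T0 z : 0 <= T z by exact: (addr_ge0 (mulr_ge0 (w0 z) (Q0 j s t z)) (mulr_ge0 (E0 z) e0)).
    have mt := mexp _ Lt; have ms := mexp _ Ls.
    have mh : moderate (heat v (fun z => expR (m * u j t z))).
      exact: (moderate_heat v mt (cexp _ Lt) (fun z => expR_ge0 _)).
    have H1 z : expR (m * u j s z) <= heat v (fun z => expR (m * u j t z)) z + T z.
      rewrite -(@expR_chop _ m M)//.
      apply: (level_expansion_exp (C := e)) => //; last exact: hC.
      by rewrite /E ler_wpM2l// ler_expR ler_wpM2l// u_lin.
    have H2 : heat Vs (fun z => expR (m * u j s z)) 0 <=
        heat Vs (heat v (fun z => expR (m * u j t z))) 0 + heat Vs T 0.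
      rewrite /heat -gmean_add; [|exact: moderate_affine mh|exact: moderate_affine].
      apply: gmean_le; [exact: moderate_affine ms|by apply: moderate_add; [exact: moderate_affine mh|exact: moderate_affine]|].
      by move=> z; exact: H1.
    have Vsge0 : 0 <= Vs by rewrite /Vs addr_ge0// divr_ge0.
    rewrite (heat_semigroup 0 mt (cexp _ Lt) (fun z => expR_ge0 _) Vsge0 v0) in H2.
    have H4 := heat_le_one mT cT T0 Vs1.
    have gT : gmean T = gmean (fun z => w z * \int[mu]_(r in `[s, t[) W j (r, z)) + e * gmean E.
      have mEe : moderate (fun z => E z * e) by under eq_fun do rewrite mulrC; exact: moderate_scale.
      rewrite /T (gmean_add (mwQ j s t st) mEe) -gmean_scale//; congr (_ + gmean _).
      by apply/funext => z; rewrite mulrC.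
    have gQ : gmean (fun z => w z * \int[mu]_(r in `[a, t[) W j (r, z)) =
        gmean (fun z => w z * \int[mu]_(r in `[a, s[) W j (r, z)) + gmean (fun z => w z * \int[mu]_(r in `[s, t[) W j (r, z)).
      rewrite -(gmean_add (mwQ j a s as_) (mwQ j s t st)); congr gmean; apply/funext => z.
      by rewrite -mulrDr (@integral_itv_split _ a s t)// as_.
    rewrite /F gQ (vol_add as_ st) addrA -/Vs -/v.
    rewrite gT in H4.
    rewrite (_ : 2 * C * gmean E * _ = 2 * (e * gmean E)); last by rewrite /e; ring.
    move: (e * gmean E) (gmean _) (gmean _) (gmean _) (heat Vs T 0) (heat Vs _ 0) (heat (Vs + v) _ 0) H2 H4 => c1 c2 c3 c4 c5 c6 c7 H2 H4.
    by lra.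
  have i0 : gmean (fun z => w z * \int[mu]_(r in `[a, a[) W j (r, z)) = 0.
    rewrite (_ : (fun z => _) = cst 0) ?gmean_cst//; apply/funext => z.
    by rewrite set_itv_ge ?bnd_simp ?ltxx// Rintegral_set0 mulr0.
  rewrite /F i0 (vol_same a) addr0.
  by move: (gmean _) (heat _ _ 0) (heat _ _ 0) => c1 c2 c3; lra.
have La := rs_Lip a01; have Lb := rs_Lip b01.
have lim : heat (1 / 2) (fun z => expR (m * P a z)) 0 <= heat (1 / 2 + vol xi a b) (fun z => expR (m * P b z)) 0.
  set A1 := heat (1 / 2) _ 0; set B1 := heat _ _ 0.
  pose c j : R := expR (m * (M * j.+1%:R^-1)) * (expR (m * (M * j.+1%:R^-1)) * B1 +
    2 * gmean (fun z => w z * \int[mu]_(r in `[a, b[) W j (r, z))).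
  have cc : c j @[j --> \oo] --> B1.
    have e1 : expR (m * (M * j.+1%:R^-1)) @[j --> \oo] --> (1 : R).
      rewrite -[X in _ --> X]expR0 -[X in expR X](mulr0 m) -[X in m * X](mulr0 M).
      apply: continuous_cvg; first exact: continuous_expR.
      by apply: cvgMr; apply: cvgMr; exact: cvg_harmonic.
    rewrite -[X in _ --> X]mul1r; apply: cvgM => //.
    rewrite -[X in _ --> X]addr0; apply: cvgD.
      by rewrite -[X in _ --> X]mul1r; apply: cvgMl.
    by rewrite -[X in _ --> X](mulr0 2); apply: cvgMr; exact: level_dissipation_cvg.
  have hc j : A1 <= c j.
    set e := M * j.+1%:R^-1.
    have scale f f' v : Lip M f -> Lip M f' -> (forall z, f z <= f' z + e) ->
        heat v (fun z => expR (m * f z)) 0 <= expR (m * e) * heat v (fun z => expR (m * f' z)) 0.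
      move=> Lf Lf' ff'; have mf := mexp _ Lf; have mf' := mexp _ Lf'.
      rewrite /heat -gmean_scale; last exact: moderate_affine mf'.
      apply: gmean_le; [exact: moderate_affine mf|apply: moderate_scale; exact: moderate_affine mf'|].
      by move=> z; rewrite -expRD -mulrDr ler_expR; apply: ler_wpM2l => //; rewrite [leRHS]addrC; exact: ff'.
    apply: (@le_trans _ _ (expR (m * e) * heat (1 / 2) (fun z => expR (m * u j a z)) 0)).
      apply: scale => //; first exact: rs_moll_Lip.
      by move=> z; have := pairing_moll_near j z La; rewrite -/(u j a z) -/e => /ler_normlP[h1 h2]; lra.
    rewrite /c -/e ler_wpM2l ?expR_ge0//; apply: le_trans (step j) _.
    rewrite lerD2r; apply: scale => //; first exact: rs_moll_Lip.
    by move=> z; have := pairing_moll_near j z Lb; rewrite -/(u j b z) -/e => /ler_normlP[h1 h2]; lra.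
  rewrite -(cvg_lim _ cc)//; apply: limr_ge; first by apply/cvg_ex; exists B1.
  by near=> j; exact: hc.
have V0 : 0 <= vol xi a b by exact: vol_ge0.
have LcV : Lip M (chop m (vol xi a b) (P b)) by exact: chop_Lip.
have hE : heat (vol xi a b) (fun z => expR (m * P b z)) = fun z => expR (m * chop m (vol xi a b) (P b) z).
  by apply/funext => z; rewrite (@expR_chop _ m M).
have half0 : 0 <= 1 / 2 :> R by rewrite divr_ge0.
rewrite -(heat_semigroup 0 (mexp _ Lb) (cexp _ Lb) (fun z => expR_ge0 _) half0 V0) hE in lim.
pose s2 := Num.sqrt (1 / 2 : R).
have s20 : 0 < s2 by rewrite sqrtr_gt0; lra.
have caff f : continuous f -> continuous (fun z => f (0 + s2 * z)).
  move=> cf z; apply: (@continuous_comp _ _ _ (fun z : R => 0 + s2 * z) f); last exact: cf.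
  by apply: cvgD; [exact: cvg_cst|apply: cvgMr; exact: cvg_id].
(* The lower bound at [m' = m], where there is no loss. *)
have low z : expR (m * chop m (vol xi a b) (P b) z) <= expR (m * P a z).
  have := level_lower z mp (lexx m) ab; rewrite subrr !mul0r subr0 => h.
  by rewrite ler_expR ler_wpM2l.
have mch := mexp _ LcV; have mPa := mexp _ La.
have := gmean_eq_of_le (moderate_affine 0 s2 mch) (moderate_affine 0 s2 mPa)
  (caff _ (cexp _ LcV)) (caff _ (cexp _ La)) (fun z => low _) lim (s2^-1 * y).
rewrite add0r mulrA mulfV ?gt_eqF// mul1r => /expR_inj h.
have mn0 : m != 0 by rewrite gt_eqF.
by rewrite (mulfI mn0 h).
Unshelve. all: by end_near. Qed.

End Level.

(** The restriction on the variance is lifted by cutting the interval into short pieces, and [m] is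
    then raised to [m'] by monotonicity. *)
Lemma level_upper m a b m' y : 0 <= a -> a <= b -> b <= 1 -> 0 <= m -> (forall z, a <= z < b -> g z = m) ->
  0 < m' -> m <= m' -> P a y <= chop m' (vol xi a b) (P b) y.
Proof.
move=> a0 ab b1 m0 gm m'0 mm'.
have [me|mn0] := eqVneq m 0; first by apply: (@level_upper0 m a b).
have mp : 0 < m by rewrite lt_neqAle eq_sym mn0.
have b01 : 0 <= b <= 1 by rewrite (le_trans a0 ab).
apply: (@le_trans _ _ (chop m (vol xi a b) (P b) y)); last first.
  by apply: (@chop_mono _ m m' M) => //; exact: rs_Lip.
pose F t := chop m (vol xi a t) (P t) y.
have X1 : 0 < 2 * X + 1 by apply: ltr_wpDl; rewrite ?mulr_ge0.
(* A piece of this length has variance at most [X / (2 * X + 1)], hence at most 1/2. *)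
have d0 : 0 < (2 * X + 1)^-1 by rewrite invr_gt0.
suff : F a <= F b by rewrite /F (vol_same a) (chop0 _ _ mp).
apply: (partition_le (C := 0) ab d0) => s t as_ st tb tsd; rewrite mul0r addr0.
have s0 : 0 <= s := le_trans a0 as_.
have t1 : t <= 1 := le_trans tb b1.
have s01 : 0 <= s <= 1 by rewrite s0 (le_trans st t1).
have t01 : 0 <= t <= 1 by rewrite t1 (le_trans s0 st).
rewrite /F (vol_add as_ st) -(@chop_semigroup _ m M) ?vol_ge0//; last exact: rs_Lip.
apply: (@chop_le _ m M M) => //; [exact: rs_Lip|by apply: chop_Lip => //; exact: rs_Lip|].
move=> z; apply: (@level_upper_small m s t) => //.
  by move=> w /andP[sw wt]; apply: gm; rewrite (le_trans as_ sw) (lt_le_trans wt tb).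
apply: le_trans (vol_le st) _.
have : X * (t - s) <= X * (2 * X + 1)^-1 by rewrite ler_wpM2l.
have : X * (2 * X + 1)^-1 * 2 <= 1.
  by rewrite mulrAC ler_pdivrMr// mul1r mulrC; lra.
by move: (X * (t - s)) (X * _^-1) => c1 c2; lra.
Qed.

End ColeHopf.

(** * Solutions for piecewise constant gamma and their perturbation *)

Section LevelInduction.
Variable R : realType.
Implicit Types (g : R -> R) (Q : R -> Prop) (s t u m T a b : R).

Definition constant_on g a b m := forall z, a <= z < b -> g z = m.

(** The form in which finite support enters: one-sided constancy at every point, on the left up to
    and including [t = 1], on the right including the point itself by right continuity. *)
Definition locally_constant g :=
  (forall t, 0 < t <= 1 -> exists s m, [/\ 0 <= s, s < t, 0 <= m & constant_on g s t m]) /\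
  (forall t, 0 <= t < 1 -> exists u m, [/\ t < u, u <= 1, 0 <= m & constant_on g t u m]).

Lemma constant_onS g a b m a' b' : a <= a' -> b' <= b -> constant_on g a b m -> constant_on g a' b' m.
Proof. by move=> aa bb h z /andP[h1 h2]; apply: h; rewrite (le_trans aa h1) (lt_le_trans h2 bb). Qed.

(* Backward induction through the finitely many levels of [g], without choosing a
   subdivision: the infimum of the good times is reached by the right constancy and
   passed by the left one. *)
Lemma level_induction g Q T : locally_constant g -> 0 <= T <= 1 ->
  (forall a b m, 0 <= a -> a < b -> b <= T -> 0 <= m -> constant_on g a b m -> Q b -> Q a) ->
  Q T -> forall t, 0 <= t <= T -> Q t.
Proof.
move=> [hl hr] /andP[T0 T1] step QT.
pose A : set R := [set t | 0 <= t <= T /\ forall r, t <= r <= T -> Q r].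
have AT : A T.
  split; first by rewrite T0 lexx.
  by move=> r /andP[h1 h2]; have -> : r = T by apply/eqP; rewrite eq_le h1 h2.
have A0 : A !=set0 by exists T.
have lA : lbound A 0 by move=> t [/andP[]].
have hA : has_inf A by split => //; exists 0.
pose i := inf A.
have i0 : 0 <= i by apply: lb_le_inf.
have iT : i <= T by apply: ge_inf => //; exists 0.
have up t : i < t -> t <= T -> Q t.
  move=> it tT; have it0 : 0 < t - i by rewrite subr_gt0.
  have [e [e1 e2] et] := inf_adherent it0 hA; rewrite -/i addrC subrK in et.
  by apply: e2; rewrite (ltW et).
have Qi : Q i.
  have [-> //|iT'] := eqVneq i T.
  have iT2 : i < T by rewrite lt_neqAle iT' iT.
  have [u [m [iu u1 m0 hc]]] : exists u m, [/\ i < u, u <= 1, 0 <= m & constant_on g i u m].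
    by apply: hr; rewrite i0 (lt_le_trans iT2 T1).
  have ib : i < Num.min u T by rewrite lt_min iu.
  have bT : Num.min u T <= T by rewrite ge_min lexx orbT.
  apply: (step i (Num.min u T) m) => //; last exact: up.
  by apply: constant_onS hc => //; rewrite ge_min lexx.
have ie : i = 0.
  apply/eqP; rewrite eq_le i0 andbT leNgt; apply/negP => ip.
  have [s [m [s0 si m0 hc]]] : exists s m, [/\ 0 <= s, s < i, 0 <= m & constant_on g s i m].
    by apply: hl; rewrite ip (le_trans iT T1).
  have : i <= s.
    apply: ge_inf; first by exists 0.
    split; first by rewrite s0 (le_trans (ltW si) iT).
    move=> r /andP[sr rT]; have [ri|ir] := ltP r i.
      by apply: (step r i m) => //; [exact: le_trans sr|exact: constant_onS hc].
    by have [->//|ri] := eqVneq r i; apply: up => //; rewrite lt_neqAle eq_sym ri.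
  by rewrite leNgt si.
move=> t /andP[t0 tT]; have [te|tn] := eqVneq t i; first by rewrite te.
by apply: up => //; rewrite lt_neqAle eq_sym tn ie.
Qed.

End LevelInduction.

(** * Solutions over all levels, and the effect of a terminal perturbation *)

Section LevelSolution.
Variable R : realType.
Notation mu := (@lebesgue_measure R).
Variables (xi : R -> R) (X : R).
Hypothesis mxi : measurable_fun setT xi.
Hypothesis hxi : forall t, 0 <= xi t <= X.
Implicit Types (g : R -> R) (P D : R -> R -> R) (s t m x y T a b d th L K G M : R).

(* The only features of a Parisi solution used in the perturbation argument.  Where
   [gamma = m] the operator [chop m'] is a supersolution for [m' > m] and loses only
   O(m' - m), which makes sense of [m = 0] without a separate heat equation. *)
Record level_solution g P := LevelSolution {
  ls_continuous : continuous (uncurry2 P);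
  ls_Lip : forall t, 0 <= t <= 1 -> Lip 1 (P t);
  ls_midconvex : forall t, 0 <= t <= 1 -> midconvex (P t);
  ls_one : P 1 = fun x => `|x|;
  ls_upper : forall m a b m' y, 0 <= a -> a <= b -> b <= 1 -> 0 <= m -> constant_on g a b m ->
    0 < m' -> m <= m' -> P a y <= chop m' (vol xi a b) (P b) y;
  ls_lower : forall m a b m' y, 0 <= a -> a <= b -> b <= 1 -> 0 <= m -> constant_on g a b m ->
    0 < m' -> m <= m' -> chop m' (vol xi a b) (P b) y - (m' - m) / 2 * vol xi a b <= P a y }.

(** The Lipschitz constant improves from the unspecified [M] to 1: the terminal value has constant 1
    and is convex, the operator preserves both, and they pass backward through the levels. Within a
    level the losses, which carry [M ^+ 2], disappear as the parameter decreases to [m]. *)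
Lemma regular_level_solution g G M P D : measurable_fun setT g -> (forall t, 0 <= g t <= G) -> 0 <= M ->
  locally_constant g -> regular_solution xi g M P D -> level_solution g P.
Proof.
move=> mg hg M0 hc hPD.
have up := level_upper mxi mg hxi hg M0 hPD.
have low := level_lower mxi mg hxi hg M0 hPD.
have cP := rs_continuous hPD.
have P1 : P 1 = fun x => `|x|.
  apply/funext => x.
  have e1 j : pairing (P 1) (moll j) x = pairing (fun x => `|x|) (moll j) x.
    have sk := smooth1_translate x (@moll_smooth R j).
    have skr := @supp_translate R 1 (moll j) x (@moll_supp1 R j).
    have := rs_time hPD sk skr (_ : 0 <= 1 <= 1); rewrite ler01 lexx => /(_ isT).
    by rewrite set_itv_ge ?bnd_simp ?ltxx// Rintegral_set0 addr0.
  have c1 : continuous (P 1) by exact: continuous_section.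
  have c2 : continuous (fun x : R => `|x|) by move=> y; exact: norm_continuous.
  have l1 := continuous_locbdd c1; have l2 := continuous_locbdd c2.
  have h1 := pairing_moll_cvg l1 (continuous_at_lebesgue_pt l1 (c1 x)).
  have h2 := pairing_moll_cvg l2 (continuous_at_lebesgue_pt l2 (c2 x)).
  have e : (fun j => pairing (P 1) (moll j) x) = fun j => pairing (fun x => `|x|) (moll j) x by apply/funext => j; exact: e1.
  rewrite e in h1.
  exact: (cvg_unique _ h1 h2).
have T1 : 0 <= (1 : R) <= 1 by rewrite ler01 lexx.
have LC : forall t, 0 <= t <= 1 -> Lip 1 (P t) /\ midconvex (P t).
  apply: (level_induction hc T1).
  - move=> a b m a0 ab b1 m0 hm [Lb mb].
    have v0 := @vol_ge0 R xi X hxi a b.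
    have eps j : 0 < m + j.+1%:R^-1 by rewrite ltr_wpDl// invr_gt0.
    have meps j : m <= m + j.+1%:R^-1 by rewrite lerDl invr_ge0.
    have u' j y := up m a b (m + j.+1%:R^-1) y a0 (ltW ab) b1 m0 hm (eps j) (meps j).
    have l' j y : chop (m + j.+1%:R^-1) (vol xi a b) (P b) y - j.+1%:R^-1 * (M ^+ 2 * vol xi a b / 2) <= P a y.
      have := low m a b a0 b1 m0 hm (m + j.+1%:R^-1) y (eps j) (meps j) (ltW ab).
      rewrite (_ : (m + j.+1%:R^-1 - m) / 2 * M ^+ 2 * vol xi a b = j.+1%:R^-1 * (M ^+ 2 * vol xi a b / 2))//.
      by rewrite addrAC subrr add0r; ring.
    set K := M ^+ 2 * vol xi a b / 2 in l'.
    split.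
      have half x y : P a x <= P a y + 1 * `|x - y|.
        apply: (@le_of_natinv _ _ _ K) => j.
        have := chop_Lip (vol xi a b) (eps j) Lb x y => /ler_normlP[_ h].
        have := u' j x; have := l' j y; rewrite (mulrC _ K).
        by move: (K * _) => e; lra.
      by move=> x y; apply/ler_normlP; split; [have := half y x; rewrite distrC; lra|have := half x y; lra].
    move=> x y; apply: (@le_of_natinv _ _ _ K) => j.
    have := chop_midconvex (vol xi a b) (eps j) Lb mb x y.
    have := u' j ((x + y) / 2); have := l' j x; have := l' j y; rewrite (mulrC _ K).
    by move: (K * _) => e; lra.
  - rewrite P1; split; first exact: Lip_normr.
    move=> x y; rewrite normrM (@ger0_norm _ (2^-1)) ?invr_ge0// ler_wpM2r ?invr_ge0//.
    exact: ler_normD.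
split => //.
- by move=> t /LC[].
- by move=> t /LC[].
move=> m a b m' y a0 ab b1 m0 hm m'0 mm'.
have v0 := @vol_ge0 R xi X hxi a b.
have [Lb mb] : Lip 1 (P b) /\ midconvex (P b) by apply: LC; rewrite b1 (le_trans a0 ab).
apply: (@le_of_natinv _ _ _ (M ^+ 2 * vol xi a b / 2)) => j.
have e0 : 0 < m + j.+1%:R^-1 by rewrite ltr_wpDl// invr_gt0.
have me : m <= m + j.+1%:R^-1 by rewrite lerDl invr_ge0.
have := low m a b a0 b1 m0 hm (m + j.+1%:R^-1) y e0 me ab.
rewrite (_ : (m + j.+1%:R^-1 - m) / 2 * M ^+ 2 * vol xi a b = M ^+ 2 * vol xi a b / 2 * j.+1%:R^-1); last first.
  by rewrite addrAC subrr add0r; ring.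
(* With Lipschitz constant 1, changing the parameter to [m'] costs at most [(m' - m) / 2] per unit
   of variance, free of [M]. *)
have : chop m' (vol xi a b) (P b) y - (m' - m) / 2 * vol xi a b <= chop (m + j.+1%:R^-1) (vol xi a b) (P b) y.
  have [h|h] := leP m' (m + j.+1%:R^-1).
    have := chop_mono (vol xi a b) y m'0 h Lb.
    have : 0 <= (m' - m) / 2 * vol xi a b by rewrite mulr_ge0// divr_ge0// subr_ge0.
    by lra.
  have := chop_cumulant_bound y e0 (ltW h) v0 Lb; rewrite expr1n mulr1.
  have : (m' - (m + j.+1%:R^-1)) / 2 * vol xi a b <= (m' - m) / 2 * vol xi a b.
    by rewrite ler_wpM2r// ler_wpM2r ?invr_ge0// lerD2l lerN2.
  move: ((m' - (m + _)) / 2 * _) ((m' - m) / 2 * _) (chop (m + _) _ _ _) => c1 c2 c3.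
  by lra.
move: (M ^+ 2 * _ / 2 * _) ((m' - m) / 2 * _) (chop (m + _) _ _ _) => c1 c2 c3.
by lra.
Qed.

Let v0 a b : 0 <= vol xi a b.
Proof. exact: vol_ge0 hxi a b. Qed.

Lemma level_solution_step g P m a b y : level_solution g P -> 0 <= a -> a <= b -> b <= 1 -> 0 < m ->
  constant_on g a b m -> P a y = chop m (vol xi a b) (P b) y.
Proof.
move=> hP a0 ab b1 m0 hm; apply/eqP; rewrite eq_le (ls_upper hP y a0 ab b1 (ltW m0) hm m0 (lexx _)).
by have := ls_lower hP y a0 ab b1 (ltW m0) hm m0 (lexx _); rewrite subrr !mul0r subr0.
Qed.

(** Monotonicity in the added constant together with a modulus of continuity, uniform in space: the
    source of the convergence of the approximations at the minimizer. The positive shifts make every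
    level accessible to the exact Cole-Hopf formula. *)
Lemma level_solution_shift g P P' (c c' : R) t y : locally_constant g -> 0 <= c' -> c' <= c -> 
  0 < c' -> level_solution (fun z => g z + c) P -> level_solution (fun z => g z + c') P' -> 0 <= t <= 1 ->
  P' t y <= P t y <= P' t y + (c - c') / 2 * vol xi t 1.
Proof.
move=> hg c'0 cc c'p hP hP' t01; move: t t01 y.
have T1 : 0 <= (1 : R) <= 1 by rewrite ler01 lexx.
apply: (level_induction hg T1) => [a b m a0 ab b1 m0 hm ih y|y]; last first.
  by rewrite (ls_one hP) (ls_one hP') vol_same mulr0 addr0 lexx.
have hm1 : constant_on (fun z => g z + c) a b (m + c) by move=> z hz; rewrite (hm z hz).
have hm2 : constant_on (fun z => g z + c') a b (m + c') by move=> z hz; rewrite (hm z hz).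
have mc' : 0 < m + c' by rewrite ltr_wpDl.
have mc : 0 < m + c by rewrite ltr_wpDl// (lt_le_trans c'p).
have mm : m + c' <= m + c by rewrite lerD2l.
have b01 : 0 <= b <= 1 by rewrite b1 (le_trans a0 (ltW ab)).
have Lb := ls_Lip hP b01; have Lb' := ls_Lip hP' b01.
rewrite (level_solution_step y hP a0 (ltW ab) b1 mc hm1) (level_solution_step y hP' a0 (ltW ab) b1 mc' hm2).
apply/andP; split.
  apply: (@le_trans _ _ (chop (m + c') (vol xi a b) (P b) y)); last exact: chop_mono Lb.
  by apply: (chop_le _ _ mc' Lb' Lb) => z; have /andP[] := ih z.
have LS := Lip_shift ((c - c') / 2 * vol xi b 1) Lb'.
apply: (@le_trans _ _ (chop (m + c) (vol xi a b) (fun z => P' b z + (c - c') / 2 * vol xi b 1) y)).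
  by apply: (chop_le _ _ mc Lb LS) => z; have /andP[] := ih z.
rewrite (chop_shift _ _ _ mc Lb') (vol_add mxi hxi (ltW ab) b1).
have := chop_cumulant_bound y mc' mm (v0 a b) Lb'; rewrite expr1n mulr1.
rewrite (_ : m + c - (m + c') = c - c'); last by ring.
by rewrite mulrDr; lra.
Qed.

(** Parameters decreasing to [m] carry the gain estimate from the operator to the solutions,
    including [m = 0]; this is why [chop_gain] had to be uniform. *)
Lemma level_gain m K w0 w1 : 0 <= m -> 0 <= K -> 0 < w0 -> w0 <= w1 -> exists2 kappa, 0 < kappa &
  forall g g' P P' a b r d th, level_solution g P -> level_solution g' P' -> 0 <= a -> a < b -> b <= 1 ->
    constant_on g a b m -> constant_on g' a b m -> w0 <= vol xi a b <= w1 -> 0 < r <= 1 -> 0 <= th <= 1 ->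
    (forall y, P' b y <= P b y + d) -> (forall y, `|y| <= r -> P' b y <= P b y + d - th) ->
    (forall y, P' a y <= P a y + d) /\ (forall y, `|y| <= K -> P' a y <= P a y + d - th * (r * kappa)).
Proof.
move=> m0 K0 w00 w01.
have m1 : 0 < m + 1 by rewrite ltr_wpDl.
have [k0 k0p hk0] := chop_gain K0 w00 w01 m1; exists k0 => //.
move=> g g' P P' a b r d th hP hP' a0 ab b1 hm hm' hw hr th01 hb1 hb2.
have b0 := le_trans a0 (ltW ab).
have b01 : 0 <= b <= 1 by rewrite b1 b0.
have Lb := ls_Lip hP b01; have Lb' := ls_Lip hP' b01.
have eps j : 0 < m + j.+1%:R^-1 by rewrite ltr_wpDl// invr_gt0.
have meps j : m <= m + j.+1%:R^-1 by rewrite lerDl invr_ge0.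
have eps1 j : m + j.+1%:R^-1 <= m + 1 by rewrite lerD2l invf_le1// ler1n.
have up j y := ls_upper hP' y a0 (ltW ab) b1 m0 hm' (eps j) (meps j).
have low j y : chop (m + j.+1%:R^-1) (vol xi a b) (P b) y - vol xi a b / 2 * j.+1%:R^-1 <= P a y.
  have := ls_lower hP y a0 (ltW ab) b1 m0 hm (eps j) (meps j).
  by rewrite (_ : (m + j.+1%:R^-1 - m) / 2 * vol xi a b = vol xi a b / 2 * j.+1%:R^-1)// addrAC subrr add0r; ring.
split=> y.
  apply: (@le_of_natinv _ _ _ (vol xi a b / 2)) => j.
  have LS := Lip_shift d Lb.
  have := chop_le (vol xi a b) y (eps j) Lb' LS hb1.
  rewrite (chop_shift _ _ _ (eps j) Lb); have := up j y; have := low j y.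
  by move: (vol xi a b / 2 * _) => e; lra.
move=> yK; apply: (@le_of_natinv _ _ _ (vol xi a b / 2)) => j.
have mj : 0 < m + j.+1%:R^-1 <= m + 1 by rewrite eps eps1.
have := hk0 (m + j.+1%:R^-1) (vol xi a b) 1 (P b) (P' b) y r d th mj hw Lb Lb' hr th01 yK hb1 hb2.
have := up j y; have := low j y.
by move: (vol xi a b / 2 * _) (th * _) => e e'; lra.
Qed.

Hypothesis vol_gt0 : forall a b, 0 <= a -> a < b -> b <= 1 -> 0 < vol xi a b.

(** The gain is reproduced on the interval [|y| <= 1] at each earlier level, multiplied by a
    positive factor; only the last step needs the general radius [K]. The factor is fixed before the
    perturbation, and is at most 1 so that the gain remains in [0, 1]. *)
Lemma gain_propagation g P q : level_solution g P -> locally_constant g -> 0 <= q <= 1 -> forall t, 0 <= t <= q ->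
  forall K, 0 <= K -> (t = q -> K <= 1) -> exists kappa, 0 < kappa <= 1 /\
  forall g' P' d th, level_solution g' P' -> (forall z, 0 <= z < q -> g' z = g z) -> 0 <= th <= 1 ->
    (forall y, P' q y <= P q y + d) -> (forall y, `|y| <= 1 -> P' q y <= P q y + d - th) ->
    (forall y, P' t y <= P t y + d) /\ (forall y, `|y| <= K -> P' t y <= P t y + d - th * kappa).
Proof.
move=> hP hg q01; have /andP[q0 q1] := q01.
apply: (level_induction hg q01) => [a b m a0 ab bq m0 hm ih K K0 _|K K0 K1]; last first.
  exists 1; split; first by rewrite ltr01 lexx.
  move=> g' P' d th hP' gg th01 h1 h2; split => // y yK; rewrite mulr1; apply: h2.
  by apply: le_trans yK _; exact: K1.
have [kb [kb01 hkb]] := ih 1 ler01 (fun=> lexx 1).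
have b1 := le_trans bq q1; have b0 := le_trans a0 (ltW ab).
have Vp := vol_gt0 a0 ab b1.
have [k0 k0p hk0] := level_gain m0 K0 Vp (lexx _).
have /andP[kbp kb1] := kb01.
exists (Num.min 1 (kb * k0)); split; first by rewrite lt_min ltr01 mulr_gt0//= ge_min lexx.
move=> g' P' d th hP' gg th01 h1 h2.
have [hb1 hb2] := hkb g' P' d th hP' gg th01 h1 h2.
have hm' : constant_on g' a b m.
  by move=> z /andP[az zb]; rewrite gg ?hm ?az//; rewrite (le_trans a0 az) (lt_le_trans zb bq).
have /andP[th0 th1] := th01.
have thk : 0 <= th * kb <= 1.
  by apply/andP; split; [exact: mulr_ge0 th0 (ltW kbp)|exact: mulr_ile1 th0 (ltW kbp) th1 kb1].
have rr : 0 < (1 : R) <= 1 by rewrite ltr01 lexx.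
have VV : vol xi a b <= vol xi a b <= vol xi a b by rewrite lexx.
have [ha1 ha2] := hk0 g g' P P' a b 1 d (th * kb) hP hP' a0 ab b1 hm hm' VV rr thk hb1 hb2.
split => // y yK; apply: le_trans (ha2 y yK) _; rewrite lerD2l lerN2 mul1r.
by rewrite -[leRHS]mulrA ler_wpM2l// ge_min lexx orbT.
Qed.

Definition bump_at g s z := g z + (if s <= z then 2 else 0).

(** The gain [c * v] near the kink is spread in two stages: from the interval of radius [sqrt v] at
    time [s] to the unit interval at time [q], which costs the factor [sqrt v], and from there to
    [h] at time 0, which costs a constant. *)
Lemma terminal_perturbation g P q m h : level_solution g P -> locally_constant g -> 0 < q < 1 -> 0 <= m ->
  constant_on g q 1 m -> exists kappa s1, [/\ 0 < kappa, q < s1, s1 < 1 & forall s P', s1 <= s -> s < 1 ->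
    level_solution (bump_at g s) P' ->
    P' 0 h <= P 0 h + vol xi s 1 - kappa * (vol xi s 1 * Num.sqrt (vol xi s 1))].
Proof.
move=> hP hg /andP[q0 q1] m0 hm.
have mp1 : 0 < m + 1 by rewrite ltr_wpDl.
have X0 : 0 <= X by have /andP[h1 h2] := hxi 0; exact: le_trans h2.
have [c [w [c0 wp hc]]] := chop_normr_gain mp1.
(* As [s] stays beyond this midpoint, the variance between [q] and [s] is bounded below, and one
   gain constant serves all [s]. *)
pose q2 := (q + 1) / 2.
have qq2 : q < q2 by rewrite /q2; lra.
have q21 : q2 < 1 by rewrite /q2; lra.
have W0 := vol_gt0 (ltW q0) qq2 (ltW q21).
have W01 : vol xi q q2 <= vol xi q 1 by rewrite (vol_add mxi hxi (ltW qq2) (ltW q21)) lerDl.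
have [k0 k0p hk0] := level_gain m0 ler01 W0 W01.
have q01 : 0 <= q <= 1 by rewrite !ltW.
have zq : 0 <= (0 : R) <= q by rewrite lexx ltW.
have zq1 : 0 = q -> `|h| <= 1 by move=> e; move: q0; rewrite -e ltxx.
have [k1 [/andP[k1p k11] hk1]] := gain_propagation hP hg q01 zq (normr_ge0 h) zq1.
pose k2 := Num.min k0 1.
have k2p : 0 < k2 by rewrite lt_min k0p ltr01.
have [k20 k21] : k2 <= k0 /\ k2 <= 1 by rewrite /k2 !ge_min !lexx orbT.
(* The three bounds put [v] in the range of the kink estimate, make [sqrt v] at most 1, and make the
   gain [c * v] at most 1. *)
pose dl := Num.min w (Num.min 1 c^-1).
have dlp : 0 < dl by rewrite !lt_min wp ltr01 invr_gt0.
have [dw d1 dc] : [/\ dl <= w, dl <= 1 & dl <= c^-1] by rewrite /dl !ge_min !lexx !orbT.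
have X1 : 0 < X + 1 by rewrite ltr_wpDl.
have e0 : 0 < dl / (X + 1) by rewrite divr_gt0.
pose s1 := Num.max q2 (1 - dl / (X + 1)).
exists (c * k2 * k1), s1; split.
- by rewrite !mulr_gt0.
- by rewrite lt_max qq2.
- by rewrite gt_max q21 ltrBlDr ltrDl.
move=> s P' ss s_1 hP'.
have [qs es] : q2 <= s /\ 1 - dl / (X + 1) <= s by move: ss; rewrite /s1 ge_max => /andP[].
have qs' := lt_le_trans qq2 qs.
have s0 : 0 < s := lt_trans q0 qs'.
set v := vol xi s 1.
have vp : 0 < v := vol_gt0 (ltW s0) s_1 (lexx _).
have vd : v <= dl.
  apply: le_trans (vol_le mxi hxi (ltW s_1)) _.
  have h1 : 1 - s <= dl / (X + 1) by lra.
  apply: (@le_trans _ _ (X * (dl / (X + 1)))); first by rewrite ler_wpM2l.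
  by rewrite mulrA ler_pdivrMr// [leLHS]mulrC; apply: ler_wpM2l; [exact: ltW|rewrite lerDl].
have v1 : v <= 1 := le_trans vd d1.
set sg := Num.sqrt v.
have sgp : 0 < sg by rewrite sqrtr_gt0.
have sg1 : sg <= 1 by rewrite /sg -sqrtr1 ler_wsqrtr.
have one01 : 0 <= (1 : R) <= 1 by rewrite ler01 lexx.
have s01 : 0 <= s <= 1 by rewrite !ltW.
have hms : constant_on g s 1 m by apply: constant_onS hm => //; exact: ltW.
have hms' : constant_on (bump_at g s) s 1 (m + 2).
  by move=> z /andP[sz z1]; rewrite /bump_at sz hms ?sz.
have L1 := @Lip_normr R.
have upS y : P' s y <= chop (m + 1 + 1) v (fun y => `|y|) y.
  have := ls_upper hP' y (ltW s0) (ltW s_1) (lexx _) (_ : 0 <= m + 2) hms' (_ : 0 < m + 1 + 1) (_ : m + 2 <= m + 1 + 1).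
  rewrite (ls_one hP'); apply; [exact: addr_ge0|by rewrite ltr_wpDl// ltW|by rewrite -addrA].
have lowS y : chop (m + 1) v (fun y => `|y|) y - v / 2 <= P s y.
  have := ls_lower hP y (ltW s0) (ltW s_1) (lexx _) m0 hms mp1 (_ : m <= m + 1).
  rewrite (ls_one hP) lerDl ler01 => /(_ isT).
  by rewrite (_ : (m + 1 - m) / 2 * vol xi s 1 = v / 2)// addrAC subrr add0r /v; ring.
(* One half of [v] is the cost of passing from [m + 1] to [m + 2], the other half is the loss in
   bounding the level [m] from below by parameter [m + 1]. *)
have g1 y : P' s y <= P s y + v.
  have := chop_cumulant_bound y mp1 (_ : m + 1 <= m + 1 + 1) (ltW vp) L1.
  rewrite lerDl ler01 => /(_ isT).
  rewrite (_ : (m + 1 + 1 - (m + 1)) / 2 * 1 ^+ 2 * v = v / 2); last by ring.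
  by have := upS y; have := lowS y; lra.
have g2 y : `|y| <= sg -> P' s y <= P s y + v - c * v.
  move=> ys; have vw : 0 < v <= w by rewrite vp (le_trans vd dw).
  by have := hc v y vw ys; have := upS y; have := lowS y; lra.
have cv : 0 <= c * v <= 1.
  rewrite (mulr_ge0 (ltW c0) (ltW vp))/= -(mulfV (lt0r_neq0 c0)).
  by apply: ler_wpM2l; [exact: ltW|exact: le_trans vd dc].
have hqs : constant_on g q s m by apply: constant_onS hm => //; exact: ltW.
have lowz z : z < s -> bump_at g s z = g z by move=> zs; rewrite /bump_at leNgt zs/= addr0.
have hqs' : constant_on (bump_at g s) q s m.
  by move=> z /andP[qz zs]; rewrite lowz ?hqs ?qz.
have VV : vol xi q q2 <= vol xi q s <= vol xi q 1.
  rewrite (vol_add mxi hxi (ltW qq2) qs) lerDl v0/= -(vol_add mxi hxi (ltW qq2) qs).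
  by rewrite (vol_add mxi hxi (ltW qs') (ltW s_1)) lerDl.
have rr : 0 < sg <= 1 by rewrite sgp.
have [a1 a2] := hk0 g (bump_at g s) P P' q s sg v (c * v) hP hP' (ltW q0) qs' (ltW s_1) hqs hqs' VV rr cv g1 g2.
have /andP[cv0 cv1] := cv.
have th01 : 0 <= c * v * (sg * k2) <= 1.
  apply/andP; split; first by rewrite mulr_ge0// mulr_ge0 ?ltW.
  have hh : sg * k2 <= 1 := mulr_ile1 (ltW sgp) (ltW k2p) sg1 k21.
  exact: mulr_ile1 cv0 (mulr_ge0 (ltW sgp) (ltW k2p)) cv1 hh.
have a2' y : `|y| <= 1 -> P' q y <= P q y + v - c * v * (sg * k2).
  move=> y1; apply: le_trans (a2 y y1) _; rewrite lerD2l lerN2.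
  by rewrite ler_wpM2l// ler_wpM2l// ltW.
have gg z : 0 <= z < q -> bump_at g s z = g z by move=> /andP[_ zq']; apply: lowz; exact: lt_trans qs'.
have [_ ff] := hk1 (bump_at g s) P' v (c * v * (sg * k2)) hP' gg th01 a1 a2'.
apply: le_trans (ff h (lexx _)) _; rewrite lerD2l lerN2.
by rewrite le_eqVlt; apply/orP; left; apply/eqP; ring.
Qed.

End LevelSolution.

(** * Limits of weak solutions *)

Section MidconvexDerivative.
Variable R : realType.
Notation mu := (@lebesgue_measure R).
Implicit Types (f F k : R -> R) (i j n : nat) (e x y r : R).

Definition quotient e f x := e^-1 * (f (x + e) - f x).

(** Midpoint convexity compares a step directly with its half, so difference quotients are taken
    along powers of 1/2, where they are monotone. *)
Definition dyadic j : R := (2 ^+ j)^-1.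

Lemma dyadic_gt0 j : 0 < dyadic j.
Proof. by rewrite invr_gt0 exprn_gt0. Qed.

Lemma dyadicS j : dyadic j.+1 = dyadic j / 2.
Proof. by rewrite /dyadic exprS invfM mulrC. Qed.

Lemma dyadic_cvg : dyadic j @[j --> \oo] --> (0 : R).
Proof.
rewrite (_ : dyadic = GRing.exp (2^-1 : R)); first by apply: cvg_expr; rewrite ger0_norm// invf_lt1// ltr1n.
by apply/funext => j; rewrite /dyadic exprVn.
Qed.

Lemma quotient_le1 e f x : e != 0 -> Lip 1 f -> `|quotient e f x| <= 1.
Proof.
move=> e0 hf; rewrite normrM normfV ler_pdivrMl ?normr_gt0// mulr1.
by apply: le_trans (hf _ _) _; rewrite addrAC subrr add0r mul1r.
Qed.

Lemma quotient_continuous e f : continuous f -> continuous (quotient e f).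
Proof.
move=> cf; apply: continuous_scale => x; apply: cvgB; last exact: cf.
apply: (@continuous_comp _ _ _ (fun x : R => x + e) f); last exact: cf.
by apply: cvgD; [exact: cvg_id|exact: cvg_cst].
Qed.

Lemma right_quotient_decr f j x : midconvex f -> quotient (dyadic j.+1) f x <= quotient (dyadic j) f x.
Proof.
move=> hf; have := hf x (x + dyadic j); have h0 := dyadic_gt0 j.
rewrite (_ : (x + (x + dyadic j)) / 2 = x + dyadic j.+1); last by rewrite dyadicS; field.
rewrite /quotient dyadicS invfM invrK; move: (dyadic j) h0 => h h0; rewrite -mulrA ler_pM2l ?invr_gt0//.
by move: (f _) (f _) (f _) => a b c; lra.
Qed.

Lemma left_quotient_incr f j x : midconvex f -> quotient (- dyadic j) f x <= quotient (- dyadic j.+1) f x.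
Proof.
move=> hf; have := hf (x - dyadic j) x; have h0 := dyadic_gt0 j.
rewrite (_ : (x - dyadic j + x) / 2 = x - dyadic j.+1); last by rewrite dyadicS; field.
rewrite /quotient !invrN dyadicS invfM invrK; move: (dyadic j) h0 => h h0.
rewrite !mulNr lerN2 -mulrA ler_pM2l ?invr_gt0//.
by move: (f _) (f _) (f _) => a b c; lra.
Qed.

Lemma left_le_right_quotient f j x : midconvex f -> quotient (- dyadic j) f x <= quotient (dyadic j) f x.
Proof.
move=> hf; have := hf (x - dyadic j) (x + dyadic j); have h0 := dyadic_gt0 j.
rewrite (_ : (x - dyadic j + (x + dyadic j)) / 2 = x); last by field.
rewrite /quotient invrN mulNr -mulrN ler_pM2l ?invr_gt0//.
by move: (f _) (f _) (f _) => a b c; lra.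
Qed.

Definition right_derivative f x := limn (fun j => quotient (dyadic j) f x).
Definition left_derivative f x := limn (fun j => quotient (- dyadic j) f x).

Lemma right_derivative_cvg f x : Lip 1 f -> midconvex f ->
  quotient (dyadic j) f x @[j --> \oo] --> right_derivative f x.
Proof.
move=> hf cf; apply: nonincreasing_is_cvgn.
  by apply/nonincreasing_seqP => j; exact: right_quotient_decr.
exists (- 1) => _ [j _ <-]; have := @quotient_le1 (dyadic j) f x (lt0r_neq0 (dyadic_gt0 j)) hf.
by rewrite ler_norml => /andP[].
Qed.

Lemma left_derivative_cvg f x : Lip 1 f -> midconvex f ->
  quotient (- dyadic j) f x @[j --> \oo] --> left_derivative f x.
Proof.
move=> hf cf; apply: nondecreasing_is_cvgn.
  by apply/nondecreasing_seqP => j; exact: left_quotient_incr.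
exists 1 => _ [j _ <-].
have d0 : - dyadic j != 0 by rewrite oppr_eq0 (lt0r_neq0 (dyadic_gt0 j)).
by have := quotient_le1 x d0 hf; rewrite ler_norml => /andP[].
Qed.

Lemma right_derivative_le f i x : Lip 1 f -> midconvex f -> right_derivative f x <= quotient (dyadic i) f x.
Proof.
move=> hf cf; apply: nonincreasing_cvgn_ge; last by apply/cvg_ex; exists (right_derivative f x); exact: right_derivative_cvg.
by apply/nonincreasing_seqP => j; exact: right_quotient_decr.
Qed.

Lemma left_derivative_ge f i x : Lip 1 f -> midconvex f -> quotient (- dyadic i) f x <= left_derivative f x.
Proof.
move=> hf cf; apply: nondecreasing_cvgn_le; last by apply/cvg_ex; exists (left_derivative f x); exact: left_derivative_cvg.
by apply/nondecreasing_seqP => j; exact: left_quotient_incr.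
Qed.

Lemma left_le_right_derivative f x : Lip 1 f -> midconvex f -> left_derivative f x <= right_derivative f x.
Proof.
move=> hf cf; apply: ler_lim; first by apply/cvg_ex; exists (left_derivative f x); exact: left_derivative_cvg.
- by apply/cvg_ex; exists (right_derivative f x); exact: right_derivative_cvg.
by near=> j; exact: left_le_right_quotient.
Unshelve. all: by end_near. Qed.

Lemma right_derivative_le1 f x : Lip 1 f -> midconvex f -> `|right_derivative f x| <= 1.
Proof.
move=> hf cf; have h : `|quotient (dyadic j) f x| @[j --> \oo] --> `|right_derivative f x|.
  by apply: cvg_norm; exact: right_derivative_cvg.
rewrite -(cvg_lim _ h)//; apply: limr_le; first by apply/cvg_ex; exists `|right_derivative f x|.
by near=> j; apply: quotient_le1 => //; exact: lt0r_neq0 (dyadic_gt0 j).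
Unshelve. all: by end_near. Qed.

Lemma left_derivative_le1 f x : Lip 1 f -> midconvex f -> `|left_derivative f x| <= 1.
Proof.
move=> hf cf; have h : `|quotient (- dyadic j) f x| @[j --> \oo] --> `|left_derivative f x|.
  by apply: cvg_norm; exact: left_derivative_cvg.
rewrite -(cvg_lim _ h)//; apply: limr_le; first by apply/cvg_ex; exists `|left_derivative f x|.
by near=> j; apply: quotient_le1 => //; rewrite oppr_eq0; exact: lt0r_neq0 (dyadic_gt0 j).
Unshelve. all: by end_near. Qed.

Lemma right_derivative_measurable f : Lip 1 f -> midconvex f -> measurable_fun setT (right_derivative f).
Proof.
move=> hf cf; apply: (measurable_fun_cvg (h := fun j => quotient (dyadic j) f)).
  by move=> j; apply: continuous_measurable_fun; apply: quotient_continuous; exact: Lip_continuous hf.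
by move=> x _; exact: right_derivative_cvg.
Qed.

Lemma left_derivative_measurable f : Lip 1 f -> midconvex f -> measurable_fun setT (left_derivative f).
Proof.
move=> hf cf; apply: (measurable_fun_cvg (h := fun j => quotient (- dyadic j) f)).
  by move=> j; apply: continuous_measurable_fun; apply: quotient_continuous; exact: Lip_continuous hf.
by move=> x _; exact: left_derivative_cvg.
Qed.

(** The integral of the difference quotient against [k] has two limits: shifted onto the test
    function it is a difference quotient of [pairing], and under the integral it converges by
    domination, the quotients being bounded by 1. *)
Lemma quotient_weak_derivative f k r (e_ : nat -> R) F : continuous f -> smooth1 k -> supp_in r k -> 0 <= r ->
  (forall j, e_ j != 0) -> e_ j @[j --> \oo] --> (0 : R) -> Lip 1 f ->
  measurable_fun setT F -> (forall x, quotient (e_ j) f x @[j --> \oo] --> F x) ->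
  \int[mu]_x (f x * derive1 k x) = - \int[mu]_x (F x * k x).
Proof.
move=> cf sk skr r0 e0 ce hf mF hF.
have ck := smooth1_continuous sk.
have lk := continuous_locbdd ck.
have lf := continuous_locbdd cf.
have p0 (h : R -> R) : continuous h -> pairing f h 0 = \int[mu]_x (f x * h x).
  by move=> ch; apply: eq_Rintegral => x _; rewrite subr0.
have d := pairing_is_derive 0 lf sk skr r0.
have c1 : (\int[mu]_x (quotient (e_ j) f x * k x)) @[j --> \oo] --> - \int[mu]_x (f x * derive1 k x).
  have e j : \int[mu]_x (quotient (e_ j) f x * k x) = (e_ j)^-1 *: (pairing f k (e_ j *: (1 : R) + 0) - pairing f k 0).
    have i1 : mu.-integrable setT (EFin \o (fun x => f (x + e_ j) * k x)).
      apply: (@supp_integrable _ r); last exact: supp_in_mull.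
      by apply: locbdd_mul => //; exact: locbdd_translate.
    have i2 : mu.-integrable setT (EFin \o (fun x => f x * k x)).
      by apply: (@supp_integrable _ r); [exact: locbdd_mul|exact: supp_in_mull].
    rewrite p0// /GRing.scale/= mulr1 addr0 pairingE// -RintegralB//.
    rewrite -RintegralZl//; last exact: Rintegrable_sub.
    by apply: eq_Rintegral => x _; rewrite /quotient; ring.
  under eq_fun do rewrite e.
  have -> : - (\int[mu]_x (f x * derive1 k x)) = 'D_1 (pairing f k) 0.
    by case: d => _ ->; rewrite p0//; apply: smooth1_continuous; exact: smooth1_derive.
  case: d => dd _.
  apply: (cvg_comp e_ (fun h : R => h^-1 *: (pairing f k (h *: (1 : R) + 0) - pairing f k 0))); last exact: dd.
  move=> U [d /= d0 hU]; move/cvgrPdist_lt: (ce) => /(_ d d0).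
  by apply: filterS => j hj; apply: hU => //; exact: e0.
have c2 : (\int[mu]_x (quotient (e_ j) f x * k x)) @[j --> \oo] --> \int[mu]_x (F x * k x).
  apply: (@dominated_Rintegral _ _ _ mu (fun j x => quotient (e_ j) f x * k x) _ (fun x => `|k x|)) => //.
  - move=> j; have mq : measurable_fun setT (quotient (e_ j) f).
      by apply: continuous_measurable_fun; exact: quotient_continuous.
    by have := measurable_funM mq lk.1.
  - by have := measurable_funM mF lk.1.
  - by apply: (integrable_norm (mu := mu)); exact: supp_integrable lk skr.
  - by move=> j x _; rewrite normrM ler_piMl//; exact: quotient_le1.
  - by apply: aeW => x _; apply: cvgMl; exact: hF.
by have := cvg_unique _ c1 c2 => <-; rewrite ?opprK.
Qed.

Lemma right_derivative_weak f k r : Lip 1 f -> midconvex f -> smooth1 k -> supp_in r k -> 0 <= r ->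
  \int[mu]_x (f x * derive1 k x) = - \int[mu]_x (right_derivative f x * k x).
Proof.
move=> hf cf sk skr r0; apply: (quotient_weak_derivative (e_ := dyadic) (r := r)) => //.
- exact: Lip_continuous hf.
- by move=> j; exact: lt0r_neq0 (dyadic_gt0 j).
- exact: dyadic_cvg.
- exact: right_derivative_measurable.
- by move=> x; exact: right_derivative_cvg.
Qed.

Lemma left_derivative_weak f k r : Lip 1 f -> midconvex f -> smooth1 k -> supp_in r k -> 0 <= r ->
  \int[mu]_x (f x * derive1 k x) = - \int[mu]_x (left_derivative f x * k x).
Proof.
move=> hf cf sk skr r0; apply: (quotient_weak_derivative (e_ := fun j => - dyadic j) (r := r)) => //.
- exact: Lip_continuous hf.
- by move=> j; rewrite oppr_eq0; exact: lt0r_neq0 (dyadic_gt0 j).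
- by rewrite -[X in _ --> X]oppr0; apply: cvgN; exact: dyadic_cvg.
- exact: left_derivative_measurable.
- by move=> x; exact: left_derivative_cvg.
Qed.

Lemma ae_eq_of_pairing (F G : R -> R) : locbdd F -> locbdd G ->
  (forall j y, pairing F (moll j) y = pairing G (moll j) y) -> {ae mu, forall x, F x = G x}.
Proof.
move=> lF lG h.
have a1 := lebesgue_differentiation (locbdd_locally_integrable lF).
have a2 := lebesgue_differentiation (locbdd_locally_integrable lG).
apply: ae_mono (ae_conj a1 a2) => y [h1 h2].
have c1 := pairing_moll_cvg lF h1; have c2 := pairing_moll_cvg lG h2.
have e : (fun j => pairing F (moll j) y) = fun j => pairing G (moll j) y by apply/funext => j.
rewrite e in c1; exact: (cvg_unique _ c1 c2).
Qed.

(** Both one-sided derivatives represent the weak derivative, hence have the same pairings with all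
    mollifiers. This replaces the countability of the kinks of a convex function. *)
Lemma ae_left_eq_right f : Lip 1 f -> midconvex f ->
  {ae mu, forall x, left_derivative f x = right_derivative f x}.
Proof.
move=> hf cf; apply: ae_eq_of_pairing.
- by apply: bounded_locbdd => [|x]; [exact: left_derivative_measurable|exact: left_derivative_le1].
- by apply: bounded_locbdd => [|x]; [exact: right_derivative_measurable|exact: right_derivative_le1].
move=> j y; have sk := smooth1_translate y (@moll_smooth R j).
have skr := @supp_translate R 1 (moll j) y (@moll_supp1 R j).
have r0 : 0 <= 1 + `|y| by rewrite addr_ge0.
apply: oppr_inj; rewrite /pairing.
by rewrite -(left_derivative_weak hf cf sk skr r0) -(right_derivative_weak hf cf sk skr r0).
Qed.

(** At a fixed step the quotients of [f_ n] converge to those of [f]; by convexity they enclose the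
    derivatives of [f_ n], and they close up where the two one-sided derivatives of [f] agree. *)
Lemma right_derivative_limit (f_ : nat -> R -> R) f x : (forall n, Lip 1 (f_ n)) -> (forall n, midconvex (f_ n)) ->
  Lip 1 f -> midconvex f -> (forall y, f_ n y @[n --> \oo] --> f y) -> left_derivative f x = right_derivative f x ->
  right_derivative (f_ n) x @[n --> \oo] --> right_derivative f x.
Proof.
move=> hf_ cf_ hf cf h hlr.
have hq e : quotient e (f_ n) x @[n --> \oo] --> quotient e f x.
  by apply: cvgMr; apply: cvgB; exact: h.
apply/cvgrPdist_le => e e0; have e2 : 0 < e / 2 by lra.
have /cvgrPdist_le/(_ _ e2) [i1 _ hi1] := @right_derivative_cvg f x hf cf.
have /cvgrPdist_le/(_ _ e2) [i2 _ hi2] := @left_derivative_cvg f x hf cf.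
have /ler_normlP[a1 a2] := hi1 i1 (leqnn _); have /ler_normlP[b1 b2] := hi2 i2 (leqnn _).
have q1 : \forall n \near \oo, `|quotient (dyadic i1) f x - quotient (dyadic i1) (f_ n) x| <= e / 2.
  by move/cvgrPdist_le: (hq (dyadic i1)); apply.
have q2 : \forall n \near \oo, `|quotient (- dyadic i2) f x - quotient (- dyadic i2) (f_ n) x| <= e / 2.
  by move/cvgrPdist_le: (hq (- dyadic i2)); apply.
near=> n.
have c1 : `|quotient (dyadic i1) f x - quotient (dyadic i1) (f_ n) x| <= e / 2.
  by near: n; exact: q1.
have c2 : `|quotient (- dyadic i2) f x - quotient (- dyadic i2) (f_ n) x| <= e / 2.
  by near: n; exact: q2.
have d1 := right_derivative_le i1 x (hf_ n) (cf_ n).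
have d2 := left_derivative_ge i2 x (hf_ n) (cf_ n).
have d3 := left_le_right_derivative x (hf_ n) (cf_ n).
move: c1 c2 => /ler_normlP[c1 c1'] /ler_normlP[c2 c2'].
rewrite hlr in b1 b2.
by apply/ler_normlP; split; lra.
Unshelve. all: by end_near. Qed.

End MidconvexDerivative.

(** * Stability of weak solutions under uniform convergence *)

Section LimitSolution.
Variable R : realType.
Notation mu := (@lebesgue_measure R).
Implicit Types (f F k : R -> R) (P D phi : R -> R -> R) (i j n : nat) (e s t x y r C : R).

Lemma continuous_rat_eq0 F : continuous F -> (forall q : rat, F (ratr q) = 0) -> forall y, F y = 0.
Proof.
move=> cF h y; apply/eqP; rewrite -normr_le0 leNgt; apply/negP => Fy.
have /cvgrPdist_lt/(_ _ Fy) [d /= d0 hd] := cF y.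
have yd : y - d < y + d by rewrite ltrD2l; lra.
have [q] := rat_in_itvoo yd.
rewrite in_itv/= => /andP[q1 q2].
have : `|y - ratr q| < d by rewrite ltr_norml; apply/andP; split; lra.
by move=> /hd; rewrite h subr0 ltxx.
Qed.

(** The null set of times must not depend on the mollifier or its centre. Countably many pairs of an
    index and a rational centre are enumerated, and the other centres follow by continuity. *)
Lemma rs_derivative_ae xi g M P D : regular_solution xi g M P D ->
  (forall t, 0 <= t <= 1 -> Lip 1 (P t)) -> (forall t, 0 <= t <= 1 -> midconvex (P t)) ->
  {ae mu, forall t, 0 < t < 1 -> {ae mu, forall x, D t x = right_derivative (P t) x}}.
Proof.
move=> hPD hL hC.
have key : {ae mu, forall t, forall n : nat, if unpickle n is Some (j, q) then
    0 < t < 1 -> - pairing (P t) (derive1 (moll j)) (ratr q) = pairing (D t) (moll j) (ratr q) else True}.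
  apply: ae_forall => n; case: (unpickle n : option (nat * rat)) => [[j q]|]; last exact: aeW.
  exact: (rs_moll_dx hPD j (ratr q)).
apply: ae_mono key => t ht t01.
have t01' : 0 <= t <= 1 by case/andP: t01 => /ltW -> /ltW ->.
have Lt := hL t t01'; have Ct := hC t t01'.
have mDt : measurable_fun setT (D t) by exact: measurable_section (rs_measurable hPD).
have lD : locbdd (D t) by apply: bounded_locbdd (rs_bounded hPD t).
have lP := continuous_locbdd (Lip_continuous Lt).
have lr : locbdd (right_derivative (P t)).
  by apply: bounded_locbdd => [|x]; [exact: right_derivative_measurable|exact: right_derivative_le1].
apply: ae_eq_of_pairing => // j y.
have sk := @moll_smooth R j; have skr := @moll_supp1 R j.
have e1 : pairing (D t) (moll j) y = - pairing (P t) (derive1 (moll j)) y.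
  apply/eqP; rewrite -subr_eq0 opprK; apply/eqP.
  apply: (@continuous_rat_eq0 (fun y => pairing (D t) (moll j) y + pairing (P t) (derive1 (moll j)) y)).
    move=> z; apply: cvgD; apply: derivable_continuous => w.
      by have [] := pairing_is_derive w lD sk skr ler01.
    by have [] := pairing_is_derive w lP (smooth1_derive sk) (supp_in_derive skr sk) ler01.
  move=> q; have := ht (pickle (j, q)); rewrite pickleK => /(_ t01) <-.
  by rewrite addNr.
rewrite e1; apply: oppr_inj; rewrite opprK.
have sk' := smooth1_translate y sk; have skr' := @supp_translate R 1 (moll j) y skr.
have r0 : 0 <= 1 + `|y| by rewrite addr_ge0.
by have := right_derivative_weak Lt Ct sk' skr' r0; rewrite derive1_translate.
Qed.

Lemma clamp_quotient_continuous P e : continuous (uncurry2 P) ->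
  continuous (fun p : R * R => quotient e (P (clamp p.1)) p.2).
Proof.
move=> cP.
have h e' : continuous (fun p : R * R => P (clamp p.1) (p.2 + e')).
  move=> p; apply: (@cvg_comp _ _ _ (fun p : R * R => (clamp p.1, p.2 + e')) (uncurry2 P)); last exact: (cP (clamp p.1, p.2 + e')).
  apply: (@cvg_pair _ _ _ _ (nbhs (clamp p.1)) (nbhs (p.2 + e'))).
    by apply: (@continuous_comp _ _ _ fst (@clamp R)); [exact: cvg_fst|exact: clamp_continuous].
  by apply: cvgD; [exact: cvg_snd|exact: cvg_cst].
move=> p; rewrite /quotient; apply: cvgMr; apply: cvgB; first exact: h.
have e0 : (fun p : R * R => P (clamp p.1) (p.2 + 0)) = fun p => P (clamp p.1) p.2.
  by apply/funext => q; rewrite addr0.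
by have h0 := h 0; rewrite e0 in h0; exact: h0.
Qed.

Lemma clamp_derivative_measurable P : continuous (uncurry2 P) -> (forall t, 0 <= t <= 1 -> Lip 1 (P t)) ->
  (forall t, 0 <= t <= 1 -> midconvex (P t)) ->
  measurable_fun setT (fun p : R * R => right_derivative (P (clamp p.1)) p.2).
Proof.
move=> cP hL hC.
apply: (measurable_fun_cvg (h := fun j => fun p : R * R => quotient (dyadic R j) (P (clamp p.1)) p.2)).
  by move=> j; apply: continuous_uncurry_measurable; exact: clamp_quotient_continuous.
by move=> p _; apply: right_derivative_cvg; [apply: hL|apply: hC]; exact: clamp_itv.
Qed.

Lemma smooth_section phi t : smooth phi -> smooth1 (phi t).
Proof.
move=> sphi k; move: phi sphi; elim: k => [|k ih] phi sphi.
  exact: continuous_section (sphi 0%N).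
split; first by have [_ h _ _] := sphi 1%N; move=> x; exact: h.
apply: (ih (dx phi)) => i.
by have [] := sphi i.+1.
Qed.

Lemma test_function_radius (A : set (R * R)) phi : test_function A phi ->
  exists2 r, 0 <= r & forall t x, A (t, x) -> r < `|x| -> phi t x = 0.
Proof.
move=> [_ [K [cK _ hK]]]; have [M [_ hM]] := compact_bounded cK.
exists (`|M| + 1); first by rewrite addr_ge0.
move=> t x Atx xr; apply: hK => // Ktx.
have := hM (`|M| + 1) (_ : M < `|M| + 1) (t, x) Ktx.
rewrite (le_lt_trans (ler_norm _)) ?ltrDl// => /(_ isT).
move=> h; have : `|(t, x)| <= `|M| + 1 := h.
by rewrite prod_normE/= ge_max => /andP[_ {}h]; move: xr; rewrite ltNge h.
Qed.

Lemma test_function_dt_radius (A : set (R * R)) phi r : smooth phi -> (forall t x, 0 < t < 1 -> A (t, x)) ->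
  (forall t x, A (t, x) -> r < `|x| -> phi t x = 0) -> forall t x, 0 < t < 1 -> r < `|x| -> dt phi t x = 0.
Proof.
move=> sphi hA hr t x t01 xr; rewrite /dt derive1E.
rewrite (@near_eq_derive _ _ _ _ (cst (0 : R))) ?derive_cst//.
have : `]0, 1[%classic t by rewrite /= in_itv.
move=> h; have : \forall s \near t, `]0, 1[%classic s by apply: open_nbhs_nbhs; split => //; exact: interval_open.
by apply: filterS => s; rewrite /= in_itv/= => s01; apply: hr => //; exact: hA.
Qed.

Section Limit.
Variables (xi g : R -> R) (X G E : R) (g_ : nat -> R -> R) (M_ e_ : nat -> R) (P_ D_ : nat -> R -> R -> R) (P : R -> R -> R).
Hypothesis mxi : measurable_fun setT xi.
Hypothesis hxi : forall t, 0 <= xi t <= X.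
Hypothesis mg : measurable_fun setT g.
Hypothesis hg : forall t, 0 <= g t <= G.
Hypothesis mg_ : forall n, measurable_fun setT (g_ n).
Hypothesis hg_ : forall n t, 0 <= g_ n t <= G.
Hypothesis cg_ : forall t, g_ n t @[n --> \oo] --> g t.
Hypothesis hPD : forall n, regular_solution xi (g_ n) (M_ n) (P_ n) (D_ n).
Hypothesis hL : forall n t, 0 <= t <= 1 -> Lip 1 (P_ n t).
Hypothesis hC : forall n t, 0 <= t <= 1 -> midconvex (P_ n t).
Hypothesis cP : continuous (uncurry2 P).
Hypothesis hP : forall n t x, 0 <= t <= 1 -> `|P_ n t x - P t x| <= e_ n.
Hypothesis ce : e_ n @[n --> \oo] --> (0 : R).
Hypothesis hE : forall n, e_ n <= E.

Let cvgP t x : 0 <= t <= 1 -> P_ n t x @[n --> \oo] --> P t x.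
Proof.
move=> t01; apply/cvgrPdist_le => d d0.
move/cvgrPdist_le: ce => /(_ d d0); apply: filterS => n; rewrite sub0r normrN => h.
by rewrite distrC (le_trans (hP n x t01))// (le_trans (ler_norm _)).
Qed.

Lemma limit_Lip t : 0 <= t <= 1 -> Lip 1 (P t).
Proof.
move=> t01 x y.
have h : `|P_ n t x - P_ n t y| @[n --> \oo] --> `|P t x - P t y|.
  by apply: cvg_norm; apply: cvgB; exact: cvgP.
rewrite -(cvg_lim _ h)//; apply: limr_le; first by apply/cvg_ex; exists `|P t x - P t y|.
by near=> n; exact: hL.
Unshelve. all: by end_near. Qed.

Lemma limit_midconvex t : 0 <= t <= 1 -> midconvex (P t).
Proof.
move=> t01 x y.
have h : (P_ n t x + P_ n t y) / 2 - P_ n t ((x + y) / 2) @[n --> \oo] --> (P t x + P t y) / 2 - P t ((x + y) / 2).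
  by apply: cvgB; [apply: cvgMl; apply: cvgD; exact: cvgP|exact: cvgP].
rewrite -subr_ge0 -(cvg_lim _ h)//; apply: limr_ge; first by apply/cvg_ex; exists ((P t x + P t y) / 2 - P t ((x + y) / 2)).
by near=> n; rewrite subr_ge0; exact: hC.
Unshelve. all: by end_near. Qed.

Let D t x := right_derivative (P (clamp t)) x.

Let mD : measurable_fun setT (uncurry2 D).
Proof.
have := clamp_derivative_measurable cP limit_Lip limit_midconvex.
by congr (measurable_fun _ _); apply/funext => -[].
Qed.

Let D1 t x : `|D t x| <= 1.
Proof. by apply: right_derivative_le1; [apply: limit_Lip|apply: limit_midconvex]; exact: clamp_itv. Qed.

(** On each time slice the right derivative of the convex limit is its weak derivative, so the
    identity holds before integrating in time. *)
Lemma limit_weak_dx : bounded_weak_dx P D.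
Proof.
split; first exact: measurable_funTS.
  by exists 1; apply: aeW => p _; exact: D1.
move=> phi hphi; have [sphi _] := hphi.
have [r r0 hr] := test_function_radius hphi.
have at0 x : phi 0 x = 0.
  by apply: test_function_at0 hphi => //; rewrite /open_strip/= ltxx.
have supp t : 0 <= t < 1 -> supp_in r (phi t).
  move=> /andP[t0 t1] x xr; have [t_0|t_0] := leP t 0.
    by have -> : t = 0 by apply/eqP; rewrite eq_le t_0.
  by apply: hr => //; rewrite /open_strip/= t_0.
have parts t : 0 <= t < 1 -> \int[mu]_x (P t x * dx phi t x) = - \int[mu]_x (D t x * phi t x).
  move=> t01; have t01' : 0 <= t <= 1 by case/andP: t01 => -> /ltW ->.
  rewrite /D clamp_id//.
  exact: (right_derivative_weak (limit_Lip t01') (limit_midconvex t01') (smooth_section t sphi) (supp t t01) r0).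
have mphi : measurable_fun setT (uncurry2 phi) by apply: continuous_uncurry_measurable; exact: (sphi 0%N).
have [C C0 hC'] := continuous_rectangle_bound 0 1 r (sphi 0%N).
rewrite /int_strip.
have mI : measurable_fun setT (fun t => \int[mu]_x (D t x * phi t x)).
  exact: (@measurable_Rintegral_section _ (fun p => uncurry2 D p * uncurry2 phi p) (measurable_funM mD mphi)).
have iI : mu.-integrable `[0, 1[ (EFin \o (fun t => \int[mu]_x (D t x * phi t x))).
  pose I t := if 0 <= t < 1 then \int[mu]_x (D t x * phi t x) else 0.
  have mI' : measurable_fun setT I.
    apply: measurable_fun_ifT => //.
    by apply: measurable_and; [exact: measurable_fun_ler|exact: measurable_fun_ltr].
  have bI t : `|I t| <= C * (2 * r).
    rewrite /I; case: ifP => t01; last by rewrite normr0 !mulr_ge0.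
    apply: supp_integral_le => //; last 1 first.
    - move=> x; have [xr|xr] := leP `|x| r; last by rewrite (supp t t01)// mulr0 normr0.
      rewrite normrM -[leRHS]mul1r; apply: ler_pM => //; apply: hC' => //.
      by case/andP: t01 => -> /ltW.
    - apply: locbdd_mul; last by apply: continuous_locbdd; exact: continuous_section (sphi 0%N).
      by apply: bounded_locbdd (D1 t); exact: measurable_section mD.
    - exact: supp_in_mull (supp t t01).
  have := locbdd_itv 0 1 (bounded_locbdd mI' bI).
  apply: eq_integrable => // t; rewrite inE/= in_itv/= => t01.
  by rewrite /I t01.
have := RintegralZl (mu := mu) (-1) (measurable_itv `[0, 1[) iI; rewrite mulN1r => <-.
by apply: eq_Rintegral => t; rewrite inE/= in_itv/= => t01; rewrite parts// mulN1r.
Qed.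

Let F n t x := right_derivative (P_ n (clamp t)) x.

Let H (Q : R -> R -> R) (g' : R -> R) (F' : R * R -> R) phi (p : R * R) :=
  - (uncurry2 Q p * uncurry2 (dt phi) p) + xi p.1 / 2 *
    (uncurry2 Q p * uncurry2 (dx (dx phi)) p + g' p.1 * F' p ^+ 2 * uncurry2 phi p).

Lemma integrand_measurable (Q : R -> R -> R) (g' : R -> R) (F' : R * R -> R) phi : continuous (uncurry2 Q) -> measurable_fun setT g' -> measurable_fun setT F' -> smooth phi ->
  measurable_fun setT (H Q g' F' phi).
Proof.
move=> cQ mg' mF' sphi.
have mQ : measurable_fun setT (uncurry2 Q) by exact: continuous_uncurry_measurable.
have mphi : measurable_fun setT (uncurry2 phi) by apply: continuous_uncurry_measurable; exact: (sphi 0%N).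
have mdt : measurable_fun setT (uncurry2 (dt phi)).
  by apply: continuous_uncurry_measurable; have [_ _] := sphi 1%N.
have mdxx : measurable_fun setT (uncurry2 (dx (dx phi))).
  by apply: continuous_uncurry_measurable; have [_ _ _ [_ _ _]] := sphi 2%N.
have m1 (f : R -> R) : measurable_fun setT f -> measurable_fun setT (fun p : R * R => f p.1).
  by move=> mf; apply: measurableT_comp.
apply: measurable_funD; first by apply: measurableT_comp => //; exact: measurable_funM.
apply: measurable_funM; first by apply: measurable_funM => //; exact: m1.
apply: measurable_funD; first exact: measurable_funM.
by apply: measurable_funM => //; apply: measurable_funM; [exact: m1|exact: measurable_funX].
Qed.

(* The spatial derivatives of convex functions converge almost everywhere, which is
   what lets the quadratic term pass to the limit. *)
Lemma limit_weak_solution : parisi_weak_solution xi g P.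
Proof.
split; first exact: continuous_subspaceT.
exists D; first exact: limit_weak_dx.
move=> phi hphi; have [sphi _] := hphi.
have [r r0 hr] := test_function_radius hphi.
have half t : 0 < t < 1 -> forall x, half_open_strip (t, x).
  by move=> /andP[t0 t1] x; rewrite /half_open_strip/= t0 ltW.
have supp t : 0 < t < 1 -> supp_in r (phi t) by move=> t01 x; apply: hr; exact: half.
have suppt t x : 0 < t < 1 -> r < `|x| -> dt phi t x = 0.
  by apply: (test_function_dt_radius sphi _ hr) => s y s01; exact: half.
have suppxx t : 0 < t < 1 -> supp_in r (dx (dx phi) t).
  move=> t01; apply: supp_in_derive; last exact: smooth1_derive (smooth_section t sphi).
  by apply: supp_in_derive (supp t t01) (smooth_section t sphi).
have suppH t Q g' (F' : R * R -> R) : 0 < t < 1 -> supp_in r (fun x => H Q g' F' phi (t, x)).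
  move=> t01 x xr; rewrite /H /uncurry2/= (suppt t x t01 xr) (supp t t01 x xr) (suppxx t t01 x xr).
  by rewrite !mulr0 addr0 mulr0 addr0 oppr0.
have mF n : measurable_fun setT (uncurry2 (F n)).
  have := clamp_derivative_measurable (rs_continuous (hPD n)) (@hL n) (@hC n).
  by congr (measurable_fun _ _); apply/funext => -[].
have F1 n t x : `|F n t x| <= 1.
  by apply: right_derivative_le1; [apply: hL|apply: hC]; exact: clamp_itv.
have cdt : continuous (uncurry2 (dt phi)) by have [_ _] := sphi 1%N.
have cdxx : continuous (uncurry2 (dx (dx phi))) by have [_ _ _ [_ _ _]] := sphi 2%N.
have [C0 C00 hC0] := continuous_rectangle_bound 0 1 r (sphi 0%N).
have [C1 C10 hC1] := continuous_rectangle_bound 0 1 r cdt.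
have [C2 C20 hC2] := continuous_rectangle_bound 0 1 r cdxx.
have [C3 C30 hC3] := continuous_rectangle_bound 0 1 r cP.
have G0 : 0 <= G by have /andP[h1 h2] := hg 0; exact: le_trans h2.
have X0 : 0 <= X by have /andP[h1 h2] := hxi 0; exact: le_trans h2.
have E0 : 0 <= E.
  have z01 : 0 <= (0 : R) <= 1 by rewrite lexx ler01.
  exact: le_trans (le_trans (normr_ge0 _) (hP 0%N 0 z01)) (hE 0%N).
(* A bound for the integrand on the support of [phi], uniform in [n]; [C3 + E] bounds the
   approximating solutions there. *)
pose B := (C3 + E) * C1 + X / 2 * ((C3 + E) * C2 + G * 1 * C0).
have CE0 : 0 <= C3 + E by exact: addr_ge0.
have B0 : 0 <= B.
  apply: addr_ge0; first exact: mulr_ge0.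
  by apply: mulr_ge0; [rewrite divr_ge0|apply: addr_ge0; rewrite !mulr_ge0].
have PE n t x : 0 <= t <= 1 -> `|x| <= r -> `|P_ n t x| <= C3 + E.
  move=> t01 xr; have h3 := hC3 t x t01 xr; have h2 := hP n x t01; have h1 := hE n.
  rewrite -[P_ n t x](subrK (P t x)); apply: le_trans (ler_normD _ _) _.
  by rewrite addrC; apply: lerD => //; exact: le_trans h1.
have bH n t x : 0 < t < 1 -> `|x| <= r -> `|H (P_ n) (g_ n) (uncurry2 (F n)) phi (t, x)| <= B.
  move=> t01 xr; have t01' : 0 <= t <= 1 by case/andP: t01 => /ltW -> /ltW ->.
  have /andP[x0 xX] := hxi t; have /andP[g0 gG] := hg_ n t.
  rewrite /H /uncurry2/=; apply: le_trans (ler_normD _ _) _; rewrite normrN; apply: lerD.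
    by rewrite normrM; apply: ler_pM => //; [exact: PE|exact: hC1].
  rewrite normrM (@ger0_norm _ (xi t / 2)) ?divr_ge0//; apply: ler_pM => //; rewrite ?divr_ge0//.
    by rewrite ler_wpM2r.
  apply: le_trans (ler_normD _ _) _; apply: lerD.
    by rewrite normrM; apply: ler_pM => //; [exact: PE|exact: hC2].
  rewrite !normrM; apply: ler_pM; rewrite ?mulr_ge0//; last exact: hC0.
  apply: ler_pM => //; first by rewrite ger0_norm.
  exact: mulr_ile1 (normr_ge0 _) (normr_ge0 _) (F1 n t x) (F1 n t x).
pose I n t := if 0 < t < 1 then \int[mu]_x H (P_ n) (g_ n) (uncurry2 (F n)) phi (t, x) else 0.
pose I0 t := if 0 < t < 1 then \int[mu]_x H P g (uncurry2 D) phi (t, x) else 0.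
have mif (K : R * R -> R) : measurable_fun setT K ->
    measurable_fun setT (fun t => if 0 < t < 1 then \int[mu]_x K (t, x) else 0).
  move=> mK; apply: measurable_fun_ifT => //; last exact: measurable_Rintegral_section.
  by apply: measurable_and; exact: measurable_fun_ltr.
have mHn n := integrand_measurable (rs_continuous (hPD n)) (mg_ n) (mF n) sphi.
have mHD n := integrand_measurable (rs_continuous (hPD n)) (mg_ n) (rs_measurable (hPD n)) sphi.
have mH0 := integrand_measurable cP mg mD sphi.
(* The support of [phi] is controlled only for positive times. *)
have ne0 : {ae mu, forall t : R, t != 0} by apply: (@ae_neq _ 0).
have itv t : t != 0 -> `[0, 1[%classic t -> 0 < t < 1.
  by move=> tn; rewrite /= in_itv/= => /andP[t0 ->]; rewrite lt_neqAle eq_sym tn t0.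
(* The unknown [D_ n] is replaced by the right derivative of the convex function [P_ n t], for which
   pointwise convergence is available. *)
have eI n : \int[mu]_(t in `[0, 1[) I n t = - \int[mu]_x (phi 1 x * `|x|).
  have := rs_weak (hPD n) hphi => /eqP; rewrite addr_eq0 => /eqP <-.
  symmetry; apply: (@ae_eq_Rintegral _ _ _ mu (fun t => \int[mu]_x H (P_ n) (g_ n) (uncurry2 (D_ n)) phi (t, x)) (I n)) => //.
  - by apply: measurable_funTS; exact: measurable_Rintegral_section (mHD n).
  - by apply: measurable_funTS; exact: mif (mHn n).
  have der := rs_derivative_ae (hPD n) (@hL n) (@hC n).
  apply: ae_mono (ae_conj ne0 der) => t [tn ht] /(itv t tn) t01.
  have t01' : 0 <= t <= 1 by case/andP: t01 => /ltW -> /ltW ->.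
  rewrite /I t01; apply: ae_eq_Rintegral => //.
  - exact: measurable_section (mHD n).
  - exact: measurable_section (mHn n).
  by apply: ae_mono (ht t01) => x hx _; rewrite /H /uncurry2/= hx /F clamp_id.
suff cI : (\int[mu]_(t in `[0, 1[) I n t) @[n --> \oo] --> \int[mu]_(t in `[0, 1[) I0 t.
  have -> : int_strip (fun t x => - (P t x * dt phi t x) + xi t / 2 * (P t x * dx (dx phi) t x + g t * D t x ^+ 2 * phi t x)) =
      \int[mu]_(t in `[0, 1[) I0 t.
    apply: (@ae_eq_Rintegral _ _ _ mu (fun t => \int[mu]_x H P g (uncurry2 D) phi (t, x)) I0) => //.
    - by apply: measurable_funTS; exact: measurable_Rintegral_section mH0.
    - by apply: measurable_funTS; exact: mif mH0.
    by apply: ae_mono ne0 => t tn /(itv t tn) t01; rewrite /I0 t01.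
  have c2 : (\int[mu]_(t in `[0, 1[) I n t) @[n --> \oo] --> - \int[mu]_x (phi 1 x * `|x|).
    by under eq_fun do rewrite eI; exact: cvg_cst.
  by rewrite (cvg_unique _ cI c2) ?addNr.
have inner t Q g' (F' : R * R -> R) : 0 < t < 1 -> \int[mu]_x H Q g' F' phi (t, x) = \int[mu]_(x in `[- r, r]) H Q g' F' phi (t, x).
  by move=> t01; apply: supp_integral; exact: suppH.
apply: (@dominated_Rintegral _ _ _ mu I I0 (fun=> B * (r - (- r)))) => //.
- by move=> n; apply: measurable_funTS; exact: mif (mHn n).
- by apply: measurable_funTS; exact: mif mH0.
- by apply: locbdd_itv; exact: locbdd_cst.
- move=> n t _; rewrite /I; case: ifP => t01; last first.
    by rewrite normr0 mulr_ge0// subr_ge0; lra.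
  rewrite inner// -(@integral_cst_itv R (- r) r); last by lra.
  have hb x : - r <= x <= r -> `|H (P_ n) (g_ n) (uncurry2 (F n)) phi (t, x)| <= B.
    by move=> xr; apply: bH => //; rewrite ler_norml.
  have ii := @integrable_itv_bounded R (- r) r _ B (measurable_section t (mHn n)) hb.
  apply: le_trans (le_normr_Rintegral _ ii) _ => //.
  apply: le_Rintegral => //; first exact: integrable_norm.
  by apply: (@integrable_itv_bounded _ _ _ _ B) => // x _; rewrite ger0_norm.
apply: aeW => t _; rewrite /I /I0; case: ifP => t01; last exact: cvg_cst.
have t01' : 0 <= t <= 1 by case/andP: t01 => /ltW -> /ltW ->.
rewrite inner//; under eq_fun do rewrite inner//.
apply: (@dominated_Rintegral _ _ _ mu (fun n x => H (P_ n) (g_ n) (uncurry2 (F n)) phi (t, x)) _ (fun=> B)) => //.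
- by move=> n; apply: measurable_funTS; exact: measurable_section (mHn n).
- by apply: measurable_funTS; exact: measurable_section mH0.
- by apply: (@integrable_itv_bounded _ _ _ _ B) => // x _; rewrite ger0_norm.
- by move=> n x; rewrite /= in_itv/= => xr; apply: bH => //; rewrite ler_norml.
apply: ae_mono (ae_left_eq_right (limit_Lip t01') (limit_midconvex t01')) => x hx _.
have cF : F n t x @[n --> \oo] --> D t x.
  rewrite /F /D !clamp_id//; apply: right_derivative_limit => //.
  - by move=> n; exact: hL.
  - by move=> n; exact: hC.
  - exact: limit_Lip.
  - exact: limit_midconvex.
  - by move=> y; exact: cvgP.
rewrite /H /uncurry2/=; apply: cvgD; first by apply: cvgN; apply: cvgMl; exact: cvgP.
apply: cvgMr; apply: cvgD; first by apply: cvgMl; exact: cvgP.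
by apply: cvgMl; apply: cvgM; [exact: cg_|rewrite !expr2; apply: cvgM].
Qed.

End Limit.

End LimitSolution.

(** * The mixture and the measure of a finitely supported minimizer *)

Section Mixture.
Variable R : realType.
Implicit Types (a c : nat -> R) (r K x t : R) (i n p : nat).

Lemma pseries_le a r K n : (forall i, 0 <= a i) -> 0 <= r -> r <= K -> pseries a r n <= pseries a K n.
Proof.
move=> a0 r0 rK; rewrite /pseries /series/=; apply: ler_sum => i _.
by rewrite ler_wpM2l// lerXn2r// nnegrE (le_trans r0).
Qed.

Lemma pseries_nondecreasing a r : (forall i, 0 <= a i) -> 0 <= r -> nondecreasing_seq (pseries a r).
Proof.
move=> a0 r0; apply/nondecreasing_seqP => n; rewrite /pseries /series/= big_nat_recr//= lerDl.
by rewrite mulr_ge0 ?exprn_ge0.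
Qed.

Lemma natr_expr_bound (q : R) n : 0 < q -> q < 1 -> n%:R * q ^+ n <= q / (1 - q).
Proof.
move=> q0 q1; have d0 : 0 < 1 - q by rewrite subr_gt0.
elim: n => [|n ih]; first by rewrite mul0r divr_ge0// ltW.
have qn : q ^+ n <= 1 by rewrite exprn_ile1// ltW.
rewrite exprS -addn1 natrD mulrDl mul1r mulrCA -mulrDr.
rewrite -[leRHS](_ : q * (q / (1 - q) + 1) = _); last by field; rewrite gt_eqF.
by apply: ler_wpM2l; [exact: ltW|exact: lerD].
Qed.

(** The factor brought down by differentiation is absorbed by a power of [r / K], at the price of a
    smaller radius. *)
Lemma pseries_diffs_cvg a r K : (forall i, 0 <= a i) -> 0 < r -> r < K -> cvgn (pseries a K) ->
  cvgn (pseries (pseries_diffs a) r).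
Proof.
move=> a0 r0 rK hK; have K0 := lt_trans r0 rK.
pose q := r / K.
have q0 : 0 < q by rewrite divr_gt0.
have q1 : q < 1 by rewrite ltr_pdivrMr// mul1r.
pose C := q / (1 - q) / r.
have C0 : 0 <= C by rewrite !divr_ge0 ?subr_ge0 ?ltW.
apply: nondecreasing_is_cvgn.
  by apply: pseries_nondecreasing; [move=> i; rewrite mulr_ge0|exact: ltW].
exists (C * limn (pseries a K)) => _ [n _ <-].
have h i : pseries_diffs a i * r ^+ i <= C * (a i.+1 * K ^+ i.+1).
  have := natr_expr_bound i.+1 q0 q1; rewrite /q expr_div_n => hb.
  have hb2 : i.+1%:R * r ^+ i <= C * K ^+ i.+1.
    rewrite /C -/q; move: hb; rewrite -/q mulrA ler_pdivrMr ?exprn_gt0// exprSr mulrA => hb.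
    by rewrite (mulrAC _ r^-1) ler_pdivlMr.
  rewrite /pseries_diffs (_ : C * _ = a i.+1 * (C * K ^+ i.+1)); last by ring.
  by rewrite mulrAC mulrC ler_wpM2l.
apply: (@le_trans _ _ (C * pseries a K n.+1)).
  rewrite /pseries /series/= big_nat_recl// mulrDr mulr_sumr.
  apply: (@le_trans _ _ (\sum_(0 <= i < n) C * (a i.+1 * K ^+ i.+1))); first exact: ler_sum.
  by rewrite lerDr mulr_ge0// mulr_ge0// exprn_ge0// ltW.
rewrite ler_wpM2l//; apply: nondecreasing_cvgn_le => //.
by apply: pseries_nondecreasing => //; exact: ltW.
Qed.

Definition mixture_coef c i : R := if (2 <= i)%N then c i ^+ 2 else 0.

Lemma mixture_coef_ge0 c i : 0 <= mixture_coef c i.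
Proof. by rewrite /mixture_coef; case: ifP => // _; exact: sqr_ge0. Qed.

Lemma mixture_pseries c s n : \sum_(2 <= p < n) c p ^+ 2 * s ^+ p = pseries (mixture_coef c) s n.
Proof.
rewrite /pseries /series/=; have [n2|n2] := leqP n 2.
  rewrite big_geq// big_nat big1// => i /andP[_ iN].
  by rewrite /mixture_coef leqNgt (leq_trans iN n2) mul0r.
rewrite (@big_cat_nat _ _ _ 2 0 n)//=; last exact: ltnW.
rewrite [X in _ = X + _]big_nat [X in _ = X + _]big1 ?add0r; last first.
  by move=> i /andP[_ i2]; rewrite /mixture_coef leqNgt i2 mul0r.
by apply: eq_big_nat => i /andP[i2 _]; rewrite /mixture_coef i2.
Qed.

Definition mixture2_coef c := pseries_diffs (pseries_diffs (mixture_coef c)).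

Lemma mixture2_coef_ge0 c i : 0 <= mixture2_coef c i.
Proof. by apply: mulr_ge0 => //; apply: mulr_ge0 => //; exact: mixture_coef_ge0. Qed.

Section Summable.
Variable c : nat -> R.
Hypothesis hc : cvgn (fun n => \sum_(2 <= p < n) (2 ^+ p * c p ^+ 2 : R)).

Let a := mixture_coef c.
Let a0 i : 0 <= a i. Proof. exact: mixture_coef_ge0. Qed.
Let da0 i : 0 <= pseries_diffs a i. Proof. by rewrite mulr_ge0. Qed.
Let dda0 i : 0 <= pseries_diffs (pseries_diffs a) i. Proof. by rewrite mulr_ge0. Qed.

Lemma mixture_cvg : cvgn (pseries a 2).
Proof.
suff -> : pseries a 2 = fun n => \sum_(2 <= p < n) (2 ^+ p * c p ^+ 2 : R) by exact: hc.
by apply/funext => n; rewrite -mixture_pseries; apply: eq_bigr => i _; rewrite mulrC.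
Qed.

(** Each differentiation costs some radius; 2, 7/4, 3/2 and 5/4 all stay above 1, and the third
    derivative series is what differentiating the first derivative term by term requires. *)
Lemma mixture_diffs_cvg : cvgn (pseries (pseries_diffs a) (7 / 4)).
Proof. by apply: (pseries_diffs_cvg a0 _ _ mixture_cvg); lra. Qed.

Lemma mixture_diffs2_cvg : cvgn (pseries (pseries_diffs (pseries_diffs a)) (3 / 2)).
Proof. by apply: (pseries_diffs_cvg da0 _ _ mixture_diffs_cvg); lra. Qed.

Lemma mixture_diffs3_cvg : cvgn (pseries (pseries_diffs (pseries_diffs (pseries_diffs a))) (5 / 4)).
Proof. by apply: (pseries_diffs_cvg dda0 _ _ mixture_diffs2_cvg); lra. Qed.

Lemma pseries_inside (f : nat -> R) r K : 0 < r -> r < K -> cvgn (pseries f K) -> cvgn (pseries f r).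
Proof. by move=> r0 rK h; apply: is_cvg_pseries_inside h _; rewrite !gtr0_norm//; exact: lt_trans rK. Qed.

(** [mixture2] consists of two-sided derivatives, so the series must be differentiated on a
    neighbourhood of [0, 1], including its right endpoint. *)
Lemma mixture2E x : `|x| < 5 / 4 -> mixture2 c x = limn (pseries (mixture2_coef c) x).
Proof.
move=> hx.
have e0 : mixture c = fun s => limn (pseries a s).
  by apply/funext => s; rewrite /mixture; congr (limn _); apply/funext => n; exact: mixture_pseries.
have d1 (y : R) : `|y| < 3 / 2 -> is_derive y 1 (mixture c) (limn (pseries (pseries_diffs a) y)).
  move=> hy; rewrite e0; apply: (@pseries_snd_diffs _ a (3 / 2)) => //.
  - by apply: pseries_inside mixture_cvg; lra.
  - by apply: pseries_inside mixture_diffs_cvg; lra.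
  - exact: mixture_diffs2_cvg.
  - by rewrite (@ger0_norm _ (3 / 2)).
have d2 : is_derive x 1 (fun y => limn (pseries (pseries_diffs a) y)) (limn (pseries (mixture2_coef c) x)).
  apply: (@pseries_snd_diffs _ (pseries_diffs a) (5 / 4)) => //.
  - by apply: pseries_inside mixture_diffs_cvg; lra.
  - by apply: pseries_inside mixture_diffs2_cvg; lra.
  - exact: mixture_diffs3_cvg.
  - by rewrite (@ger0_norm _ (5 / 4)).
rewrite /mixture2 derive1nS/= derive1E.
rewrite (@near_eq_derive _ _ _ _ (fun y => limn (pseries (pseries_diffs a) y))); first by case: d2.
have hx2 : `]- (3 / 2), 3 / 2[%classic x by rewrite /= in_itv/= -ltr_norml; lra.
have : \forall y \near x, `]- (3 / 2), 3 / 2[%classic y by apply: open_nbhs_nbhs; split => //; exact: interval_open.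
by apply: filterS => y; rewrite /= in_itv/= -ltr_norml => /d1 []; rewrite -derive1E.
Qed.

(* Defined by the series rather than by [mixture2], so that it is measurable and
   bounded on the whole line. *)
Definition xi_ext t : R := limn (pseries (mixture2_coef c) (clamp t)).

Lemma mixture2_cvg t : 0 <= t <= 1 -> cvgn (pseries (mixture2_coef c) t).
Proof.
move=> /andP[t0 t1]; apply: is_cvg_pseries_inside mixture_diffs2_cvg _.
by rewrite !ger0_norm//; lra.
Qed.

Lemma xi_extE t : 0 <= t <= 1 -> xi_ext t = mixture2 c t.
Proof. by move=> t01; rewrite /xi_ext clamp_id// mixture2E//; case/andP: t01 => t0 t1; rewrite ger0_norm//; lra. Qed.

Lemma xi_ext_bounds t : 0 <= xi_ext t <= xi_ext 1.
Proof.
have ht := clamp_itv t; have /andP[t0 t1] := ht.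
have one : 0 <= (1 : R) <= 1 by rewrite ler01 lexx.
apply/andP; split.
  apply: limr_ge; first exact: mixture2_cvg.
  by near=> n; apply: sumr_ge0 => i _; rewrite mulr_ge0 ?exprn_ge0// mixture2_coef_ge0.
rewrite /xi_ext (clamp_id one); apply: ler_lim; [exact: mixture2_cvg|exact: mixture2_cvg|].
by near=> n; apply: pseries_le => // i; exact: mixture2_coef_ge0.
Unshelve. all: by end_near. Qed.

Lemma xi_ext_measurable : measurable_fun setT xi_ext.
Proof.
apply: (measurable_fun_cvg (h := fun n t => pseries (mixture2_coef c) (clamp t) n)).
  move=> n; apply: measurable_sum => i; apply: measurable_funM => //; apply: measurable_funX.
  by apply: continuous_measurable_fun; exact: clamp_continuous.
by move=> t _; apply: mixture2_cvg; exact: clamp_itv.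
Qed.

(** All terms of the series are nonnegative, and the one of degree [p - 2] has coefficient
    [p * (p - 1) * c p ^+ 2]. *)
Lemma xi_ext_ge p t : (2 <= p)%N -> 0 <= t <= 1 -> c p ^+ 2 * t ^+ (p - 2) <= xi_ext t.
Proof.
move=> p2 t01; have /andP[t0 t1] := t01.
rewrite /xi_ext clamp_id//; apply: limr_ge; first exact: mixture2_cvg.
near=> n.
have pn : (p - 2 < n)%N by near: n; exact: nbhs_infty_gt.
rewrite /pseries /series/= (@big_cat_nat _ _ _ (p - 2) 0 n)//=; last exact: ltnW.
rewrite (@big_ltn _ _ _ (p - 2) n)// addrCA.
have s0 m1 m2 : 0 <= \sum_(m1 <= i < m2) mixture2_coef c i * t ^+ i.
  by apply: sumr_ge0 => i _; rewrite mulr_ge0 ?exprn_ge0// mixture2_coef_ge0.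
apply: (@le_trans _ _ (mixture2_coef c (p - 2) * t ^+ (p - 2))); last by rewrite lerDl addr_ge0.
rewrite ler_wpM2r ?exprn_ge0// /mixture2_coef /pseries_diffs.
have -> : (p - 2).+2 = p by rewrite -addn2 subnK.
rewrite /mixture_coef p2 mulrA ler_peMl ?sqr_ge0//.
by rewrite -natrM ler1n muln_gt0/=; exact: ltnW.
Unshelve. all: by end_near. Qed.

End Summable.

Lemma mixture2_zero c : (forall p, (2 <= p)%N -> c p = 0) -> mixture2 c = fun=> 0.
Proof.
move=> h; have e : mixture c = cst 0.
  apply/funext => s; rewrite /mixture (_ : (fun n => _) = fun=> 0); first exact: lim_cst.
  apply/funext => n; rewrite big_nat big1// => i /andP[i2 _].
  by rewrite h// expr0n mul0r.
apply/funext => s; rewrite /mixture2 derive1nS/= e.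
have -> : derive1 (cst (0 : R)) = cst 0 by apply/funext => y; rewrite derive1E derive_cst.
by rewrite derive1E derive_cst.
Qed.

End Mixture.

(** * Distribution functions of measures on [0, 1[ with finite support *)

Section Induced.
Variable R : realType.
Notation mu := (@lebesgue_measure R).
Implicit Types (gamma g : R -> R) (s t u a b c m q : R).

Lemma nondecreasing_measurable g : (forall s t, s <= t -> g s <= g t) -> measurable_fun setT g.
Proof.
move=> hg; apply: (measurability _ (RGenOInfty.measurableE R)) => // _ [_ [x ->] <-]; rewrite setTI; apply: is_interval_measurable => y z /= gy gz w yw.
move: gy; rewrite !in_itv/= !andbT => gy; apply: lt_le_trans gy _.
by apply: hg; case/andP: yw.
Qed.

Variables (nu : {measure set (measurableTypeR R) -> \bar R}) (gamma : R -> R).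
Hypothesis hnu : induces nu gamma.

Lemma induces_ge0 t : 0 <= t < 1 -> 0 <= gamma t.
Proof. by move=> t01; rewrite -lee_fin -(hnu.2 t)//; exact: measure_ge0. Qed.

Lemma induces_mono s t : 0 <= s -> s <= t -> t < 1 -> gamma s <= gamma t.
Proof.
move=> s0 st t1; rewrite -lee_fin -(hnu.2 s) ?in_itv/= ?s0 ?(le_lt_trans st t1)//.
rewrite -(hnu.2 t) ?in_itv/= ?(le_trans s0 st)//; apply: le_measure; rewrite ?inE//.
by move=> z /=; rewrite !in_itv/= => /andP[-> /le_trans]; apply.
Qed.

Lemma induces_add s (c : {nonneg R}) : 0 <= s < 1 ->
  exists nu' : {measure set (measurableTypeR R) -> \bar R},
    induces nu' (fun z => gamma z + (if s <= z then c%:num else 0)).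
Proof.
move=> s01; pose ds := @dirac _ (measurableTypeR R) s R.
pose nu' : {measure set (measurableTypeR R) -> \bar R} := measure_add nu (mscale c ds).
exists nu'.
have E A : nu' A = (nu A + c%:num%:E * \d_s A)%E by exact: measure_addE.
split; first by rewrite E hnu.1 add0e diracE memNset ?mule0.
move=> t t01; rewrite E hnu.2// diracE EFinD; congr (_ + _)%E.
move: s01 => /andP[s0 s1]; case: ifPn => st.
  by rewrite mem_set ?mule1//= in_itv/= s0.
by rewrite memNset ?mule0//= in_itv/= => /andP[_]; exact/negP.
Qed.

Lemma parisi_space_add s (c : {nonneg R}) : 0 <= s < 1 -> parisi_space gamma ->
  parisi_space (fun z => gamma z + (if s <= z then c%:num else 0)).
Proof.
move=> s01 [_ hI]; split; first exact: induces_add.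
have mgam : measurable_fun `[(0 : R), (1 : R)[%classic gamma.
  (* The function may be unbounded near 1 and is arbitrary outside [0, 1[, so measurability is
     obtained on an exhaustion, where truncating the argument gives a monotone function on the
     line. *)
  have -> : `[0, 1[%classic = \bigcup_n `[0, 1 - n.+1%:R^-1]%classic :> set R.
    apply/seteqP; split => [z|z [n _]] /=; rewrite !in_itv/= => /andP[z0 z1].
      have d0 : 0 < 1 - z by rewrite subr_gt0.
      near \oo => n; exists n => //=; rewrite in_itv/= z0/=.
      have : n.+1%:R^-1 < 1 - z by near: n; exact: (near_infty_natSinv_lt (PosNum d0)).
      by move: (n.+1%:R^-1 : R) => e; lra.
    rewrite z0 (le_lt_trans z1)// ltrBlDr ltrDl invr_gt0//.
  apply/measurable_fun_bigcup => // n.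
  pose b : R := 1 - n.+1%:R^-1.
  have b1 : b < 1 by rewrite ltrBlDr ltrDl invr_gt0.
  have b0 : 0 <= b by rewrite subr_ge0 invf_le1// ler1n.
  pose gb z := gamma (Num.min b (Num.max 0 z)).
  have mgb : measurable_fun setT gb.
    apply: nondecreasing_measurable => z w zw; apply: induces_mono.
    - by rewrite le_min b0 le_max lexx.
    - by rewrite le_min ge_min lexx/= ge_min ge_max !le_max lexx zw !orbT.
    - by rewrite gt_min b1.
  apply: (eq_measurable_fun gb); last exact: measurable_funTS.
  move=> z; rewrite inE/= in_itv/= => /andP[z0 zb].
  by rewrite /gb (max_idPr z0) (min_idPr zb).
have mE : measurable_fun `[(0 : R), (1 : R)[%classic (fun t => (if s <= t then c%:num else 0) : R).
  by apply: measurable_funTS; apply: measurable_fun_ifT => //; exact: measurable_fun_ler.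
have -> : (\int[mu]_(t in `[0%R, 1%R[) (gamma t + (if s <= t then c%:num else 0))%:E =
    \int[mu]_(t in `[0%R, 1%R[) ((gamma t)%:E + ((if s <= t then c%:num else 0) : R)%:E))%E.
  by apply: eq_integral => t _; rewrite EFinD.
rewrite ge0_integralD//=.
- apply: lte_add_pinfty => //.
  apply: (@le_lt_trans _ _ (\int[mu]_(t in `[0%R, 1%R[) (c%:num : R)%:E)%E).
    apply: ge0_le_integral => //.
    - by move=> t _; rewrite lee_fin; case: ifP.
    - exact/measurable_EFinP.
    - by move=> t _; rewrite lee_fin; case: ifP.
  by rewrite integral_cst//= lebesgue_measure_itv/= lte_fin ltr01 -EFinD subr0 mule1 ltry.
- by move=> t; rewrite /= in_itv/= => t01; rewrite lee_fin; exact: induces_ge0.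
- exact/measurable_EFinP.
- by move=> t _; rewrite lee_fin; case: ifP.
- exact/measurable_EFinP.
Unshelve. all: by end_near. Qed.

Hypothesis hfin : finite_set (measure_support nu).

Lemma finite_gap (S : set R) a b : finite_set S -> a < b ->
  (exists u, [/\ a < u, u <= b & forall x, S x -> ~ (a < x < u)]) /\
  (exists s, [/\ a <= s, s < b & forall x, S x -> ~ (s < x < b)]).
Proof.
move=> /finite_seqP[l ->] ab; elim: l => [|y l [[u [au ub hu]] [s [as_ sb hs]]]].
  by split; [exists b|exists a]; split.
split.
  have [ya|ay] := leP y a.
    exists u; split => // x; rewrite /= inE => /orP[/eqP ->|/hu//].
    by move=> /andP[h _]; move: h; rewrite ltNge ya.
  exists (Num.min u y); split; [by rewrite lt_min au|by rewrite ge_min ub|].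
  move=> x; rewrite /= inE => /orP[/eqP ->|/hu h]; first by rewrite lt_min ltxx andbF andbF.
  by rewrite lt_min => /and3P[h1 h2 _]; apply: h; rewrite h1.
have [yb|yb] := leP b y.
  exists s; split => // x; rewrite /= inE => /orP[/eqP ->|/hs//].
  by move=> /andP[_ h]; move: h; rewrite ltNge yb.
exists (Num.max s y); split; [by rewrite le_max as_|by rewrite gt_max sb|].
move=> x; rewrite /= inE => /orP[/eqP ->|/hs h]; first by rewrite gt_max ltxx andbF.
by rewrite gt_max => /andP[/andP[h1 _] h2]; apply: h; rewrite h1.
Qed.

Lemma null_open_constant (U : set R) s t : open U -> nu U = 0%E -> 0 <= s -> s <= t -> t < 1 ->
  (forall z, s <= z <= t -> U z) -> gamma s = gamma t.
Proof.
move=> oU U0 s0 st t1 hU; apply: EFin_inj.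
have t0 := le_trans s0 st; have s1 := le_lt_trans st t1.
rewrite -(hnu.2 s) ?in_itv/= ?s0// -(hnu.2 t) ?in_itv/= ?t0//.
have mU : measurable (U : set (measurableTypeR R)) by exact: open_measurable.
apply/eqP; rewrite eq_le; apply/andP; split.
  by apply: le_measure; rewrite ?inE// => z /=; rewrite !in_itv/= => /andP[-> /le_trans]; apply.
have : (nu `[0%R, t]%classic <= nu (`[0%R, s]%classic `|` U))%E.
  apply: le_measure; rewrite ?inE//; first exact: measurableU.
  move=> z /=; rewrite !in_itv/= => /andP[z0 zt]; have [zs|zs] := leP z s; first by left; rewrite /= z0.
  by right; apply: hU; rewrite zt ltW.
move=> hle; apply: le_trans hle _; apply: (@le_trans _ _ (nu `[0%R, s]%classic + nu U)%E); first exact: measureU2.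
by rewrite U0 adde0.
Qed.

(** Every point of the gap has a null neighbourhood, so the function is locally constant there; the
    mean value inequality with zero derivative makes it constant, in place of a compactness
    argument. *)
Lemma gap_constant a b : 0 <= a -> b <= 1 -> (forall x, measure_support nu x -> ~ (a < x < b)) ->
  forall x y, a < x -> x <= y -> y < b -> gamma x = gamma y.
Proof.
move=> a0 b1 h x y ax xy yb.
have dz z : a < z < b -> is_derive z 1 gamma 0.
  move=> /andP[az zb].
  have : ~ (forall U : set R, open U -> U z -> (0 < nu U)%E).
    by move=> hU; apply: (h z); [split=> //; rewrite in_itv/= (le_trans a0 (ltW az)) (lt_le_trans zb b1)|rewrite az].
  move=> /existsNP[U /not_implyP[oU /not_implyP[Uz /negP]]]; rewrite -leNgt => hle.
  have U0 : nu U = 0%E by apply/eqP; rewrite eq_le hle measure_ge0.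
  have nU : nbhs z (U `&` `]a, b[%classic).
    apply: open_nbhs_nbhs; split; first by apply: openI => //; exact: interval_open.
    by split => //=; rewrite in_itv/= az.
  move: nU; rewrite -nbhs_ballE => -[d /= d0 hd].
  have c w : `|z - w| < d -> gamma w = gamma z.
    move=> zw; have bw v : Num.min z w <= v <= Num.max z w -> (U `&` `]a, b[%classic) v.
      move=> /andP[v1 v2]; apply: hd; rewrite /ball/=.
      by move: zw v1 v2; rewrite !ltr_norml; case: (leP z w) => _; move=> /andP[h1 h2] v1 v2; apply/andP; split; lra.
    have rng v : Num.min z w <= v <= Num.max z w -> 0 <= v < 1.
      by move=> /bw[_ /=]; rewrite in_itv/= => /andP[v1 v2]; rewrite (le_trans a0 (ltW v1)) (lt_le_trans v2 b1).
    have mn : Num.min z w <= Num.max z w by rewrite le_max ge_min lexx.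
    have /andP[r1 r2] := rng (Num.min z w) (introT andP (conj (lexx _) mn)).
    have /andP[r3 r4] := rng (Num.max z w) (introT andP (conj mn (lexx _))).
    have := null_open_constant oU U0 r1 mn r4 (fun v hv => (bw v hv).1).
    by case: (leP z w).
  apply: (@near_eq_is_derive _ _ _ (cst (gamma z))) => //.
  have : \forall w \near z, `|z - w| < d by exists d.
  by apply: filterS => w hw; rewrite (c w hw).
have p1 z : Num.min x y <= z <= Num.max x y -> is_derive z 1 gamma 0.
  move=> /andP[z1 z2]; apply: dz; rewrite (min_idPl xy) in z1; rewrite (max_idPr xy) in z2.
  by rewrite (lt_le_trans ax z1) (le_lt_trans z2 yb).
have p2 z : Num.min x y <= z <= Num.max x y -> `|0 : R| <= 0 by rewrite normr0.
have := @mean_value_bound R gamma (fun=> 0) 0 x y p1 p2.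
by rewrite mul0r normr_le0 subr_eq0 => /eqP.
Qed.

(** Right continuity of a distribution function: the measure is continuous along decreasing
    intervals, all of which have the finite mass [m]. *)
Lemma induces_right_continuous t b m : 0 <= t -> t < b -> b <= 1 -> (forall z, t < z < b -> gamma z = m) -> gamma t = m.
Proof.
move=> t0 tb b1 hm; apply: EFin_inj.
have t1 := lt_le_trans tb b1.
rewrite -(hnu.2 t) ?in_itv/= ?t0//.
(* The offset in [n.+2] keeps the right endpoint strictly below [b], already for [n = 0]. *)
pose F n : set R := `[0, t + (b - t) * n.+2%:R^-1]%classic.
have e0 n : 0 < (b - t) * n.+2%:R^-1 by rewrite mulr_gt0 ?subr_gt0 ?invr_gt0.
have e1 n : (b - t) * n.+2%:R^-1 < b - t.
  by rewrite ltr_pdivrMr ?ltr0n// ltr_pMr ?subr_gt0// ltr1n.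
have eb n : t + (b - t) * n.+2%:R^-1 < b by rewrite -ltrBrDl.
have nuF n : nu (F n) = m%:E.
  rewrite hnu.2 ?hm//; first by rewrite ltrDl e0 eb.
  by rewrite in_itv/= (lt_le_trans (eb n) b1) addr_ge0// ltW.
have FI : \bigcap_n F n = `[0, t]%classic.
  apply/seteqP; split => z.
    move=> h; have h0 := h 0%N I; move: h0; rewrite /F /= in_itv/= => /andP[z0 _]; rewrite in_itv/= z0/=.
    apply/ler_addgt0Pr => e ep.
    have bt : 0 < b - t by rewrite subr_gt0.
    have d0 : 0 < e / (b - t) by rewrite divr_gt0.
    near \oo => n.
    have := h n I; rewrite /F /= in_itv/= => /andP[_ /le_trans]; apply; rewrite lerD2l mulrC -ler_pdivlMr//.
    apply: (@le_trans _ _ n.+1%:R^-1); first by rewrite lef_pV2 ?posrE// ler_nat.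
    by apply: ltW; near: n; exact: (near_infty_natSinv_lt (PosNum d0)).
  rewrite /= in_itv/= => /andP[z0 zt] n _; rewrite /F /= in_itv/= z0 (le_trans zt)// lerDl ltW//.
have := @nonincreasing_cvg_mu _ _ _ nu F.
rewrite FI nuF ltry => /(_ isT (fun n => measurable_itv _) (measurable_itv _)) hc.
have ni : nonincreasing_seq F.
  apply/nonincreasing_seqP => n; apply/subsetPset => z; rewrite /F /= !in_itv/= => /andP[-> /le_trans]; apply.
  by rewrite lerD2l ler_wpM2l// ?subr_ge0 ?(ltW tb)// lef_pV2 ?posrE// ler_nat.
have c1 := hc ni.
have c2 : nu \o F @ \oo --> m%:E.
  by rewrite (_ : nu \o F = fun=> m%:E); [exact: cvg_cst|apply/funext => n; rewrite /= nuF].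
exact: (cvg_unique _ c1 c2).
Unshelve. all: by end_near. Qed.

Lemma induces_locally_constant : locally_constant gamma.
Proof.
split=> t /andP[t0 t1].
  have [_ [s [s0 st hs]]] := finite_gap hfin t0.
  (* The gap is open at [s], where there may be an atom or mass, so the interval of constancy starts
     at an interior point. *)
  pose s' := (s + t) / 2.
  have ss' : s < s' by rewrite /s'; lra.
  have s't : s' < t by rewrite /s'; lra.
  have s'0 : 0 <= s' by exact: le_trans s0 (ltW ss').
  exists s', (gamma s'); split => //.
    by apply: induces_ge0; rewrite s'0 (lt_le_trans s't t1).
  by move=> z /andP[z1 z2]; symmetry; exact: (gap_constant s0 t1 hs ss' z1 z2).
have [[u [tu u1 hu]] _] := finite_gap hfin t1.
pose u' := (t + u) / 2.
have tu' : t < u' by rewrite /u'; lra.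
have u'u : u' < u by rewrite /u'; lra.
have cst z : t < z < u -> gamma z = gamma u'.
  move=> /andP[z1 z2]; have [zu|uz] := leP z u'.
    exact: (gap_constant t0 u1 hu z1 zu u'u).
  by symmetry; exact: (gap_constant t0 u1 hu tu' (ltW uz) z2).
exists u, (gamma u'); split => //.
  by apply: induces_ge0; rewrite (le_trans t0 (ltW tu')) (lt_le_trans u'u u1).
move=> z /andP[z1 z2]; have [->|zt] := eqVneq z t; first exact: (induces_right_continuous t0 tu u1 cst).
by apply: cst; rewrite z2 lt_neqAle eq_sym zt z1.
Qed.

End Induced.

(** * The subtracted integral, and positivity of solutions *)

Section Energy.
Variable R : realType.
Notation mu := (@lebesgue_measure R).
Implicit Types (xi g : R -> R) (s t a b m G X : R).

(** The equation sees the two coefficients only through [xi] and the product [xi * g] on [0, 1[.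
    This allows bounded measurable extensions to the line, and makes [g] irrelevant when [xi] is
    zero. *)
Lemma parisi_weak_solution_congr xi xi' g g' Psi :
  (forall t, 0 <= t < 1 -> xi t = xi' t /\ xi t * g t = xi' t * g' t) ->
  parisi_weak_solution xi g Psi -> parisi_weak_solution xi' g' Psi.
Proof.
move=> e [cP [D hD hw]]; split; first exact: cP.
exists D; first exact: hD.
move=> phi hphi.
rewrite (@int_strip_eq R _ (fun t x => - (Psi t x * dt phi t x) +
  xi t / 2 * (Psi t x * dx (dx phi) t x + g t * D t x ^+ 2 * phi t x))); first exact: (hw phi hphi).
move=> t x t01; have [e1 e2] := e t t01.
have E (z A y u w : R) : z / 2 * (A + y * u * w) = z / 2 * A + (z * y) / 2 * (u * w) by ring.
by rewrite !E -e2 -e1.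
Qed.

Lemma locally_constant_congr f g : (forall t, 0 <= t < 1 -> f t = g t) -> locally_constant f -> locally_constant g.
Proof.
move=> e [hl hr]; split=> t /andP[t0 t1].
  have [s [m [s0 st m0 hm]]] := hl t (introT andP (conj t0 t1)).
  exists s, m; split => // z /andP[z1 z2].
  by rewrite -(hm z) ?z1// e// (le_trans s0 z1) (lt_le_trans z2 t1).
have [u [m [tu u1 m0 hm]]] := hr t (introT andP (conj t0 t1)).
exists u, m; split => // z /andP[z1 z2].
by rewrite -(hm z) ?z1// e// (le_trans t0 z1) (lt_le_trans z2 u1).
Qed.

Lemma locally_constant_step g s b : 0 <= b -> 0 <= s ->
  locally_constant g -> locally_constant (fun z => g z + (if s <= z then b else 0)).
Proof.
move=> b0 s0 [hl hr]; split=> t /andP[t0 t1].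
  have [u [m [u0 ut m0 hm]]] := hl t (introT andP (conj t0 t1)).
  have [st|ts] := ltP s t.
    exists (Num.max s u), (m + b); split; [by rewrite le_max s0|by rewrite gt_max st|exact: addr_ge0|].
    by move=> z /andP[]; rewrite ge_max => /andP[sz uz] zt; rewrite sz hm// uz.
  exists u, m; split => // z /andP[z1 z2].
  by rewrite hm ?z1// leNgt (lt_le_trans z2 ts)/= addr0.
have [u [m [tu u1 m0 hm]]] := hr t (introT andP (conj t0 t1)).
have [st|ts] := leP s t.
  exists u, (m + b); split => //; first exact: addr_ge0.
  by move=> z /andP[z1 z2]; rewrite hm ?z1// (le_trans st z1).
exists (Num.min s u), m; split => //; [by rewrite lt_min ts|by rewrite ge_min u1 orbT|].
by move=> z /andP[z1]; rewrite lt_min => /andP[zs zu]; rewrite hm ?z1// leNgt zs/= addr0.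
Qed.

Lemma parisi_space_step g s (b : {nonneg R}) : 0 <= s < 1 -> parisi_space g ->
  parisi_space (fun z => g z + (if s <= z then b%:num else 0)).
Proof. by move=> s01 hg; have [[nu hnu] _] := hg; exact: (parisi_space_add hnu). Qed.

Lemma step_measurable s b : measurable_fun setT (fun z : R => if s <= z then b else 0).
Proof. by apply: measurable_fun_ifT => //; exact: measurable_fun_ler. Qed.

Variables (xi : R -> R) (X : R).
Hypothesis mxi : measurable_fun setT xi.
Hypothesis hxi : forall t, 0 <= xi t <= X.

Lemma chop_ge0 m L v f y : 0 < m -> Lip L f -> (forall z, 0 <= f z) -> 0 <= chop m v f y.
Proof.
move=> m0 hf f0.
have l0 : Lip 0 (fun _ : R => 0) by move=> x z; rewrite subrr normr0 mul0r.
apply: le_trans (chop_le _ _ m0 l0 hf f0).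
rewrite /chop cumulant.unlock (_ : (fun _ => _) = fun=> 1); last by apply/funext => z; rewrite mulr0 expR0.
by rewrite gmean_cst ln1 mulr0.
Qed.

(** The weight [t] is bounded below by [s'] on [s', 1[ only. A free [s'] beyond [s] keeps the gain
    positive when the mass is added at [s = 0]. *)
Lemma energy_step g G s s' b : measurable_fun setT g -> (forall t, 0 <= g t <= G) ->
  0 <= s -> s <= s' -> s' < 1 -> 0 <= b ->
  \int[mu]_(t in `[0, 1[) (t * xi t * g t) + b * s' * vol xi s' 1 <=
  \int[mu]_(t in `[0, 1[) (t * xi t * (g t + (if s <= t then b else 0))).
Proof.
move=> mg hg s0 ss s1 b0.
have lid : locbdd (fun t : R => t) by apply: continuous_locbdd => t; exact: cvg_id.
have lxi : locbdd xi by apply: (bounded_locbdd mxi) => t; have /andP[h1 h2] := hxi t; rewrite ger0_norm//; exact: h2.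
have lg : locbdd g by apply: (bounded_locbdd mg) => t; have /andP[h1 h2] := hg t; rewrite ger0_norm//; exact: h2.
have lst : locbdd (fun t : R => if s <= t then b else 0).
  by apply: (@bounded_locbdd _ _ b); [exact: step_measurable|move=> t; case: ifP; rewrite ?normr0 ?ger0_norm].
have l1 := locbdd_mul lid lxi.
have l2 := locbdd_mul l1 lg; have l3 := locbdd_mul l1 lst.
have -> : (fun t : R => t * xi t * (g t + (if s <= t then b else 0))) =
   (fun t => t * xi t * g t + t * xi t * (if s <= t then b else 0)).
  by apply/funext => t; rewrite mulrDr.
rewrite (@RintegralD _ _ _ mu)//; [|exact: locbdd_itv l2|exact: locbdd_itv l3].
rewrite lerD2l (integral_itv_split l3 (_ : 0 <= s' <= 1)); last by rewrite (le_trans s0 ss) ltW.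
rewrite -[leLHS]add0r; apply: lerD.
  apply: Rintegral_ge0 => t; rewrite /= in_itv/= => /andP[t0 _].
  by have /andP[h1 _] := hxi t; rewrite !mulr_ge0//; case: ifP.
rewrite (vol_scale mxi hxi); apply: le_Rintegral => //.
- by apply: locbdd_itv; apply: (locbdd_mul lxi); exact: locbdd_cst.
- exact: locbdd_itv.
move=> t; rewrite /= in_itv/= => /andP[st _]; rewrite (le_trans ss st).
have /andP[h1 _] := hxi t.
rewrite (_ : xi t * (b * s') = s' * (xi t * b)); last by ring.
by rewrite -(mulrA t); apply: ler_wpM2r => //; exact: mulr_ge0.
Qed.

(** Needed to compare a true solution with the default value 0 of [parisi_Psi]. *)
Lemma level_solution_ge0 g P t y : locally_constant g -> level_solution xi g P -> 0 <= t <= 1 -> 0 <= P t y.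
Proof.
move=> hg hP t01; move: t t01 y.
have T1 : 0 <= (1 : R) <= 1 by rewrite ler01 lexx.
apply: (level_induction hg T1); last by move=> y; rewrite (ls_one hP).
move=> a b m a0 ab b1 m0 hm hb y.
apply: (@le_of_natinv _ _ _ (vol xi a b / 2)) => j.
have m'0 : 0 < m + j.+1%:R^-1 by rewrite ltr_wpDl// invr_gt0.
have mm' : m <= m + j.+1%:R^-1 by rewrite lerDl invr_ge0.
have b01 : 0 <= b <= 1 by rewrite b1 (le_trans a0 (ltW ab)).
have h1 := ls_lower hP y a0 (ltW ab) b1 m0 hm m'0 mm'.
have h2 : 0 <= chop (m + j.+1%:R^-1) (vol xi a b) (P b) y.
  exact: (chop_ge0 _ y m'0 (ls_Lip hP b01) hb).
move: h1; rewrite addrAC subrr add0r.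
have -> : j.+1%:R^-1 / 2 * vol xi a b = vol xi a b / 2 * j.+1%:R^-1 by ring.
by move: (vol xi a b / 2 * _) (chop _ _ _ _) h2 => e1 e2; lra.
Qed.

End Energy.

(** * Levels and variance for a concrete mixture *)

Section Mixture2.
Variables (R : realType) (c : nat -> R).
Hypothesis hc : cvgn (fun n => \sum_(2 <= p < n) (2 ^+ p * c p ^+ 2 : R)).
Notation mu := (@lebesgue_measure R).
Notation xi := (xi_ext c).
Implicit Types (f g : R -> R) (s t a b G : R).

Let mxi := xi_ext_measurable hc.
Let hxi := xi_ext_bounds hc.

Lemma mixture_vol_ge p a b : (2 <= p)%N -> 0 <= a -> a <= b -> b <= 1 ->
  c p ^+ 2 * a ^+ (p - 2) * (b - a) <= vol xi a b.
Proof.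
move=> p2 a0 ab b1.
have lxi : locbdd xi by apply: (bounded_locbdd mxi) => t; have /andP[h1 h2] := hxi t; rewrite ger0_norm//; exact: h2.
set K := c p ^+ 2 * _.
have -> : K * (b - a) = \int[mu]_(x in `[a, b[) (K : R).
  by rewrite Rintegral_cst//= lebesgue_measure_itv/= lte_fin; move: ab; rewrite le_eqVlt => /predU1P[->|->//]; rewrite ltxx subrr.
rewrite vol.unlock; apply: le_Rintegral => //.
- by apply: locbdd_itv; exact: locbdd_cst.
- exact: locbdd_itv.
move=> t; rewrite /= in_itv/= => /andP[at_ tb].
have t0 := le_trans a0 at_.
have t01 : 0 <= t <= 1 by rewrite t0 (le_trans (ltW tb) b1).
apply: le_trans (xi_ext_ge hc p2 t01); apply: ler_wpM2l; first exact: sqr_ge0.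
by apply: lerXn2r.
Qed.

Lemma mixture_vol_gt0 p a b : (2 <= p)%N -> c p != 0 -> 0 <= a -> a < b -> b <= 1 -> 0 < vol xi a b.
Proof.
(* The lower bound on the variance degenerates at [a = 0] for [p > 2]; only the right half of the
   interval is used. *)
move=> p2 cp a0 ab b1; pose d := (a + b) / 2.
have ad : a < d by rewrite /d; lra.
have db : d < b by rewrite /d; lra.
rewrite (vol_add mxi hxi (ltW ad) (ltW db)) ltr_wpDl ?(vol_ge0 hxi)//.
have d0 : 0 < d by exact: le_lt_trans ad.
apply: lt_le_trans (mixture_vol_ge p2 (ltW d0) (ltW db) b1).
by apply: mulr_gt0; [apply: mulr_gt0; [rewrite lt0r expf_neq0// sqr_ge0|exact: exprn_gt0]|rewrite subr_gt0].
Qed.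

Lemma mixture2_energy g g' : (forall t, 0 <= t < 1 -> g t = g' t) ->
  \int[mu]_(t in `[0, 1[) (t * mixture2 c t * g t) = \int[mu]_(t in `[0, 1[) (t * xi t * g' t).
Proof.
move=> e; apply: eq_Rintegral => t; rewrite inE/= in_itv/= => /andP[t0 t1].
by rewrite (xi_extE hc) ?t0 ?ltW// e ?t0.
Qed.

Lemma weak_level_solution f g G Psi : measurable_fun setT f -> (forall t, 0 <= f t <= G) -> locally_constant f ->
  (forall t, 0 <= t < 1 -> f t = g t) -> parisi_weak_solution (mixture2 c) g Psi ->
  let P := fun t x => Psi (clamp t) x in
  exists M D, regular_solution xi f M P D /\ level_solution xi f P.
Proof.
move=> mf hf lf e hw P.
have hw' : parisi_weak_solution xi f Psi.
  apply: parisi_weak_solution_congr hw => t t01; have /andP[t0 t1] := t01.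
  by rewrite (xi_extE hc) ?t0 ?ltW// e.
have [M [D [M0 hD]]] := regular_of_weak mxi mf hxi hf hw'.
by exists M, D; split => //; apply: (regular_level_solution mxi hxi mf hf M0 lf hD).
Qed.

End Mixture2.

(** * The minimizer: existence of its solution, and the contradiction *)

Section Minimizer.
Variables (R : realType) (c : nat -> R) (h : R) (gam : R -> R).
Hypothesis hc : cvgn (fun n => \sum_(2 <= p < n) (2 ^+ p * c p ^+ 2 : R)).
Hypothesis hP : is_the_parisi_minimizer c h gam.
Notation mu := (@lebesgue_measure R).
Notation xi := (xi_ext c).
Notation X := (xi_ext c 1).
Implicit Types (f g : R -> R) (s t a b : R).

Let mxi := xi_ext_measurable hc.
Let hxi := xi_ext_bounds hc.

Lemma parisi_functional_no_solution g : ~ (exists Psi, parisi_weak_solution (mixture2 c) g Psi) ->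
  parisi_functional c h g = - (2^-1 * \int[mu]_(t in `[0, 1[) (t * mixture2 c t * g t)).
Proof.
move=> hn; rewrite /parisi_functional /parisi_Psi xgetPN ?sub0r// => Psi hPsi.
by apply: hn; exists Psi.
Qed.

Lemma parisi_Psi_weak g : (exists Psi, parisi_weak_solution (mixture2 c) g Psi) ->
  parisi_weak_solution (mixture2 c) g (parisi_Psi (mixture2 c) g).
Proof. by move=> [Psi hPsi]; rewrite /parisi_Psi; case: xgetP => [Psi' -> //|/(_ Psi)]. Qed.

Lemma minimizer_step s (b : {nonneg R}) : 0 <= s < 1 ->
  parisi_functional c h gam <= parisi_functional c h (fun z => gam z + (if s <= z then b%:num else 0)).
Proof. by move=> s01; have [h1 h2 _] := hP; apply: h2; exact: parisi_space_step. Qed.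

Lemma mixture_nonzero : exists2 p, (2 <= p)%N & c p != 0.
Proof.
apply: contrapT => hn.
have z : mixture2 c = fun=> 0.
  by apply: mixture2_zero => p p2; apply/eqP/negPn/negP => cp; apply: hn; exists p.
have e g : parisi_functional c h g = parisi_functional c h gam.
  have eS : [set Psi | parisi_weak_solution (fun=> 0) g Psi] = [set Psi | parisi_weak_solution (fun=> 0) gam Psi].
    by apply/funext => Psi; apply/propext; split; apply: parisi_weak_solution_congr => t _; rewrite !mul0r.
  have eI (f : R -> R) : \int[mu]_(t in `[0, 1[) (t * (fun=> 0) t * f t) = \int[mu]_(t in `[0, 1[) (0 : R).
    by apply: eq_Rintegral => t _; rewrite mulr0 mul0r.
  by rewrite /parisi_functional /parisi_Psi z eS (eI g) (eI gam).
have [h1 h2 h3] := hP.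
have z01 : 0 <= (0 : R) < 1 by rewrite lexx ltr01.
(* Adding unit mass at 0 gives a competitor that differs from [gam] at 0 and yet has the same value
   of the functional. *)
have hm g : parisi_space g -> parisi_functional c h (fun z => gam z + (if 0 <= z then 1 else 0)) <= parisi_functional c h g.
  by move=> _; rewrite (e g) (e (fun _ => _)).
have z0I : (0 : R) \in `[0, 1[ by rewrite in_itv/=.
have : gam 0 + (if 0 <= 0 :> R then 1 else 0) = gam 0 := h3 _ (@parisi_space_step R gam 0 (NngNum (ler01 : 0 <= (1 : R))) z01 h1) hm 0 z0I.
by move/eqP; rewrite lexx -subr_eq0 addrAC subrr add0r oner_eq0.
Qed.

Variable nu : {measure set (measurableTypeR R) -> \bar R}.
Hypothesis hnu : induces nu gam.
Hypothesis hfin : finite_set (measure_support nu).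

(** Freezing the argument at 0 on the left and at some [q] inside the last level on the right keeps
    the values on [0, 1[ and gives a bounded monotone function on the whole line, as the analytic
    part requires. *)
Lemma finite_support_extension : exists g G q m,
  [/\ measurable_fun setT g, forall t, 0 <= g t <= G, locally_constant g, forall t, 0 <= t < 1 -> g t = gam t &
    [/\ 0 < q < 1, 0 <= m & constant_on g q 1 m]].
Proof.
have lc := induces_locally_constant hnu hfin.
have l1 : 0 < (1 : R) <= 1 by rewrite ltr01 lexx.
have [s [m [s0 s1 m0 hm]]] := lc.1 1 l1.
pose q := (s + 1) / 2.
have sq : s < q by rewrite /q; lra.
have q1 : q < 1 by rewrite /q; lra.
have q0 : 0 < q by exact: le_lt_trans sq.
pose k t := Num.min q (Num.max 0 t).
have k01 t : 0 <= k t <= q by rewrite /k le_min ge_min lexx (ltW q0) le_max lexx.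
have kmono t t' : t <= t' -> k t <= k t'.
  by move=> tt; rewrite /k le_min ge_min lexx/= ge_min ge_max !le_max lexx tt !orbT.
have gE t : 0 <= t < 1 -> gam (k t) = gam t.
  move=> /andP[t0 t1]; rewrite /k (max_idPr t0).
  have [qt|//] := leP q t.
  by rewrite !hm ?(ltW sq)// ?t1 ?q1// (le_trans (ltW sq) qt).
exists (fun t => gam (k t)), (gam q), q, m; split.
- apply: nondecreasing_measurable => t t' tt; have /andP[h1 h2] := k01 t; have /andP[h3 h4] := k01 t'.
  by apply: (induces_mono hnu) => //; [exact: kmono|exact: le_lt_trans q1].
- move=> t; have /andP[h1 h2] := k01 t; apply/andP; split.
    by apply: (induces_ge0 hnu); rewrite h1 (le_lt_trans h2 q1).
  exact: (induces_mono hnu).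
- by apply: locally_constant_congr lc => t t01; rewrite gE.
- exact: gE.
split; [by rewrite q0|exact: m0|].
move=> z /andP[z1 z2]; rewrite gE ?z2 ?andbT ?(le_trans (ltW q0) z1)//.
by apply: hm; rewrite z2 (le_trans (ltW sq) z1).
Qed.

(* [parisi_Psi] takes the junk value 0 when there is no weak solution.  If that
   happened at [gam], then [gam + 1/(n+1)] would have a solution for every [n], for
   otherwise its functional would be smaller; these solutions converge to one for [gam]. *)
Lemma minimizer_weak_solution : exists Psi, parisi_weak_solution (mixture2 c) gam Psi.
Proof.
apply: contrapT => hn.
have [p p2 cp] := mixture_nonzero.
have vgt0 a b := @mixture_vol_gt0 _ _ hc p a b p2 cp.
have [g [G [q [m [mg hg lg gE _]]]]] := finite_support_extension.
have gE' t : 0 <= t < 1 -> gam t = g t by move=> t01; rewrite gE.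
pose e n : R := n.+1%:R^-1.
have e0 n : 0 < e n by rewrite invr_gt0.
have eng n : 0 <= e n by exact: ltW.
have e1 n : e n <= 1 by rewrite invf_le1// ler1n.
have hs n : exists Psi, parisi_weak_solution (mixture2 c) (fun z => gam z + (if 0 <= z then e n else 0)) Psi.
  apply: contrapT => hn'.
  have z01 : 0 <= (0 : R) < 1 by rewrite lexx ltr01.
  have := @minimizer_step 0 (NngNum (eng n)) z01.
  rewrite (parisi_functional_no_solution hn) (parisi_functional_no_solution hn').
  rewrite (mixture2_energy hc gE').
  rewrite (@mixture2_energy _ _ hc _ (fun z => g z + (if 0 <= z then e n else 0))); last by move=> t t01; rewrite gE.
  (* The mass is added at 0; the part of the integral beyond 1/2 already makes the increase strictly
     positive. *)
  have := energy_step mxi hxi mg hg (lexx 0) (_ : 0 <= 2^-1) (_ : 2^-1 < 1) (eng n).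
  rewrite invr_ge0 ler0n invf_lt1// ltr1n => /(_ isT isT).
  have v0 : 0 < e n * 2^-1 * vol xi 2^-1 1.
    by rewrite !mulr_gt0// vgt0// ?invr_ge0// invf_lt1// ltr1n.
  move: (e n * 2^-1 * _) v0 => v v0.
  move=> hle; rewrite lerN2 ler_pM2l ?invr_gt0// => hle2.
  by have := le_trans hle hle2; rewrite gerDl leNgt v0.
have /choice[Psi hPsi] := hs.
pose f n z := g z + e n.
have mf n : measurable_fun setT (f n) by apply: measurable_funD.
have hf n t : 0 <= f n t <= G + 1.
  by have /andP[h1 h2] := hg t; rewrite /f addr_ge0// lerD.
have lf n : locally_constant (f n).
  have := locally_constant_step (eng n) (lexx 0) lg; apply: locally_constant_congr => t /andP[t0 _].
  by rewrite t0.
have fE n t : 0 <= t < 1 -> f n t = gam t + (if 0 <= t then e n else 0).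
  by move=> t01; rewrite /f gE//; case/andP: t01 => ->.
have hR n : exists MD : R * (R -> R -> R), regular_solution xi (f n) MD.1 (fun t x => Psi n (clamp t) x) MD.2 /\
    level_solution xi (f n) (fun t x => Psi n (clamp t) x).
  have [M [D hMD]] := weak_level_solution hc (mf n) (hf n) (lf n) (fE n) (hPsi n).
  by exists (M, D).
have /choice[MD hMD] := hR.
pose P_ n t x := Psi n (clamp t) x.
have X0 : 0 <= X by have /andP[h1 h2] := hxi 0; exact: le_trans h2.
have clampP n t x : P_ n t x = P_ n (clamp t) x by rewrite /P_ (clamp_id (clamp_itv t)).
(* The approximations decrease with the index and stay within [e n * X] of one another, which yields
   the limit and a uniform rate at once. *)
have sh n k t x : (n <= k)%N -> P_ k t x <= P_ n t x <= P_ k t x + e n * X.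
  move=> nk; rewrite !(clampP _ t); have ct := clamp_itv t; move: (clamp t) ct => u u01.
  have ekn : e k <= e n by rewrite lef_pV2 ?posrE// ler_nat.
  have := level_solution_shift mxi hxi x lg (eng k) ekn (e0 k) (hMD n).2 (hMD k).2 u01.
  rewrite -/(P_ n) -/(P_ k) => /andP[h1 h2]; rewrite h1; apply: le_trans h2 _; rewrite lerD2l.
  have v1 : vol xi u 1 <= X.
    case/andP: u01 => u0 u1; apply: le_trans (vol_le mxi hxi u1) _.
    by rewrite -[leRHS]mulr1; apply: ler_wpM2l => //; rewrite gerBl.
  have v0 := @vol_ge0 _ _ _ hxi u 1.
  apply: ler_pM => //; last by have := eng k; have := eng n; lra.
  by rewrite divr_ge0// subr_ge0.
pose P t x := limn (fun n => P_ n t x).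
have cvP t x : P_ n t x @[n --> \oo] --> P t x.
  apply: nonincreasing_is_cvgn.
    by move=> n k nk; have /andP[] := sh n k t x nk.
  exists (P_ 0%N t x - e 0%N * X) => _ [n _ <-]; have /andP[_] := sh 0%N n t x (leq0n n).
  by rewrite lerBlDr.
have hPP n t x : `|P_ n t x - P t x| <= e n * X.
  rewrite ler_norml; apply/andP; split.
    suff : P t x <= P_ n t x by have := mulr_ge0 (eng n) X0; move: (e n * X) => w; lra.
    apply: limr_le; first by apply/cvg_ex; exists (P t x).
    by near=> k; have /andP[] : P_ k t x <= P_ n t x <= P_ k t x + e n * X by apply: sh; near: k; exact: nbhs_infty_ge.
  rewrite lerBlDl -lerBlDr.
  apply: limr_ge; first by apply/cvg_ex; exists (P t x).
  near=> k; have /andP[_] : P_ k t x <= P_ n t x <= P_ k t x + e n * X by apply: sh; near: k; exact: nbhs_infty_ge.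
  by rewrite lerBlDr.
have ce : e n @[n --> \oo] --> (0 : R).
  by apply/cvgrPdist_lt => d d0; near=> n; rewrite sub0r normrN gtr0_norm//; near: n; exact: (near_infty_natSinv_lt (PosNum d0)).
have ceX : e n * X @[n --> \oo] --> (0 : R).
  by rewrite -(mul0r X); apply: cvgM => //; exact: cvg_cst.
have cP : continuous (uncurry2 P).
  move=> z; apply/cvgrPdist_le => d d0.
  have d3 : 0 < d / 3 by rewrite divr_gt0.
  have [n _ hn3] : \forall n \near \oo, `|0 - e n * X| <= d / 3 by move/cvgrPdist_le: ceX; apply.
  have en3 : e n * X <= d / 3 by have := hn3 n (leqnn n); rewrite sub0r normrN ger0_norm// mulr_ge0.
  have cn : continuous (uncurry2 (P_ n)) := ls_continuous (hMD n).2.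
  have := cn z; move/cvgrPdist_le => /(_ _ d3).
  apply: filterS => w hw.
  have h1 := hPP n z.1 z.2; have h2 := hPP n w.1 w.2.
  move: hw; rewrite /uncurry2 -/(P_ n); move: h1 h2.
  move: (P_ n z.1 z.2) (P_ n w.1 w.2) (P z.1 z.2) (P w.1 w.2) => a1 a2 a3 a4 h1 h2 h3.
  rewrite (_ : a3 - a4 = - (a1 - a3) + (a1 - a2) + (a2 - a4)); last by ring.
  apply: le_trans (ler_normD _ _) _; apply: le_trans (lerD (ler_normD _ _) (lexx _)) _.
  by rewrite normrN; lra.
apply: hn; exists P.
have hw : parisi_weak_solution xi g P.
  apply: (@limit_weak_solution R xi g X (G + 1) X f (fun n => (MD n).1) (fun n => e n * X) P_ (fun n => (MD n).2) P) => //.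
  - by move=> t; have /andP[h1 h2] := hg t; rewrite h1 (le_trans h2)// lerDl.
  - move=> t; rewrite -[X in _ --> X]addr0; apply: cvgD => //; exact: cvg_cst.
  - by move=> n; exact: (hMD n).1.
  - by move=> n t t01; exact: (ls_Lip (hMD n).2 t01).
  - by move=> n t t01; exact: (ls_midconvex (hMD n).2 t01).
  - by move=> n; rewrite -[leRHS]mul1r; apply: ler_wpM2r.
apply: parisi_weak_solution_congr hw => t t01; have /andP[t0 t1] := t01.
by rewrite (xi_extE hc) ?t0 ?ltW// gE.
Unshelve. all: by end_near. Qed.

Lemma minimizer_contradiction : False.
Proof.
have [p p2 cp] := mixture_nonzero.
have vgt0 a b := @mixture_vol_gt0 _ _ hc p a b p2 cp.
have [g [G [q [m [mg hg lg gE [q01 m0 hm]]]]]] := finite_support_extension.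
have gE' t : 0 <= t < 1 -> gam t = g t by move=> t01; rewrite gE.
have hw := parisi_Psi_weak minimizer_weak_solution.
have [M [D [_ hL]]] := weak_level_solution hc mg hg lg gE hw.
set Psi := parisi_Psi _ _ in hw hL.
pose P t x := Psi (clamp t) x.
have z01 : 0 <= (0 : R) <= 1 by rewrite lexx ler01.
have X0 : 0 <= X by have /andP[h1 h2] := hxi 0; exact: le_trans h2.
have P0 : Psi 0 h = P 0 h by rewrite /P (clamp_id z01).
have P0ge : 0 <= P 0 h by exact: (level_solution_ge0 h lg hL z01).
have [kappa [s1 [k0 qs1 s11 hk]]] := terminal_perturbation mxi hxi vgt0 h hL lg q01 m0 hm.
(* A positive lower bound for the second derivative of the mixture on [1/2, 1], hence
   [xm * (1 - s) <= v] below. *)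
pose xm := c p ^+ 2 * 2^-1 ^+ (p - 2).
have xm0 : 0 < xm.
  by apply: mulr_gt0; [rewrite lt0r expf_neq0// sqr_ge0|rewrite exprn_gt0// invr_gt0].
pose w := kappa * xm.
have w0 : 0 < w by exact: mulr_gt0.
(* Chosen so that [1 - s <= d] forces [v < w ^+ 2], that is [sqrt v < w], where [w] is
   [kappa * xm]. *)
pose d := w ^+ 2 / (X + 1).
have X1 : 0 < X + 1 by rewrite ltr_wpDl.
have d0 : 0 < d by rewrite divr_gt0// exprn_gt0.
have dw : X * d < w ^+ 2.
  rewrite /d mulrA ltr_pdivrMr// mulrC ltr_pM2l ?exprn_gt0//; lra.
pose s := Num.max (Num.max s1 2^-1) (1 - d).
have h12 : 2^-1 < (1 : R) by rewrite invf_lt1// ltr1n.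
have s1s : s1 <= s by rewrite !le_max lexx.
have s2s : 2^-1 <= s by rewrite !le_max lexx orbT.
have sd : 1 - s <= d by rewrite lerBlDr -lerBlDl le_max lexx orbT.
have slt : s < 1 by rewrite !gt_max s11 h12 ltrBlDr ltrDl.
have s0 : 0 <= s by apply: le_trans s2s; rewrite invr_ge0.
pose v := vol xi s 1.
have v0 : 0 < v by exact: vgt0.
have vX : v <= X * (1 - s) by apply: (vol_le mxi hxi); exact: ltW.
have vw : v < w ^+ 2.
  by apply: le_lt_trans dw; apply: le_trans vX _; exact: ler_wpM2l.
have vxm : xm * (1 - s) <= v.
  apply: le_trans (mixture_vol_ge hc p2 s0 (ltW slt) (lexx 1)).
  rewrite /xm; apply: ler_wpM2r; first by rewrite subr_ge0 ltW.
  by apply: ler_wpM2l; [exact: sqr_ge0|apply: lerXn2r; rewrite ?nnegrE ?invr_ge0].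
pose sg := Num.sqrt v.
have sg0 : 0 < sg by rewrite sqrtr_gt0.
have sgv : sg ^+ 2 = v by rewrite sqr_sqrtr// ltW.
have sgw : sg < w by rewrite -(ltr_pXn2r (n := 2)) ?nnegrE ?(ltW sg0) ?(ltW w0)// sgv.
have s01 : 0 <= s < 1 by rewrite s0.
pose gam' z := gam z + (if s <= z then 2 else 0).
have hmin : parisi_functional c h gam <= parisi_functional c h gam' by exact: (@minimizer_step s (NngNum (ler0n R 2)) s01).
have bE t : 0 <= t < 1 -> bump_at g s t = gam' t by move=> t01; rewrite /bump_at gE.
have bE' t : 0 <= t < 1 -> gam' t = bump_at g s t by move=> t01; rewrite bE.
pose J := \int[mu]_(t in `[0, 1[) (t * xi t * g t).
pose J' := \int[mu]_(t in `[0, 1[) (t * xi t * bump_at g s t).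
have JJ : J + 2 * s * v <= J' by exact: (energy_step mxi hxi mg hg s0 (lexx s) slt).
have fP : parisi_functional c h gam = P 0 h - 2^-1 * J by rewrite /parisi_functional -/Psi P0 (mixture2_energy hc gE').
(* If the perturbed equation had no weak solution, its functional would be minus half of the larger
   integral, below the value at [gam] because the solution there is nonnegative. *)
have [hs|hn] := pselect (exists Psi', parisi_weak_solution (mixture2 c) gam' Psi'); last first.
  have : parisi_functional c h gam' = - (2^-1 * J').
    by rewrite (parisi_functional_no_solution hn) (mixture2_energy hc bE').
  have sv : 0 < s * v by rewrite mulr_gt0// (lt_le_trans _ s2s)// invr_gt0.
  move=> e; move: hmin JJ; rewrite fP e -mulrA {e}.
  by move: (s * v) (P 0 h) J J' sv P0ge {fP} => a1 a2 a3 a4; lra.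
have mb : measurable_fun setT (bump_at g s) by apply: measurable_funD => //; exact: step_measurable.
have hb t : 0 <= bump_at g s t <= G + 2.
  have /andP[h1 h2] := hg t; rewrite /bump_at; case: ifP => _; apply/andP; split; lra.
have lb : locally_constant (bump_at g s) by apply: locally_constant_step.
have hw' := parisi_Psi_weak hs.
have [_ [_ [_ hL']]] := weak_level_solution hc mb hb lb bE hw'.
set Psi' := parisi_Psi _ _ in hw' hL'.
have := hk s _ s1s slt hL'; rewrite (clamp_id z01) P0 -/v -/sg.
move: hmin; rewrite fP {1}/parisi_functional -/Psi' (mixture2_energy hc bE') -/J'.
move: (Psi' 0 h) (P 0 h) => a1 a2 hmin h1.
(* Minimality forces the gain [kappa * v * sqrt v] to be at most the deficit [(1 - s) * v]. With
   [xm * (1 - s) <= v] this gives [w <= sqrt v], against the choice of [s]. *)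
have h2 : kappa * (v * sg) <= (1 - s) * v.
  move: (kappa * _) h1 => e1 h1; rewrite mulrBl mul1r.
  clear fP; move: JJ; rewrite -mulrA; move: (s * v) => e2; move: J J' hmin => b1 b2; lra.
have h3 : kappa * sg <= 1 - s.
  by move: h2; rewrite (mulrC v) mulrA ler_pM2r.
have h4 : xm * (kappa * sg) <= v.
  by apply: le_trans vxm; apply: ler_wpM2l => //; exact: ltW.
move: h4; rewrite -sgv expr2 mulrA ler_pM2r// mulrC -/w leNgt.
by rewrite sgw.
Qed.

End Minimizer.

Unset Implicit Arguments.

Theorem theorem1 (R : realType) (c : nat -> R)
    (hc : cvgn (fun n => \sum_(2 <= p < n) (2 ^+ p * c p ^+ 2 : R)))
    (h : R) (gammaP : R -> R)
    (hP : is_the_parisi_minimizer c h gammaP)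
    (nu : {measure set (measurableTypeR R) -> \bar R})
    (hnu : induces nu gammaP) :
  infinite_set (measure_support nu).
Proof. by move=> hfin; exact: (minimizer_contradiction hc hP hnu hfin). Qed.
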